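(* Consider the general random graph mixture model described in the context. Let $k,s\ge 1$ be integers, $p=\binom{k}{2}$, and let $g:\mathcal X^p\to\mathbb R^s$ be a measurable function such that $\mathbb E(\|g(\mathbb X^{(1,\ldots,k)})\|^2)<\infty$. Let $$\hat m_g=\frac{(n-k)!}{n!}\sum_{\underline{i}\in\mathcal I_k} g(\mathbb X^{\underline i}),\qquad m_g=\mathbb E\big(g(\mathbb X^{(1,\ldots,k)})\big).$$ Then: (1) $\hat m_g\to m_g$ almost surely as $n\to\infty$. (2) $\sqrt n(\hat m_g-m_g)$ converges in distribution, as $n\to\infty$, to a centered (possibly degenerate) Gaussian distribution $\mathcal N(0,\Sigma_g)$ for some covariance matrix $\Sigma_g$. (3) If moreover the model has an affiliation structure, i.e. $\mathbb P(X_{ij}\mid Z_i,Z_j)=\mathbb P(X_{ij}\mid 1_{Z_i=Z_j})$, and equal group proportions, i.e. $\pi_q=1/Q$ for all $q\in\{1,\ldots,Q\}$, then $\Sigma_g=0$ and $n(\hat m_g-m_g)$ converges in distribution as $n\to\infty$.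
   Context: General model. Fix an integer $Q\ge 1$. Let $\mathcal V_Q=\{(v_1,\ldots,v_Q): v_q\in\{0,1\},\ \sum_q v_q=1\}$ and let $\boldsymbol\pi=(\pi_1,\ldots,\pi_Q)$ satisfy $\pi_q\ge 0$, $\sum_q\pi_q=1$. The latent variables $Z_i=(Z_{i1},\ldots,Z_{iQ})$, $i\ge 1$, are i.i.d. random vectors in $\mathcal V_Q$ with multinomial distribution $\mathcal M(1,\boldsymbol\pi)$, i.e. $\mathbb P(Z_{iq}=1)=\pi_q$; the event $Z_{iq}=1$ means that node $i$ belongs to group $q$. The observations $\{X_{ij}\}_{i<j}$ take values in a normed vector space $\mathcal X$. Conditionally on the $Z_i$'s, the variables $\{X_{ij}\}_{i<j}$ are independent; the conditional distribution of $X_{ij}$ depends only on $(Z_i,Z_j)$ (through the same kernel for all pairs), and $\mathbb E(\|X_{ij}\|^2\mid Z_i,Z_j)<\infty$. The graph is undirected without self-loops: $X_{ji}=X_{ij}$, and the conditional law of $X_{ij}$ given $Z_{iq}Z_{j\ell}=1$ is symmetric in $(q,\ell)$. The asymptotics $n\to\infty$ refers to the number $n$ of nodes. Notation. $\mathcal I_k=\{(i_1,\ldots,i_k)\in\{1,\ldots,n\}^k: i_j\ne i_l \text{ for all } j\ne l\}$. For $\underline i=(i_1,\ldots,i_k)\in\mathcal I_k$, $\mathbb X^{\underline i}=(X_{i_1i_2},\ldots,X_{i_1i_k},X_{i_2i_3},\ldots,X_{i_{k-1}i_k})\in\mathcal X^p$ is the vector of the $p=\binom k2$ variables induced by $\underline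 i$. *)

(* Defs.v *)
From HB Require Import structures.
From mathcomp Require Import all_boot all_order all_algebra finmap.
From mathcomp Require Import all_classical all_reals all_analysis.
From mathcomp Require Import measurable_realfun.

Set Implicit Arguments.
Unset Strict Implicit.
Unset Printing Implicit Defensive.
Import Order.TTheory GRing.Theory Num.Theory.
Import numFieldNormedType.Exports.
Local Open Scope classical_set_scope.
Local Open Scope ring_scope.

Notation borel V := (g_sigma_algebraType (@open V)).

Section probability_notions.
Context d (T : measurableType d) (R : realType) (P : probability T R).

Definition mutually_independent (I : choiceType) d' (E : measurableType d')
    (Y : I -> {RV P >-> E}) : Prop :=
  forall (J : {fset I}) (A : I -> set E), (forall i, measurable (A i)) ->
    P (\bigcap_(i in [set` J]) Y i @^-1` A i) =
    (\prod_(i <- J) P (Y i @^-1` A i))%E.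

(* [p] is a version of the conditional probability of the event [A] given the
   sigma-algebra generated by the set system [G]. *)
Definition is_cond_prob (G : set (set T)) (A : set T) (p : T -> \bar R) : Prop :=
  @measurable_fun _ _ (g_sigma_algebraType G) (\bar R) [set: T] p /\
  forall B, <<s G >> B -> P (A `&` B) = (\int[P]_(w in B) p w)%E.

Definition cvg_in_distribution (V : normedModType R) (Y : nat -> T -> V)
    (mu : probability (borel V) R) : Prop :=
  (forall n, measurable_fun [set: T] (Y n : T -> borel V)) /\
  forall f : V -> R, continuous f -> (exists M, forall x, `|f x| <= M) ->
    (\int[P]_w (f (Y n w))%:E)%E @[n --> \oo] --> (\int[mu]_x (f x)%:E)%E.

End probability_notions.

Definition is_covariance (R : realType) s (S : 'M[R]_s) : Prop :=
  S^T = S /\ forall t : 'rV[R]_s, 0 <= (t *m S *m t^T) 0 0.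

(* The zero-variance case is singled out because [normal_prob 0 0] is the
   uniform law on [0, 1] rather than the Dirac mass at 0. *)
Definition centered_normal (R : realType) (v : R) : set R -> \bar R :=
  if v == 0 then \d_(0 : R) else normal_prob 0 (Num.sqrt v).

(* N(0, S), possibly degenerate: every linear form t has law N(0, t S t^T). *)
Definition is_centered_gaussian (R : realType) s (S : 'M[R]_s)
    (mu : probability (borel 'rV[R]_s) R) : Prop :=
  is_covariance S /\
  forall (t : 'rV[R]_s) (A : set R), measurable A ->
    mu [set x : 'rV[R]_s | A ((x *m t^T) 0 0)] =
    centered_normal ((t *m S *m t^T) 0 0) A.

(* The pairs a < b of positions, in the order (0,1), ..., (0,k-1), (1,2), ... *)
Definition pair_seq k : seq ('I_k * 'I_k) :=
  [seq (a, b) | a : 'I_k <- enum 'I_k,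
                b : 'I_k <- [seq b : 'I_k <- enum 'I_k | (a < b)%N]].

Lemma size_pair_seq k : size (pair_seq k) == 'C(k, 2)%N.
Proof.
rewrite /pair_seq size_allpairs_dep sumnE big_map big_enum /= -bin2_sum.
rewrite big_mkord; apply/eqP.
transitivity (\sum_(a < k) \sum_(b < k | (a < b)%N) 1)%N.
  apply: eq_bigr => a _; rewrite size_filter -sum1_count.
  by rewrite big_enum_cond.
rewrite (exchange_big_dep predT) //=; apply: eq_bigr => b _.
by rewrite -(big_ord_widen k (fun=> 1%N)) ?sum1_card ?card_ord // ltnW.
Qed.

Canonical pair_tuple k := Tuple (size_pair_seq k).

Definition induced_vector (E : Type) k (x : nat -> nat -> E) (i : 'I_k -> nat) :
    'C(k, 2).-tuple E :=
  map_tuple (fun e => x (i e.1) (i e.2)) (pair_tuple k).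

Definition one_hot Q : set (Q.-tuple bool) :=
  [set v : Q.-tuple bool | (\sum_(q < Q) tnth v q)%N = 1%N].

Section mixture_model.
Context d (T : measurableType d) (R : realType) (P : probability T R).
Variables (X : normedModType R) (Q : nat).

(* Nodes are numbered from 0. [Z i] is the membership vector of node i, [x i j]
   the observation on the pair {i, j} ([x i i] plays no role), and [K (u, v)]
   the conditional law of x i j given Z i = u and Z j = v. *)
Record mixture_model (pi : 'I_Q -> R) (Z : nat -> {RV P >-> Q.-tuple bool})
    (x : nat -> nat -> {RV P >-> borel X})
    (K : R.-pker (Q.-tuple bool * Q.-tuple bool)%type ~> borel X) : Prop := {
  proportion_ge0 : forall q, 0 <= pi q;
  proportion_sum : \sum_(q < Q) pi q = 1;
  latent_one_hot : forall i w, one_hot (Z i w);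
  latent_law : forall i q, P [set w | tnth (Z i w) q] = (pi q)%:E;
  latent_indep : mutually_independent Z;
  obs_undirected : forall i j, x j i = x i j;
  (* Conditionally on (Z_i)_i, the x i j, i < j, are independent, with
     respective laws K (Z i, Z j). *)
  obs_cond_law : forall (J : {fset nat * nat}) (A : nat * nat -> set (borel X)),
    (forall e, e \in J -> (e.1 < e.2)%N) -> (forall e, measurable (A e)) ->
    is_cond_prob P
      (\bigcup_i preimage_set_system [set: T] (Z i) measurable)
      (\bigcap_(e in [set` J]) x e.1 e.2 @^-1` A e)
      (fun w => \prod_(e <- J) K (Z e.1 w, Z e.2 w) (A e))%E;
  kernel_sym : forall u v A, one_hot u -> one_hot v -> measurable A ->
    K (u, v) A = K (v, u) A;
  obs_cond_moment2 : forall i j, (i < j)%N ->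
    {ae P, forall w,
      (\int[K (Z i w, Z j w)]_y (`|y : X| ^+ 2)%:E < +oo)%E}
}.

(* P(x i j | Z i, Z j) = P(x i j | 1_(Z i = Z j)): the two conditional
   probabilities of each event about x i j have a common version. *)
Definition affiliation (Z : nat -> {RV P >-> Q.-tuple bool})
    (x : nat -> nat -> {RV P >-> borel X}) : Prop :=
  forall i j (A : set (borel X)), (i < j)%N -> measurable A ->
  exists p : T -> \bar R,
    is_cond_prob P
      (preimage_set_system [set: T] (fun w => (Z i w, Z j w)) measurable)
      (x i j @^-1` A) p /\
    is_cond_prob P
      (preimage_set_system [set: T] (fun w => Z i w == Z j w) measurable)
      (x i j @^-1` A) p.

Section motif_moments.
Variables (x : nat -> nat -> {RV P >-> borel X}) (k s : nat).
Variable g : 'C(k, 2).-tuple (borel X) -> 'rV[R]_s.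

Definition induced_obs (i : 'I_k -> nat) (w : T) : 'C(k, 2).-tuple (borel X) :=
  induced_vector (fun a b => x a b w) i.

Definition first_nodes : 'I_k -> nat := @nat_of_ord k.

Definition empirical_moment (n : nat) (w : T) : 'rV[R]_s :=
  ((n - k)`!%:R / n`!%:R) *:
  \sum_(i : {ffun 'I_k -> 'I_n} | injectiveb i) g (induced_obs (fun a => i a) w).

Definition moment : 'rV[R]_s :=
  \row_j fine 'E_P[fun w => g (induced_obs first_nodes w) ord0 j].

Definition finite_second_moment : Prop :=
  ('E_P[fun w => (\sum_(j < s) (g (induced_obs first_nodes w) ord0 j) ^+ 2)%R]
    < +oo)%E.

End motif_moments.
End mixture_model.

(* Main.v *)
(* A motif average is a U-statistic in independent variables: a label for each node and, for each
   pair of nodes, the value observed there, whose law depends on the two labels.  For a function g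
   of finitely many measurable pieces of the observations, the probability space is a finite
   product indexed by the nonempty sets of nodes, and the Hoeffding projections are explicit
   finite sums.  Write m^ - m = (m^ - A) + (A - m), where A averages E[g(X^i) | Z^i].
   - Conditionally on the labels, n (m^ - A) is, up to O(n^(-1/2)) in L1, a normalized sum over
     pairs of nodes of independent centered terms; it is asymptotically Gaussian, jointly with the
     centered label frequencies.  The variance bound E (n (m^ - A))^2 <= C E g^2 extends this to
     every square integrable g, because finitary functions are dense in L2.
   - A - m is a U-statistic in the labels alone.  Its linear part gives the limit of
     sqrt n (m^ - m).  Under affiliation with equal proportions, permuting the groups leaves
     E[g(X^i) | Z^i] unchanged, so the linear part vanishes and n (A - m) is asymptotically a
     quadratic form in the label frequencies; n (m^ - m) then converges by continuous mapping.
   - E (m^ - m)^2 = O(1/n) gives almost sure convergence along the squares, and monotonicity of the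
     sums for g >= 0 fills the gaps.
   Weak convergence is derived from the convergence of E cos(c + t.Y) together with bounded second
   moments. *)
Require Import Defs.
From HB Require Import structures.
From mathcomp Require Import all_boot all_order all_algebra finmap.
From mathcomp Require Import fingroup perm.
From mathcomp Require Import ring lra zify.

Set Implicit Arguments.
Unset Strict Implicit.
Unset Printing Implicit Defensive.
Import Order.TTheory GRing.Theory Num.Theory.
Local Open Scope ring_scope.

(** * Finite product spaces and Hoeffding projections *)

(** The space X need not be standard Borel, so the observations are not represented as functions of
    the labels and of independent uniform variables. Once a finite measurable partition of X is
    fixed, only the table of labels and marks matters; its law is that of a function of independent
    cells, and expectations are carried over by equality of laws, without a coupling. The partition
    acts on the observations only: the labels are never approximated, so A - m is treated exactly
    for every g. For general g the Hoeffding kernel on pairs is not constructed. The constant [Cst]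
    depends on k alone, so the bound on n (m^ - A) is uniform over partitions and over n. It permits
    the exchange of the limit in n with the limit of the approximation, and the limiting covariance
    is then recovered from the limits of Gaussian characteristic functions. Cosines with a phase c
    replace complex exponentials: the phase supplies the sines, and linear combinations of such
    cosines form an algebra. *)

Section product_space.
Variables (R : realFieldType) (I A : finType) (mu : A -> R).
Hypotheses (mu_ge0 : forall a, 0 <= mu a) (mu_sum : \sum_a mu a = 1).
Implicit Types (x y : {ffun I -> A}) (F G : {ffun I -> A} -> R) (S B : {set I}).

Definition wt x := \prod_i mu (x i).
Definition Ex F := \sum_x wt x * F x.

Lemma wt_ge0 x : 0 <= wt x.
Proof. by apply: prodr_ge0. Qed.

Lemma wt_sum : \sum_x wt x = 1.
Proof.
rewrite -(bigA_distr_bigA (fun (_ : I) a => mu a)) big1 // => i _.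
Qed.

Lemma Ex_cst c : Ex (fun=> c) = c.
Proof. by rewrite /Ex -big_distrl /= wt_sum mul1r. Qed.

Lemma ExD F G : Ex (fun x => F x + G x) = Ex F + Ex G.
Proof.
by rewrite /Ex -big_split; apply: eq_bigr => x _; rewrite mulrDr.
Qed.

Lemma ExZ c F : Ex (fun x => c * F x) = c * Ex F.
Proof. by rewrite /Ex big_distrr; apply: eq_bigr => x _; rewrite mulrCA. Qed.

Lemma ExN F : Ex (fun x => - F x) = - Ex F.
Proof. by rewrite /Ex -sumrN; apply: eq_bigr => x _; rewrite mulrN. Qed.

Lemma ExB F G : Ex (fun x => F x - G x) = Ex F - Ex G.
Proof. by rewrite ExD ExN. Qed.

Lemma Ex_sum (J : Type) (s : seq J) (Q : pred J) (F : J -> {ffun I -> A} -> R) :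
  Ex (fun x => \sum_(j <- s | Q j) F j x) = \sum_(j <- s | Q j) Ex (F j).
Proof.
rewrite /Ex exchange_big; apply: eq_bigr => x _.
by rewrite big_distrr.
Qed.

Lemma eq_Ex F G : F =1 G -> Ex F = Ex G.
Proof. by move=> FG; apply: eq_bigr => x _; rewrite FG. Qed.

Lemma Ex_eq0 F : (forall x, F x = 0) -> Ex F = 0.
Proof. by move=> F0; rewrite /Ex big1 // => x _; rewrite F0 mulr0. Qed.

Lemma le_Ex F G : (forall x, F x <= G x) -> Ex F <= Ex G.
Proof. by move=> FG; apply: ler_sum => x _; rewrite ler_wpM2l ?wt_ge0. Qed.

Lemma Ex_ge0 F : (forall x, 0 <= F x) -> 0 <= Ex F.
Proof. by move=> F0; rewrite -(Ex_cst 0); apply: le_Ex. Qed.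

Lemma norm_Ex F : `|Ex F| <= Ex (fun x => `|F x|).
Proof.
apply: le_trans (ler_norm_sum _ _ _) _; apply: ler_sum => x _.
by rewrite normrM (ger0_norm (wt_ge0 x)).
Qed.

Lemma Ex_sqr_le F : Ex F ^+ 2 <= Ex (fun x => F x ^+ 2).
Proof.
rewrite -subr_ge0.
have -> : Ex (fun x => F x ^+ 2) - Ex F ^+ 2 = Ex (fun x => (F x - Ex F) ^+ 2).
  rewrite (_ : Ex (fun x => (F x - Ex F) ^+ 2) =
    Ex (fun x => (F x ^+ 2 - (2 * Ex F) * F x) + Ex F ^+ 2)).
    by rewrite ExD ExB ExZ Ex_cst; ring.
  by apply: eq_Ex => x; ring.
by apply: Ex_ge0 => x; rewrite sqr_ge0.
Qed.

(* [mix] takes x on S and y elsewhere, so that [Pr S F] is the conditional expectation of F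
   given the coordinates in S. *)
Definition mix S x y : {ffun I -> A} := [ffun i => if i \in S then x i else y i].
Definition Pr S F x := Ex (fun y => F (mix S x y)).
Definition dep S F := forall x y, F (mix S x y) = F x.

(** Exchanging the coordinates outside [S] between two independent copies is an involution that
    preserves the product weight. Hence [mix S x y] has the law of a single copy. *)
Lemma Ex2_swap S (H : {ffun I -> A} -> {ffun I -> A} -> R) :
  Ex (fun x => Ex (fun y => H (mix S x y) (mix S y x))) =
  Ex (fun x => Ex (fun y => H x y)).
Proof.
have E (H' : {ffun I -> A} -> {ffun I -> A} -> R) :
    Ex (fun x => Ex (fun y => H' x y)) =
    \sum_(p : {ffun I -> A} * {ffun I -> A}) wt p.1 * wt p.2 * H' p.1 p.2.
  rewrite /Ex -(pair_big_dep xpredT (fun _ _ => true)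
    (fun x y => wt x * wt y * H' x y)) /=.
  by apply: eq_bigr => x _; rewrite big_distrr; apply: eq_bigr => y _ /=; rewrite mulrA.
rewrite !E.
have inv : involutive (fun p : {ffun I -> A} * {ffun I -> A} =>
    (mix S p.1 p.2, mix S p.2 p.1)).
  move=> [x y] /=; congr (_, _); apply/ffunP => i; rewrite !ffunE;
  by case: ifP => iS; rewrite ?iS.
rewrite [RHS](reindex_inj (inv_inj inv)) /=; apply: eq_bigr => -[x y] _ /=.
congr (_ * _); rewrite /wt -!big_split; apply: eq_bigr => i _ /=.
by rewrite !ffunE; case: ifP => // _; rewrite mulrC.
Qed.

Lemma Ex_mix S F : Ex (fun x => Ex (fun y => F (mix S x y))) = Ex F.
Proof.
rewrite (Ex2_swap S (fun x _ => F x)); apply: eq_Ex => x; exact: Ex_cst.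
Qed.

Lemma Ex_Pr S F : Ex (Pr S F) = Ex F.
Proof. exact: Ex_mix. Qed.

Lemma Ex_Pr_mul S F G : dep S G ->
  Ex (fun x => F x * G x) = Ex (fun x => Pr S F x * G x).
Proof.
move=> GS; rewrite -(Ex_mix S); apply: eq_Ex => x.
rewrite /Pr -[RHS]mulrC -ExZ; apply: eq_Ex => y.
by rewrite GS mulrC.
Qed.

(** After both mixings, [x] survives only on the intersection; the rest is read in [mix B y z],
    which again has the law of one copy. This commutation of conditional expectations drives all the
    Hoeffding computations. *)
Lemma Pr_Pr S B F x : Pr S (Pr B F) x = Pr (S :&: B) F x.
Proof.
rewrite /Pr -[RHS](Ex_mix B); apply: eq_Ex => y; apply: eq_Ex => z.
congr F; apply/ffunP => i; rewrite !ffunE in_setI.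
by case: (i \in B); case: (i \in S).
Qed.

Lemma dep_Pr S F : dep S (Pr S F).
Proof.
move=> x y; apply: eq_Ex => z; congr F; apply/ffunP => i; rewrite !ffunE.
by case: ifP => // ->.
Qed.

Lemma Pr_depI S B F x : dep S F -> Pr B F x = Pr (B :&: S) F x.
Proof.
move=> FS; apply: eq_Ex => z; rewrite -[LHS](FS _ z); congr F.
by apply/ffunP => i; rewrite !ffunE in_setI; case: (i \in S); case: (i \in B).
Qed.

Lemma dep_sub S B F : S \subset B -> dep S F -> dep B F.
Proof.
move=> /subsetP SB FS x y; rewrite -(FS (mix B x y) x) -[RHS](FS x x); congr F.
apply/ffunP => i; rewrite !ffunE; case: ifP => // iS.
by rewrite (SB _ iS).
Qed.

Lemma Pr0 F x : Pr set0 F x = Ex F.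
Proof. by apply: eq_Ex => y; congr F; apply/ffunP => i; rewrite ffunE inE. Qed.

Lemma PrB S F G x : Pr S (fun z => F z - G z) x = Pr S F x - Pr S G x.
Proof. exact: ExB. Qed.

Lemma Ex_indep S F G : dep S F -> dep (~: S) G ->
  Ex (fun x => F x * G x) = Ex F * Ex G.
Proof.
move=> FS GS; rewrite (Ex_Pr_mul _ GS).
rewrite (_ : Ex F * Ex G = Ex (fun x => Ex F * G x)); last by rewrite ExZ.
apply: eq_Ex => x; congr (_ * _).
by rewrite (Pr_depI _ _ FS) setIC setICr Pr0.
Qed.

Lemma Ex_prod (f : I -> A -> R) :
  Ex (fun x => \prod_i f i (x i)) = \prod_i \sum_a mu a * f i a.
Proof.
rewrite (bigA_distr_bigA (fun i a => mu a * f i a)) /Ex; apply: eq_bigr => x _.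
by rewrite /wt -big_split.
Qed.

Lemma Ex_coord i (f : A -> R) : Ex (fun x => f (x i)) = \sum_a mu a * f a.
Proof.
rewrite (_ : Ex _ = Ex (fun x => \prod_j (if j == i then f else (fun=> 1)) (x j))).
  rewrite (Ex_prod (fun j => if j == i then f else (fun=> 1))) (bigD1 i) //= eqxx [X in _ * X]big1 ?mulr1 // => j /negbTE ->.
  by rewrite -[RHS]mu_sum; apply: eq_bigr => a _; rewrite mulr1.
apply: eq_Ex => x; rewrite (bigD1 i) //= eqxx big1 ?mulr1 // => j /negbTE -> //.
Qed.

Lemma Ex_mul_coord i (f : A -> R) G :
  (forall x y, (forall j, j != i -> x j = y j) -> G x = G y) ->
  Ex (fun x => f (x i) * G x) = (\sum_a mu a * f a) * Ex G.
Proof.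
move=> Gi; rewrite -(Ex_coord i); apply: (@Ex_indep [set i]).
  by move=> x y; rewrite ffunE !inE eqxx.
by move=> x y; apply: Gi => j ji; rewrite ffunE !inE ji.
Qed.

Lemma Ex_coord2 i j (f : A -> A -> R) : i != j ->
  Ex (fun x => f (x i) (x j)) = \sum_u \sum_v mu u * mu v * f u v.
Proof.
move=> ij.
have E x : f (x i) (x j) = \sum_u (x i == u)%:R * f u (x j).
  rewrite (bigD1 (x i)) //= eqxx mul1r big1 ?addr0 // => u /negbTE.
  by rewrite eq_sym => ->; rewrite mul0r.
rewrite (eq_Ex E) Ex_sum; apply: eq_bigr => u _.
rewrite (Ex_mul_coord (fun a => (a == u)%:R)); last by move=> x y -> //; rewrite eq_sym.
rewrite (Ex_coord j) (bigD1 u) //= eqxx mulr1 big1 ?addr0 => [|a /negbTE ->]; last by rewrite mulr0.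
by rewrite big_distrr; apply: eq_bigr => v _ /=; rewrite mulrA.
Qed.

End product_space.

Section pullback.
Variables (R : realFieldType) (I J A : finType) (mu : A -> R).
Hypotheses (mu_ge0 : forall a, 0 <= mu a) (mu_sum : \sum_a mu a = 1).
Variable h : J -> I.
Hypothesis h_inj : injective h.

Definition pull (x : {ffun I -> A}) : {ffun J -> A} := [ffun j => x (h j)].

(** Expanding [F] over its values turns the left side into a sum of products of indicators over [I].
    Coordinates outside the image of [h] contribute the total mass 1; by injectivity each remaining
    one carries a single constraint. *)
Lemma Ex_pull (F : {ffun J -> A} -> R) :
  Ex mu (fun x => F (pull x)) = Ex mu F.
Proof.
pose f (y : {ffun J -> A}) i a : R :=
  \prod_(j | h j == i) (a == y j)%:R.
have E x : F (pull x) = \sum_y F y * \prod_i f y i (x i).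
  rewrite (bigD1 (pull x)) //= [X in _ * X]big1; last first.
    move=> i _; rewrite /f big1 // => j /eqP <-; by rewrite ffunE eqxx.
  rewrite mulr1 big1 ?addr0 // => y ypx.
  have [j yj] : exists j, y j != x (h j).
    apply/existsP; apply: contraR ypx; rewrite negb_exists => /forallP yx.
    by apply/eqP/ffunP => j; rewrite ffunE; apply/eqP; rewrite -[_ == _]negbK yx.
  rewrite (bigD1 (h j)) //= /f (bigD1 j) //= eq_sym (negbTE yj) !mul0r.
  by rewrite mulr0.
rewrite (eq_Ex _ E) Ex_sum /Ex; apply: eq_bigr => y _.
rewrite -/(Ex mu (fun x => F y * _)) ExZ mulrC; congr (_ * _).
rewrite Ex_prod /wt.
rewrite (bigID (mem (h @: [set: J]))) /= [X in _ * X]big1; last first.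
  move=> i ih; rewrite -[RHS]mu_sum; apply: eq_bigr => a _.
  rewrite /f big1 ?mulr1 // => j /eqP hj; case/negP: ih.
  by rewrite -hj imset_f.
rewrite mulr1 big_imset /=; last by move=> ? ? _ _; apply: h_inj.
rewrite (eq_bigl xpredT) => [|j]; last by rewrite inE.
apply: eq_bigr => j _.
rewrite (bigD1 (y j)) //= big1 => [|a ay].
  rewrite /f big1 ?mulr1 ?addr0 // => j' /eqP/h_inj ->.
  by rewrite eqxx.
by rewrite /f (bigD1 j) //= (negbTE ay) mul0r mulr0.
Qed.

Lemma pull_mix (S : {set I}) x y :
  pull (mix S x y) = mix (h @^-1: S) (pull x) (pull y).
Proof. by apply/ffunP => j; rewrite !ffunE inE. Qed.

Lemma Pr_pull (S : {set I}) (F : {ffun J -> A} -> R) x :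
  Pr mu S (fun z => F (pull z)) x = Pr mu (h @^-1: S) F (pull x).
Proof.
rewrite /Pr -[RHS]Ex_pull; apply: eq_Ex => y; by rewrite pull_mix.
Qed.

Lemma dep_pull (S : {set J}) (B : {set I}) (F : {ffun J -> A} -> R) :
  S \subset h @^-1: B -> dep S F -> dep B (fun z => F (pull z)).
Proof.
by move=> SB FS x y; rewrite pull_mix (dep_sub SB FS).
Qed.

End pullback.

(** * U-statistics on finite product spaces *)

Section ustat.
Variables (R : realFieldType) (A : finType) (mu : A -> R).
Hypotheses (mu_ge0 : forall a, 0 <= mu a) (mu_sum : \sum_a mu a = 1).

(* The Hoeffding projection of a U-statistic on a set S of nodes conditions on all the variables
   attached to nonempty subsets of S. *)
Definition cells n (S : {set 'I_n}) : {set {set 'I_n}} :=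
  [set B : {set 'I_n} | (B != set0) && (B \subset S)].

Lemma cellsI n (S S' : {set 'I_n}) : cells S :&: cells S' = cells (S :&: S').
Proof. by apply/setP => B; rewrite !inE subsetI; case: (B != set0); case: (B \subset S). Qed.

Lemma cells_sub n (S S' : {set 'I_n}) : S \subset S' -> cells S \subset cells S'.
Proof.
move=> SS'; apply/subsetP => B; rewrite !inE => /andP[-> /= /subset_trans]; exact.
Qed.

Definition simg n k (i : {ffun 'I_k -> 'I_n}) (B : {set 'I_k}) : {set 'I_n} :=
  [set i a | a in B].

Lemma simg_inj n k (i : {ffun 'I_k -> 'I_n}) : injective i -> injective (simg i).
Proof. exact: imset_inj. Qed.

Lemma simg_cells n k (i : {ffun 'I_k -> 'I_n}) (S : {set 'I_n}) :
  simg i @^-1: cells S = cells (i @^-1: S).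
Proof.
apply/setP => B; rewrite !inE /simg; congr (_ && _).
  by rewrite imset_eq0.
by rewrite sub_imset_pre.
Qed.

Definition restr n k (i : {ffun 'I_k -> 'I_n}) (x : {ffun {set 'I_n} -> A}) :=
  pull (simg i) x.

(** For [n < k] the value is 0, both because the inverse of 0 is 0 and because the sum is empty. *)
Definition avg n k (f : {ffun 'I_k -> 'I_n} -> R) : R :=
  (n ^_ k)%:R^-1 * \sum_(i : {ffun 'I_k -> 'I_n} | injectiveb i) f i.

Definition Uavg n k (F : {ffun {set 'I_k} -> A} -> R) (x : {ffun {set 'I_n} -> A}) : R :=
  avg (fun i => F (restr i x)).

(** The Hoeffding components of level below [r] vanish; the U-statistic of such an [F] is of order
    [n ^ (- r / 2)]. *)
Definition degen k r (F : {ffun {set 'I_k} -> A} -> R) :=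
  forall S : {set 'I_k}, (#|S| < r)%N -> forall x, Pr mu (cells S) F x = 0.

Lemma cells0 n : cells (set0 : {set 'I_n}) = set0.
Proof.
apply/setP => B; rewrite !inE subset0.
by case: (B == set0).
Qed.

Lemma degen1 k (F : {ffun {set 'I_k} -> A} -> R) : Ex mu F = 0 -> degen 1 F.
Proof.
by move=> F0 S; rewrite ltnS leqn0 cards_eq0 => /eqP -> x; rewrite cells0 Pr0.
Qed.

(** Projecting the component of [S] on [S0] conditions on the intersection, which has fewer than [r]
    nodes unless [S = S0]. So only the component of [S0] itself survives, and the subtraction
    cancels it. *)
Lemma hoeffding k r (F : {ffun {set 'I_k} -> A} -> R) : degen r F ->
  degen r.+1 (fun x => F x - \sum_(S : {set 'I_k} | #|S| == r) Pr mu (cells S) F x).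
Proof.
move=> dF S0; rewrite ltnS => S0r x; rewrite PrB {2}/Pr Ex_sum.
under eq_bigr => S _ do rewrite -/(Pr mu _ _ _) Pr_Pr // cellsI.
have [S0r'|/negP S0r'] := boolP (#|S0| == r); last first.
  have lt : (#|S0| < r)%N by rewrite ltn_neqAle S0r andbT; apply/negP.
  rewrite dF // big1 ?subrr // => S _; apply: dF.
  exact: leq_ltn_trans (subset_leq_card (subsetIl _ _)) lt.
rewrite (bigD1 S0) //= setIid big1 ?addr0 ?subrr // => S /andP[Sr SS0].
apply: dF; rewrite -(eqP S0r'); apply: proper_card.
rewrite properE subsetIl /= subsetI subxx /=.
apply: contra SS0 => S0S; rewrite eq_sym eqEcard S0S (eqP S0r') (eqP Sr) leqnn //.
Qed.

(** Enumerating its image, such a function factors through ['I_m]: there are [m ^ #|D|] first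
    factors and [n ^ m] second ones. *)
Lemma card_small_image (D : finType) n m : (0 < m)%N -> (0 < #|D|)%N ->
  (#|[set f : {ffun D -> 'I_n} | (#|f @: [set: D]| <= m)%N]|
     <= m ^ #|D| * n ^ m)%N.
Proof.
move=> m0 /card_gt0P[d _].
pose comp (ch : {ffun D -> 'I_m} * {ffun 'I_m -> 'I_n}) : {ffun D -> 'I_n} :=
  [ffun d => ch.2 (ch.1 d)].
have -> : (m ^ #|D| * n ^ m = #|{: {ffun D -> 'I_m} * {ffun 'I_m -> 'I_n}}|)%N.
  by rewrite card_prod !card_ffun !card_ord.
apply: leq_trans (leq_imset_card comp _); apply: subset_leq_card.
apply/subsetP => f; rewrite inE => fm.
set S := f @: [set: D] in fm.
have fS d' : f d' \in S by apply: imset_f.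
pose h : {ffun 'I_m -> 'I_n} := [ffun l : 'I_m => nth (f d) (enum S) l].
have lt d' : (index (f d') (enum S) < m)%N.
  by apply: leq_trans fm; rewrite cardE index_mem mem_enum.
apply/imsetP; exists ([ffun d' => Ordinal (lt d')], h) => //.
by apply/ffunP => d'; rewrite !ffunE /= nth_index // mem_enum.
Qed.

(** Factor by factor, [n <= k * (n - i)] for [i < k <= n]. *)
Lemma expn_le_ffact n k : (k <= n)%N -> (n ^ k <= k ^ k * n ^_ k)%N.
Proof.
move=> kn; rewrite ffact_prod -[X in (n ^ X <= X ^ X * _)%N]card_ord.
rewrite -!prod_nat_const -big_split /=; apply: leq_prod => i _.
have ik := ltn_ord i; rewrite !card_ord mulnBr.
have : (i * k <= k.-1 * n)%N by apply: leq_mul => //; lia.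
by case: k kn i ik => // k kn i ik /=; lia.
Qed.

(** The first factor comes from [card_overlap], the second from comparing [n ^ (2 * k)] with the
    square of [n ^_ k] by [expn_le_ffact]. *)
Definition Cst k : R := ((k + k) ^ (k + k) * (k ^ k) ^ 2)%:R.

(** Joined into one function on [2 * k] points, two injective tuples sharing at least [r] nodes have
    an image of at most [2 * k - r] elements. *)
Lemma card_overlap n k r : (0 < k)%N -> (r <= k)%N ->
  (#|[set p : {ffun 'I_k -> 'I_n} * {ffun 'I_k -> 'I_n} |
     [&& injectiveb p.1, injectiveb p.2 &
       (r <= #|p.1 @^-1: (p.2 @: [set: 'I_k])|)%N]]|
   <= (k + k) ^ (k + k) * n ^ (k + k - r))%N.
Proof.
move=> k0 rk.
pose join (p : {ffun 'I_k -> 'I_n} * {ffun 'I_k -> 'I_n}) :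
  {ffun ('I_k + 'I_k)%type -> 'I_n} :=
  [ffun s => match s with inl a => p.1 a | inr b => p.2 b end].
have join_inj : injective join.
  move=> [i j] [i' j'] /ffunP e; congr (_, _); apply/ffunP => a.
    by have := e (inl a); rewrite !ffunE.
  by have := e (inr a); rewrite !ffunE.
rewrite -(card_imset _ join_inj).
set D := ('I_k + 'I_k)%type; have cD : #|{: D}| = (k + k)%N by rewrite card_sum !card_ord.
apply: (@leq_trans #|[set f : {ffun D -> 'I_n} | (#|f @: [set: D]| <= k + k - r)%N]|);
  last first.
  apply: leq_trans (card_small_image _ _ _) _; rewrite ?cD; [lia|lia|].
  by rewrite leq_mul2r leq_exp2r ?leq_subr ?orbT //; lia.
apply: subset_leq_card; apply/subsetP => f /imsetP[[i j] + ->] {f}.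
rewrite inE /= => /and3P[/injectiveP ii /injectiveP ij] rp; rewrite inE.
have -> : join (i, j) @: [set: D] = (i @: [set: 'I_k]) :|: (j @: [set: 'I_k]).
  apply/setP => c; rewrite inE; apply/imsetP/orP.
    move=> [[a|a] _ ->]; rewrite ffunE; [left|right]; exact: imset_f.
  move=> [] /imsetP[a _ ->]; [exists (inl a)|exists (inr a)] => //; by rewrite ffunE.
rewrite cardsU !card_imset // !cardsT !card_ord leq_sub2l //.
apply: leq_trans rp _; rewrite -(card_imset _ ii); apply: subset_leq_card.
apply/subsetP => y /imsetP[a + ->]; rewrite inE => ja.
by rewrite inE ja andbT; apply: imset_f.
Qed.

Lemma Ex_restr n k (i : {ffun 'I_k -> 'I_n}) (F : {ffun {set 'I_k} -> A} -> R) :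
  injective i -> Ex mu (fun x => F (restr i x)) = Ex mu F.
Proof. by move=> ii; apply: Ex_pull => //; apply: simg_inj. Qed.

(** The square is a double sum over pairs of tuples. Conditioning on the cells of the second tuple
    projects the first factor on the shared nodes, so pairs sharing fewer than [r] nodes have zero
    covariance. By [card_overlap] of order [n ^ (2 * k - r)] pairs remain, each contributing at most
    the second moment. *)
Lemma Uavg_variance n k r (F : {ffun {set 'I_k} -> A} -> R) : (0 < k)%N ->
  dep (cells [set: 'I_k]) F -> degen r F ->
  Ex mu (fun x : {ffun {set 'I_n} -> A} => Uavg F x ^+ 2) * (n%:R) ^+ r <=
  Cst k * Ex mu (fun y => F y ^+ 2).
Proof.
move=> k0 dF FD; set V := Ex mu (fun y => _).
have V0 : 0 <= V by apply: Ex_ge0 => // x; rewrite sqr_ge0.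
have CV0 : 0 <= Cst k * V by rewrite mulr_ge0.
set N := (n ^_ k)%:R : R.
pose e (i j : {ffun 'I_k -> 'I_n}) := Ex mu (fun x => F (restr i x) * F (restr j x)).
have eV (i j : {ffun 'I_k -> 'I_n}) : injective i -> injective j -> e i j <= V.
  move=> ii ij.
  have -> : V = Ex mu (fun x => 2^-1 * (F (restr i x) ^+ 2 + F (restr j x) ^+ 2)).
    by rewrite ExZ ExD !(Ex_restr (fun y => F y ^+ 2)) // -/V; field.
  apply: le_Ex => // x; rewrite -subr_ge0.
  have -> : 2^-1 * (F (restr i x) ^+ 2 + F (restr j x) ^+ 2) - F (restr i x) * F (restr j x)
    = 2^-1 * (F (restr i x) - F (restr j x)) ^+ 2 by field.
  by rewrite mulr_ge0 ?invr_ge0 ?ler0n ?sqr_ge0.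
have e0 (i j : {ffun 'I_k -> 'I_n}) : injective i -> injective j ->
    (#|i @^-1: (j @: [set: 'I_k])| < r)%N -> e i j = 0.
  move=> ii ij lt; rewrite /e (@Ex_Pr_mul _ _ _ _ _ (cells (j @: [set: 'I_k]))) //.
    apply: Ex_eq0 => x.
    by rewrite (Pr_pull _ (simg_inj ii)) // simg_cells FD // mul0r.
  apply: dep_pull dF; rewrite simg_cells; apply: cells_sub.
  by apply/subsetP => a _; rewrite inE; apply: imset_f.
set good := [set p : {ffun 'I_k -> 'I_n} * {ffun 'I_k -> 'I_n} |
     [&& injectiveb p.1, injectiveb p.2 &
       (r <= #|p.1 @^-1: (p.2 @: [set: 'I_k])|)%N]].
have H : Ex mu (fun x : {ffun {set 'I_n} -> A} => Uavg F x ^+ 2) <= N ^- 2 * (#|good|%:R * V).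
  have -> : Ex mu (fun x : {ffun {set 'I_n} -> A} => Uavg F x ^+ 2) = N ^- 2 *
      \sum_(p : {ffun 'I_k -> 'I_n} * {ffun 'I_k -> 'I_n} | injectiveb p.1 && injectiveb p.2) e p.1 p.2.
    pose injp := [pred i : {ffun 'I_k -> 'I_n} | injectiveb i].
    rewrite -(pair_big injp injp e) /=.
    rewrite -exprVn -/N /e; under eq_bigr => i _ do rewrite -Ex_sum.
    rewrite -Ex_sum -ExZ; apply: eq_Ex => x; rewrite /Uavg /avg exprMn; congr (_ * _).
    rewrite expr2 big_distrl; apply: eq_bigr => i _.
    by rewrite big_distrr.
  rewrite ler_wpM2l ?invr_ge0 ?exprn_ge0 ?ler0n //.
  rewrite (bigID (mem good)) /= [X in _ + X]big1 ?addr0; last first.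
    move=> [i j] /= /andP[/andP[ii ij]]; rewrite inE /= ii ij /= -ltnNge => lt.
    by apply: e0 => //; apply/injectiveP.
  rewrite mulr_natl -sumr_const big_mkcond [leRHS]big_mkcond /=; apply: ler_sum.
  move=> [i j] _ /=; have [gij|_] := boolP ((i, j) \in good); last by rewrite andbF.
  rewrite andbT; case: ifP => // /andP[/injectiveP ii /injectiveP ij]; exact: eV.
have [kn|nk] := leqP k n; last first.
  suff -> : Ex mu (fun x : {ffun {set 'I_n} -> A} => Uavg F x ^+ 2) = 0 by rewrite mul0r.
  apply: Ex_eq0 => x.
  by rewrite /Uavg /avg ffact_small // invr0 mul0r expr0n.
have n0 : (0 < n)%N by lia.
have N0 : 0 < N by rewrite ltr0n ffact_gt0.
have [rk|kr] := leqP r k; last first.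
  have g0 : #|good| = 0%N.
    apply/eqP; rewrite cards_eq0; apply/eqP/setP => -[i j]; rewrite !inE /=.
    apply/negP => /and3P[_ _] /leq_trans /(_ (max_card _)); rewrite card_ord; lia.
  rewrite g0 mul0r mulr0 in H; apply: le_trans CV0.
  by rewrite pmulr_lle0 // exprn_gt0 // ltr0n.
apply: le_trans (_ : N ^- 2 * (#|good|%:R * V) * n%:R ^+ r <= _).
  by rewrite ler_wpM2r ?exprn_ge0 ?ler0n.
rewrite [X in X * _]mulrC -mulrA [X in _ * X]mulrC mulrA ler_pdivrMr ?exprn_gt0 //.
rewrite (_ : #|good|%:R * V * n%:R ^+ r = V * (#|good|%:R * n%:R ^+ r)); last by ring.
rewrite (_ : Cst k * V * N ^+ 2 = V * (Cst k * N ^+ 2)); last by ring.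
rewrite ler_wpM2l // -!natrX -!natrM ler_nat.
apply: (@leq_trans ((k + k) ^ (k + k) * n ^ (k + k - r) * n ^ r)).
  by rewrite leq_mul2r card_overlap ?orbT.
rewrite -!mulnA -expnD subnK; last lia.
rewrite leq_mul2l; apply/orP; right.
have -> : (k ^ k * (k ^ k * (n ^_ k) ^ 2) = (k ^ k * n ^_ k) ^ 2)%N.
  by rewrite expnMn !expnS !expn0 !muln1 -!mulnA.
rewrite addnn -mul2n mulnC expnM leq_exp2r ?expn_le_ffact ?orbT //.
Qed.

Lemma eq_avg n k (f g : {ffun 'I_k -> 'I_n} -> R) : f =1 g -> avg f = avg g.
Proof. by move=> fg; congr (_ * _); apply: eq_bigr => i _. Qed.

Lemma avg_sum n k (J : Type) (s : seq J) (Q : pred J)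
    (f : J -> {ffun 'I_k -> 'I_n} -> R) :
  avg (fun i => \sum_(j <- s | Q j) f j i) = \sum_(j <- s | Q j) avg (f j).
Proof. by rewrite /avg exchange_big big_distrr. Qed.

Lemma avgD n k (f g : {ffun 'I_k -> 'I_n} -> R) :
  avg (fun i => f i + g i) = avg f + avg g.
Proof. by rewrite /avg big_split mulrDr. Qed.

Lemma avgB n k (f g : {ffun 'I_k -> 'I_n} -> R) :
  avg (fun i => f i - g i) = avg f - avg g.
Proof. by rewrite avgD /avg sumrN mulrN. Qed.

Lemma avgZ n k c (f : {ffun 'I_k -> 'I_n} -> R) :
  avg (fun i => c * f i) = c * avg f.
Proof. by rewrite /avg -big_distrr mulrCA. Qed.

Lemma card_injective n k :
  #|[pred i : {ffun 'I_k -> 'I_n} | injectiveb i]| = (n ^_ k)%N.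
Proof. by have := card_inj_ffuns 'I_k 'I_n; rewrite !card_ord => <-; rewrite cardsE. Qed.

Lemma avg_cst n k c : (k <= n)%N -> avg (fun _ : {ffun 'I_k -> 'I_n} => c) = c.
Proof.
move=> kn; rewrite /avg sumr_const card_injective -[c *+ _]mulr_natl mulrA mulVf ?mul1r //.
by rewrite pnatr_eq0 -lt0n ffact_gt0.
Qed.

(* Marginals of the uniform law on injective tuples: by symmetry under
   permutations of 'I_n every value of the marginal has the same weight. *)
Lemma avg_marginal (T : finType) n k (Q : pred T) (h : {ffun 'I_k -> 'I_n} -> T)
    (act : {perm 'I_n} -> T -> T) (f : T -> R) :
  (forall (i : {ffun 'I_k -> 'I_n}) (s : {perm 'I_n}), h [ffun a => s (i a)] = act s (h i)) ->
  (forall s, injective (act s)) ->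
  (forall t t', Q t -> Q t' -> exists s, act s t = t') ->
  (forall i : {ffun 'I_k -> 'I_n}, injectiveb i -> Q (h i)) -> (k <= n)%N ->
  avg (fun i => f (h i)) = #|Q|%:R^-1 * \sum_(t | Q t) f t.
Proof.
move=> hact act_inj trans hQ kn.
pose fib t := #|[pred i : {ffun 'I_k -> 'I_n} | injectiveb i & h i == t]|.
have fib_le t s : (fib t <= fib (act s t))%N.
  pose p (i : {ffun 'I_k -> 'I_n}) := [ffun a => s (i a)].
  have pinj : injective p.
    by move=> i j /ffunP e; apply/ffunP => a; have := e a; rewrite !ffunE => /perm_inj.
  rewrite /fib -(card_imset _ pinj); apply: subset_leq_card.
  apply/subsetP => y /imsetP[i + ->]; rewrite !inE => /andP[/injectiveP ii /eqP hi].
  rewrite hact hi eqxx andbT; apply/injectiveP => a b; rewrite !ffunE.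
  by move=> /perm_inj/ii.
have fib_eq t t' : Q t -> Q t' -> fib t = fib t'.
  move=> Qt Qt'; have [s st] := trans _ _ Qt Qt'; have [s' st'] := trans _ _ Qt' Qt.
  by apply/eqP; rewrite eqn_leq; apply/andP; split; [rewrite -st|rewrite -st']; apply: fib_le.
have sumE (f' : T -> R) : \sum_(i : {ffun 'I_k -> 'I_n} | injectiveb i) f' (h i) =
    \sum_(t | Q t) (fib t)%:R * f' t.
  rewrite (partition_big h Q) //; apply: eq_bigr => t Qt.
  rewrite (eq_bigr (fun=> f' t)) => [|i /andP[_ /eqP ->] //].
  by rewrite sumr_const mulr_natl.
have [t0 Qt0] : exists t0, Q t0.
  have : (0 < #|[pred i : {ffun 'I_k -> 'I_n} | injectiveb i]|)%N.
    by rewrite card_injective ffact_gt0.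
  by move=> /card_gt0P[i ii]; exists (h i); apply: hQ.
have totE : (n ^_ k)%:R = #|Q|%:R * (fib t0)%:R :> R.
  rewrite -card_injective -sumr_const (sumE (fun=> 1)).
  rewrite (eq_bigr (fun=> (fib t0)%:R)) => [|t Qt]; last by rewrite mulr1 (fib_eq t t0).
  by rewrite sumr_const mulr_natl.
have : (n ^_ k)%:R != 0 :> R by rewrite pnatr_eq0 -lt0n ffact_gt0.
rewrite /avg sumE totE mulf_eq0 negb_or => /andP[q0 f0].
rewrite (eq_bigr (fun t => (fib t0)%:R * f t)) => [|t Qt]; last by rewrite (fib_eq t t0).
by rewrite -big_distrr /= invfM -mulrA; congr (_ * _); rewrite mulrA mulVf ?mul1r.
Qed.

Lemma avg_marginal1 n k (a : 'I_k) (f : 'I_n -> R) : (k <= n)%N ->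
  avg (fun i : {ffun 'I_k -> 'I_n} => f (i a)) = n%:R^-1 * \sum_c f c.
Proof.
move=> kn.
rewrite (@avg_marginal _ n k xpredT (fun i => i a) (fun s c => s c)) ?card_ord //.
- by move=> i s; rewrite ffunE.
- by move=> s; apply: perm_inj.
- by move=> t t' _ _; exists (tperm t t'); rewrite tpermL.
Qed.

Lemma avg_marginal2 n k (a b : 'I_k) (f : 'I_n -> 'I_n -> R) : a != b -> (k <= n)%N ->
  avg (fun i : {ffun 'I_k -> 'I_n} => f (i a) (i b)) =
  (n%:R * (n%:R - 1))^-1 * \sum_c \sum_(d | d != c) f c d.
Proof.
move=> ab kn.
rewrite (@avg_marginal _ n k [pred p : 'I_n * 'I_n | p.2 != p.1] (fun i => (i a, i b))
  (fun s p => (s p.1, s p.2)) (fun p => f p.1 p.2)) //=.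
- rewrite (pair_big_dep xpredT (fun c d => d != c)) /=; congr (_ ^-1 * _).
  rewrite -sum1_card -(pair_big_dep xpredT (fun c d => d != c) (fun _ _ => 1%N)) /=.
  rewrite (eq_bigr (fun=> n.-1)) => [|c _].
    rewrite sum_nat_const card_ord; case: n {f kn} => [|n] /=; first by rewrite !mul0r.
    by rewrite natrM -[in RHS](natrB _ (ltn0Sn n)) subn1.
  by have := cardC1 c; rewrite card_ord sum1_card.
- by move=> i s; rewrite !ffunE.
- by move=> s [c d] [c' d'] [/perm_inj -> /perm_inj ->].
- move=> [c d] [c' d'] /= dc dc'.
  (* The first transposition brings [c] to [c']. The second brings the image of [d] to [d'] and
     fixes [c'], which is neither of its two points. *)
  exists (tperm c c' * tperm (tperm c c' d) d')%g; rewrite !permM tpermL.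
  rewrite [in X in (_, X)]tpermL; congr (_, _); apply: tpermD => //.
  by rewrite -{2}[c'](tpermL c) (inj_eq perm_inj).
- by move=> i /injectiveP ii; apply: contra ab => /eqP/ii ->.
Qed.
End ustat.

(** * Positive semidefinite matrices as sums of rank-one matrices *)

Section positive_semidefinite.
Variables (R : rcfType) (s : nat).
Implicit Types (S : 'M[R]_s) (t u : 'rV[R]_s).

Let B S t u : R := (t *m S *m u^T) 0 0.
Let e j : 'rV[R]_s := delta_mx 0 j.

Let BDl S t u v a : B S (t + a *: u) v = B S t v + a * B S u v.
Proof. by rewrite /B mulmxDl mulmxDl mxE -!scalemxAl [X in _ + X]mxE. Qed.

Let BC S t u : S^T = S -> B S t u = B S u t.
Proof.
move=> sS; rewrite /B; transitivity ((t *m S *m u^T)^T 0 0); first by rewrite [RHS]mxE.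
by rewrite !trmx_mul !trmxK sS mulmxA.
Qed.

Let BDr S t u v a : B S v (t + a *: u) = B S v t + a * B S v u.
Proof. by rewrite /B linearD linearZ /= mulmxDr mxE -scalemxAr [X in _ + X]mxE. Qed.

Let Be S i j : B S (e i) (e j) = S i j.
Proof. by rewrite /B trmx_delta -rowE -colE !mxE. Qed.

(** With a null entry at [i], the form at [e j + a *: e i] is affine in [a]. A nonzero slope lets it
    take the value -1, which is what the chosen [a] achieves. *)
Lemma psd_null_row S i j : S^T = S -> (forall t, 0 <= B S t t) -> S i i = 0 -> S i j = 0.
Proof.
move=> sS pS Sii; apply/eqP; apply: contraT => Sij.
pose a := - (S j j + 1) / (2 * S i j).
have := pS (e j + a *: e i); rewrite !BDl !BDr !Be Sii !mulr0 addr0.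
have -> : S j i = S i j by rewrite -{1}sS mxE.
have -> : S j j + a * S i j + a * S i j = - 1 by rewrite /a; field.
by rewrite oppr_ge0 leNgt ltr01.
Qed.

(* Elimination of a row with a nonzero diagonal entry. *)
Lemma psd_decomposition S : S^T = S -> (forall t, 0 <= (t *m S *m t^T) 0 0) ->
  exists L : seq 'rV[R]_s, S = \sum_(a <- L) a^T *m a.
Proof.
have [n] := ubnP #|[set j | S j j != 0]|; elim: n S => // n IH S leS sS pS.
have [/existsP[j Sj]|/existsPn S0] := boolP [exists j, S j j != 0]; last first.
  exists [::]; rewrite big_nil; apply/matrixP => i j; rewrite mxE.
  by apply: psd_null_row => //; apply/eqP; have := S0 i; rewrite negbK.
have Sj0 : 0 < S j j by rewrite lt_def Sj /= -Be; exact: pS.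
pose r := row j S; pose S' := S - (S j j)^-1 *: (r^T *m r).
have S'E a b : S' a b = S a b - (S j j)^-1 * (S j a * S j b).
  by rewrite !mxE big_ord1 !mxE.
have sS' : S'^T = S'.
  by rewrite /S' linearB linearZ /= trmx_mul trmxK sS.
have pS' t : 0 <= (t *m S' *m t^T) 0 0.
  (* The Schur complement at [t] is the minimum of the form of [S] over the line through [t]
     directed by [e j]; this vector attains it. *)
  have := pS (t + (- (B S t (e j) / S j j)) *: e j).
  rewrite -/(B S _ _) -/(B S' t t) !BDl !BDr !Be (BC (e j)) // => /le_trans; apply.
  have -> : B S' t t = B S t t - (S j j)^-1 * B S t (e j) ^+ 2.
    have sub00 (a : R) (C D : 'M[R]_1) : (C - a *: D) 0 0 = C 0 0 - a * D 0 0 by rewrite !mxE.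
    rewrite /B /S' mulmxBr mulmxBl -scalemxAr -scalemxAl sub00; congr (_ - _ * _).
    have -> : t *m (r^T *m r) *m t^T = (t *m r^T) *m (r *m t^T) by rewrite !mulmxA.
    rewrite [LHS]mxE big_ord1 expr2.
    have E : (t *m r^T) 0 0 = (t *m S *m (e j)^T) 0 0.
      by rewrite /r tr_row sS trmx_delta -mulmxA -colE.
    have E' : (r *m t^T) 0 0 = (t *m r^T) 0 0.
      by transitivity ((r *m t^T)^T 0 0); [rewrite [RHS]mxE|rewrite trmx_mul trmxK].
    by rewrite E' E.
  move: (B S t t) (B S t (e j)) => p q; rewrite le_eqVlt; apply/orP; left; apply/eqP; field; exact: Sj.
have card' : (#|[set i | S' i i != 0%R]| < n)%N.
  rewrite -ltnS; apply: leq_trans leS; rewrite ltnS; apply: proper_card.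
  apply/properP; split.
    apply/subsetP => i; rewrite !inE; apply: contra => /eqP Si.
    rewrite S'E Si; have -> : S j i = 0.
      by rewrite -sS mxE; apply: psd_null_row.
    by rewrite mul0r mulr0 subr0.
  exists j; rewrite inE // S'E negbK; apply/eqP; field.
  by rewrite gt_eqF.
have [L SL] := IH S' card' sS' pS'.
exists ((Num.sqrt (S j j))^-1 *: r :: L).
rewrite big_cons -SL; apply/matrixP => a b; rewrite mxE S'E mxE big_ord1 !mxE.
have := sqr_sqrtr (ltW Sj0); move: (Num.sqrt _) => q qE.
have q0 : q != 0 by move: Sj; rewrite -qE; apply: contraNneq => ->; rewrite expr0n.
by rewrite -qE; field.
Qed.

End positive_semidefinite.

(* A module, so that the notations for classical sets do not hide those for
   finite sets in what follows. *)
Module TrigBounds.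
From mathcomp Require Import all_classical all_reals all_analysis.
Import numFieldNormedType.Exports.
Local Open Scope classical_set_scope.
Local Open Scope ring_scope.

(** * Taylor and Lipschitz bounds for cos, sin and exp *)

Section trig_bounds.
Variable R : realType.
Implicit Types x y : R.

Lemma ler_of_derive_ge0 (f f' : R -> R) y :
  (forall x, is_derive x 1 f (f' x)) -> (forall x, 0 <= x -> 0 <= f' x) ->
  0 <= y -> f 0 <= f y.
Proof.
move=> df f'0 y0.
have cf : {within `[0, y], continuous f}.
  by apply: derivable_within_continuous => x _; have := df x => -[].
have [z zy e] := MVT_segment y0 (fun x _ => df x) cf.
rewrite -subr_ge0 e subr0 mulr_ge0 // f'0 //.
by move: zy; rewrite in_itv /= => /andP[].
Qed.

(** First link of a chain: [sin_le], [cos_ge], [sin_ge] and [cos_le] each say that the function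
    bounded in the next one has a nonnegative derivative. *)
Lemma sin_le y : 0 <= y -> sin y <= y.
Proof.
move=> y0; rewrite -subr_ge0.
have := @ler_of_derive_ge0 (fun x => x - sin x) (fun x => 1 - cos x) y _ _ y0.
rewrite sin0 subr0; apply.
  by move=> x _; rewrite subr_ge0 cos_le1.
Qed.

Lemma cos_ge y : 0 <= y -> 1 - y ^+ 2 / 2 <= cos y.
Proof.
move=> y0; rewrite -subr_ge0.
have := @ler_of_derive_ge0 (fun x => cos x - (1 - x ^+ 2 / 2)) (fun x => x - sin x) y _ _ y0.
rewrite cos0 expr0n /= mul0r subr0 subrr; apply.
  move=> x; apply: is_derive_eq; rewrite /GRing.scale /=; by field.
by move=> x x0; rewrite subr_ge0 sin_le.
Qed.

Lemma sin_ge y : 0 <= y -> y - y ^+ 3 / 6 <= sin y.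
Proof.
move=> y0; rewrite -subr_ge0.
have := @ler_of_derive_ge0 (fun x => sin x - (x - x ^+ 3 / 6))
  (fun x => cos x - (1 - x ^+ 2 / 2)) y _ _ y0.
rewrite sin0 expr0n /= mul0r !subr0; apply.
  move=> x; apply: is_derive_eq; rewrite /GRing.scale /=; by field.
by move=> x x0; rewrite subr_ge0 cos_ge.
Qed.

Lemma cos_le y : 0 <= y -> cos y <= 1 - y ^+ 2 / 2 + y ^+ 4 / 24.
Proof.
move=> y0; rewrite -subr_ge0.
have := @ler_of_derive_ge0 (fun x => (1 - x ^+ 2 / 2 + x ^+ 4 / 24) - cos x)
  (fun x => sin x - (x - x ^+ 3 / 6)) y _ _ y0.
rewrite cos0 !expr0n /= !mul0r subr0 addr0 subrr; apply.
  move=> x; apply: is_derive_eq; rewrite /GRing.scale /=; by field.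
by move=> x x0; rewrite subr_ge0 sin_ge.
Qed.

Lemma expRN_le y : 0 <= y -> expR (- y) <= 1 - y + y ^+ 2 / 2.
Proof.
move=> y0; rewrite -subr_ge0.
have := @ler_of_derive_ge0 (fun x => (1 - x + x ^+ 2 / 2) - expR (- x))
  (fun x => expR (- x) - (1 - x)) y _ _ y0.
rewrite oppr0 expR0 !expr0n /= !mul0r !addr0 subrr; apply.
  move=> x; apply: is_derive_eq; rewrite /GRing.scale /=; by field.
by move=> x x0; rewrite subr_ge0; apply: expR_ge1Dx.
Qed.

Lemma cos_taylor y : `|cos y - (1 - y ^+ 2 / 2)| <= y ^+ 4.
Proof.
wlog y0 : y / 0 <= y => [H|].
  have [/H //|/ltW yn] := leP 0 y.
  by have := H (- y); rewrite cosN sqrrN oppr_ge0 (_ : (- y) ^+ 4 = y ^+ 4) => [|]; [exact|ring].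
have y4 : 0 <= y ^+ 4 by rewrite exprn_ge0.
have := cos_ge y0; have := cos_le y0; rewrite ler_norml; lra.
Qed.

Lemma sin_taylor y : `|sin y - y| <= `|y| ^+ 3.
Proof.
wlog y0 : y / 0 <= y => [H|].
  have [/H //|/ltW yn] := leP 0 y.
  have := H (- y); rewrite sinN normrN oppr_ge0 => /(_ yn).
  by rewrite -opprB opprK normrN addrC.
have y3 : 0 <= y ^+ 3 by rewrite exprn_ge0.
have := sin_ge y0; have := sin_le y0; rewrite (ger0_norm y0) ler_norml; lra.
Qed.

Lemma expRN_taylor y : 0 <= y -> `|expR (- y) - (1 - y)| <= y ^+ 2.
Proof.
move=> y0; have y2 : 0 <= y ^+ 2 by rewrite exprn_ge0.
have := expRN_le y0; have := expR_ge1Dx (- y); rewrite ler_norml; lra.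
Qed.

Lemma expRN_lipschitz x y : 0 <= x -> 0 <= y ->
  `|expR (- x) - expR (- y)| <= `|x - y|.
Proof.
wlog xy : x y / x <= y => [H x0 y0|x0 _].
  have [/H->//|/ltW/H yx] := leP x y.
  by rewrite distrC [leRHS]distrC yx.
rewrite ger0_norm ?subr_ge0 ?ler_expR ?lerN2 // ler0_norm ?subr_le0 // opprB.
have -> : expR (- y) = expR (- x) * expR (- (y - x)) by rewrite -expRD; congr expR; lra.
rewrite -[X in X - _]mulr1 -mulrBr.
have := expR_ge1Dx (- (y - x)) => e1; have : expR (- x) <= 1 by rewrite expR_le1 oppr_le0.
have := expR_gt0 (- x) => e2 e3.
apply: le_trans (_ : expR (- x) * (y - x) <= _).
  by rewrite ler_wpM2l ?expR_ge0 //; lra.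
by rewrite ler_piMl // subr_ge0.
Qed.

Lemma cos_lipschitz x y : `|cos x - cos y| <= `|x - y|.
Proof.
wlog xy : x y / x <= y => [H|].
  by have [/H//|/ltW/H yx] := leP x y; rewrite distrC [leRHS]distrC.
have cf : {within `[x, y], continuous (@cos R)}.
  by apply: derivable_within_continuous => z _; apply: derivable_cos.
have [z zy e] := MVT_segment xy (fun x _ => is_derive_cos x) cf.
by rewrite distrC e normrM normrN [leRHS]distrC ler_piMl // sin_max.
Qed.

End trig_bounds.

End TrigBounds.
Import TrigBounds.
From mathcomp Require Import reals sequences exp trigo.

(** * Central limit theorem for sums over nodes and pairs *)

Section telescope.
Variables (R : realType) (I A : finType) (mu : A -> R).
Hypotheses (mu_ge0 : forall a, 0 <= mu a) (mu_sum : \sum_a mu a = 1).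

Lemma mean_le (f : A -> R) (B : R) : (forall a, f a <= B) -> \sum_a mu a * f a <= B.
Proof.
move=> fB; rewrite -[leRHS]mul1r -mu_sum big_distrl; apply: ler_sum => a _.
by rewrite ler_wpM2l.
Qed.

Lemma norm_mean_le (f : A -> R) (B : R) : (forall a, `|f a| <= B) -> `|\sum_a mu a * f a| <= B.
Proof.
move=> fB; apply: le_trans (ler_norm_sum _ _ _) _; apply: le_trans (mean_le fB).
by apply: ler_sum => a _; rewrite normrM ger0_norm.
Qed.

Lemma mean_ge0 (f : A -> R) : (forall a, 0 <= f a) -> 0 <= \sum_a mu a * f a.
Proof. by move=> f0; apply: sumr_ge0 => a _; rewrite mulr_ge0. Qed.

(** Both terms equal [1 - v / 2] up to [B ^+ 4], with [v] the second moment of [f]. The assumption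
    [B <= 1] turns this into the order [B ^+ 3], which is also that of the sine term. *)
Lemma mean_cos (f : A -> R) (B : R) : (forall a, `|f a| <= B) -> B <= 1 ->
  `|\sum_a mu a * cos (f a) - expR (- (2^-1 * \sum_a mu a * f a ^+ 2))| <= 2 * B ^+ 3.
Proof.
move=> fB B1; set v := \sum_a mu a * f a ^+ 2.
have [a0 _|A0] := pickP (@predT A); last first.
  by move: mu_sum; rewrite big_pred0 // => /eqP; rewrite eq_sym oner_eq0.
have B0 : 0 <= B by apply: le_trans (fB a0).
have f2 a : f a ^+ 2 <= B ^+ 2 by rewrite -real_normK ?num_real // lerXn2r ?nnegrE.
have v0 : 0 <= v by apply: mean_ge0 => a; rewrite sqr_ge0.
have vB : v <= B ^+ 2 by apply: mean_le.
have B34 : B ^+ 4 <= B ^+ 3 by rewrite exprS ler_piMl // exprn_ge0.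
have h1 : `|\sum_a mu a * cos (f a) - (1 - 2^-1 * v)| <= B ^+ 4.
  have -> : \sum_a mu a * cos (f a) - (1 - 2^-1 * v) =
      \sum_a mu a * (cos (f a) - (1 - f a ^+ 2 / 2)).
    rewrite [RHS](eq_bigr (fun a => mu a * cos (f a) - (mu a - 2^-1 * (mu a * f a ^+ 2)))).
      by rewrite !sumrB mu_sum -big_distrr.
    by move=> a _; field.
  apply: norm_mean_le => a; apply: le_trans (cos_taylor _) _.
  by rewrite [leLHS](exprM _ 2 2) [leRHS](exprM _ 2 2) lerXn2r ?nnegrE ?sqr_ge0.
have h2 : `|expR (- (2^-1 * v)) - (1 - 2^-1 * v)| <= B ^+ 4.
  apply: le_trans (expRN_taylor _) _; first by rewrite mulr_ge0 // invr_ge0.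
  rewrite exprMn (exprM _ 2 2); apply: le_trans (_ : 1 * v ^+ 2 <= _).
    rewrite ler_wpM2r ?sqr_ge0 //; lra.
  by rewrite mul1r lerXn2r ?nnegrE ?sqr_ge0.
rewrite (_ : _ - _ = (\sum_a mu a * cos (f a) - (1 - 2^-1 * v)) -
  (expR (- (2^-1 * v)) - (1 - 2^-1 * v))); last by ring.
by apply: le_trans (ler_normB _ _) _; lra.
Qed.

Lemma mean_sin (f : A -> R) (B : R) : (forall a, `|f a| <= B) -> \sum_a mu a * f a = 0 ->
  `|\sum_a mu a * sin (f a)| <= B ^+ 3.
Proof.
move=> fB f0; have -> : \sum_a mu a * sin (f a) = \sum_a mu a * (sin (f a) - f a).
  by rewrite -[LHS]subr0 -[X in _ - X]f0 -sumrB; apply: eq_bigr => a _; rewrite mulrBr.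
apply: norm_mean_le => a; apply: le_trans (sin_taylor _) _.
by rewrite lerXn2r ?nnegrE // (le_trans (normr_ge0 _) (fB a)).
Qed.

(** One summand is peeled off at a time by the addition formula for cos. Distinct keys make it
    independent of the others, its cosine averages to a Gaussian factor, and its sine to almost 0 by
    centering. *)
Lemma cos_telescope (J : eqType) (key : J -> I) (f : J -> A -> R) (B : R) (s : seq J) (c : R) :
  uniq (map key s) -> (forall j a, `|f j a| <= B) -> B <= 1 ->
  (forall j, \sum_a mu a * f j a = 0) ->
  `|Ex mu (fun x => cos (c + \sum_(j <- s) f j (x (key j)))) -
    expR (- (2^-1 * \sum_(j <- s) \sum_a mu a * f j a ^+ 2)) * cos c| <=
  (size s)%:R * (3 * B ^+ 3).
Proof.
move=> + fB B1 f0; elim: s => [_|i s IH /= /andP[ks us]].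
  rewrite big_nil mulr0 oppr0 expR0 mul1r.
  under eq_Ex => x do rewrite big_nil addr0.
  by rewrite Ex_cst // subrr normr0 mul0r.
pose G x := c + \sum_(j <- s) f j (x (key j)).
have Gi x y : (forall k, k != key i -> x k = y k) -> G x = G y.
  move=> xy; rewrite /G; congr (_ + _); rewrite !big_seq; apply: eq_bigr => j js.
  by rewrite xy //; apply: contraNneq ks => <-; apply: map_f.
have -> : Ex mu (fun x => cos (c + \sum_(j <- i :: s) f j (x (key j)))) =
  (\sum_a mu a * cos (f i a)) * Ex mu (fun x => cos (G x)) -
  (\sum_a mu a * sin (f i a)) * Ex mu (fun x => sin (G x)).
  rewrite -!(@Ex_mul_coord _ _ _ _ mu_sum (key i)) ?ExB //; first last.
  - by move=> x y xy; rewrite (Gi x y).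
  - by move=> x y xy; rewrite (Gi x y).
  rewrite -ExB; apply: eq_Ex => x; rewrite big_cons addrCA cosD //.
rewrite big_cons; set vi := \sum_a mu a * f i a ^+ 2; set v := \sum_(j <- s) _.
set p := \sum_a _; set q := \sum_a _; set C := Ex mu _; set S := Ex mu _.
have -> : expR (- (2^-1 * (vi + v))) = expR (- (2^-1 * vi)) * expR (- (2^-1 * v)).
  by rewrite -expRD; congr expR; ring.
have := IH us; rewrite -/C -/v; set e1 := expR (- (2^-1 * vi)); set e2 := expR _ => IHs.
have hp : `|p - e1| <= 2 * B ^+ 3 by apply: mean_cos.
have hq : `|q| <= B ^+ 3 by apply: mean_sin.
have hC : `|C| <= 1.
  apply: le_trans (norm_Ex mu_ge0 _) _; rewrite -[leRHS](Ex_cst I mu_sum 1).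
  by apply: le_Ex => // x; apply: cos_max.
have hS : `|S| <= 1.
  apply: le_trans (norm_Ex mu_ge0 _) _; rewrite -[leRHS](Ex_cst I mu_sum 1).
  by apply: le_Ex => // x; apply: sin_max.
have e10 : 0 <= e1 by apply: expR_ge0.
have e11 : e1 <= 1.
  rewrite expR_le1 oppr_le0 mulr_ge0 ?invr_ge0 //.
  by apply: mean_ge0 => a; rewrite sqr_ge0.
(* One step costs [2 * B ^+ 3] for the cosine and [B ^+ 3] for the sine; the error accumulated
   before is multiplied by [e1 <= 1]. *)
have -> : p * C - q * S - e1 * e2 * cos c =
  (p - e1) * C - q * S + e1 * (C - e2 * cos c) by ring.
apply: le_trans (ler_normD _ _) _; apply: le_trans (lerD (ler_normB _ _) (lexx _)) _.
rewrite !normrM (ger0_norm e10) -natr1 mulrDl mul1r addrC; apply: lerD.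
  apply: le_trans IHs; rewrite ler_piMl //.
have -> : 3 * B ^+ 3 = 2 * B ^+ 3 * 1 + B ^+ 3 * 1 by ring.
by apply: lerD; apply: ler_pM.
Qed.

End telescope.

Section pair_clt.
Variables (R : realType) (A : finType) (mu : A -> R).
Hypotheses (mu_ge0 : forall a, 0 <= mu a) (mu_sum : \sum_a mu a = 1).

Definition sum_pairs n (f : 'I_n -> 'I_n -> R) : R := \sum_c \sum_(d | d != c) f c d.

Lemma sum_pairs_lt n (f : 'I_n -> 'I_n -> R) :
  sum_pairs f = \sum_(p : 'I_n * 'I_n | (p.1 < p.2)%N) (f p.1 p.2 + f p.2 p.1).
Proof.
rewrite /sum_pairs pair_big_dep /= (bigID (fun p : 'I_n * 'I_n => (p.1 < p.2)%N)) /=.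
rewrite big_split; congr (_ + _).
  by apply: eq_bigl => -[c d] /=; rewrite -val_eqE /=; lia.
have inv : involutive (fun p : 'I_n * 'I_n => (p.2, p.1)) by case.
rewrite (reindex_inj (inv_inj inv)) /=.
by apply: eq_bigl => -[c d] /=; rewrite -val_eqE /=; lia.
Qed.

Definition pavg n (f : 'I_n -> 'I_n -> R) : R :=
  (n%:R * (n%:R - 1))^-1 * sum_pairs f.

Lemma Ex_norm_le (I : finType) (F : {ffun I -> A} -> R) (K : R) : 0 <= K ->
  Ex mu (fun x => F x ^+ 2) <= K ^+ 2 -> Ex mu (fun x => `|F x|) <= K.
Proof.
move=> K0 FK; rewrite -(@ler_pXn2r _ 2) ?nnegrE //; last exact: Ex_ge0.
apply: le_trans (Ex_sqr_le mu_ge0 mu_sum _) _; apply: le_trans FK.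
by apply: le_Ex => // x; rewrite real_normK ?num_real.
Qed.

(** The average over pairs is a U-statistic with two positions; centered, it is degenerate at level
    1, so [Uavg_variance] with [r = 1] bounds its variance by a multiple of [1 / n]. *)
Lemma pavg_lln (s : A -> A -> R) :
  let m := \sum_u \sum_v mu u * mu v * s u v in
  exists2 K, 0 <= K & forall n, (1 < n)%N ->
    Ex mu (fun x : {ffun {set 'I_n} -> A} =>
      `|pavg (fun c d => s (x [set c]) (x [set d])) - m|) <= K / Num.sqrt n%:R.
Proof.
move=> m; pose o0 : 'I_2 := ord0; pose o1 : 'I_2 := ord_max.
pose F (y : {ffun {set 'I_2} -> A}) := s (y [set o0]) (y [set o1]) - m.
set K2 := Cst R 2 * Ex mu (fun y => F y ^+ 2).
have K20 : 0 <= K2 by rewrite mulr_ge0 ?ler0n // Ex_ge0 // => x; rewrite sqr_ge0.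
exists (Num.sqrt K2); first exact: sqrtr_ge0.
move=> n n1.
have n0 : 0 < n%:R :> R by rewrite ltr0n; lia.
have dF : dep (cells [set: 'I_2]) F.
  move=> x y; rewrite /F !ffunE !inE !subsetT !andbT.
  by rewrite -!card_gt0 !cards1.
have F0 : degen mu 1 F.
  apply: degen1; rewrite ExB Ex_cst // Ex_coord2 ?subrr //.
  by apply/eqP => /set1_inj.
have V := Uavg_variance mu_ge0 mu_sum n (ltn0Sn 1) dF F0.
apply: Ex_norm_le; first by rewrite divr_ge0 ?sqrtr_ge0.
rewrite exprMn exprVn !sqr_sqrtr ?ler0n // ler_pdivlMr //.
rewrite -[n%:R]expr1; apply: le_trans V; rewrite le_eqVlt; apply/orP; left; apply/eqP.
congr (_ * _); apply: eq_Ex => x; congr (_ ^+ 2).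
rewrite /Uavg /F avgB avg_cst //; congr (_ - _).
rewrite /pavg /sum_pairs -(@avg_marginal2 R n 2 o0 o1 (fun c d => s (x [set c]) (x [set d]))) //.
by apply: eq_avg => i; rewrite /restr !ffunE /simg !imset_set1.
Qed.

(* Given the variables of the nodes, the terms attached to the pairs are independent and centered;
   their conditional variance is itself an average over pairs, close to its mean. *)
Lemma pair_clt (t : A -> R) (psi : A -> A -> A -> R) (c0 : R) :
  \sum_a mu a * t a = 0 ->
  (forall u v, \sum_a mu a * psi u v a = 0) ->
  let gamma := 2^-1 * \sum_u \sum_v mu u * mu v *
    \sum_a mu a * (psi u v a + psi v u a) ^+ 2 in
  exists K, forall n, (1 < n)%N ->
    `|Ex mu (fun x : {ffun {set 'I_n} -> A} =>
        cos (c0 + (Num.sqrt n%:R)^-1 * \sum_c t (x [set c]) +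
             n%:R * pavg (fun c d => psi (x [set c]) (x [set d]) (x [set c; d])))) -
      expR (- (2^-1 * \sum_a mu a * t a ^+ 2) - 2^-1 * gamma) * cos c0| <=
    K / Num.sqrt n%:R.
Proof.
move=> t0 psi0 gamma.
pose ps u v a := psi u v a + psi v u a.
have ps0 u v : \sum_a mu a * ps u v a = 0.
  rewrite (eq_bigr (fun a => mu a * psi u v a + mu a * psi v u a)).
    by rewrite big_split /= !psi0 addr0.
  by move=> a _; rewrite mulrDr.
pose s u v := \sum_a mu a * ps u v a ^+ 2.
have sC u v : s u v = s v u by apply: eq_bigr => a _; rewrite /ps addrC.
have s0 u v : 0 <= s u v by apply: mean_ge0 => // a; rewrite sqr_ge0.
set m := \sum_u \sum_v mu u * mu v * s u v.
have gm : gamma = 2^-1 * m by [].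
have m0 : 0 <= m.
  by apply: sumr_ge0 => u _; apply: sumr_ge0 => v _; rewrite !mulr_ge0.
have [K1 K10 LLN] := pavg_lln s; rewrite -/m in LLN.
pose B : R := 1 + (\sum_a `|t a| + \sum_u \sum_v \sum_a `|ps u v a|).
have sum_norm (T : finType) (f : T -> R) a0 : (forall a, 0 <= f a) -> f a0 <= \sum_a f a.
  by move=> f0; rewrite (bigD1 a0) //= lerDl sumr_ge0.
have Bps u v a : `|ps u v a| <= B.
  rewrite /B addrCA; apply: le_trans (_ : \sum_u \sum_v \sum_a `|ps u v a| <= _).
    apply: le_trans (_ : _ <= \sum_v \sum_a `|ps u v a|) _; last first.
      by apply: (sum_norm _ (fun u => \sum_v \sum_a `|ps u v a|)) => ?; do 2!apply: sumr_ge0 => ? _.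
    apply: le_trans (_ : _ <= \sum_a `|ps u v a|) _; last first.
      by apply: (sum_norm _ (fun v => \sum_a `|ps u v a|)) => ?; apply: sumr_ge0 => ? _.
    exact: (sum_norm _ (fun a => `|ps u v a|)).
  rewrite addrA lerDr addr_ge0 //; exact: sumr_ge0.
have Bt a : `|t a| <= B.
  apply: le_trans (_ : \sum_a `|t a| <= _); first exact: (sum_norm _ (fun a => `|t a|)).
  rewrite /B addrCA lerDl addr_ge0 //; by do 3!apply: sumr_ge0 => ? _.
have B1 : 1 <= B.
  rewrite /B lerDl addr_ge0 //; first exact: sumr_ge0.
  by do 3!apply: sumr_ge0 => ? _.
(* The term [4 * B] settles the case [rn < 2 * B], where the trivial bound 2 on the difference is
   enough. The others add up the errors below: [24 * B ^+ 3] for the pairs, [K1 + m] for the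
   conditional variance, [3 * B ^+ 3] for the nodes. *)
exists (4 * B + 27 * B ^+ 3 + K1 + m) => n n1.
set rn := Num.sqrt n%:R; set E := _ * cos c0.
have n0 : 0 < n%:R :> R by rewrite ltr0n; lia.
have rn0 : 0 < rn by rewrite sqrtr_gt0.
have rn2 : rn ^+ 2 = n%:R by rewrite sqr_sqrtr // ltW.
have B30 : 0 <= B ^+ 3 by rewrite exprn_ge0 //; lra.
have v0 : 0 <= \sum_a mu a * t a ^+ 2 by apply: mean_ge0 => // a; rewrite sqr_ge0.
have cos1 (I : finType) (G : {ffun I -> A} -> R) : `|Ex mu (fun x => cos (G x))| <= 1.
  apply: le_trans (norm_Ex mu_ge0 _) _; rewrite -[leRHS](Ex_cst I mu_sum 1).
  by apply: le_Ex => // x; apply: cos_max.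
have [big|small] := leP (2 * B) rn; last first.
  apply: le_trans (_ : 2 <= _).
    apply: le_trans (ler_normB _ _) _.
    have := cos1 _ (fun x : {ffun {set 'I_n} -> A} =>
      c0 + rn^-1 * \sum_c t (x [set c]) +
      n%:R * pavg (fun c d => psi (x [set c]) (x [set d]) (x [set c; d]))).
    have : `|E| <= 1.
      rewrite normrM ger0_norm ?expR_ge0 // mulr_ile1 ?expR_ge0 ?cos_max //.
      by rewrite expR_le1 -opprD oppr_le0 addr_ge0 // mulr_ge0 ?invr_ge0 // gm mulr_ge0 ?invr_ge0.
    by move=> h1 h2; apply: le_trans (lerD h2 h1) _; lra.
  rewrite ler_pdivlMr //; apply: le_trans (_ : 4 * B <= _); first lra.
  by rewrite -!addrA lerDl !addr_ge0 // mulr_ge0.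
have rn1 : 1 <= rn by lra.
have B0 : 0 <= B by lra.
pose nodes : {set {set 'I_n}} := [set D : {set 'I_n} | #|D| == 1%N].
pose C (x : {ffun {set 'I_n} -> A}) := c0 + rn^-1 * \sum_c t (x [set c]).
pose V (x : {ffun {set 'I_n} -> A}) :=
  \sum_(p : 'I_n * 'I_n | (p.1 < p.2)%N) (n%:R - 1) ^- 2 * s (x [set p.1]) (x [set p.2]).
have nm1 : 2^-1 * n%:R <= n%:R - 1 :> R.
  have : 2 <= n%:R :> R by rewrite ler_nat. lra.
have nm0 : 0 < n%:R - 1 :> R by apply: lt_le_trans nm1; rewrite mulr_gt0 // invr_gt0.
have invn : (n%:R - 1)^-1 <= 2 / n%:R :> R.
  rewrite ler_pdivlMr // mulrC ler_pdivrMr //; lra.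
have invrn : n%:R^-1 <= rn^-1 :> R.
  by rewrite lef_pV2 ?posrE // -rn2 expr2 ler_peMl // ltW.
have rnn : n%:R / rn = rn by rewrite -rn2 expr2 mulfK // gt_eqF.
(* With the node variables frozen by [Ex_mix], [cos_telescope] is applied to the pairs, keyed by the
   sets of their two nodes. At most [n ^ 2] terms of size [2 * B / n] cost [24 * B ^+ 3 / n]. *)
have stepa : `|Ex mu (fun x : {ffun {set 'I_n} -> A} => cos (C x +
             n%:R * pavg (fun c d => psi (x [set c]) (x [set d]) (x [set c; d])))) -
      Ex mu (fun x => expR (- (2^-1 * V x)) * cos (C x))| <= 24 * B ^+ 3 / rn.
  rewrite -(Ex_mix mu_sum nodes) -ExB; apply: le_trans (norm_Ex mu_ge0 _) _.
  rewrite -[leRHS](Ex_cst {set 'I_n} mu_sum); apply: le_Ex => // x.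
  pose sq := [seq p : 'I_n * 'I_n <- enum {: 'I_n * 'I_n} | (p.1 < p.2)%N].
  pose f (p : 'I_n * 'I_n) a := (n%:R - 1)^-1 * ps (x [set p.1]) (x [set p.2]) a.
  have us : uniq [seq [set p.1; p.2] | p : 'I_n * 'I_n <- sq].
    have usq : uniq sq by apply: filter_uniq; apply: enum_uniq.
    rewrite map_inj_in_uniq // => -[c d] [c' d'].
    rewrite !mem_filter /= => /andP[cd _] /andP[cd' _] /setP e.
    have /orP hc : (c == c') || (c == d') by have := e c; rewrite !inE eqxx /= => <-.
    have /orP hd : (d == c') || (d == d') by have := e d; rewrite !inE eqxx orbT => <-.
    case: hc => /eqP hc; case: hd => /eqP hd; rewrite hc hd //.
    - by move: cd; rewrite hc hd ltnn.
    - by move: cd; rewrite hc hd ltnNge (ltnW cd').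
    - by move: cd; rewrite hc hd ltnn.
  have fB p a : `|f p a| <= 2 * B / n%:R.
    rewrite normrM gtr0_norm ?invr_gt0 // mulrAC.
    by apply: ler_pM => //; rewrite invr_ge0 ltW.
  have BB1 : 2 * B / n%:R <= 1.
    by rewrite ler_pdivrMr // mul1r (le_trans big) // -rn2 expr2 ler_peMl // ltW.
  have f0 p : \sum_a mu a * f p a = 0.
    rewrite (eq_bigr (fun a => (n%:R - 1)^-1 * (mu a * ps (x [set p.1]) (x [set p.2]) a))).
      by rewrite -big_distrr /= ps0 mulr0.
    by move=> a _; rewrite /f mulrCA.
  have := cos_telescope mu_ge0 mu_sum (C x) us fB BB1 f0.
  have -> : \sum_(j <- sq) \sum_a mu a * f j a ^+ 2 = V x.
    rewrite big_filter big_enum_cond /=; apply: eq_bigr => p _.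
    by rewrite /s big_distrr; apply: eq_bigr => a _; rewrite /f exprMn exprVn mulrCA.
  move=> H; apply: le_trans (le_trans H _).
    rewrite le_eqVlt; apply/orP; left; apply/eqP; congr `|_ - _|; apply: eq_Ex => y.
    have nd c : (mix nodes x y) [set c] = x [set c] by rewrite ffunE inE cards1 eqxx.
    congr cos; congr (_ + _).
      by rewrite /C; congr (_ + _ * _); apply: eq_bigr => c _; rewrite nd.
    rewrite /pavg sum_pairs_lt big_filter big_enum_cond /= mulrA big_distrr /=.
    apply: eq_bigr => p pp; rewrite /f /ps !nd; congr (_ * _).
      by rewrite invfM mulrA mulfV ?mul1r // gt_eqF.
    have pne : p.1 != p.2 by rewrite -val_eqE /= ltn_eqF.
    by rewrite (setUC [set p.2]) ffunE inE cards2 pne.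
  apply: le_trans (_ : n%:R ^+ 2 * (3 * (2 * B / n%:R) ^+ 3) <= _).
    have g0 : 0 <= 3 * (2 * B / n%:R) ^+ 3 by rewrite mulr_ge0 // exprn_ge0 // divr_ge0 // mulr_ge0.
    apply: (ler_wpM2r g0).
    rewrite -natrX ler_nat size_filter; apply: leq_trans (count_size _ _) _.
    by rewrite -cardE card_prod !card_ord.
  have -> : n%:R ^+ 2 * (3 * (2 * B / n%:R) ^+ 3) = 24 * B ^+ 3 * n%:R^-1 :> R.
    by field; rewrite gt_eqF.
  by rewrite ler_wpM2l // mulr_ge0.
(* Hence [V] is close to [m / 2], which is [gamma]; the ratio [n / (n - 1)] is responsible for the
   extra [m / rn] in [stepb]. *)
have VE x : V x = n%:R / (2 * (n%:R - 1)) * pavg (fun c d => s (x [set c]) (x [set d])).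
  rewrite /V /pavg sum_pairs_lt -big_distrr /= mulrA.
  rewrite [in RHS](eq_bigr (fun p : 'I_n * 'I_n => 2 * s (x [set p.1]) (x [set p.2]))).
    by rewrite -big_distrr /=; field; rewrite !gt_eqF.
  by move=> p _; rewrite [s (x [set p.2]) _]sC; ring.
have V0 x : 0 <= V x.
  by apply: sumr_ge0 => p _; rewrite mulr_ge0 // invr_ge0 sqr_ge0.
have stepb : `|Ex mu (fun x => expR (- (2^-1 * V x)) * cos (C x)) -
    Ex mu (fun x => expR (- (2^-1 * gamma)) * cos (C x))| <= (K1 + m) / rn.
  rewrite -ExB; apply: le_trans (norm_Ex mu_ge0 _) _.
  apply: le_trans (_ : Ex mu (fun x : {ffun {set 'I_n} -> A} =>
     `|pavg (fun c d => s (x [set c]) (x [set d])) - m| + m / rn) <= _).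
    apply: le_Ex => // x; rewrite -mulrBl normrM; apply: le_trans (_ : _ * 1 <= _).
      by apply: ler_wpM2l => //; apply: cos_max.
    rewrite mulr1; apply: le_trans (expRN_lipschitz _ _) _.
    - by rewrite mulr_ge0 ?invr_ge0.
    - by rewrite gm !mulr_ge0 ?invr_ge0.
    set P := pavg _; rewrite VE -/P gm.
    have -> : 2^-1 * (n%:R / (2 * (n%:R - 1)) * P) - 2^-1 * (2^-1 * m) =
       (n%:R / (4 * (n%:R - 1))) * (P - m) + 4^-1 * m * (n%:R - 1)^-1.
      by field; rewrite gt_eqF.
    apply: le_trans (ler_normD _ _) _; apply: lerD.
      rewrite normrM ler_piMl // ger0_norm; last by rewrite divr_ge0 ?mulr_ge0 ?ltW.
      rewrite ler_pdivrMr ?mulr_gt0 //; lra.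
    have g1 : 0 <= 4^-1 * m * (n%:R - 1)^-1 by rewrite mulr_ge0 ?mulr_ge0 ?invr_ge0 // ltW.
    rewrite (ger0_norm g1).
    apply: le_trans (_ : 4^-1 * m * (2 / rn) <= _).
      rewrite ler_wpM2l ?mulr_ge0 ?invr_ge0 //; apply: le_trans invn _.
      by rewrite ler_wpM2l.
    rewrite mulrA; apply: ler_wpM2r; [by rewrite invr_ge0 ltW|lra].
  by rewrite ExD Ex_cst // mulrDl lerD // LLN.
have stepc : `|Ex mu (fun x : {ffun {set 'I_n} -> A} => cos (C x)) -
    expR (- (2^-1 * \sum_a mu a * t a ^+ 2)) * cos c0| <= 3 * B ^+ 3 / rn.
  pose f (c : 'I_n) a := rn^-1 * t a.
  have us : uniq [seq [set c] | c <- enum 'I_n].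
    by rewrite map_inj_uniq ?enum_uniq //; apply: set1_inj.
  have fB c a : `|f c a| <= B / rn.
    by rewrite normrM gtr0_norm ?invr_gt0 // mulrC ler_wpM2r // invr_ge0 ltW.
  have BB1 : B / rn <= 1 by rewrite ler_pdivrMr //; lra.
  have f0 c : \sum_a mu a * f c a = 0.
    rewrite (eq_bigr (fun a => rn^-1 * (mu a * t a))).
      by rewrite -big_distrr /= t0 mulr0.
    by move=> a _; rewrite /f mulrCA.
  have := cos_telescope mu_ge0 mu_sum c0 us fB BB1 f0.
  have -> : \sum_(j <- enum 'I_n) \sum_a mu a * f j a ^+ 2 = \sum_a mu a * t a ^+ 2.
    transitivity (\sum_(j <- enum 'I_n) n%:R^-1 * \sum_a mu a * t a ^+ 2).
      apply: eq_bigr => j _; rewrite big_distrr /=; apply: eq_bigr => a _.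
      by rewrite /f exprMn exprVn rn2 mulrCA.
    by rewrite big_enum /= sumr_const card_ord -[LHS]mulr_natl mulrA mulfV ?mul1r // gt_eqF.
  rewrite size_enum_ord.
  have -> : n%:R * (3 * (B / rn) ^+ 3) = 3 * B ^+ 3 / rn.
    by rewrite -rn2; field; rewrite gt_eqF.
  apply: le_trans; rewrite le_eqVlt; apply/orP; left; apply/eqP.
  congr `|_ - _|; apply: eq_Ex => x; rewrite /C big_distrr big_enum //.
have EE : E = expR (- (2^-1 * gamma)) * (expR (- (2^-1 * \sum_a mu a * t a ^+ 2)) * cos c0).
  by rewrite /E addrC expRD mulrA.
have stepd : `|Ex mu (fun x => expR (- (2^-1 * gamma)) * cos (C x)) - E| <= 3 * B ^+ 3 / rn.
  rewrite ExZ EE -mulrBr normrM ger0_norm ?expR_ge0 //.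
  apply: le_trans stepc; rewrite ler_piMl // expR_le1 oppr_le0 gm !mulr_ge0 ?invr_ge0 //.
set E1 := Ex mu _ in stepa *; set E2 := Ex mu _ in stepa stepb; set E3 := Ex mu _ in stepb stepd.
have -> : E1 - E = (E1 - E2) + ((E2 - E3) + (E3 - E)) by ring.
apply: le_trans (ler_normD _ _) _.
apply: le_trans (lerD stepa (le_trans (ler_normD _ _) (lerD stepb stepd))) _.
rewrite -!mulrDl ler_wpM2r ?invr_ge0 ?ltW //; lra.
Qed.

End pair_clt.

(** * Second-order expansion of U-statistics *)

Section second_order.
Variables (R : realType) (A : finType) (mu : A -> R).
Hypotheses (mu_ge0 : forall a, 0 <= mu a) (mu_sum : \sum_a mu a = 1).

Lemma dep_eq (I : finType) (S : {set I}) (F : {ffun I -> A} -> R) (x y : {ffun I -> A}) :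
  dep S F -> (forall i, i \in S -> x i = y i) -> F x = F y.
Proof.
move=> FS xy; rewrite -(FS x y); congr F.
apply/ffunP => i; rewrite ffunE; case: ifP => // iS; exact: xy.
Qed.

Lemma dep_eqP (I : finType) (S : {set I}) (F : {ffun I -> A} -> R) :
  (forall x y : {ffun I -> A}, (forall i, i \in S -> x i = y i) -> F x = F y) -> dep S F.
Proof. by move=> H x y; apply: H => i iS; rewrite ffunE iS. Qed.

Lemma depB (I : finType) (S : {set I}) (F G : {ffun I -> A} -> R) :
  dep S F -> dep S G -> dep S (fun x => F x - G x).
Proof. by move=> FS GS x y; rewrite FS GS. Qed.

Lemma dep_sum (I : finType) (S : {set I}) (J : Type) (s : seq J) (Q : pred J)
    (F : J -> {ffun I -> A} -> R) :
  (forall j, dep S (F j)) -> dep S (fun x => \sum_(j <- s | Q j) F j x).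
Proof. by move=> FS x y; apply: eq_bigr => j _; rewrite FS. Qed.

Lemma mem_cells1 k (a : 'I_k) (B : {set 'I_k}) : B \in cells [set a] -> B = [set a].
Proof.
by rewrite inE subset1 => /andP[/negbTE ->]; rewrite orbF => /eqP.
Qed.

Lemma mem_cells2 k (a b : 'I_k) (B : {set 'I_k}) : B \in cells [set a; b] ->
  [\/ B = [set a], B = [set b] | B = [set a; b]].
Proof.
rewrite inE => /andP[B0 /subsetP Bab].
have Bc c : c \in B -> (c == a) || (c == b) by move=> /Bab; rewrite !inE.
have [aB|aB] := boolP (a \in B); have [bB|bB] := boolP (b \in B).
- apply: Or33; apply/setP => c; rewrite !inE; apply/idP/idP; first exact: Bc.
  by move=> /orP[] /eqP ->.
- apply: Or31; apply/setP => c; rewrite !inE; apply/idP/idP; last by move=> /eqP ->.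
  by move=> cB; have /orP[//|/eqP cb] := Bc c cB; rewrite -cb cB in bB.
- apply: Or32; apply/setP => c; rewrite !inE; apply/idP/idP; last by move=> /eqP ->.
  by move=> cB; have /orP[/eqP ca|//] := Bc c cB; rewrite -ca cB in aB.
- have /set0Pn[c cB] := B0.
  by have /orP[] := Bc c cB => /eqP e; [rewrite -e cB in aB|rewrite -e cB in bB].
Qed.

Lemma set1_cells k (a : 'I_k) (S : {set 'I_k}) : a \in S -> [set a] \in cells S.
Proof. by move=> aS; rewrite inE -card_gt0 cards1 sub1set. Qed.

Lemma sum_sets1 k (f : {set 'I_k} -> R) :
  \sum_(S : {set 'I_k} | #|S| == 1%N) f S = \sum_a f [set a].
Proof.
rewrite (eq_bigl [in [set [set a] | a : 'I_k]]) => [|S].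
  by rewrite big_imset //= => a b _ _ /set1_inj.
apply/cards1P/imsetP => [[a ->]|[a _ ->]]; by exists a.
Qed.

Lemma sum_sets2 k (f : {set 'I_k} -> R) :
  \sum_(S : {set 'I_k} | #|S| == 2%N) f S =
  \sum_(p : 'I_k * 'I_k | (p.1 < p.2)%N) f [set p.1; p.2].
Proof.
rewrite (eq_bigl [in [set [set p.1; p.2] | p : 'I_k * 'I_k in
  [set p : 'I_k * 'I_k | (p.1 < p.2)%N]]]) => [|S].
  rewrite big_imset /=; first by apply: eq_bigl => p; rewrite inE.
  move=> [c d] [c' d'] /=; rewrite !inE /= => cd cd' /setP e.
  have /orP hc : (c == c') || (c == d') by have := e c; rewrite !inE eqxx /= => <-.
  have /orP hd : (d == c') || (d == d') by have := e d; rewrite !inE eqxx orbT => <-.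
  case: hc => /eqP hc; case: hd => /eqP hd; rewrite hc hd //.
  - by move: cd; rewrite hc hd ltnn.
  - by move: cd; rewrite hc hd ltnNge (ltnW cd').
  - by move: cd; rewrite hc hd ltnn.
apply/cards2P/imsetP => [[a [b [ab ->]]]|[[a b]]].
  have [lt|lt|/val_inj e] := ltngtP a b.
  - by exists (a, b); rewrite ?inE.
  - by exists (b, a); rewrite ?inE // setUC.
  - by rewrite e eqxx in ab.
rewrite inE /= => ab ->; exists a, b; split => //; by rewrite -val_eqE /= ltn_eqF.
Qed.

Definition nodes n : {set {set 'I_n}} := [set B : {set 'I_n} | #|B| == 1%N].

(* A configuration as seen from the cells of {a, b}: u at {a}, v at {b}, w at {a, b}. *)
Definition pt k (a b : 'I_k) (u v w : A) : {ffun {set 'I_k} -> A} :=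
  [ffun B => if B == [set a] then u else if B == [set b] then v else w].

Lemma pt_a k (a b : 'I_k) u v w : pt a b u v w [set a] = u.
Proof. by rewrite ffunE eqxx. Qed.

Lemma pt_b k (a b : 'I_k) u v w : a != b -> pt a b u v w [set b] = v.
Proof.
move=> ab; rewrite ffunE eqxx ifN //; apply: contra ab => /eqP/set1_inj ->; exact: eqxx.
Qed.

Lemma pt_ab k (a b : 'I_k) u v w : a != b -> pt a b u v w [set a; b] = w.
Proof.
move=> ab; rewrite ffunE !ifN //; apply/eqP => /(congr1 (fun B : {set 'I_k} => #|B|));
by rewrite cards2 cards1 ab.
Qed.

Lemma dep_pt k (a b : 'I_k) (H : {ffun {set 'I_k} -> A} -> R) x : a != b ->
  dep (cells [set a; b]) H ->
  H x = H (pt a b (x [set a]) (x [set b]) (x [set a; b])).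
Proof.
move=> ab HS; apply: dep_eq HS _ => B /mem_cells2[] ->.
- by rewrite pt_a.
- by rewrite pt_b.
- by rewrite pt_ab.
Qed.

(** When [G] is degenerate at level 2, this is its Hoeffding kernel on a pair of nodes. It is not
    symmetric in [u] and [v], since positions are taken in increasing order; [gpsi] symmetrizes
    it. *)
Definition psi k (G : {ffun {set 'I_k} -> A} -> R) u v w : R :=
  \sum_(p : 'I_k * 'I_k | (p.1 < p.2)%N)
    Pr mu (cells [set p.1; p.2]) G (pt p.1 p.2 u v w).

Lemma lt_neq k (p : 'I_k * 'I_k) : (p.1 < p.2)%N -> p.1 != p.2.
Proof. by move=> lt; rewrite -val_eqE /= ltn_eqF. Qed.

Lemma restrE n k (i : {ffun 'I_k -> 'I_n}) (x : {ffun {set 'I_n} -> A}) B :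
  restr i x B = x (i @: B).
Proof. by rewrite /restr ffunE. Qed.

Lemma UavgB n k (F G : {ffun {set 'I_k} -> A} -> R) (x : {ffun {set 'I_n} -> A}) :
  Uavg (fun y => F y - G y) x = Uavg F x - Uavg G x.
Proof. exact: avgB. Qed.

(** A projection on two positions sees only the two nodes placed there, and these are uniform over
    ordered pairs of distinct nodes by [avg_marginal2]. *)
Lemma Uavg_level2 n k (G : {ffun {set 'I_k} -> A} -> R) (x : {ffun {set 'I_n} -> A}) :
  (k <= n)%N ->
  Uavg (fun y => \sum_(S : {set 'I_k} | #|S| == 2%N) Pr mu (cells S) G y) x =
  pavg (fun c d => psi G (x [set c]) (x [set d]) (x [set c; d])).
Proof.
move=> kn; rewrite /Uavg.
rewrite (eq_avg (fun i => sum_sets2 (fun S => Pr mu (cells S) G (restr i x)))) avg_sum.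
rewrite /pavg /sum_pairs.
under [in RHS]eq_bigr => c _ do rewrite /psi exchange_big.
rewrite [in RHS]exchange_big big_distrr /=; apply: eq_bigr => p pp.
have ne := lt_neq pp; rewrite -(@avg_marginal2 R n k p.1 p.2
  (fun c d => Pr mu (cells [set p.1; p.2]) G (pt p.1 p.2 (x [set c]) (x [set d]) (x [set c; d])))) //.
apply: eq_avg => i; rewrite (dep_pt _ ne (dep_Pr mu _ _)) !restrE.
by rewrite imsetU !imset_set1.
Qed.

Lemma Uavg_level1 n k (G : {ffun {set 'I_k} -> A} -> R) (x : {ffun {set 'I_n} -> A}) :
  (k <= n)%N ->
  Uavg (fun y => \sum_(S : {set 'I_k} | #|S| == 1%N) Pr mu (cells S) G y) x =
  n%:R^-1 * \sum_c \sum_a Pr mu (cells [set a]) G [ffun=> x [set c]].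
Proof.
move=> kn; rewrite /Uavg.
rewrite (eq_avg (fun i => sum_sets1 (fun S => Pr mu (cells S) G (restr i x)))) avg_sum.
rewrite [in RHS]exchange_big big_distrr /=; apply: eq_bigr => a _.
rewrite -(@avg_marginal1 R n k a (fun c => Pr mu (cells [set a]) G [ffun=> x [set c]])) //.
apply: eq_avg => i; apply: dep_eq (dep_Pr mu _ _) _ => B /mem_cells1 ->.
by rewrite restrE ffunE imset_set1.
Qed.

Lemma dep_hoeffding k r (G : {ffun {set 'I_k} -> A} -> R) :
  dep (cells [set: 'I_k]) G -> dep (cells [set: 'I_k])
    (fun x => G x - \sum_(S : {set 'I_k} | #|S| == r) Pr mu (cells S) G x).
Proof.
move=> dG; apply: depB => //; apply: dep_sum => S.
apply: dep_sub (dep_Pr mu _ _); apply: cells_sub; exact: subsetT.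
Qed.

(** Removing the second level leaves a kernel degenerate at level 3, whose U-statistic has variance
    of order [n ^ -3]; after scaling by [n] it is of order [n ^ (- 1 / 2)]. [level1_approx] is the
    same argument one level lower. *)
Lemma level2_approx k (G : {ffun {set 'I_k} -> A} -> R) : (0 < k)%N ->
  dep (cells [set: 'I_k]) G -> degen mu 2 G ->
  exists2 K, 0 <= K & forall n, (k < n)%N ->
    Ex mu (fun x : {ffun {set 'I_n} -> A} => `|n%:R * Uavg G x -
       n%:R * pavg (fun c d => psi G (x [set c]) (x [set d]) (x [set c; d]))|)
    <= K / Num.sqrt n%:R.
Proof.
move=> k0 dG dg.
set T := fun y => G y - \sum_(S : {set 'I_k} | #|S| == 2%N) Pr mu (cells S) G y.
set K2 := Cst R k * Ex mu (fun y => T y ^+ 2).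
have K20 : 0 <= K2 by rewrite mulr_ge0 ?ler0n // Ex_ge0 // => x; rewrite sqr_ge0.
exists (Num.sqrt K2); first exact: sqrtr_ge0.
move=> n kn; have n0 : 0 < n%:R :> R by rewrite ltr0n (leq_ltn_trans _ kn).
apply: Ex_norm_le => //; first by rewrite divr_ge0 ?sqrtr_ge0.
rewrite exprMn exprVn !sqr_sqrtr ?ler0n // ler_pdivlMr //.
have V := Uavg_variance mu_ge0 mu_sum n k0 (dep_hoeffding 2 dG) (hoeffding mu_sum dg).
apply: le_trans V; rewrite le_eqVlt; apply/orP; left; apply/eqP.
rewrite (exprSr _ 2) mulrA; congr (_ * _); rewrite [RHS]mulrC -ExZ; apply: eq_Ex => x.
by rewrite -Uavg_level2 ?(ltnW kn) // -mulrBr -UavgB exprMn.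
Qed.

Lemma level1_approx k (G : {ffun {set 'I_k} -> A} -> R) : (0 < k)%N ->
  dep (cells [set: 'I_k]) G -> degen mu 1 G ->
  exists2 K, 0 <= K & forall n, (k < n)%N ->
    Ex mu (fun x : {ffun {set 'I_n} -> A} => `|Num.sqrt n%:R * Uavg G x -
       (Num.sqrt n%:R)^-1 * \sum_c \sum_a Pr mu (cells [set a]) G [ffun=> x [set c]]|)
    <= K / Num.sqrt n%:R.
Proof.
move=> k0 dG dg.
set T := fun y => G y - \sum_(S : {set 'I_k} | #|S| == 1%N) Pr mu (cells S) G y.
set K2 := Cst R k * Ex mu (fun y => T y ^+ 2).
have K20 : 0 <= K2 by rewrite mulr_ge0 ?ler0n // Ex_ge0 // => x; rewrite sqr_ge0.
exists (Num.sqrt K2); first exact: sqrtr_ge0.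
move=> n kn; have n0 : 0 < n%:R :> R by rewrite ltr0n (leq_ltn_trans _ kn).
apply: Ex_norm_le => //; first by rewrite divr_ge0 ?sqrtr_ge0.
rewrite exprMn exprVn !sqr_sqrtr ?ler0n // ler_pdivlMr //.
have V := Uavg_variance mu_ge0 mu_sum n k0 (dep_hoeffding 1 dG) (hoeffding mu_sum dg).
apply: le_trans V; rewrite le_eqVlt; apply/orP; left; apply/eqP.
rewrite (exprSr _ 1) expr1 mulrA; congr (_ * _); rewrite [RHS]mulrC -ExZ; apply: eq_Ex => x.
have -> : (Num.sqrt n%:R)^-1 = Num.sqrt n%:R * n%:R^-1 :> R.
  apply/esym; rewrite -{2}(sqr_sqrtr (ltW n0)) expr2 invfM mulrA mulfV ?mul1r //.
  by rewrite gt_eqF // sqrtr_gt0.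
by rewrite -mulrA -Uavg_level1 ?(ltnW kn) // -mulrBr -UavgB exprMn sqr_sqrtr // ltW.
Qed.

Definition centered k (F : {ffun {set 'I_k} -> A} -> R) y := F y - Ex mu F.

Lemma center_degen k (F : {ffun {set 'I_k} -> A} -> R) : degen mu 1 (centered F).
Proof. by apply: degen1; rewrite /centered ExB Ex_cst ?subrr. Qed.

Lemma dep_center k (F : {ffun {set 'I_k} -> A} -> R) S : dep S F -> dep S (centered F).
Proof. by move=> FS; apply: depB. Qed.

Lemma Ex_center_sqr k (F : {ffun {set 'I_k} -> A} -> R) :
  Ex mu (fun y => centered F y ^+ 2) <= Ex mu (fun y => F y ^+ 2).
Proof.
rewrite -subr_ge0.
have -> : Ex mu (fun y => F y ^+ 2) - Ex mu (fun y => centered F y ^+ 2) = Ex mu F ^+ 2.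
  rewrite -ExB (eq_Ex mu (_ : _ =1 (fun y => (2 * Ex mu F) * F y - Ex mu F ^+ 2))).
    by rewrite ExB ExZ Ex_cst //; ring.
  by move=> y; rewrite /centered; ring.
exact: sqr_ge0.
Qed.

(** The part of [F] left after conditioning on the node variables. *)
Definition nres k (F : {ffun {set 'I_k} -> A} -> R) y := F y - Pr mu (nodes k) F y.

Lemma cells_nodes k (S : {set 'I_k}) : (#|S| < 2)%N -> cells S \subset nodes k.
Proof.
move=> S2; apply/subsetP => B; rewrite !inE -card_gt0 => /andP[B0 /subset_leq_card].
by move=> BS; rewrite eqn_leq B0 -ltnS (leq_ltn_trans BS).
Qed.

Lemma nodes_cells k : nodes k \subset cells [set: 'I_k].
Proof.
by apply/subsetP => B; rewrite !inE subsetT andbT -card_gt0 => /eqP ->.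
Qed.

(** The cells of a set of at most one node are node cells, and [nres F] projects to 0 on node
    cells. *)
Lemma nres_degen k (F : {ffun {set 'I_k} -> A} -> R) : degen mu 2 (nres F).
Proof.
move=> S S2 x; rewrite PrB Pr_Pr //; have /setIidPl -> := cells_nodes S2.
by rewrite subrr.
Qed.

Lemma dep_nres k (F : {ffun {set 'I_k} -> A} -> R) :
  dep (cells [set: 'I_k]) F -> dep (cells [set: 'I_k]) (nres F).
Proof.
move=> dF; apply: depB => //; apply: dep_sub (dep_Pr mu _ _); exact: nodes_cells.
Qed.

Lemma Ex_nres_sqr k (F : {ffun {set 'I_k} -> A} -> R) :
  Ex mu (fun y => nres F y ^+ 2) <= Ex mu (fun y => F y ^+ 2).
Proof.
rewrite -subr_ge0.
have e : Ex mu (fun y => F y * Pr mu (nodes k) F y) = Ex mu (fun y => Pr mu (nodes k) F y ^+ 2).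
  by rewrite (Ex_Pr_mul mu_sum _ (dep_Pr mu (nodes k) F)); apply: eq_Ex => y; rewrite expr2.
have -> : Ex mu (fun y => F y ^+ 2) - Ex mu (fun y => nres F y ^+ 2) =
    Ex mu (fun y => Pr mu (nodes k) F y ^+ 2).
  rewrite -ExB (eq_Ex mu (_ : _ =1 (fun y => 2 * (F y * Pr mu (nodes k) F y) -
    Pr mu (nodes k) F y ^+ 2))).
    by rewrite ExB ExZ e; ring.
  by move=> y; rewrite /nres; ring.
by apply: Ex_ge0 => // y; rewrite sqr_ge0.
Qed.

Definition gpsi k (F : {ffun {set 'I_k} -> A} -> R) u v w : R :=
  psi (nres F) u v w + psi (nres F) v u w.

(* Asymptotic covariance of the fluctuations n (Uavg F - E[Uavg F | nodes]). *)
Definition gcov k (F G : {ffun {set 'I_k} -> A} -> R) : R :=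
  2^-1 * \sum_u \sum_v mu u * mu v * \sum_w mu w * (gpsi F u v w * gpsi G u v w).

(** Averaging over the variable of the pair amounts to conditioning on the two singletons, where
    [nres F] projects to 0. *)
Lemma psi_nres_mean k (F : {ffun {set 'I_k} -> A} -> R) u v :
  \sum_w mu w * psi (nres F) u v w = 0.
Proof.
rewrite (eq_bigr (fun w => \sum_(p : 'I_k * 'I_k | (p.1 < p.2)%N)
    mu w * Pr mu (cells [set p.1; p.2]) (nres F) (pt p.1 p.2 u v w))); last first.
  by move=> w _; rewrite big_distrr.
rewrite exchange_big big1 //= => p pp; have ne := lt_neq pp.
pose S := [set [set p.1]; [set p.2]].
have SN : S \subset nodes k.
  by apply/subsetP => B; rewrite !inE => /orP[] /eqP ->; rewrite cards1.
have Sc : S \subset cells [set p.1; p.2].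
  apply/subsetP => B; rewrite !inE => /orP[] /eqP ->;
  by rewrite -card_gt0 cards1 sub1set !inE eqxx ?orbT.
set H := Pr mu (cells [set p.1; p.2]) (nres F).
(* The last argument of [pt] is arbitrary here: the pair cell is outside [S] and gets averaged
   out. *)
transitivity (Pr mu S H (pt p.1 p.2 u v u)).
  rewrite -(Ex_coord mu_sum [set p.1; p.2] (fun w => H (pt p.1 p.2 u v w))).
  apply: eq_Ex => y; rewrite [RHS](dep_pt _ ne (dep_Pr mu _ _)); congr H.
  have -> : mix S (pt p.1 p.2 u v u) y [set p.1] = u by rewrite ffunE !inE eqxx /= pt_a.
  have -> : mix S (pt p.1 p.2 u v u) y [set p.2] = v.
    by rewrite ffunE !inE eqxx orbT pt_b.
  rewrite ffunE; case: ifP => //; rewrite !inE => /orP[] /eqP/(congr1 (fun B : {set _} => #|B|));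
  by rewrite cards2 cards1 ne.
rewrite /H Pr_Pr // (setIidPl Sc) PrB Pr_Pr // (setIidPl SN); exact: subrr.
Qed.

(** The linear statistic of the nodes is kept inside the cosine so that the limit is joint with the
    label frequencies. *)
Lemma nres_clt k (F : {ffun {set 'I_k} -> A} -> R) (t : A -> R) (c0 : R) : (0 < k)%N ->
  dep (cells [set: 'I_k]) F -> \sum_a mu a * t a = 0 ->
  exists K, forall n, (k < n)%N ->
    `|Ex mu (fun x : {ffun {set 'I_n} -> A} =>
        cos (c0 + (Num.sqrt n%:R)^-1 * \sum_c t (x [set c]) + n%:R * Uavg (nres F) x)) -
      expR (- (2^-1 * \sum_a mu a * t a ^+ 2) - 2^-1 * gcov F F) * cos c0| <=
    K / Num.sqrt n%:R.
Proof.
move=> k0 dF t0.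
have [K1 K10 H1] := level2_approx k0 (dep_nres dF) (nres_degen F).
have [K2 H2] := pair_clt mu_ge0 mu_sum c0 t0 (psi_nres_mean F).
exists (K1 + K2) => n kn; have n1 : (1 < n)%N by apply: leq_ltn_trans kn.
rewrite mulrDl.
set M := fun x : {ffun {set 'I_n} -> A} => n%:R * Uavg (nres F) x.
set M' := fun x : {ffun {set 'I_n} -> A} =>
  n%:R * pavg (fun c d => psi (nres F) (x [set c]) (x [set d]) (x [set c; d])).
set L := fun x : {ffun {set 'I_n} -> A} => (Num.sqrt n%:R)^-1 * \sum_c t (x [set c]).
set E := _ * cos c0.
have -> : Ex mu (fun x => cos (c0 + L x + M x)) - E =
    Ex mu (fun x => cos (c0 + L x + M x) - cos (c0 + L x + M' x)) +
    (Ex mu (fun x => cos (c0 + L x + M' x)) - E) by rewrite ExB; ring.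
apply: le_trans (ler_normD _ _) (lerD _ (H2 n n1)).
apply: le_trans (norm_Ex mu_ge0 _) (le_trans _ (H1 n kn)); apply: le_Ex => // x.
apply: le_trans (cos_lipschitz _ _) _.
by rewrite (_ : _ - _ = M x - M' x) // /M /M'; ring.
Qed.

Lemma PrZ (I : finType) (S : {set I}) c (F : {ffun I -> A} -> R) x :
  Pr mu S (fun z => c * F z) x = c * Pr mu S F x.
Proof. exact: ExZ. Qed.

Lemma Pr_sum (I : finType) (S : {set I}) (J : Type) (s : seq J) (Q : pred J)
    (F : J -> {ffun I -> A} -> R) x :
  Pr mu S (fun z => \sum_(j <- s | Q j) F j z) x = \sum_(j <- s | Q j) Pr mu S (F j) x.
Proof. exact: Ex_sum. Qed.

Lemma gpsi_linear k (J : finType) (r : J -> R) (F : J -> {ffun {set 'I_k} -> A} -> R) u v w :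
  gpsi (fun y => \sum_j r j * F j y) u v w = \sum_j r j * gpsi (F j) u v w.
Proof.
have e x y z : psi (nres (fun y => \sum_j r j * F j y)) x y z =
    \sum_j r j * psi (nres (F j)) x y z.
  rewrite /psi; under [in RHS]eq_bigr => j _ do rewrite big_distrr /=.
  rewrite [in RHS]exchange_big /=; apply: eq_bigr => p _.
  have nE y' : nres (fun y => \sum_j r j * F j y) y' = \sum_j r j * nres (F j) y'.
    rewrite /nres Pr_sum -sumrB; apply: eq_bigr => j _; by rewrite PrZ mulrBr.
  apply: etrans (eq_Ex mu (fun y' => nE _)) _; rewrite Ex_sum; apply: eq_bigr => j _; exact: ExZ.
by rewrite /gpsi !e -big_split /=; apply: eq_bigr => j _; rewrite mulrDr.
Qed.

Lemma sum_lin (T J : finType) (c : T -> R) (r : J -> R) (X : J -> T -> R) :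
  \sum_t c t * (\sum_j r j * X j t) = \sum_j r j * \sum_t c t * X j t.
Proof.
rewrite (eq_bigr (fun t => \sum_j r j * (c t * X j t))) => [|t _].
  by rewrite exchange_big; apply: eq_bigr => j _; rewrite mulr_sumr.
by rewrite mulr_sumr; apply: eq_bigr => j _; rewrite mulrCA.
Qed.

Lemma gcovC k (F G : {ffun {set 'I_k} -> A} -> R) : gcov F G = gcov G F.
Proof.
congr (_ * _); apply: eq_bigr => u _; apply: eq_bigr => v _; congr (_ * _).
by apply: eq_bigr => w _; rewrite [X in _ * X]mulrC.
Qed.

Lemma gcov_sumr k (J : finType) (r : J -> R) (F : {ffun {set 'I_k} -> A} -> R)
    (G : J -> {ffun {set 'I_k} -> A} -> R) :
  gcov F (fun y => \sum_j r j * G j y) = \sum_j r j * gcov F (G j).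
Proof.
rewrite /gcov (eq_bigr (fun j => 2^-1 * (r j * \sum_u \sum_v mu u * mu v *
    \sum_w mu w * (gpsi F u v w * gpsi (G j) u v w)))); last by move=> j _; rewrite mulrCA.
rewrite -mulr_sumr; congr (_ * _).
transitivity (\sum_u 1 * \sum_j r j * \sum_v mu u * mu v *
    \sum_w mu w * (gpsi F u v w * gpsi (G j) u v w)).
  apply: eq_bigr => u _; rewrite mul1r -(sum_lin (fun v => mu u * mu v)).
  apply: eq_bigr => v _; congr (_ * _).
  rewrite -(sum_lin mu); apply: eq_bigr => w _; congr (_ * _).
  by rewrite gpsi_linear mulr_sumr; apply: eq_bigr => j _; rewrite mulrCA.
by rewrite (sum_lin (fun=> 1)); apply: eq_bigr => j _; congr (_ * _); apply: eq_bigr => u _; rewrite mul1r.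
Qed.

Lemma gcov_quadratic k (J : finType) (r : J -> R) (F : J -> {ffun {set 'I_k} -> A} -> R) :
  gcov (fun y => \sum_j r j * F j y) (fun y => \sum_j r j * F j y) =
  \sum_i \sum_j r i * r j * gcov (F i) (F j).
Proof.
rewrite gcov_sumr (eq_bigr (fun i => \sum_j r i * r j * gcov (F i) (F j))) // => i _.
rewrite gcovC gcov_sumr mulr_sumr; apply: eq_bigr => j _.
by rewrite mulrA.
Qed.

Lemma gcov_ge0 k (F : {ffun {set 'I_k} -> A} -> R) : 0 <= gcov F F.
Proof.
rewrite mulr_ge0 ?invr_ge0 //; apply: sumr_ge0 => u _; apply: sumr_ge0 => v _.
rewrite !mulr_ge0 //; apply: mean_ge0 => // w; exact: sqr_ge0.
Qed.

Lemma nres_variance k (F : {ffun {set 'I_k} -> A} -> R) n : (0 < k)%N -> (0 < n)%N ->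
  dep (cells [set: 'I_k]) F ->
  Ex mu (fun x : {ffun {set 'I_n} -> A} => (n%:R * Uavg (nres F) x) ^+ 2) <=
  Cst R k * Ex mu (fun y => F y ^+ 2).
Proof.
move=> k0 n0 dF.
have V := Uavg_variance mu_ge0 mu_sum n k0 (dep_nres dF) (nres_degen F).
apply: le_trans (le_trans V _).
  rewrite mulrC -ExZ le_eqVlt; apply/orP; left; apply/eqP; apply: eq_Ex => x.
  by rewrite exprMn.
by rewrite ler_wpM2l ?ler0n // Ex_nres_sqr.
Qed.

End second_order.

(** * U-statistics in the labels alone *)

Section iid_ustat.
Variables (R : realType) (A : finType) (mu : A -> R).
Hypotheses (mu_ge0 : forall a, 0 <= mu a) (mu_sum : \sum_a mu a = 1).
Variables (k : nat) (k0 : (0 < k)%N) (F : {ffun {set 'I_k} -> A} -> R).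
Hypothesis dF : dep (nodes k) F.

Let G := centered mu F.

Let dG : dep (nodes k) G.
Proof. exact: dep_center. Qed.

Let dcG : dep (cells [set: 'I_k]) G.
Proof. exact: dep_sub (nodes_cells k) dG. Qed.

Lemma center_variance n : (0 < n)%N ->
  Ex mu (fun x : {ffun {set 'I_n} -> A} => Uavg G x ^+ 2) * n%:R <=
  Cst R k * Ex mu (fun y => F y ^+ 2).
Proof.
move=> n0; have V := Uavg_variance mu_ge0 mu_sum n k0 dcG (center_degen mu_sum F).
rewrite -[X in _ * X]expr1; apply: le_trans V _.
by rewrite ler_wpM2l ?ler0n // Ex_center_sqr.
Qed.

(** The kernel of the Hajek projection, summed over the positions that a node can occupy. *)
Definition proj1 u : R := \sum_a Pr mu (cells [set a]) G [ffun=> u].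

(** The second-order kernel. The third argument [u] of [pt] is a filler: [G] depends on node cells
    only. *)
Definition proj2 u v : R := \sum_(p : 'I_k * 'I_k | (p.1 < p.2)%N)
  Pr mu (cells [set p.1; p.2]) G (pt p.1 p.2 u v u).

Lemma proj1_mean : \sum_u mu u * proj1 u = 0.
Proof.
rewrite (eq_bigr (fun u => \sum_a mu u * Pr mu (cells [set a]) G [ffun=> u])); last first.
  by move=> u _; rewrite mulr_sumr.
rewrite exchange_big big1 //= => a _.
rewrite -(Ex_coord mu_sum [set a] (fun u => Pr mu (cells [set a]) G [ffun=> u])).
transitivity (Ex mu (Pr mu (cells [set a]) G)).
  apply: eq_Ex => y; apply: dep_eq (dep_Pr mu _ _) _ => B /mem_cells1 ->.
  by rewrite ffunE.
by rewrite Ex_Pr // /G /centered ExB Ex_cst // subrr.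
Qed.

Lemma sum_proj1_clt (c0 l : R) : exists K, forall n, (k < n)%N ->
  `|Ex mu (fun x : {ffun {set 'I_n} -> A} => cos (c0 + l * (Num.sqrt n%:R * Uavg G x))) -
    expR (- (2^-1 * \sum_u mu u * (l * proj1 u) ^+ 2)) * cos c0| <= K / Num.sqrt n%:R.
Proof.
have [K1 K10 H1] := level1_approx mu_ge0 mu_sum k0 dcG (center_degen mu_sum F).
have t0 : \sum_u mu u * (l * proj1 u) = 0.
  rewrite (eq_bigr (fun u => l * (mu u * proj1 u))) => [|u _]; last by rewrite mulrCA.
  by rewrite -mulr_sumr proj1_mean mulr0.
(* With the zero kernel on pairs, [pair_clt] becomes the central limit theorem for sums over
   nodes. *)
have p0 u v : \sum_a mu a * (fun _ _ _ : A => 0 : R) u v a = 0.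
  by rewrite big1 // => a _; rewrite mulr0.
have [K2 H2] := pair_clt mu_ge0 mu_sum c0 t0 p0.
exists (`|l| * K1 + K2) => n kn; have n1 : (1 < n)%N by apply: leq_ltn_trans kn.
rewrite mulrDl; move: (H2 n n1).
rewrite [X in 2^-1 * (2^-1 * X)]big1 ?mulr0 ?subr0 => [|u _]; last first.
  by rewrite big1 // => v _; rewrite big1 ?mulr0 // => a _; rewrite addr0 expr0n mulr0.
set E := _ * cos c0 => H2n.
set L := fun x : {ffun {set 'I_n} -> A} => (Num.sqrt n%:R)^-1 * \sum_c proj1 (x [set c]).
have eL : Ex mu (fun x : {ffun {set 'I_n} -> A} =>
    cos (c0 + (Num.sqrt n%:R)^-1 * \sum_c l * proj1 (x [set c]) +
      n%:R * pavg (fun _ _ : 'I_n => 0))) = Ex mu (fun x => cos (c0 + l * L x)).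
  have z : pavg (fun _ _ : 'I_n => 0 : R) = 0.
    by rewrite /pavg /sum_pairs big1 ?mulr0 // => c _; rewrite big1.
  apply: eq_Ex => x; rewrite z.
  by rewrite !mulr0 addr0 /L -mulr_sumr mulrCA.
rewrite eL in H2n.
rewrite (_ : _ - E = Ex mu (fun x : {ffun {set 'I_n} -> A} =>
    cos (c0 + l * (Num.sqrt n%:R * Uavg G x)) - cos (c0 + l * L x)) +
    (Ex mu (fun x => cos (c0 + l * L x)) - E)); last by rewrite ExB; ring.
apply: le_trans (ler_normD _ _) (lerD _ H2n).
apply: le_trans (norm_Ex mu_ge0 _) _; rewrite -mulrA.
apply: le_trans (ler_wpM2l (normr_ge0 l) (H1 n kn)); rewrite -ExZ; apply: le_Ex => // x.
apply: le_trans (cos_lipschitz _ _) _.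
rewrite -normrM le_eqVlt; apply/orP; left; apply/eqP; congr (`|_|).
by rewrite /L /proj1; ring.
Qed.

Section degenerate.
Hypothesis degF : degen mu 2 G.

Lemma psi_proj2 u v w : psi mu G u v w = proj2 u v.
Proof.
apply: eq_bigr => p pp; have ne := lt_neq pp.
have e : forall y, Pr mu (cells [set p.1; p.2]) G y =
    Pr mu (cells [set p.1; p.2] :&: nodes k) G y by move=> y; apply: Pr_depI.
rewrite !e; apply: dep_eq (dep_Pr mu _ _) _ => B; rewrite in_setI => /andP[/mem_cells2[] ->].
- by rewrite !pt_a.
- by rewrite !pt_b.
- by rewrite inE cards2 ne.
Qed.

(** Averaging over the second label conditions on a single node, where [G] projects to 0 by
    degeneracy. *)
Lemma proj2_meanr u : \sum_v mu v * proj2 u v = 0.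
Proof.
rewrite (eq_bigr (fun v => \sum_(p : 'I_k * 'I_k | (p.1 < p.2)%N)
    mu v * Pr mu (cells [set p.1; p.2]) G (pt p.1 p.2 u v u))); last first.
  by move=> v _; rewrite mulr_sumr.
rewrite exchange_big big1 //= => p pp; have ne := lt_neq pp.
set H := Pr mu (cells [set p.1; p.2]) G.
transitivity (Pr mu (cells [set p.1]) H [ffun=> u]).
  rewrite -(Ex_coord mu_sum [set p.2] (fun v => H (pt p.1 p.2 u v u))).
  apply: eq_Ex => y.
  have eH z : H z = Pr mu (cells [set p.1; p.2] :&: nodes k) G z by apply: Pr_depI.
  rewrite !eH; apply: dep_eq (dep_Pr mu _ _) _ => B; rewrite in_setI => /andP[/mem_cells2[] ->].
  + by rewrite pt_a ffunE set1_cells ?inE // ffunE.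
  + rewrite pt_b // ffunE ifN //; apply: contra ne => /mem_cells1/set1_inj ->; exact: eqxx.
  + by rewrite inE cards2 ne.
rewrite /H Pr_Pr // cellsI degF //.
by apply: leq_ltn_trans (subset_leq_card (subsetIl _ _)) _; rewrite cards1.
Qed.

Lemma proj2_meanl v : \sum_u mu u * proj2 u v = 0.
Proof.
rewrite (eq_bigr (fun u => \sum_(p : 'I_k * 'I_k | (p.1 < p.2)%N)
    mu u * Pr mu (cells [set p.1; p.2]) G (pt p.1 p.2 u v u))); last first.
  by move=> u _; rewrite mulr_sumr.
rewrite exchange_big big1 //= => p pp; have ne := lt_neq pp.
set H := Pr mu (cells [set p.1; p.2]) G.
transitivity (Pr mu (cells [set p.2]) H [ffun=> v]).
  rewrite -(Ex_coord mu_sum [set p.1] (fun u => H (pt p.1 p.2 u v u))).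
  apply: eq_Ex => y.
  have eH z : H z = Pr mu (cells [set p.1; p.2] :&: nodes k) G z by apply: Pr_depI.
  rewrite !eH; apply: dep_eq (dep_Pr mu _ _) _ => B; rewrite in_setI => /andP[/mem_cells2[] ->].
  + rewrite pt_a ffunE ifN //; apply: contra ne => /mem_cells1/set1_inj ->; exact: eqxx.
  + by rewrite pt_b // ffunE set1_cells ?inE // ffunE.
  + by rewrite inE cards2 ne.
rewrite /H Pr_Pr // cellsI degF //.
by apply: leq_ltn_trans (subset_leq_card (subsetIl _ _)) _; rewrite cards1.
Qed.

(* Quadratic form in the centered empirical frequencies. *)
Definition qform n (x : {ffun {set 'I_n} -> A}) : R :=
  n%:R^-1 * \sum_c \sum_d proj2 (x [set c]) (x [set d]).

(** By [level2_approx], [n * Uavg G] is close to [n] times the average of [proj2] over pairs of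
    distinct nodes. The form [qform] also contains the diagonal, whose average obeys a law of large
    numbers and is compensated by its mean, and it is normalized by [n] instead of [n - 1]. *)
Lemma degenerate_approx : exists2 K, 0 <= K & forall n, (k < n)%N ->
  Ex mu (fun x : {ffun {set 'I_n} -> A} =>
    `|n%:R * Uavg G x - (qform x - \sum_u mu u * proj2 u u)|) <= K / Num.sqrt n%:R.
Proof.
have [K1 K10 H1] := level2_approx mu_ge0 mu_sum k0 dcG degF.
set tr := \sum_u mu u * proj2 u u.
pose h (y : {ffun {set 'I_1} -> A}) := proj2 (y [set ord0]) (y [set ord0]) - tr.
have dh : dep (cells [set: 'I_1]) h.
  move=> x y; rewrite /h !ffunE !inE subsetT andbT.
  by rewrite -card_gt0 cards1.
have hdeg : degen mu 1 h.
  by apply: degen1; rewrite ExB Ex_cst // (Ex_coord mu_sum [set ord0] (fun u => proj2 u u)) subrr.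
(* The diagonal average is a U-statistic with one position, hence the constant [Cst R 1]. *)
set K2 := Cst R 1 * Ex mu (fun y => h y ^+ 2).
set K3 := Cst R k * Ex mu (fun y => G y ^+ 2).
have K20 : 0 <= K2 by rewrite mulr_ge0 ?ler0n // Ex_ge0 // => x; rewrite sqr_ge0.
have K30 : 0 <= K3 by rewrite mulr_ge0 ?ler0n // Ex_ge0 // => x; rewrite sqr_ge0.
exists (K1 + (K1 + Num.sqrt K3) + Num.sqrt K2) => [|n kn].
  by rewrite !addr_ge0 ?sqrtr_ge0.
have n1 : (1 < n)%N by apply: leq_ltn_trans kn.
have n0 : 0 < n%:R :> R by rewrite ltr0n ltnW.
have n11 : 1 <= n%:R :> R by rewrite ler1n ltnW.
have nm0 : 0 < n%:R - 1 :> R by rewrite subr_gt0 ltr1n.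
have rn0 : 0 < Num.sqrt n%:R :> R by rewrite sqrtr_gt0.
have rn1 : 1 <= Num.sqrt n%:R :> R by have := ler_wsqrtr n11; rewrite sqrtr1.
have invrn : n%:R^-1 <= (Num.sqrt n%:R)^-1 :> R.
  by rewrite lef_pV2 ?posrE // -{2}(sqr_sqrtr (ltW n0)) expr2 ler_peMl // ltW.
pose P (x : {ffun {set 'I_n} -> A}) := pavg (fun c d => proj2 (x [set c]) (x [set d])).
pose S1 (x : {ffun {set 'I_n} -> A}) := n%:R^-1 * \sum_c proj2 (x [set c]) (x [set c]) - tr.
have E1 : Ex mu (fun x : {ffun {set 'I_n} -> A} => `|n%:R * Uavg G x - n%:R * P x|) <=
    K1 / Num.sqrt n%:R.
  apply: le_trans (H1 n kn); rewrite le_eqVlt; apply/orP; left; apply/eqP.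
  apply: eq_Ex => x; congr (`|_ - _ * _|); rewrite /P /pavg /sum_pairs; congr (_ * _).
  by apply: eq_bigr => c _; apply: eq_bigr => d _; rewrite psi_proj2.
have E2 : Ex mu (fun x => `|S1 x|) <= Num.sqrt K2 / Num.sqrt n%:R.
  have V := Uavg_variance mu_ge0 mu_sum n (ltn0Sn 0) dh hdeg.
  apply: Ex_norm_le => //; first by rewrite divr_ge0 ?sqrtr_ge0.
  rewrite exprMn exprVn !sqr_sqrtr ?ler0n // ler_pdivlMr // -[X in _ * X]expr1.
  apply: le_trans V; rewrite le_eqVlt; apply/orP; left; apply/eqP; congr (_ * _).
  apply: eq_Ex => x; congr (_ ^+ 2); rewrite /S1 /Uavg /h avgB avg_cst ?(ltnW n1) //.
  congr (_ - _); rewrite -(@avg_marginal1 R n 1 ord0 (fun c => proj2 (x [set c]) (x [set c]))) ?(ltnW n1) //.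
  by apply: eq_avg => i; rewrite !restrE imset_set1.
have E3 : Ex mu (fun x : {ffun {set 'I_n} -> A} => `|n%:R * Uavg G x|) <= Num.sqrt K3.
  have V := Uavg_variance mu_ge0 mu_sum n k0 dcG degF.
  apply: Ex_norm_le => //; first exact: sqrtr_ge0.
  rewrite sqr_sqrtr //; apply: le_trans V; rewrite mulrC -ExZ.
  rewrite le_eqVlt; apply/orP; left; apply/eqP; apply: eq_Ex => x; by rewrite exprMn.
(* The middle term is the price of the normalization by [n]; it is small because [n * P] is bounded
   in mean by [E1] and [E3]. *)
have qE x : qform x - tr = n%:R * P x - n%:R^-1 * (n%:R * P x) + S1 x.
  have -> : qform x = n%:R^-1 * (sum_pairs (fun c d => proj2 (x [set c]) (x [set d])) +
      \sum_c proj2 (x [set c]) (x [set c])).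
    rewrite /qform /sum_pairs -big_split /=; congr (_ * _); apply: eq_bigr => c _.
    by rewrite (bigD1 c) //= addrC.
  rewrite /P /pavg /S1; field; by rewrite !gt_eqF.
apply: le_trans (_ : Ex mu (fun x : {ffun {set 'I_n} -> A} =>
    `|n%:R * Uavg G x - n%:R * P x| + ((Num.sqrt n%:R)^-1 *
      (`|n%:R * Uavg G x - n%:R * P x| + `|n%:R * Uavg G x|) + `|S1 x|)) <= _).
  apply: le_Ex => // x; rewrite qE.
  rewrite (_ : _ - _ = (n%:R * Uavg G x - n%:R * P x) + (n%:R^-1 * (n%:R * P x) - S1 x)); last by ring.
  apply: le_trans (ler_normD _ _) _; rewrite lerD2l.
  apply: le_trans (ler_normB _ _) _; rewrite lerD2r normrM ger0_norm ?invr_ge0 ?(ltW n0) //.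
  apply: ler_pM => //; first by rewrite invr_ge0 ltW.
  rewrite [X in `|X| <= _](_ : _ = n%:R * Uavg G x - (n%:R * Uavg G x - n%:R * P x)); last by ring.
  by apply: le_trans (ler_normB _ _) _; rewrite addrC.
rewrite ExD ExD ExZ ExD -addrA mulrDl mulrDl lerD // lerD //.
rewrite mulrC ler_wpM2r ?invr_ge0 ?(ltW rn0) // lerD //; apply: le_trans E1 _.
by rewrite ler_pdivrMr // ler_peMr.
Qed.

End degenerate.
End iid_ustat.

(** * The mixture model with finitely many observable values *)

Section finite_model.
Variables (R : realFieldType) (V W : finType) (w0 : W) (v0 : V).
Variables (p : V -> R) (kp : V -> V -> W -> R).
Hypotheses (p_ge0 : forall v, 0 <= p v) (p_sum : \sum_v p v = 1).
Hypotheses (kp_ge0 : forall u v w, 0 <= kp u v w) (kp_sum : forall u v, \sum_w kp u v w = 1).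
Hypothesis kp_sym : forall u v w, kp u v w = kp v u w.

(* A cell carries a label and one mark for each unordered pair of labels: the mark of the edge
   {i, j} is read at the pair of the labels of i and j. *)
Definition cell : finType := (V * {ffun {set V} -> W})%type.

(** Symmetry lets the kernel be indexed by unordered pairs of labels. Sets that are not of the form
    [[set u; v]] receive the law at [(v0, v0)], so that every mark has a probability law. *)
Definition kset (S : {set V}) (w : W) : R :=
  let uv := odflt (v0, v0) [pick uv : V * V | S == [set uv.1; uv.2]] in kp uv.1 uv.2 w.

Lemma ksetE u v w : kset [set u; v] w = kp u v w.
Proof.
rewrite /kset; case: pickP => [[u' v'] /= /eqP e|/(_ (u, v))]; last by rewrite eqxx.
have : u' \in [set u; v] by rewrite e set21.
have : v' \in [set u; v] by rewrite e set22.
have : u \in [set u'; v'] by rewrite -e set21.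
have : v \in [set u'; v'] by rewrite -e set22.
rewrite !inE => /orP[]/eqP hv /orP[]/eqP hu /orP[]/eqP hv' /orP[]/eqP hu'; subst => //; exact: kp_sym.
Qed.

Definition cell_law (a : cell) : R := p a.1 * \prod_S kset S (a.2 S).

Lemma cell_law_ge0 a : 0 <= cell_law a.
Proof. by rewrite mulr_ge0 // prodr_ge0 // => S _; exact: kp_ge0. Qed.

Lemma sum_cell_law (g : V -> R) (f : {set V} -> W -> R) :
  \sum_a cell_law a * (g a.1 * \prod_S f S (a.2 S)) =
  (\sum_v p v * g v) * \prod_S \sum_w kset S w * f S w.
Proof.
rewrite bigA_distr_bigA big_distrlr /= pair_bigA /=; apply: eq_bigr => -[v m] _ /=.
rewrite /cell_law /= big_split /=; ring.
Qed.

Lemma kset_sum S : \sum_w kset S w = 1.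
Proof. exact: kp_sum. Qed.

Lemma cell_law_label (g : V -> R) : \sum_a cell_law a * g a.1 = \sum_v p v * g v.
Proof.
have := sum_cell_law g (fun _ _ => 1).
rewrite [X in _ = _ * X -> _]big1 => [|S _]; last first.
  by rewrite -[RHS](kset_sum S); apply: eq_bigr => w _; rewrite mulr1.
by rewrite mulr1 => <-; apply: eq_bigr => a _; rewrite big1 ?mulr1.
Qed.

Lemma cell_law_sum : \sum_a cell_law a = 1.
Proof.
have := cell_law_label (fun=> 1).
by under eq_bigr do rewrite mulr1; under [in RHS]eq_bigr do rewrite mulr1; rewrite p_sum.
Qed.

Lemma cell_law_mark (S : {set V}) (h : W -> R) :
  \sum_a cell_law a * h (a.2 S) = \sum_w kset S w * h w.
Proof.
have := sum_cell_law (fun=> 1) (fun S' w => if S' == S then h w else 1).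
rewrite [X in _ = X * _](_ : _ = 1); last by rewrite -[RHS]p_sum; apply: eq_bigr => v _; rewrite mulr1.
rewrite mul1r (bigD1 S) //= eqxx [X in _ * X]big1 ?mulr1 => [|S' /negbTE SS']; last first.
  by rewrite SS' -[RHS](kset_sum S'); apply: eq_bigr => w _; rewrite mulr1.
move=> <-; apply: eq_bigr => a _; rewrite mul1r (bigD1 S) //= eqxx big1 ?mulr1 // => S' /negbTE ->.
by [].
Qed.

Definition labels n (x : {ffun {set 'I_n} -> cell}) : {ffun 'I_n -> V} := [ffun a => (x [set a]).1].

Definition marks n (x : {ffun {set 'I_n} -> cell}) : {ffun 'I_n * 'I_n -> W} :=
  [ffun e => if e.1 == e.2 then w0
             else (x [set e.1; e.2]).2 [set labels x e.1; labels x e.2]].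

(** Symmetric tables with the default mark on the diagonal: the only ones that [marks] can
    produce. *)
Definition mark_table n (m : {ffun 'I_n * 'I_n -> W}) : bool :=
  [forall e, (m (e.2, e.1) == m e) && ((e.1 == e.2) ==> (m e == w0))].

Lemma mark_table_marks n (x : {ffun {set 'I_n} -> cell}) : mark_table (marks x).
Proof.
apply/forallP => -[a b] /=; rewrite !ffunE /= (eq_sym b a) (setUC [set b]) (setUC [set _.1]) eqxx.
by case: (a == b) => /=.
Qed.

Lemma prod_cells n (A : 'I_n -> R) (B : 'I_n * 'I_n -> R) :
  \prod_(S : {set 'I_n}) ((\prod_(i | S == [set i]) A i) *
     \prod_(e : 'I_n * 'I_n | (e.1 < e.2)%N && (S == [set e.1; e.2])) B e) =
  (\prod_i A i) * \prod_(e : 'I_n * 'I_n | (e.1 < e.2)%N) B e.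
Proof.
rewrite big_split /=; congr (_ * _).
  rewrite (exchange_big_dep xpredT) //=; apply: eq_bigr => i _.
  by rewrite (big_pred1 [set i]).
rewrite (exchange_big_dep (fun e : 'I_n * 'I_n => (e.1 < e.2)%N)) /= => [|S e _ /andP[]//].
apply: eq_bigr => e e12; rewrite (big_pred1 [set e.1; e.2]) // => S.
by rewrite e12.
Qed.

Lemma set2_ord_inj n (e e' : 'I_n * 'I_n) : (e.1 < e.2)%N -> (e'.1 < e'.2)%N ->
  [set e.1; e.2] = [set e'.1; e'.2] -> e = e'.
Proof.
case: e e' => a b [a' b'] /= ab ab' E.
have : a' \in [set a; b] by rewrite E set21.
have : b' \in [set a; b] by rewrite E set22.
rewrite !inE => /orP[]/eqP hb /orP[]/eqP ha; subst => //; move: ab'; rewrite ?ltnn //.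
by rewrite ltnNge ltnW.
Qed.

(** The indicator is a product over cells: singletons carry the constraint on a label, two-element
    sets the constraint on a mark, and all other cells integrate to 1. *)
Lemma finite_law n (c : {ffun 'I_n -> V}) (m : {ffun 'I_n * 'I_n -> W}) :
  Ex cell_law (fun x : {ffun {set 'I_n} -> cell} => ((labels x == c) && (marks x == m))%:R) =
  if mark_table m then
    (\prod_a p (c a)) * \prod_(e : 'I_n * 'I_n | (e.1 < e.2)%N) kp (c e.1) (c e.2) (m e)
  else 0.
Proof.
case: ifP => gm; last first.
  rewrite (eq_Ex _ (G := fun=> 0)) ?Ex_cst //; first exact: cell_law_sum.
  move=> x; rewrite (_ : (_ && _) = false) //; apply/negbTE/negP => /andP[_ /eqP mE].
  by move: gm; rewrite -mE mark_table_marks.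
pose A (a : cell) i : R := (a.1 == c i)%:R.
(* Once the labels equal [c], the mark of [e] is read at a place that no longer depends on other
   cells; this is what makes the product factor. *)
pose B (a : cell) (e : 'I_n * 'I_n) : R := (a.2 [set c e.1; c e.2] == m e)%:R.
pose f (S : {set 'I_n}) (a : cell) : R := (\prod_(i | S == [set i]) A a i) *
  \prod_(e : 'I_n * 'I_n | (e.1 < e.2)%N && (S == [set e.1; e.2])) B a e.
rewrite (eq_Ex _ (G := fun x => \prod_S f S (x S))); last first.
  move=> x; have -> : \prod_S f S (x S) = (\prod_i A (x [set i]) i) *
      \prod_(e : 'I_n * 'I_n | (e.1 < e.2)%N) B (x [set e.1; e.2]) e.
    rewrite -prod_cells; apply: eq_bigr => S _; rewrite /f; congr (_ * _).
      by apply: eq_bigr => i /eqP ->.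
    by apply: eq_bigr => e /andP[_ /eqP ->].
  case: (boolP ((labels x == c) && (marks x == m))) => [/andP[/eqP lc /eqP mm]|].
    rewrite !big1 ?mulr1 // => [e e12|i _]; rewrite /A /B -?mm -lc ?ffunE ?eqxx //.
    by rewrite -val_eqE /= ltn_eqF // eqxx.
  rewrite negb_and => /orP[lc|].
    have [i] : exists i, labels x i != c i.
      by apply/existsP; apply: contraR lc => /existsPn h; apply/eqP/ffunP => i; apply/eqP; have := h i; rewrite negbK.
    rewrite ffunE => /negbTE xi; by rewrite (bigD1 i) //= /A xi !mul0r.
  have [/eqP lc|lc] := boolP (labels x == c); last first.
    have [i] : exists i, labels x i != c i.
      by apply/existsP; apply: contraR lc => /existsPn h; apply/eqP/ffunP => i; apply/eqP; have := h i; rewrite negbK.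
    rewrite ffunE => /negbTE xi; by rewrite (bigD1 i) //= /A xi !mul0r.
  move=> mm; have [e e12 em] : exists2 e : 'I_n * 'I_n, (e.1 < e.2)%N & marks x e != m e.
    have [e em] : exists e, marks x e != m e.
      by apply/existsP; apply: contraR mm => /existsPn h; apply/eqP/ffunP => i; apply/eqP; have := h i; rewrite negbK.
    have [e12|e21|e12] := ltngtP e.1 e.2; first by exists e.
    - exists (e.2, e.1) => //.
      have /forallP/(_ e)/andP[/eqP -> _] := mark_table_marks x.
      by have /forallP/(_ e)/andP[/eqP -> _] := gm.
    - move: em; have /forallP/(_ e)/andP[_ /implyP h1] := mark_table_marks x.
      have /forallP/(_ e)/andP[_ /implyP h2] := gm.
      by rewrite (eqP (h1 _)) ?(eqP (h2 _)) ?eqxx // (val_inj e12).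
  have {}em : B (x [set e.1; e.2]) e = 0.
    by move: em; rewrite /B -lc ffunE -val_eqE /= ltn_eqF // => /negbTE ->.
  by rewrite [X in _ * X](bigD1 e) //= em mul0r mulr0.
rewrite Ex_prod -prod_cells; apply: eq_bigr => S _; rewrite /f.
have [/existsP[i /eqP Si]|/existsPn noi] := boolP [exists i, S == [set i]].
  have e0 (e : 'I_n * 'I_n) : (e.1 < e.2)%N && (S == [set e.1; e.2]) = false.
    apply/negbTE/negP => /andP[e12 /eqP SE]; have := congr1 (fun S : {set 'I_n} => #|S|) SE.
    by rewrite Si cards1 cards2 -val_eqE /= ltn_eqF.
  have ei i' : (S == [set i']) = (i' == i).
    by rewrite Si; apply/eqP/eqP => [/set1_inj ->|->].
  rewrite (big_pred1 i) // (big_pred0 _ _ _ _ e0) mulr1.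
  under eq_bigr => a _ do rewrite (big_pred1 i) // (big_pred0 _ _ _ _ e0) mulr1.
  rewrite (cell_law_label (fun v => (v == c i)%:R)) (bigD1 (c i)) //= eqxx mulr1 big1 ?addr0 // => v /negbTE ->.
  by rewrite mulr0.
rewrite [X in X * _]big_pred0 => [|i]; last exact/negbTE/noi.
rewrite mul1r.
have noi' i : (S == [set i]) = false by exact/negbTE/noi.
under eq_bigr => a _ do rewrite (big_pred0 _ _ _ _ noi').
have [/existsP[e /andP[e12 /eqP Se]]|/existsPn noe] :=
    boolP [exists e : 'I_n * 'I_n, (e.1 < e.2)%N && (S == [set e.1; e.2])].
  have ee (e' : 'I_n * 'I_n) : (e'.1 < e'.2)%N && (S == [set e'.1; e'.2]) = (e' == e).
    apply/andP/eqP => [[e'12 /eqP]|->]; last by rewrite Se.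
    by rewrite Se => /set2_ord_inj -> //.
  rewrite (big_pred1 e) //.
  under eq_bigr => a _ do rewrite (big_pred1 e) // mul1r.
  rewrite (cell_law_mark _ (fun w => (w == m e)%:R)) (bigD1 (m e)) //= eqxx mulr1 ksetE big1 ?addr0 // => w /negbTE ->.
  by rewrite mulr0.
have noe' (e : 'I_n * 'I_n) : (e.1 < e.2)%N && (S == [set e.1; e.2]) = false by exact/negbTE/(noe e).
rewrite (big_pred0 _ _ _ _ noe') -[RHS]cell_law_sum; apply: eq_bigr => a _.
by rewrite (big_pred0 _ _ _ _ noe') !mulr1.
Qed.

End finite_model.

Section finite_motif.
Variables (R : realType) (V W : finType) (w0 : W) (v0 : V).
Variables (p : V -> R) (kp : V -> V -> W -> R).
Hypotheses (p_ge0 : forall v, 0 <= p v) (p_sum : \sum_v p v = 1).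
Hypotheses (kp_ge0 : forall u v w, 0 <= kp u v w) (kp_sum : forall u v, \sum_w kp u v w = 1).
Hypothesis kp_sym : forall u v w, kp u v w = kp v u w.

Let mu := cell_law v0 p kp.
Let mu1 : \sum_a mu a = 1. Proof. exact: cell_law_sum. Qed.

Lemma labels_restr n k (i : {ffun 'I_k -> 'I_n}) (x : {ffun {set 'I_n} -> cell V W}) :
  labels (restr i x) = [ffun a => labels x (i a)].
Proof. by apply/ffunP => a; rewrite !ffunE /simg imset_set1. Qed.

Lemma marks_restr n k (i : {ffun 'I_k -> 'I_n}) (x : {ffun {set 'I_n} -> cell V W}) :
  injective i -> marks w0 (restr i x) = [ffun e => marks w0 x (i e.1, i e.2)].
Proof.
move=> i_inj; apply/ffunP => e; rewrite !ffunE /= (inj_eq i_inj).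
by case: ifP => // _; rewrite /simg imsetU1 !imset_set1.
Qed.

Variable k : nat.

(** The conditional mean of [h] of the marks given the labels [c], with a meaning even when [c] has
    probability 0. *)
Definition mean_marks (h : {ffun 'I_k * 'I_k -> W} -> R) (c : {ffun 'I_k -> V}) : R :=
  Ex mu (fun y : {ffun {set 'I_k} -> cell V W} => h [ffun e => if e.1 == e.2 then w0
    else (y [set e.1; e.2]).2 [set c e.1; c e.2]]).

Lemma labels_mix (y y' : {ffun {set 'I_k} -> cell V W}) : labels (mix (nodes k) y y') = labels y.
Proof. by apply/ffunP => a; rewrite !ffunE inE cards1. Qed.

Lemma Pr_nodes_marks h (y : {ffun {set 'I_k} -> cell V W}) :
  Pr mu (nodes k) (fun y => h (marks w0 y)) y = mean_marks h (labels y).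
Proof.
apply: eq_Ex => y'; congr h; apply/ffunP => e; rewrite [LHS]ffunE [RHS]ffunE labels_mix.
by case: eqP => // /eqP e12; rewrite ffunE inE cards2 e12.
Qed.

Lemma dep_marks (h : {ffun 'I_k * 'I_k -> W} -> R) : dep (cells [set: 'I_k]) (fun y : {ffun {set 'I_k} -> cell V W} => h (marks w0 y)).
Proof.
apply: dep_eqP => y y' yy'; congr h; apply/ffunP => e; rewrite !ffunE !yy' ?set1_cells ?inE //.
by apply/andP; split; [apply/set0Pn; exists e.1; rewrite set21|exact: subsetT].
Qed.

Lemma dep_labels (g : {ffun 'I_k -> V} -> R) :
  dep (nodes k) (fun y : {ffun {set 'I_k} -> cell V W} => g (labels y)).
Proof. by move=> y y'; rewrite labels_mix. Qed.

Lemma Ex_labels (c : {ffun 'I_k -> V}) :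
  Ex mu (fun y : {ffun {set 'I_k} -> cell V W} => (labels y == c)%:R) = \prod_a p (c a).
Proof.
pose f (S : {set 'I_k}) (a : cell V W) : R := \prod_(i | S == [set i]) (a.1 == c i)%:R.
rewrite (eq_Ex _ (G := fun y => \prod_S f S (y S))); last first.
  move=> y; rewrite /f (exchange_big_dep xpredT) //=.
  rewrite (eq_bigr (fun i => (labels y i == c i)%:R)); last first.
    by move=> i _; rewrite (big_pred1 [set i]) // ffunE.
  have [/eqP ->|] := boolP (labels y == c); first by rewrite big1 // => i _; rewrite eqxx.
  move=> h; have [i] : exists i, labels y i != c i.
    by apply/existsP; apply: contraR h => /existsPn h'; apply/eqP/ffunP => i; apply/eqP; have := h' i; rewrite negbK.
  by move=> /negbTE yi; rewrite (bigD1 i) //= yi mul0r.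
rewrite Ex_prod (eq_bigr (fun S : {set 'I_k} => \prod_(i | S == [set i]) p (c i))); last first.
  move=> S _; rewrite /f.
  have [/existsP[i /eqP Si]|/existsPn noi] := boolP [exists i, S == [set i]].
    have ei i' : (S == [set i']) = (i' == i).
      by rewrite Si; apply/eqP/eqP => [/set1_inj ->|->].
    rewrite (big_pred1 i) //; under eq_bigr => a _ do rewrite (big_pred1 i) //.
    rewrite (cell_law_label v0 p kp_sum (fun v => (v == c i)%:R)) (bigD1 (c i)) //= eqxx mulr1 big1 ?addr0 // => v /negbTE ->.
    by rewrite mulr0.
  have noi' i : (S == [set i]) = false by exact/negbTE/noi.
  rewrite (big_pred0 _ _ _ _ noi') -[RHS]mu1; apply: eq_bigr => a _.
  by rewrite (big_pred0 _ _ _ _ noi') mulr1.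
rewrite (exchange_big_dep xpredT) //=; apply: eq_bigr => i _.
by rewrite (big_pred1 [set i]).
Qed.

Lemma Ex_marks_labels h (c : {ffun 'I_k -> V}) :
  Ex mu (fun y : {ffun {set 'I_k} -> cell V W} => h (marks w0 y) * (labels y == c)%:R) =
  mean_marks h c * \prod_a p (c a).
Proof.
rewrite (Ex_Pr_mul mu1 (S := nodes k) _ (dep_labels (fun l => (l == c)%:R))) -Ex_labels -ExZ.
apply: eq_Ex => y; rewrite Pr_nodes_marks.
by case: eqP => [->|_]; rewrite ?mulr1 ?mulr0.
Qed.

End finite_motif.

From mathcomp Require Import all_classical all_reals all_analysis.
From mathcomp Require Import measurable_realfun.
Import numFieldNormedType.Exports.
Local Open Scope classical_set_scope.
Local Open Scope ring_scope.

(** * Weak convergence through trigonometric moments *)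

Section expectation_toolkit.
Context d (T : measurableType d) (R : realType) (P : probability T R).
Implicit Types f g : T -> R.

Definition L1 f := P.-integrable [set: T] (EFin \o f).
Definition ev f : R := (\int[P]_x f x)%R.

Lemma ev_EFin f : L1 f -> (\int[P]_x (f x)%:E = (ev f)%:E)%E.
Proof.
move=> Lf; rewrite /ev /Rintegral fineK //.
exact: integrable_fin_num Lf.
Qed.

Lemma L1_bounded f M : measurable_fun [set: T] f -> (forall x, `|f x| <= M) -> L1 f.
Proof.
move=> mf fM; apply: measurable_bounded_integrable => //.
  by rewrite (le_lt_trans (probability_le1 P measurableT)) // ltry.
exists M; split; first exact: num_real.
by move=> y My x _ /=; apply: le_trans (fM x) (ltW My).
Qed.

Lemma L1_cst c : L1 (fun=> c).
Proof. exact: (@L1_bounded _ `|c|). Qed.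

Lemma L1D f g : L1 f -> L1 g -> L1 (fun x => f x + g x).
Proof. by move=> Lf Lg; exact: (integrableD measurableT Lf Lg). Qed.

Lemma L1Z c f : L1 f -> L1 (fun x => c * f x).
Proof. by move=> Lf; apply: (integrableZl _ c Lf). Qed.

Lemma L1B f g : L1 f -> L1 g -> L1 (fun x => f x - g x).
Proof. by move=> Lf Lg; exact: (integrableB measurableT Lf Lg). Qed.

Lemma L1_norm f : L1 f -> L1 (fun x => `|f x|).
Proof. by move=> Lf; apply: integrable_norm. Qed.

Lemma L1_sum (I : Type) (s : seq I) (Q : pred I) (F : I -> T -> R) :
  (forall i, Q i -> L1 (F i)) -> L1 (fun x => \sum_(i <- s | Q i) F i x).
Proof.
move=> LF; elim: s => [|i s IH].
  by rewrite (_ : (fun x => _) = (fun=> 0)); [exact: L1_cst|apply/funext => x; rewrite big_nil].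
have [Qi|Qi] := boolP (Q i); last first.
  by rewrite (_ : (fun x => _) = (fun x => \sum_(i <- s | Q i) F i x)) //; apply/funext => x;
  rewrite big_cons (negbTE Qi).
rewrite (_ : (fun x => _) = (fun x => F i x + \sum_(i <- s | Q i) F i x)).
  by apply: L1D => //; apply: LF.
by apply/funext => x; rewrite big_cons Qi.
Qed.

Lemma le_L1 f g : measurable_fun [set: T] f -> (forall x, `|f x| <= g x) -> L1 g -> L1 f.
Proof.
move=> mf fg Lg; apply: le_integrable Lg => //; first exact/measurable_EFinP.
by move=> x _ /=; rewrite lee_fin; apply: le_trans (fg x) (ler_norm _).
Qed.

Lemma L1_measurable f : L1 f -> measurable_fun [set: T] f.
Proof. by move=> /measurable_int/measurable_EFinP. Qed.

Lemma eq_ev f g : f =1 g -> ev f = ev g.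
Proof. by move=> fg; apply: eq_Rintegral => x _. Qed.

Lemma evD f g : L1 f -> L1 g -> ev (fun x => f x + g x) = ev f + ev g.
Proof. by move=> Lf Lg; apply: RintegralD. Qed.

Lemma evB f g : L1 f -> L1 g -> ev (fun x => f x - g x) = ev f - ev g.
Proof. by move=> Lf Lg; apply: RintegralB. Qed.

Lemma evZ c f : L1 f -> ev (fun x => c * f x) = c * ev f.
Proof. by move=> Lf; apply: RintegralZl. Qed.

Lemma ev_cst c : ev (fun=> c) = c.
Proof.
rewrite /ev (@Rintegral_cst _ _ _ P [set: T]) //.
by rewrite [X in fine X]probability_setT mulr1.
Qed.

Lemma ev_sum (I : Type) (s : seq I) (Q : pred I) (F : I -> T -> R) :
  (forall i, Q i -> L1 (F i)) ->
  ev (fun x => \sum_(i <- s | Q i) F i x) = \sum_(i <- s | Q i) ev (F i).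
Proof.
move=> LF; elim: s => [|i s IH].
  by rewrite big_nil -[RHS]ev_cst; apply: eq_ev => x; rewrite big_nil.
rewrite big_cons -IH; case: ifP => Qi; last first.
  by apply: eq_ev => x; rewrite big_cons Qi.
rewrite -evD; [|exact: LF|exact: L1_sum].
by apply: eq_ev => x; rewrite big_cons Qi.
Qed.

Lemma le_ev f g : L1 f -> L1 g -> (forall x, f x <= g x) -> ev f <= ev g.
Proof. by move=> Lf Lg fg; apply: le_Rintegral. Qed.

Lemma ev_ge0 f : (forall x, 0 <= f x) -> 0 <= ev f.
Proof. by move=> f0; apply: Rintegral_ge0. Qed.

Lemma norm_ev f : L1 f -> `|ev f| <= ev (fun x => `|f x|).
Proof. by move=> Lf; apply: le_normr_Rintegral. Qed.

Lemma cvg_ev (F : nat -> T -> R) f g :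
  (forall n, measurable_fun [set: T] (F n)) -> measurable_fun [set: T] f -> L1 g ->
  (forall x, F n x @[n --> \oo] --> f x) -> (forall n x, `|F n x| <= g x) ->
  ev (F n) @[n --> \oo] --> ev f.
Proof.
move=> mF mf Lg Ff Fg.
have [] := @dominated_convergence _ _ _ P [set: T] measurableT
  (fun n => EFin \o F n) (EFin \o f) (EFin \o g).
- by move=> n; apply/measurable_EFinP.
- exact/measurable_EFinP.
- by apply/aeW => x _; apply: cvg_EFin; [exact: nearW|exact: Ff].
- exact: Lg.
- by apply/aeW => x n _ /=; rewrite lee_fin.
move=> Lf _ H; apply: fine_cvg.
rewrite (_ : (ev f)%:E = (\int[P]_x (EFin \o f) x)%E); last by rewrite -ev_EFin.
exact: H.
Qed.

End expectation_toolkit.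

(** * Trigonometric polynomials on row vectors *)

Section row_vectors.
Variables (R : realType) (s : nat).
Implicit Types x y : 'rV[R]_s.

Definition dot (t x : 'rV[R]_s) : R := (x *m t^T) 0 0.

Lemma dotE t x : dot t x = \sum_j x 0 j * t 0 j.
Proof. by rewrite /dot mxE; apply: eq_bigr => j _; rewrite mxE. Qed.

Lemma dotDl t u x : dot (t + u) x = dot t x + dot u x.
Proof. by rewrite !dotE -big_split /=; apply: eq_bigr => j _; rewrite mxE mulrDr. Qed.

Lemma dotNl t x : dot (- t) x = - dot t x.
Proof. by rewrite !dotE -sumrN; apply: eq_bigr => j _; rewrite mxE mulrN. Qed.

Lemma dotZl a t x : dot (a *: t) x = a * dot t x.
Proof. by rewrite !dotE mulr_sumr; apply: eq_bigr => j _; rewrite mxE mulrCA. Qed.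

Lemma dot0l x : dot 0 x = 0.
Proof. by rewrite dotE big1 // => j _; rewrite mxE mulr0. Qed.

Lemma dotC t x : dot t x = dot x t.
Proof. by rewrite !dotE; apply: eq_bigr => j _; rewrite mulrC. Qed.

Lemma dot_delta j x : dot (delta_mx 0 j) x = x 0 j.
Proof.
rewrite dotE (bigD1 j) //= mxE !eqxx mulr1 big1 ?addr0 // => i /negbTE ij.
by rewrite mxE eqxx ij mulr0.
Qed.

Inductive trigpoly : ('rV[R]_s -> R) -> Prop :=
| trig_cos c t : trigpoly (fun x => cos (c + dot t x))
| trig_add f g : trigpoly f -> trigpoly g -> trigpoly (fun x => f x + g x)
| trig_scale a f : trigpoly f -> trigpoly (fun x => a * f x).

Lemma trig_ext f g : f =1 g -> trigpoly f -> trigpoly g.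
Proof. by move=> /funext ->. Qed.

Lemma trig_cst a : trigpoly (fun=> a).
Proof.
apply: trig_ext (trig_scale a (trig_cos 0 0)) => x.
by rewrite dot0l addr0 cos0 mulr1.
Qed.

Lemma trig_mul f g : trigpoly f -> trigpoly g -> trigpoly (fun x => f x * g x).
Proof.
move=> tf; elim: tf g => {f} [c t|f1 f2 _ IH1 _ IH2|a f _ IH] g tg.
- elim: tg => {g} [c' t'|g1 g2 _ IH1 _ IH2|a g _ IH].
  + apply: trig_ext (trig_add (trig_scale 2^-1 (trig_cos (c + c') (t + t')))
      (trig_scale 2^-1 (trig_cos (c - c') (t - t')))) => x.
    rewrite dotDl dotDl dotNl.
    rewrite (_ : c + c' + _ = (c + dot t x) + (c' + dot t' x)); last by ring.
    rewrite (_ : c - c' + _ = (c + dot t x) - (c' + dot t' x)); last by ring.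
    by rewrite cosD cosB; field.
  + by apply: trig_ext (trig_add IH1 IH2) => x; rewrite mulrDr.
  + by apply: trig_ext (trig_scale a IH) => x; rewrite mulrCA.
- by apply: trig_ext (trig_add (IH1 _ tg) (IH2 _ tg)) => x; rewrite mulrDl.
- by apply: trig_ext (trig_scale a (IH _ tg)) => x; rewrite mulrA.
Qed.

Lemma trig_prod (I : Type) (r : seq I) (F : I -> 'rV[R]_s -> R) :
  (forall i, trigpoly (F i)) -> trigpoly (fun x => \prod_(i <- r) F i x).
Proof.
move=> tF; elim: r => [|i r IH].
  by apply: trig_ext (trig_cst 1) => x; rewrite big_nil.
by apply: trig_ext (trig_mul (tF i) IH) => x; rewrite big_cons.
Qed.

Lemma trig_sum (I : Type) (r : seq I) (F : I -> 'rV[R]_s -> R) :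
  (forall i, trigpoly (F i)) -> trigpoly (fun x => \sum_(i <- r) F i x).
Proof.
move=> tF; elim: r => [|i r IH].
  by apply: trig_ext (trig_cst 0) => x; rewrite big_nil.
by apply: trig_ext (trig_add (tF i) IH) => x; rewrite big_cons.
Qed.

Lemma trig_sin a j : trigpoly (fun x : 'rV[R]_s => sin (a * x 0 j)).
Proof.
apply: trig_ext (trig_cos (- (pi / 2)) (a *: delta_mx 0 j)) => x.
by rewrite dotZl dot_delta addrC cosBpihalf.
Qed.

Lemma rV_norm_le x (e : R) : 0 <= e -> (forall j, `|x 0 j| <= e) -> `|x| <= e.
Proof.
move=> e0 xe; rewrite [leLHS]mx_normrE.
apply/bigmax_leP; split => // -[i j] _ /=.
by rewrite (ord1 i).
Qed.

Lemma rV_coord_le x j : `|x 0 j| <= `|x|.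
Proof.
rewrite [leRHS]mx_normrE.
by apply: (le_bigmax _ (fun ij : 'I_1 * 'I_s => `|x ij.1 ij.2|) (0, j)).
Qed.

(** Only [x] is confined to the compact cube; [y] is any nearby point, so approximants need not be
    shown to stay in the cube. *)
Lemma cube_unif_continuous (f : 'rV[R]_s -> R) (B e : R) : continuous f -> 0 < e ->
  exists2 del, 0 < del & forall x y, (forall j, `|x 0 j| <= B) ->
    (forall j, `|x 0 j - y 0 j| < del) -> `|f x - f y| < e.
Proof.
move=> cf e0.
pose K := [set x : 'rV[R]_s | forall j, `|x 0 j| <= B].
have cK : compact K.
  have := @rV_compact R s (fun=> [set r : R | `|r| <= B]).
  have eK : K = [set v : 'rV[R]_s | forall i, [set r : R | `|r| <= B] (v ord0 i)] by [].
  rewrite -eK; apply => i.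
  rewrite (_ : [set r : R | `|r| <= B] = `[- B, B]%classic); first exact: segment_compact.
  by apply/seteqP; split => r /=; rewrite in_itv /= ler_norml.
move/compact_near_coveringP : cK => cK.
have := cK R (0^'+) (fun del x => forall y, `|x - y| < del -> `|f x - f y| < e) _.
move=> /(_ _)[].
  move=> x Kx.
  have e20 : 0 < e / 2 by rewrite divr_gt0.
  have /cvgrPdist_lt/(_ _ e20) := cf x.
  move=> /nbhs_ballP[/= d0 d00 Hd].
  near=> x' del => /= y x'y.
  have xx' : `|x - x'| < d0 / 2.
    near: x'; apply/nbhs_ballP; exists (d0 / 2) => /=; first by rewrite divr_gt0.
    by move=> z; rewrite -ball_normE.
  have del0 : del < d0 / 2.
    near: del; apply: nbhs_right_lt; by rewrite divr_gt0.
  have h1 : `|f x - f x'| < e / 2.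
    apply: Hd; rewrite -ball_normE /=; apply: lt_trans xx' _.
    by rewrite ltr_pdivrMr // ltr_pMr // ltr1n.
  have h2 : `|f x - f y| < e / 2.
    apply: Hd; rewrite -ball_normE /= (_ : x - y = (x - x') + (x' - y)); last by rewrite addrA subrK.
    apply: le_lt_trans (ler_normD _ _) _; rewrite [X in _ < X]splitr.
    by rewrite ltrD // (lt_trans x'y).
  rewrite (_ : f x' - f y = (f x - f y) - (f x - f x')); last by ring.
  by apply: le_lt_trans (ler_normB _ _) _; rewrite [X in _ < X]splitr ltrD.
move=> del0 /= del00 Hdel; exists (del0 / 4); first by rewrite divr_gt0.
move=> x y Kx xy; have := Hdel (del0 / 2); apply => //=.
- by rewrite sub0r normrN gtr0_norm ?divr_gt0 // ltr_pdivrMr // ltr_pMr // ltr1n.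
- by rewrite divr_gt0.
- apply: le_lt_trans (_ : del0 / 4 < _).
    apply: rV_norm_le => [|j]; first by rewrite divr_ge0 // ltW.
    by rewrite !mxE ltW.
  by rewrite ltr_pM2l // ltf_pV2 ?posrE // ltr_nat.
Unshelve. all: by end_near.
Qed.

End row_vectors.

(** * Bernstein approximation *)

Section bernstein.
Variable R : realType.

Definition bern (th : R) (b : bool) : R := if b then th else 1 - th.

Lemma bern_ge0 th b : 0 <= th <= 1 -> 0 <= bern th b.
Proof. by move=> /andP[h0 h1]; case: b => //=; rewrite subr_ge0. Qed.

Lemma bern_sum th : \sum_b bern th b = 1.
Proof. by rewrite big_bool /= addrC subrK. Qed.

Lemma bern_variance (th : R) N : 0 <= th <= 1 -> (0 < N)%N ->
  Ex (bern th) (fun w : {ffun 'I_N -> bool} =>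
    (N%:R^-1 * \sum_i (w i)%:R - th) ^+ 2) <= N%:R^-1.
Proof.
move=> th01 N0; have mu0 b := bern_ge0 b th01; have mu1 := bern_sum th.
have N0' : 0 < N%:R :> R by rewrite ltr0n.
pose h (b : bool) : R := b%:R - th.
have hm : \sum_b bern th b * h b = 0 by rewrite big_bool /bern /h /= mulr0n mulr1n; ring.
have h2 : \sum_b bern th b * h b ^+ 2 <= 1.
  apply: mean_le => // b; rewrite /h; move/andP: th01 => [t0 t1].
  by case: b => /=; nra.
have e (w : {ffun 'I_N -> bool}) : (N%:R^-1 * \sum_(i < N) (w i)%:R - th) ^+ 2 =
    N%:R ^- 2 * \sum_(i < N) \sum_(j < N) h (w i) * h (w j).
  have -> : N%:R^-1 * \sum_(i < N) (w i)%:R - th = N%:R^-1 * \sum_(i < N) h (w i).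
    rewrite /h sumrB sumr_const card_ord mulrBr -[th *+ N]mulr_natl mulrA mulVf ?mul1r //.
    by rewrite gt_eqF.
  rewrite exprMn exprVn; congr (_ * _); rewrite expr2 mulr_suml; apply: eq_bigr => i _.
  by rewrite mulr_sumr.
rewrite (eq_Ex _ e) ExZ Ex_sum (eq_bigr (fun=> \sum_b bern th b * h b ^+ 2)) => [|i _].
  rewrite sumr_const card_ord -[X in _ * X]mulr_natl.
  rewrite (_ : N%:R ^- 2 * (N%:R * _) = N%:R^-1 * \sum_b bern th b * h b ^+ 2).
    by rewrite ler_piMr // invr_ge0 ltW.
  by field; rewrite gt_eqF.
rewrite Ex_sum (bigD1 i) //= (Ex_coord mu1 i (fun b => h b * h b)) [X in _ + X]big1 ?addr0.
  by apply: eq_bigr => b _; rewrite expr2.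
move=> j ji; rewrite (Ex_coord2 mu1 (fun b c => h b * h c)); last by rewrite eq_sym.
rewrite big1 // => b _; rewrite (eq_bigr (fun c => bern th b * h b * (bern th c * h c))).
  by rewrite -mulr_sumr hm mulr0.
by move=> c _; ring.
Qed.

Variable s : nat.

(** A truncation to the cube of half-side [L] whose coordinates are trigonometric polynomials, and
    which tends to the identity as [L] grows. *)
Definition sin_clip (L : R) (x : 'rV[R]_s) : 'rV[R]_s := \row_j (L * sin (L^-1 * x 0 j)).

Lemma marginal_weight (O : finType) (W : 'I_s -> O -> R) (j0 : 'I_s) (h : O -> R) :
  (forall j, \sum_o W j o = 1) ->
  \sum_(m : {ffun 'I_s -> O}) (\prod_j W j (m j)) * h (m j0) = \sum_o W j0 o * h o.
Proof.
move=> W1; pose W' j o := W j o * (if j == j0 then h o else 1).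
transitivity (\sum_(m : {ffun 'I_s -> O}) \prod_j W' j (m j)).
  apply: eq_bigr => m _; rewrite /W' big_split /=; congr (_ * _).
  by rewrite (bigD1 j0) //= eqxx big1 ?mulr1 // => j /negbTE ->.
rewrite -(bigA_distr_bigA W') (bigD1 j0) //= /W' eqxx [X in _ * X]big1 ?mulr1 // => j /negbTE jj.
by rewrite -[RHS](W1 j); apply: eq_bigr => o _; rewrite jj mulr1.
Qed.

(* A Bernstein polynomial of f in the coordinates L sin(x_j / L) is a trigonometric polynomial. *)
Lemma bernstein_trig (f : 'rV[R]_s -> R) (L e M : R) : continuous f ->
  (forall x, `|f x| <= M) -> 0 < L -> 0 < e ->
  exists2 p, trigpoly p & forall x, `|p x - f (sin_clip L x)| <= e.
Proof.
move=> cf fM L0 e0.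
have e20 : 0 < e / 2 by rewrite divr_gt0.
have [del del0 unif] := cube_unif_continuous L cf e20.
have M0 : 0 <= M := le_trans (normr_ge0 _) (fM 0).
(* Chebyshev: at distance at least [del] the difference [2 * M] is at most [2 * M / del ^+ 2] times
   the squared distance, and each of the [s] coordinates, a Bernoulli mean stretched by [2 * L], has
   variance at most [4 * L ^+ 2 / N]. *)
pose K := 2 * M / del ^+ 2 * (s%:R * (4 * L ^+ 2)).
have K0 : 0 <= K by rewrite !mulr_ge0 ?invr_ge0 ?exprn_ge0 // ltW.
pose N := (Num.trunc (K / (e / 2))).+1.
have N0 : (0 < N)%N by [].
have NK : K / N%:R <= e / 2.
  rewrite ler_pdivrMr ?ltr0n // mulrC -ler_pdivrMr //; apply/ltW.
  by rewrite /N truncnS_gt.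
pose O := {ffun 'I_N -> bool}.
(* The Bernoulli parameter whose image under the affine map from [[0, 1]] to [[- L, L]] is the
   clipped coordinate. *)
pose th (x : 'rV[R]_s) j := (1 + sin (L^-1 * x 0 j)) / 2.
have th01 x j : 0 <= th x j <= 1.
  have := sin_le1 (L^-1 * x 0 j); have := sin_geN1 (L^-1 * x 0 j).
  by rewrite /th => h1 h2; apply/andP; split; lra.
pose node (m : {ffun 'I_s -> O}) : 'rV[R]_s :=
  \row_j (L * (2 * (N%:R^-1 * \sum_i ((m j) i)%:R) - 1)).
pose W x j (o : O) := wt (bern (th x j)) o.
have W1 x j : \sum_o W x j o = 1 by apply: wt_sum; apply: bern_sum.
have W0 x j o : 0 <= W x j o by apply: wt_ge0 => b; apply: bern_ge0.
exists (fun x => \sum_(m : {ffun 'I_s -> O}) f (node m) * \prod_j W x j (m j)).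
  apply: trig_sum => m; apply: trig_scale; apply: trig_prod => j; apply: trig_prod => i.
  have tth : trigpoly (fun x => th x j).
    apply: trig_ext (trig_scale 2^-1 (trig_add (trig_cst s 1) (trig_sin L^-1 j))) => x.
    by rewrite /th mulrC.
  case: (m j i) => //=.
  by apply: trig_ext (trig_add (trig_cst s 1) (trig_scale (-1) tth)) => x; rewrite mulN1r.
move=> x; set y := sin_clip L x.
have Wsum : \sum_(m : {ffun 'I_s -> O}) \prod_j W x j (m j) = 1.
  by rewrite -(bigA_distr_bigA (W x)) big1.
have yL j : `|y 0 j| <= L.
  by rewrite mxE normrM gtr0_norm // ler_piMr ?(ltW L0) // sin_max.
have nodey m j : node m 0 j - y 0 j = (2 * L) * (N%:R^-1 * \sum_i ((m j) i)%:R - th x j).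
  by rewrite !mxE /th; set a := N%:R^-1 * _; set b := sin _; by field.
have dev m : `|f (node m) - f y| <= e / 2 + 2 * M / del ^+ 2 *
    \sum_j (node m 0 j - y 0 j) ^+ 2.
  have S0 : 0 <= \sum_j (node m 0 j - y 0 j) ^+ 2.
    by apply: sumr_ge0 => j _; rewrite sqr_ge0.
  have c0 : 0 <= 2 * M / del ^+ 2 by rewrite !mulr_ge0 // invr_ge0 exprn_ge0 // ltW.
  have [near|/existsNP[j /negP]] := pselect (forall j, `|y 0 j - node m 0 j| < del).
    rewrite distrC; apply: le_trans (ltW (unif y (node m) yL near)) _.
    by rewrite lerDl mulr_ge0.
  rewrite -leNgt => far.
  apply: le_trans (_ : 2 * M <= _).
    by apply: le_trans (ler_normB _ _) _; rewrite mulr_natl mulr2n lerD.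
  apply: le_trans (_ : 2 * M / del ^+ 2 * (node m 0 j - y 0 j) ^+ 2 <= _).
    rewrite -mulrA ler_peMr ?mulr_ge0 // mulrC ler_pdivlMr ?exprn_gt0 // mul1r.
    by rewrite -[leRHS]real_normK ?num_real // distrC lerXn2r // nnegrE ltW.
  apply: le_trans (_ : 2 * M / del ^+ 2 * \sum_j (node m 0 j - y 0 j) ^+ 2 <= _).
    rewrite ler_wpM2l // (bigD1 j) //= lerDl; apply: sumr_ge0 => i _; exact: sqr_ge0.
  by rewrite lerDr ltW.
have -> : \sum_(m : {ffun 'I_s -> O}) f (node m) * \prod_j W x j (m j) - f y =
    \sum_(m : {ffun 'I_s -> O}) (\prod_j W x j (m j)) * (f (node m) - f y).
  rewrite [RHS](eq_bigr (fun m : {ffun 'I_s -> O} => f (node m) * \prod_j W x j (m j) - (\prod_j W x j (m j)) * f y)).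
    by rewrite sumrB -mulr_suml Wsum mul1r.
  by move=> m _; rewrite mulrBr [X in X - _]mulrC.
apply: le_trans (ler_norm_sum _ _ _) _.
have PW0 m : 0 <= \prod_j W x j (m j) by apply: prodr_ge0.
apply: le_trans (_ : \sum_(m : {ffun 'I_s -> O}) (\prod_j W x j (m j)) *
   (e / 2 + 2 * M / del ^+ 2 * \sum_j (node m 0 j - y 0 j) ^+ 2) <= _).
  by apply: ler_sum => m _; rewrite normrM ger0_norm // ler_wpM2l.
have -> : \sum_(m : {ffun 'I_s -> O}) (\prod_j W x j (m j)) *
   (e / 2 + 2 * M / del ^+ 2 * \sum_j (node m 0 j - y 0 j) ^+ 2) =
   e / 2 + 2 * M / del ^+ 2 * \sum_j (\sum_(m : {ffun 'I_s -> O})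
     (\prod_j W x j (m j)) * (node m 0 j - y 0 j) ^+ 2).
  rewrite [LHS](eq_bigr (fun m : {ffun 'I_s -> O} => (\prod_j W x j (m j)) * (e / 2) + 2 * M / del ^+ 2 *
      \sum_j (\prod_j W x j (m j)) * (node m 0 j - y 0 j) ^+ 2)).
    by rewrite big_split /= -mulr_suml Wsum mul1r -mulr_sumr exchange_big.
  by move=> m _; rewrite mulrDr; congr (_ + _); rewrite mulrCA; congr (_ * _); rewrite mulr_sumr.
rewrite [leRHS]splitr lerD2l; apply: le_trans NK; rewrite /K -[leRHS]mulrA.
rewrite ler_wpM2l ?mulr_ge0 ?invr_ge0 ?exprn_ge0 // ?(ltW del0) //.
apply: le_trans (_ : \sum_(j < s) 4 * L ^+ 2 / N%:R <= _); last first.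
  by rewrite sumr_const card_ord -[X in X <= _]mulr_natl mulrA.
apply: ler_sum => j _.
have -> : \sum_(m : {ffun 'I_s -> O}) (\prod_j W x j (m j)) * (node m 0 j - y 0 j) ^+ 2 =
   \sum_o W x j o * ((2 * L) * (N%:R^-1 * \sum_i (o i)%:R - th x j)) ^+ 2.
  rewrite -(marginal_weight j (fun o : O => ((2 * L) * (N%:R^-1 * \sum_i (o i)%:R - th x j)) ^+ 2)) //.
  by apply: eq_bigr => m _; rewrite nodey.
rewrite (eq_bigr (fun o : O => 4 * L ^+ 2 * (W x j o * (N%:R^-1 * \sum_i (o i)%:R - th x j) ^+ 2))).
  by rewrite -mulr_sumr ler_wpM2l ?mulr_ge0 ?exprn_ge0 ?(ltW L0) //; apply: bern_variance.
by move=> o _; ring.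
Qed.

Lemma sin_clip_near (L B x : R) : 0 < L -> `|x| <= B ->
  `|L * sin (L^-1 * x) - x| <= B ^+ 3 / L ^+ 2.
Proof.
move=> L0 xB.
have -> : L * sin (L^-1 * x) - x = L * (sin (L^-1 * x) - L^-1 * x).
  by rewrite mulrBr mulrA mulfV ?mul1r // gt_eqF.
rewrite normrM gtr0_norm //; apply: le_trans (ler_wpM2l (ltW L0) (sin_taylor _)) _.
rewrite normrM gtr0_norm ?invr_gt0 // exprMn.
have -> : L * (L^-1 ^+ 3 * `|x| ^+ 3) = `|x| ^+ 3 / L ^+ 2 by field; rewrite gt_eqF.
rewrite ler_wpM2r ?invr_ge0 ?exprn_ge0 ?(ltW L0) //.
by rewrite lerXn2r // nnegrE ?(le_trans _ xB).
Qed.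

End bernstein.

(** * Criterion for weak convergence *)

Section weak_convergence.
Variables (R : realType).

Lemma continuous_borel_measurable (V W : normedModType R) (f : V -> W) :
  continuous f -> measurable_fun [set: borel V] (f : borel V -> borel W).
Proof.
move=> cf; apply: (@measurability _ _ (borel V) (borel W) [set: borel V] f (@open W)) => // _ [U oU <-].
rewrite setTI; apply: sub_sigma_algebra.
exact: (open_comp (fun x _ => cf x) oU).
Qed.

Lemma continuous_real_measurable (V : normedModType R) (f : V -> R) :
  continuous f -> measurable_fun [set: borel V] (f : borel V -> R).
Proof.
move=> cf; apply: (measurability _ (RGenOpens.measurableE R)) => _ [_ [a [b ->] <-]].
rewrite setTI; apply: sub_sigma_algebra.
by apply: (open_comp (fun x _ => cf x)); apply: interval_open.
Qed.

Variable s : nat.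

Lemma contD (V : topologicalType) (f g : V -> R) :
  continuous f -> continuous g -> continuous (fun x => f x + g x).
Proof. by move=> cf cg x; exact: (continuousD (cf x) (cg x)). Qed.

Lemma contM (V : topologicalType) (f g : V -> R) :
  continuous f -> continuous g -> continuous (fun x => f x * g x).
Proof. by move=> cf cg x; exact: (continuousM (cf x) (cg x)). Qed.

Lemma contZ (V : topologicalType) a (f : V -> R) :
  continuous f -> continuous (fun x => a * f x).
Proof. by move=> cf; apply: contM => //; exact: cst_continuous. Qed.

Lemma cont_comp (V : topologicalType) (f : V -> R) (g : R -> R) :
  continuous f -> continuous g -> continuous (fun x => g (f x)).
Proof. by move=> cf cg x; apply: (@continuous_comp _ _ _ f g); [exact: cf|exact: cg]. Qed.

Lemma cont_sum (V : topologicalType) (I : Type) (r : seq I) (F : I -> V -> R) :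
  (forall i, continuous (F i)) -> continuous (fun x => \sum_(i <- r) F i x).
Proof.
move=> cF; elim: r => [|i r IH].
  by rewrite (_ : (fun _ => _) = (fun=> 0)); [exact: cst_continuous|apply/funext => x; rewrite big_nil].
rewrite (_ : (fun _ => _) = (fun x => F i x + \sum_(i <- r) F i x)); first exact: contD.
by apply/funext => x; rewrite big_cons.
Qed.

Lemma continuous_rV (V : normedModType R) (f : V -> 'rV[R]_s) :
  (forall j, continuous (fun x => f x 0 j)) -> continuous f.
Proof.
move=> cf x; apply/cvgrPdist_le => e e0.
have : \forall y \near x, forall j, `|f x 0 j - f y 0 j| <= e.
  apply: filter_forall => j; have := cf j x; move/cvgrPdist_le => /(_ e e0); exact.
apply: filterS => y H; apply: rV_norm_le; first exact: ltW.
by move=> j; rewrite !mxE.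
Qed.

Lemma continuous_sin_clip L : continuous (@sin_clip R s L).
Proof.
apply: continuous_rV => j x.
rewrite (_ : (fun _ => _) = (fun x : 'rV[R]_s => L * sin (L^-1 * x 0 j))); last first.
  by apply/funext => y; rewrite mxE.
apply: contZ; apply: cont_comp; last exact: continuous_sin.
by apply: contZ; exact: coord_continuous.
Qed.

Lemma continuous_dot t : continuous (dot (s := s) t : 'rV[R]_s -> R).
Proof.
rewrite (_ : dot t = (fun x => \sum_j x 0 j * t 0 j)); last by apply/funext => x; rewrite dotE.
apply: cont_sum => j; apply: contM; [exact: coord_continuous|exact: cst_continuous].
Qed.

Lemma continuous_trig (p : 'rV[R]_s -> R) : trigpoly p -> continuous p.
Proof.
elim=> {p} [c t|f g _ cf _ cg|a f _ cf].
- apply: cont_comp; last exact: continuous_cos.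
  by apply: contD; [exact: cst_continuous|exact: continuous_dot].
- exact: contD.
- exact: contZ.
Qed.

Lemma trig_bounded (p : 'rV[R]_s -> R) : trigpoly p -> exists M, forall x, `|p x| <= M.
Proof.
elim=> {p} [c t|f g _ [M fM] _ [N gN]|a f _ [M fM]].
- by exists 1 => x; apply: cos_max.
- by exists (M + N) => x; apply: le_trans (ler_normD _ _) (lerD _ _).
- by exists (`|a| * M) => x; rewrite normrM ler_wpM2l.
Qed.

Lemma sin_clip_cvg (x : 'rV[R]_s) : sin_clip n.+1%:R x @[n --> \oo] --> x.
Proof.
apply/cvgrPdist_le => e e0.
have := @cvg_harmonic R; move/cvgrPdist_le => /(_ (e / (1 + `|x| ^+ 3))).
have c0 : 0 < 1 + `|x| ^+ 3 by rewrite ltr_pwDl // exprn_ge0.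
move=> /(_ (divr_gt0 e0 c0)); apply: filterS => n.
rewrite sub0r normrN /harmonic ger0_norm ?invr_ge0 // ler_pdivlMr // => H.
apply: rV_norm_le; first exact: ltW.
move=> j; rewrite !mxE distrC.
have := @sin_clip_near R n.+1%:R `|x| (x 0 j) (ltr0Sn R n) (rV_coord_le x j).
move=> /le_trans; apply; apply: le_trans H; rewrite mulrC; apply: ler_pM => //.
- rewrite /= lef_pV2 ?posrE ?exprn_gt0 // expr2 ler_peMl // ler1n //.
- by rewrite lerDr.
Qed.

Context d (T : measurableType d) (P : probability T R).

(* Levy-type criterion: uniform second moments give tightness, and a bounded
   continuous f is, up to truncation by L sin(./L), a uniform limit of
   trigonometric polynomials. *)
Lemma weak_cvg_trig (Y : nat -> T -> 'rV[R]_s) (mu : probability (borel 'rV[R]_s) R)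
    (C : R) (N0 : nat) :
  (forall n, measurable_fun [set: T] (Y n : T -> borel 'rV[R]_s)) ->
  (forall n j, L1 P (fun w => (Y n w 0 j) ^+ 2)) ->
  (forall n j, (N0 <= n)%N -> ev P (fun w => (Y n w 0 j) ^+ 2) <= C) ->
  (forall c t, ev P (fun w => cos (c + dot t (Y n w))) @[n --> \oo] -->
     ev mu (fun x => cos (c + dot t x))) ->
  cvg_in_distribution P Y mu.
Proof.
move=> mY LY YC cfY; split=> // f cf [M fM].
have mfc (g : 'rV[R]_s -> R) : continuous g -> measurable_fun [set: borel 'rV[R]_s] g.
  exact: continuous_real_measurable.
have L1f (g : 'rV[R]_s -> R) n : continuous g -> (exists M, forall x, `|g x| <= M) ->
    L1 P (fun w => g (Y n w)).
  move=> cg [K gK]; apply: (@L1_bounded _ _ _ _ _ K) => //.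
  exact: (measurableT_comp (mfc g cg) (mY n)).
have L1m (g : 'rV[R]_s -> R) : continuous g -> (exists M, forall x, `|g x| <= M) ->
    L1 mu g.
  by move=> cg [K gK]; apply: (@L1_bounded _ _ _ _ _ K) => //; apply: mfc.
rewrite (ev_EFin (L1m f cf (ex_intro _ M fM))).
rewrite (_ : (fun n => _) = (fun n => (ev P (fun w => f (Y n w)))%:E)); last first.
  by apply/funext => n; rewrite ev_EFin //; apply: L1f => //; exists M.
apply: cvg_EFin; first exact: nearW.
have trigcvg p : trigpoly p -> ev P (fun w => p (Y n w)) @[n --> \oo] --> ev mu p.
  elim=> {p} [c t|g h tg cg th ch|a g tg cg].
  - exact: cfY.
  - rewrite evD; try by apply: L1m; [exact: continuous_trig|exact: trig_bounded].
    rewrite (_ : (fun n => _) = (fun n => ev P (fun w => g (Y n w)) + ev P (fun w => h (Y n w)))).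
      exact: cvgD.
    by apply/funext => n; rewrite evD //; apply: L1f; [exact: continuous_trig|exact: trig_bounded|exact: continuous_trig|exact: trig_bounded].
  - rewrite evZ; last by apply: L1m; [exact: continuous_trig|exact: trig_bounded].
    rewrite (_ : (fun n => _) = (fun n => a * ev P (fun w => g (Y n w)))).
      exact: cvgMr.
    by apply/funext => n; rewrite evZ //; apply: L1f; [exact: continuous_trig|exact: trig_bounded].
apply/cvgrPdist_le => e e0.
have M0 : 0 <= M := le_trans (normr_ge0 _) (fM 0).
have C0 : 0 <= Num.max C 0 by rewrite le_max lexx orbT.
(* Four of the five comparisons below cost [e5], and the truncation under [P] costs twice that. *)
pose e5 := e / 6; have e50 : 0 < e5 by rewrite divr_gt0.
(* With [B ^+ 2 = B2], the second moment bound makes the contribution of the outside of the cube of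
   half-side [B] at most [e5]. *)
pose B2 := 1 + 2 * M * (s%:R * Num.max C 0) / e5.
have B20 : 0 < B2 by rewrite ltr_pwDl // !mulr_ge0 // invr_ge0 ltW.
pose B := Num.sqrt B2.
have B0 : 0 < B by rewrite sqrtr_gt0.
have BB : B ^+ 2 = B2 by rewrite sqr_sqrtr // ltW.
have [del del0 unif] := cube_unif_continuous B cf e50.
(* The level [K] must serve twice: large enough for the truncation under [mu], and for the clip to
   be nearly the identity on the cube. *)
have clip n : exists2 K, (n <= K)%N & forall x : 'rV[R]_s, (forall j, `|x 0 j| <= B) ->
    `|f x - f (sin_clip K.+1%:R x)| <= e5.
  pose q := B ^+ 3 / del; have q0 : 0 <= q by rewrite divr_ge0 ?exprn_ge0 ?ltW.
  pose K := maxn n (Num.trunc q).+1; exists K; first by rewrite leq_maxl.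
  move=> x xB; apply/ltW; apply: unif => // j; rewrite mxE distrC.
  apply: le_lt_trans (sin_clip_near (ltr0Sn R K) (xB j)) _.
  rewrite ltr_pdivrMr ?exprn_gt0 // mulrC -ltr_pdivrMr // -/q.
  apply: lt_le_trans (truncnS_gt q) _; rewrite expr2 -natrM ler_nat.
  have h : ((Num.trunc q).+1 <= K)%N by rewrite leq_maxr.
  by apply: (leq_trans h); rewrite (leq_trans (leqnSn K)) // leq_pmulr.
have mucvg : ev mu (fun x => f (sin_clip n.+1%:R x)) @[n --> \oo] --> ev mu f.
  apply: (@cvg_ev _ _ _ mu _ f (fun=> M)) => //.
  - by move=> n; apply: mfc => x; apply: continuous_comp; [exact: continuous_sin_clip|exact: cf].
  - exact: mfc.
  - exact: L1_cst.
  - move=> x; apply: continuous_cvg; [exact: cf|exact: sin_clip_cvg].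
move/cvgrPdist_le: mucvg => /(_ e5 e50)[N1 _ HN1].
have [K N1K Kclip] := clip N1.
have [p tp pf] := bernstein_trig cf fM (ltr0Sn R K) e50.
have /cvgrPdist_le/(_ e5 e50)[N2 _ HN2] := trigcvg p tp.
have cfK : continuous (fun x : 'rV[R]_s => f (sin_clip K.+1%:R x)).
  by move=> x; apply: continuous_comp; [exact: continuous_sin_clip|exact: cf].
have fKM : exists M, forall x : 'rV[R]_s, `|f (sin_clip K.+1%:R x)| <= M by exists M.
have cp := continuous_trig tp; have bp := trig_bounded tp.
exists (maxn N0 N2) => // n /=; rewrite geq_max => /andP[N0n N2n].
have bf : exists M, forall x, `|f x| <= M by exists M.
have E1 : `|ev mu f - ev mu (fun x => f (sin_clip K.+1%:R x))| <= e5 by apply: HN1.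
have E2 : `|ev mu (fun x => f (sin_clip K.+1%:R x)) - ev mu p| <= e5.
  rewrite -evB; [|exact: L1m|exact: L1m]; apply: le_trans (norm_ev _) _.
    by apply: L1B; apply: L1m.
  rewrite -[leRHS](ev_cst mu); apply: le_ev; [by apply/L1_norm/L1B; apply: L1m|exact: L1_cst|].
  by move=> x; rewrite distrC.
have E3 : `|ev mu p - ev P (fun w => p (Y n w))| <= e5 by apply: HN2.
have E4 : `|ev P (fun w => p (Y n w)) - ev P (fun w => f (sin_clip K.+1%:R (Y n w)))| <= e5.
  have La := L1f _ n cp bp; have Lb := L1f _ n cfK fKM.
  rewrite -evB //; apply: le_trans (norm_ev (L1B La Lb)) _.
  by rewrite -[leRHS](ev_cst P); apply: le_ev; [exact/L1_norm/L1B|exact: L1_cst|].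
have E5 : `|ev P (fun w => f (sin_clip K.+1%:R (Y n w))) - ev P (fun w => f (Y n w))| <= 2 * e5.
  have La := L1f _ n cfK fKM; have Lb := L1f _ n cf bf.
  have Ls : L1 P (fun w => 2 * M / B ^+ 2 * \sum_j (Y n w 0 j) ^+ 2).
    by apply: L1Z; apply: L1_sum => j _.
  rewrite -evB //; apply: le_trans (norm_ev (L1B La Lb)) _.
  apply: le_trans (_ : ev P (fun w => e5 + 2 * M / B ^+ 2 * \sum_j (Y n w 0 j) ^+ 2) <= _).
    apply: le_ev; [exact/L1_norm/L1B|by apply: L1D => //; exact: L1_cst|].
    move=> w; have S0 : 0 <= \sum_j (Y n w 0 j) ^+ 2.
      by apply: sumr_ge0 => j _; rewrite sqr_ge0.
    have c0 : 0 <= 2 * M / B ^+ 2 by rewrite !mulr_ge0 // invr_ge0 exprn_ge0 // ltW.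
    have [wB|/existsNP[j /negP]] := pselect (forall j, `|Y n w 0 j| <= B).
      by rewrite distrC; apply: le_trans (Kclip _ wB) _; rewrite lerDl mulr_ge0.
    rewrite -ltNge => far; apply: le_trans (_ : 2 * M <= _).
      by apply: le_trans (ler_normB _ _) _; rewrite mulr_natl mulr2n lerD.
    apply: le_trans (_ : 2 * M / B ^+ 2 * (Y n w 0 j) ^+ 2 <= _).
      rewrite -mulrA ler_peMr ?mulr_ge0 // mulrC ler_pdivlMr ?exprn_gt0 // mul1r.
      by rewrite -[leRHS]real_normK ?num_real // lerXn2r // ?nnegrE ltW.
    apply: le_trans (_ : 2 * M / B ^+ 2 * \sum_j (Y n w 0 j) ^+ 2 <= _).
      rewrite ler_wpM2l // (bigD1 j) //= lerDl; apply: sumr_ge0 => i _; exact: sqr_ge0.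
    by rewrite lerDr ltW.
  rewrite evD //; last exact: L1_cst.
  rewrite ev_cst evZ; last by apply: L1_sum => j _.
  rewrite ev_sum // (_ : 2 * e5 = e5 + e5); last by ring.
  rewrite lerD2l.
  apply: le_trans (_ : 2 * M / B ^+ 2 * (s%:R * Num.max C 0) <= _).
    rewrite ler_wpM2l ?mulr_ge0 ?invr_ge0 ?exprn_ge0 ?(ltW B0) //.
    rewrite mulr_natl -[X in _ *+ X](card_ord s) -sumr_const; apply: ler_sum => j _.
    by rewrite le_max YC.
  rewrite BB mulrAC ler_pdivrMr // /B2; set q := 2 * M * _.
  rewrite (_ : e5 * (1 + q / e5) = e5 + q); last by field; rewrite gt_eqF.
  by rewrite lerDr ltW.
rewrite (_ : ev mu f - _ = (ev mu f - ev mu (fun x => f (sin_clip K.+1%:R x))) +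
  ((ev mu (fun x => f (sin_clip K.+1%:R x)) - ev mu p) +
  ((ev mu p - ev P (fun w => p (Y n w))) +
  ((ev P (fun w => p (Y n w)) - ev P (fun w => f (sin_clip K.+1%:R (Y n w)))) +
  (ev P (fun w => f (sin_clip K.+1%:R (Y n w))) - ev P (fun w => f (Y n w))))))); last by ring.
have -> : e = e5 + (e5 + (e5 + (e5 + 2 * e5))) by rewrite /e5; field.
do 4!(apply: le_trans (ler_normD _ _) (lerD _ _) => //).
Qed.

End weak_convergence.

Lemma continuous_idR (R : realType) : continuous (fun x : R => x).
Proof. by move=> x; exact: cvg_id. Qed.

Lemma is_derive_quad (R : realType) (a b x : R) :
  is_derive (x : R) (1 : R) (fun x : R => a * (x - b) ^+ 2 : R) (2 * a * (x - b)).
Proof.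
apply: is_derive_eq; rewrite /GRing.scale /=; ring.
Qed.

(** The product of [h] with the inverse Gaussian factor has zero derivative. *)
Lemma gaussian_ode (R : realType) (h : R -> R) (k t : R) :
  (forall t : R, is_derive (t : R) (1 : R) h (- (k * t * h t))) ->
  h t = expR (- (k * t ^+ 2 / 2)) * h 0.
Proof.
move=> dh; pose G (u : R) := h u * expR (k / 2 * u ^+ 2) : R.
have dG (u : R) : is_derive (u : R) (1 : R) G 0.
  have dhu := dh u; rewrite /G.
  have d1 : is_derive (u : R) (1 : R) (fun u : R => k / 2 * u ^+ 2 : R) (k * u).
    rewrite (_ : (fun u : R => _) = (fun u : R => k / 2 * (u - 0) ^+ 2)); last first.
      by apply/funext => y; rewrite subr0.
    by have := is_derive_quad (k / 2) 0 u; rewrite (_ : 2 * _ * _ = k * u) //; field.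
  have d2 : is_derive (u : R) (1 : R) (fun u : R => expR (k / 2 * u ^+ 2) : R) _ :=
    @is_derive1_comp _ expR (fun u : R => k / 2 * u ^+ 2) u _ _ (is_derive_expR _) d1.
  have d3 : is_derive (u : R) (1 : R) (fun u : R => h u * expR (k / 2 * u ^+ 2) : R) _ :=
    @is_deriveM _ _ h (fun u : R => expR (k / 2 * u ^+ 2)) _ _ _ _ dhu d2.
  by apply: (is_derive_eq d3); rewrite /GRing.scale /=; ring.
have := is_derive_0_is_cst t 0 dG; rewrite /G expr0n /= mulr0 expR0 mulr1 => <-.
rewrite mulrCA -expRD (_ : _ + _ = 0) ?expR0 ?mulr1 //; ring.
Qed.

(** * Characteristic function of the normal law *)

Section normal_cf.
Variables (R : realType) (sg : R).
Hypothesis sg0 : 0 < sg.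
Let mu := @lebesgue_measure R.
Let N : probability (measurableTypeR R) R := normal_prob 0 sg.
Let p := normal_pdf 0 sg : R -> R.
Let sg_neq0 : sg != 0. Proof. by rewrite gt_eqF. Qed.

Let mp : measurable_fun [set: measurableTypeR R] (EFin \o p).
Proof. by apply/measurable_EFinP; exact: measurable_normal_pdf. Qed.

Let p0 x : 0 <= p x. Proof. exact: normal_pdf_ge0. Qed.

Lemma integral_normal_ge0 (f : R -> \bar R) : measurable_fun [set: measurableTypeR R] f ->
  (forall x, 0 <= f x)%E -> (\int[N]_x f x = \int[mu]_x (f x * (p x)%:E))%E.
Proof.
move=> mf f0; have dom : N `<< mu by exact: normal_prob_dominates.
rewrite -(@Radon_Nikodym_SigmaFinite.change_of_variables _ _ _ N mu dom f [set: R]) //.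
have mrn : measurable_fun [set: measurableTypeR R] (Radon_Nikodym_SigmaFinite.f N mu).
  by apply: (measurable_int mu); exact: Radon_Nikodym_SigmaFinite.f_integrable.
apply: ae_eq_integral => //.
- exact: emeasurable_funM.
- exact: emeasurable_funM.
- apply: ae_eqe_mul2l; apply: integral_ae_eq => //.
  + exact: Radon_Nikodym_SigmaFinite.f_integrable.
  + by move=> E _ mE; rewrite -Radon_Nikodym_SigmaFinite.f_integral.
Qed.

Lemma ev_normal (f : R -> R) : L1 N f -> ev N f = \int[mu]_x (f x * p x).
Proof.
move=> Lf; have mf := L1_measurable Lf.
have pos (g : R -> R) : L1 N g -> (forall x, 0 <= g x) ->
    mu.-integrable [set: R] (EFin \o (fun x => g x * p x)) /\ ev N g = \int[mu]_x (g x * p x).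
  move=> Lg g0; have mg : measurable_fun [set: measurableTypeR R] (EFin \o g).
    by apply/measurable_EFinP; exact: L1_measurable Lg.
  have e := integral_normal_ge0 mg (fun x => g0 x).
  have m2 : measurable_fun [set: measurableTypeR R] (EFin \o (fun x => g x * p x)).
    apply/measurable_EFinP; apply: measurable_funM; [exact: L1_measurable Lg|].
    exact: measurable_normal_pdf.
  split; last by rewrite /ev /Rintegral e.
  apply/integrableP; split => //.
  rewrite (_ : (fun x => _) = (fun x => (g x)%:E * (p x)%:E)%E); last first.
    by apply/funext => x; rewrite /= ger0_norm ?mulr_ge0 // EFinM.
  by rewrite -e ev_EFin // ltry.
have Lp : L1 N (fun x => Num.max (f x) 0).
  apply: le_L1 (L1_norm Lf) => [|x]; first by apply: measurable_maxr => //; exact: measurable_cst.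
  by rewrite ger0_norm ?le_max ?lexx ?orbT // ge_max ler_norm normr_ge0.
have Ln : L1 N (fun x => Num.max (- f x) 0).
  apply: le_L1 (L1_norm Lf) => [|x].
    by apply: measurable_maxr; [exact: measurableT_comp|exact: measurable_cst].
  by rewrite ger0_norm ?le_max ?lexx ?orbT // ge_max -normrN ler_norm normr_ge0.
have [i1 e1] := pos _ Lp (fun x => (ltac:(by rewrite le_max lexx orbT) : 0 <= Num.max (f x) 0)).
have [i2 e2] := pos _ Ln (fun x => (ltac:(by rewrite le_max lexx orbT) : 0 <= Num.max (- f x) 0)).
have fE x : f x = Num.max (f x) 0 - Num.max (- f x) 0.
  by have [h|h] := leP 0 (f x); [rewrite (max_idPr _) ?oppr_le0 // subr0|
    rewrite (max_idPl _) ?oppr_ge0 ?(ltW h) // sub0r opprK].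
rewrite (eq_ev N fE) evB // e1 e2 -RintegralB //; apply: eq_Rintegral => x _.
by rewrite -mulrBl -fE.
Qed.

(** Half of the exponent absorbs the factor: with [y = |x| / (2 * sg)],
    [2 * y <= 1 + y ^+ 2 <= expR (y ^+ 2)]. The other half is a normal density of variance
    [2 * sg ^+ 2]. This yields both the integrability of [|x|] and the decay of [p] at infinity. *)
Lemma normal_pdf_wide x : `|x| * p x <=
  sg * normal_peak sg / normal_peak (Num.sqrt 2 * sg) * normal_pdf 0 (Num.sqrt 2 * sg) x.
Proof.
have s20 : Num.sqrt 2 * sg != 0 by rewrite mulf_neq0 // gt_eqF // sqrtr_gt0.
rewrite /p !normal_pdfE //=.
set a := normal_peak sg; set b := normal_peak _.
have b0 : 0 < b by exact: normal_peak_gt0.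
have a0 : 0 <= a by exact: normal_peak_ge0.
have -> : sg * a / b * (b * normal_fun 0 (Num.sqrt 2 * sg) x) =
   a * (sg * normal_fun 0 (Num.sqrt 2 * sg) x) by field; rewrite gt_eqF.
rewrite mulrCA ler_wpM2l // /normal_fun subr0.
have -> : - x ^+ 2 / (sg ^+ 2 *+ 2) = - ((x / (2 * sg)) ^+ 2) - (x / (2 * sg)) ^+ 2.
  by rewrite -mulr_natr; field; rewrite gt_eqF.
have -> : - x ^+ 2 / ((Num.sqrt 2 * sg) ^+ 2 *+ 2) = - ((x / (2 * sg)) ^+ 2).
  rewrite exprMn sqr_sqrtr // -mulr_natr; field; by rewrite gt_eqF.
rewrite expRD mulrCA [leRHS]mulrC ler_wpM2l ?expR_ge0 //.
have h := expR_ge1Dx ((x / (2 * sg)) ^+ 2).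
rewrite expRN ler_pdivrMr ?expR_gt0 //.
apply: le_trans (_ : sg * (1 + (x / (2 * sg)) ^+ 2) <= _); last by rewrite ler_wpM2l // ltW.
have -> : `|x| = sg * (2 * `|x / (2 * sg)|).
  rewrite normrM normfV (gtr0_norm (mulr_gt0 _ sg0)) //; field; by rewrite gt_eqF.
rewrite ler_wpM2l ?(ltW sg0) // -[X in 1 + X]real_normK ?num_real //.
by have := sqr_ge0 (`|x / (2 * sg)| - 1); nra.
Qed.

Lemma L1_normal_abs : L1 N (fun x => `|x|).
Proof.
set K := sg * normal_peak sg / normal_peak (Num.sqrt 2 * sg).
have mabs : measurable_fun [set: measurableTypeR R] (fun x : R => `|x|%:E).
  by apply/measurable_EFinP; apply: continuous_measurable_fun; exact: norm_continuous.
apply/integrableP; split => //.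
rewrite (_ : (fun x => _) = (fun x : R => `|x|%:E)); last first.
  by apply/funext => x /=; rewrite normr_id.
rewrite integral_normal_ge0 //.
apply: (@le_lt_trans _ _ (\int[mu]_x (K * normal_pdf 0 (Num.sqrt 2 * sg) x)%:E)%E).
  apply: ge0_le_integral => //.
  - by move=> x _; rewrite mule_ge0 ?lee_fin.
  - exact: emeasurable_funM.
  - by apply/measurable_EFinP; apply: measurable_funM => //; exact: measurable_normal_pdf.
  - by move=> x _; rewrite -EFinM lee_fin normal_pdf_wide.
rewrite (_ : (fun x => _) = (fun x => K%:E * (normal_pdf 0 (Num.sqrt 2 * sg) x)%:E)%E); last first.
  by apply/funext => x; rewrite EFinM.
rewrite integralZl //; last exact: integrable_normal_pdf.
by rewrite integral_normal_pdf mule1 ltry.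
Qed.

Let h c t := ev N (fun x : R => cos (c + t * x)).

Let mcos c t : measurable_fun [set: measurableTypeR R] (fun x : R => cos (c + t * x)).
Proof.
apply: continuous_measurable_fun; apply: cont_comp; last exact: continuous_cos.
by apply: contD; [exact: cst_continuous|apply: contZ; exact: continuous_idR].
Qed.

Let msin c t : measurable_fun [set: measurableTypeR R] (fun x : R => sin (c + t * x)).
Proof.
apply: continuous_measurable_fun; apply: cont_comp; last exact: continuous_sin.
by apply: contD; [exact: cst_continuous|apply: contZ; exact: continuous_idR].
Qed.

(** Stein's identity. The function [F = sin (c + t * x) * p x] has derivative [q * p] and vanishes
    at infinity, so [q] has mean 0; the integration is carried out on growing intervals and passed
    to the limit by domination. *)
Lemma normal_by_parts c t :
  ev N (fun x => x * sin (c + t * x)) = sg ^+ 2 * t * h c t.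
Proof.
pose q x := t * cos (c + t * x) - x / sg ^+ 2 * sin (c + t * x).
pose F x := sin (c + t * x) * p x.
have Lxs : L1 N (fun x => x * sin (c + t * x)).
  apply: le_L1 L1_normal_abs => [|x]; first by apply: measurable_funM => //; exact: msin.
  by rewrite normrM ler_piMr // sin_max.
have Lc : L1 N (fun x => cos (c + t * x)) by apply: (@L1_bounded _ _ _ _ _ 1) => // x; apply: cos_max.
have qE x : q x = t * cos (c + t * x) - sg ^- 2 * (x * sin (c + t * x)) by rewrite /q; ring.
have evq : ev N q = t * h c t - sg ^- 2 * ev N (fun x => x * sin (c + t * x)).
  by rewrite (eq_ev N qE) evB ?evZ //; exact: L1Z.
suff q0 : ev N q = 0.
  move: evq; rewrite q0 => /esym/eqP; rewrite subr_eq0 => /eqP e.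
  by rewrite -mulrA e mulrA mulfV ?mul1r // expf_neq0.
have Lq : L1 N q.
  rewrite (_ : q = (fun x => t * cos (c + t * x) - sg ^- 2 * (x * sin (c + t * x)))); last exact/funext.
  by apply: L1B; apply: L1Z.
have mq := L1_measurable Lq.
have dF (x : R) : is_derive (x : R) (1 : R) F (q x * p x).
  rewrite /F /p normal_pdfE // /normal_fun /q.
  have d1 : is_derive (x : R) (1 : R) (fun x : R => - (x - 0) ^+ 2 / (sg ^+ 2 *+ 2) : R) (- x / sg ^+ 2).
    rewrite (_ : (fun x => _) = (fun x => - (2 * sg ^+ 2)^-1 * (x - 0) ^+ 2)); last first.
      by apply/funext => y; rewrite -mulr_natl; field.
    have := is_derive_quad (- (2 * sg ^+ 2)^-1) 0 x.
    by rewrite (_ : 2 * _ * _ = - x / sg ^+ 2) //; field.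
  have d2 : is_derive (x : R) (1 : R) (fun x : R => c + t * x : R) t.
    by apply: is_derive_eq; rewrite /GRing.scale /=; ring.
  have d3 : is_derive (x : R) (1 : R) (fun x : R => expR (- (x - 0) ^+ 2 / (sg ^+ 2 *+ 2)) : R) _ :=
    @is_derive1_comp _ expR (fun x : R => - (x - 0) ^+ 2 / (sg ^+ 2 *+ 2)) x _ _ (is_derive_expR _) d1.
  have d4 : is_derive (x : R) (1 : R) (fun x : R => sin (c + t * x) : R) _ :=
    @is_derive1_comp _ sin (fun x : R => c + t * x) x _ _ (is_derive_sin _) d2.
  have d5 := @is_deriveZ _ _ _ (fun x : R => expR (- (x - 0) ^+ 2 / (sg ^+ 2 *+ 2))) (normal_peak sg) _ _ _ d3.
  have d6 : is_derive (x : R) (1 : R) (fun x : R => sin (c + t * x) *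
     (normal_peak sg * expR (- (x - 0) ^+ 2 / (sg ^+ 2 *+ 2))) : R) _ :=
    @is_deriveM _ _ (fun x : R => sin (c + t * x))
      (fun x : R => normal_peak sg * expR (- (x - 0) ^+ 2 / (sg ^+ 2 *+ 2))) _ _ _ _ d4 d5.
  by apply: (is_derive_eq d6); rewrite /GRing.scale /=; ring.
have cF : continuous F by move=> x; apply: differentiable_continuous; apply/derivable1_diffP; have := dF x => -[].
have cqp : continuous (fun x => q x * p x).
  apply: contM; last exact: continuous_normal_pdf.
  rewrite (_ : q = (fun x => t * cos (c + t * x) + (- (sg ^- 2)) * (x * sin (c + t * x)))); last first.
    by apply/funext => x; rewrite qE mulNr.
  have cl : continuous (fun x : R => c + t * x).
    by apply: contD; [exact: cst_continuous|apply: contZ; exact: continuous_idR].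
  apply: contD; apply: contZ; first by apply: cont_comp => //; exact: continuous_cos.
  by apply: contM; [exact: continuous_idR|apply: cont_comp => //; exact: continuous_sin].
pose J n := `[(- n.+1%:R : R), n.+1%:R]%classic.
have mJ n : measurable_fun [set: measurableTypeR R] (\1_(J n) : R -> R).
  by apply: measurable_indic; exact: measurable_itv.
have key n : ev N (fun x => q x * \1_(J n) x) = F n.+1%:R - F (- n.+1%:R).
  have L1n : L1 N (fun x => q x * \1_(J n) x).
    apply: le_L1 (L1_norm Lq) => [|x]; first exact: measurable_funM mq (mJ n).
    rewrite normrM ler_piMr // indicE; by case: (_ \in _); rewrite ?normr1 ?normr0.
  rewrite ev_normal //.
  rewrite (_ : \int[mu]_x _ = \int[mu]_(x in J n) (q x * p x)); last first.
    rewrite [RHS]Rintegral_mkcond; apply: eq_Rintegral => x _.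
    by rewrite /= patchE indicE; case: (x \in J n); rewrite ?mulr1 ?mulr0 ?mul0r.
  rewrite /Rintegral (@continuous_FTC2 _ _ F) //.
  - by rewrite (lt_le_trans (_ : _ < 0)) ?oppr_lt0.
  - exact: continuous_subspaceT.
  - split.
    + by move=> x _; have := dF x => -[].
    + by apply: cvg_at_right_filter; apply: cF.
    + by apply: cvg_at_left_filter; apply: cF.
  - by move=> x _; rewrite derive1E; have := dF x => -[_ ->].
have lim1 : F n.+1%:R - F (- n.+1%:R) @[n --> \oo] --> ev N q.
  rewrite (_ : (fun n => _) = (fun n => ev N (fun x => q x * \1_(J n) x))); last first.
    by apply/funext => n; rewrite key.
  apply: (@cvg_ev _ _ _ N _ q (fun x => `|q x|)) => //.
  - by move=> n; exact: measurable_funM mq (mJ n).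
  - exact: L1_norm.
  - move=> x; apply: cvg_near_cst.
    exists (Num.trunc `|x|).+1 => // n /= xn; rewrite indicE mem_set ?mulr1 //.
    rewrite /J /= in_itv /= -ler_norml; apply: ltW; apply: lt_le_trans (truncnS_gt _) _.
    by rewrite ler_nat ltnW.
  - move=> n x; rewrite normrM ler_piMr // indicE; by case: (_ \in _); rewrite ?normr1 ?normr0.
have s20 : Num.sqrt 2 * sg != 0 by rewrite mulf_neq0 // gt_eqF // sqrtr_gt0.
pose K := sg * normal_peak sg / normal_peak (Num.sqrt 2 * sg) * normal_peak (Num.sqrt 2 * sg).
have pb x : 0 < `|x| -> p x <= K / `|x|.
  move=> x0; rewrite ler_pdivlMr // mulrC; apply: le_trans (normal_pdf_wide x) _.
  rewrite /K ler_wpM2l ?normal_pdf_ub //.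
  by rewrite !mulr_ge0 ?invr_ge0 ?normal_peak_ge0 // ltW.
have lim0 : F n.+1%:R - F (- n.+1%:R) @[n --> \oo] --> 0.
  apply: norm_cvg0; apply: (@squeeze_cvgr _ _ _ _ (fun=> 0) (fun n => 2 * K * n.+1%:R^-1)).
  - apply: nearW => n; rewrite normr_ge0 /=.
    apply: le_trans (ler_normB _ _) _; rewrite -mulrA mulr_natl mulr2n.
    have n0 : 0 < `|n.+1%:R : R| by rewrite normr_gt0.
    have F1 x : `|F x| <= p x by rewrite normrM (ger0_norm (p0 x)) ler_piMl // sin_max.
    apply: lerD; apply: le_trans (F1 _) _.
      by apply: le_trans (pb _ n0) _; rewrite ger0_norm.
    by apply: le_trans (pb _ _) _; rewrite normrN // ger0_norm.
  - exact: cvg_cst.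
  - by rewrite -[X in _ --> X](mulr0 (2 * K)); apply: cvgMr; exact: cvg_harmonic.
exact: (cvg_unique _ lim1 lim0).
Qed.

(** Differentiation under the integral, dominated by [|x|], followed by Stein's identity;
    [gaussian_ode] then solves the resulting equation. *)
Lemma is_derive_normal_cf (c t : R) :
  is_derive (t : R) (1 : R) (h c : R -> R) (- (sg ^+ 2 * t * h c t)).
Proof.
pose f u x := cos (c + u * x) : R.
have df u x : is_derive (u : R) (1 : R) (fun u => f u x : R) (- (x * sin (c + u * x))).
  by rewrite /f; apply: is_derive_eq; rewrite /GRing.scale /=; ring.
have Lf u : N.-integrable [set: R] (EFin \o f u).
  by apply: (@L1_bounded _ _ _ N (f u) 1); [exact: mcos|move=> x; exact: cos_max].
have It : `](t - 1), (t + 1)[%classic t by rewrite /= in_itv /=; lra.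
have d1 u x : partial1of2 f u x = - (x * sin (c + u * x)).
  by rewrite partial1of2E; have := df u x => -[_ ->].
have H : h0^-1 *: (h c (h0 + t) - h c t) @[h0 --> 0^'] --> - (sg ^+ 2 * t * h c t).
  rewrite (_ : - (sg ^+ 2 * t * h c t) = \int[N]_(y in [set: R]) partial1of2 f t y); last first.
    rewrite -normal_by_parts -mulN1r -evZ.
      by apply: eq_ev => x; rewrite d1 mulN1r.
    apply: le_L1 L1_normal_abs => [|x]; first by apply: measurable_funM => //; exact: msin.
    by rewrite normrM ler_piMr // sin_max.
  apply: (@cvg_differentiation_under_integral R _ _ N f [set: R] measurableT t (t - 1) (t + 1)
    It (fun u _ => Lf u) (fun u x _ _ => @ex_derive _ _ _ _ _ _ _ (df u x)) (fun x => `|x|)) => //.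
    exact: L1_normal_abs.
  by move=> u x _ _; rewrite d1 normrN normrM ler_piMr // sin_max.
have H' : h0^-1 *: ((h c \o shift t) (h0 *: (1 : R)) - h c t) @[h0 --> 0^'] --> - (sg ^+ 2 * t * h c t).
  rewrite (_ : (fun h0 => _) = (fun h0 => h0^-1 *: (h c (h0 + t) - h c t))) //.
  by apply/funext => z; rewrite /= /GRing.scale /= mulr1.
by apply: DeriveDef; [apply/cvg_ex; eexists; exact: H'|apply/cvg_lim => //; exact: H'].
Qed.

Lemma normal_cf (c t : R) :
  ev N (fun x => cos (c + t * x)) = expR (- (sg ^+ 2 * t ^+ 2 / 2)) * cos c.
Proof.
have -> : cos c = h c 0.
  by rewrite /h -[LHS](ev_cst N); apply: eq_ev => x; rewrite mul0r addr0.
by apply: gaussian_ode => u; exact: is_derive_normal_cf.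
Qed.

End normal_cf.

(** * Measurability and laws of random vectors *)

Section measurability_of_row_vectors.
Context d (T : measurableType d) (R : realType) (s : nat).

(** An open set is the union of the rational boxes it contains; these are countably many, and
    membership in a box is a condition on the coordinates. *)
Lemma measurable_rV (Y : T -> 'rV[R]_s) :
  (forall j, measurable_fun [set: T] (fun w => Y w 0 j)) ->
  measurable_fun [set: T] (Y : T -> borel 'rV[R]_s).
Proof.
move=> mY.
pose box (b : 'rV[rat]_s * nat) : set 'rV[R]_s :=
  [set x | forall j, `|x 0 j - ratr (b.1 0 j)| < b.2.+1%:R^-1].
apply: (@measurability _ _ T (borel 'rV[R]_s) [set: T] Y (@open 'rV[R]_s)) => // _ [U oU <-].
rewrite setTI.
have -> : Y @^-1` U = \bigcup_(b in [set b | box b `<=` U]) (Y @^-1` box b).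
  apply/seteqP; split=> [w /= Uw|w [b /= bU]]; last exact: bU.
  have [e /= e0 eU] : nbhs_ball (Y w) U by apply/nbhs_ballP; exact: open_nbhs_nbhs.
  pose n := Num.trunc (2 / e).
  have n0 : 0 < n.+1%:R^-1 :> R by rewrite invr_gt0.
  have ne : n.+1%:R^-1 * 2 < e.
    rewrite mulrC ltr_pdivrMr // -ltr_pdivrMl // mulrC; exact: truncnS_gt.
  have /choice[q qP] j : exists q : rat, `|Y w 0 j - ratr q| < n.+1%:R^-1.
    have [q] := @rat_in_itvoo R (Y w 0 j - n.+1%:R^-1) (Y w 0 j + n.+1%:R^-1) (ltac:(by rewrite ltrBlDr -addrA ltrDl addr_gt0)).
    rewrite in_itv /= => /andP[q1 q2]; exists q.
    by rewrite distrC ltr_distl q1 q2.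
  exists (\row_j q j, n); last by move=> j; rewrite mxE.
  move=> x /= xb; apply: eU; rewrite -ball_normE /=.
  apply: le_lt_trans ne; apply: rV_norm_le; first by rewrite mulr_ge0 ?ltW.
  move=> j; rewrite !mxE mulr_natr mulr2n.
  have := xb j; rewrite mxE => xj.
  rewrite (_ : _ - _ = (Y w 0 j - ratr (q j)) - (x 0 j - ratr (q j))); last by ring.
  apply: le_trans (ler_normB _ _) _; apply: lerD; exact: ltW.
rewrite bigcup_mkcond; apply: countable_bigcupT_measurable; first exact: countableP.
move=> b; case: ifP => // _.
rewrite (_ : Y @^-1` box b = ~` \bigcup_(j : 'I_s)
    ~` ((fun w => Y w 0 j) @^-1` [set r | `|r - ratr (b.1 0 j)| < b.2.+1%:R^-1])); last first.
  by rewrite setC_bigcup; apply/seteqP; split => [w /= H j _|w /= H j]; rewrite ?setCK; [exact: H|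
     have := H j I; rewrite setCK].
apply: measurableC; apply: countable_bigcupT_measurable => [|j]; first exact: countableP.
apply: measurableC.
rewrite -[X in measurable X]setTI; apply: mY => //.
rewrite (_ : [set r | _] = ball (ratr (b.1 0 j) : R) b.2.+1%:R^-1); last first.
  by apply/seteqP; split=> r; rewrite -ball_normE /= distrC.
exact: measurable_ball.
Qed.

Lemma measurable_coord (Y : T -> 'rV[R]_s) j :
  measurable_fun [set: T] (Y : T -> borel 'rV[R]_s) ->
  measurable_fun [set: T] (fun w => Y w 0 j).
Proof.
move=> mY; have := @continuous_real_measurable R 'rV[R]_s (fun x => x 0 j) (@coord_continuous _ _ _ 0 j).
by move=> /measurableT_comp; apply.
Qed.

End measurability_of_row_vectors.

Section laws.
Context d (T : measurableType d) (R : realType) (P : probability T R).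

Lemma law_exists d' (T' : measurableType d') (Y : T -> T') : measurable_fun [set: T] Y ->
  exists mu : probability T' R, (forall A, mu A = P (Y @^-1` A)) /\
    forall f : T' -> R, measurable_fun [set: T'] f -> L1 P (f \o Y) ->
      L1 mu f /\ ev mu f = ev P (f \o Y).
Proof.
move=> mY.
pose Y' : {mfun T >-> T'} := MeasurableFun.Pack (MeasurableFun.Class (isMeasurableFun.Build _ _ _ _ _ mY)).
exists (distribution P Y'); split => // f mf Lf.
have mf' : measurable_fun [set: T'] (EFin \o f) by apply/measurable_EFinP.
split; first exact: (integrable_pushforward mY mf').
by rewrite /ev /Rintegral (integral_pushforward mY mf').
Qed.

Lemma ev_prod d' (T' : measurableType d') (P' : probability T' R) (f : T * T' -> R) M :
  measurable_fun [set: T * T'] f -> (forall z, `|f z| <= M) ->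
  ev (P \x P')%E f = ev P (fun x => ev P' (fun y => f (x, y))).
Proof.
move=> mf fM; have Lf := L1_bounded (P \x P')%E mf fM.
rewrite /ev /Rintegral -(integral12_prod_meas1 Lf); congr (fine _).
apply: eq_integral => x _; rewrite /fubini_F /= fineK //.
apply: integrable_fin_num => //; apply: (L1_bounded P') => // y.
exact: (measurableT_comp mf (measurable_pair1 x)).
Qed.

End laws.

(** * Uniqueness of a law from its trigonometric moments *)

Section uniqueness.
Variable R : realType.

(** The clipped [f] is a uniform limit of trigonometric polynomials, and the clip is removed by
    dominated convergence. *)
Lemma ev_trig_ext s (mu nu : probability (borel 'rV[R]_s) R) (f : 'rV[R]_s -> R) (M : R) :
  (forall c t, ev mu (fun x => cos (c + dot t x)) = ev nu (fun x => cos (c + dot t x))) ->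
  continuous f -> (forall x, `|f x| <= M) -> ev mu f = ev nu f.
Proof.
move=> h cf fM.
have mfc (g : 'rV[R]_s -> R) : continuous g -> measurable_fun [set: borel 'rV[R]_s] g.
  exact: continuous_real_measurable.
have cfK K : continuous (fun x : 'rV[R]_s => f (sin_clip K x)).
  by move=> x; apply: continuous_comp; [exact: continuous_sin_clip|exact: cf].
have lim (m : probability (borel 'rV[R]_s) R) :
    ev m (fun x => f (sin_clip n.+1%:R x)) @[n --> \oo] --> ev m f.
  apply: (@cvg_ev _ _ _ m _ f (fun=> M)) => //.
  - by move=> n; apply: mfc.
  - exact: mfc.
  - exact: L1_cst.
  - move=> x; apply: continuous_cvg; [exact: cf|exact: sin_clip_cvg].
have L1m (m : probability (borel 'rV[R]_s) R) (g : 'rV[R]_s -> R) :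
    continuous g -> (exists M, forall x, `|g x| <= M) -> L1 m g.
  by move=> cg [K gK]; apply: (@L1_bounded _ _ _ _ _ K) => //; apply: mfc.
have trigE p : trigpoly p -> ev mu p = ev nu p.
  elim=> {p} [c t|g k tg eg tk ek|a g tg eg]; first exact: h.
    rewrite !evD ?eg ?ek //; by apply: L1m; [exact: continuous_trig|exact: trig_bounded].
  rewrite !evZ ?eg //; by apply: L1m; [exact: continuous_trig|exact: trig_bounded].
have clipE n : ev mu (fun x => f (sin_clip n.+1%:R x)) = ev nu (fun x => f (sin_clip n.+1%:R x)).
  apply/eqP; rewrite -subr_eq0 -normr_le0; apply/ler_addgt0Pl => e e0; rewrite addr0.
  have e20 : 0 < e / 2 by rewrite divr_gt0.
  have [p tp pf] := bernstein_trig cf fM (ltr0Sn R n) e20.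
  have Lp m := L1m m p (continuous_trig tp) (trig_bounded tp).
  have Lf m := L1m m _ (cfK n.+1%:R) (ex_intro _ M (fun x => fM _)).
  have near (m : probability (borel 'rV[R]_s) R) :
      `|ev m p - ev m (fun x => f (sin_clip n.+1%:R x))| <= e / 2.
    rewrite -evB //; apply: le_trans (norm_ev (L1B (Lp m) (Lf m))) _.
    by rewrite -[leRHS](ev_cst m); apply: le_ev; [exact/L1_norm/L1B|exact: L1_cst|].
  rewrite (_ : _ - _ = (ev nu p - ev nu (fun x => f (sin_clip n.+1%:R x))) -
    (ev mu p - ev mu (fun x => f (sin_clip n.+1%:R x)))); last by rewrite (trigE _ tp); ring.
  by apply: le_trans (ler_normB _ _) _; rewrite [leRHS]splitr lerD.
have := lim mu; rewrite (_ : (fun n => _) = (fun n => ev nu (fun x => f (sin_clip n.+1%:R x)))); last first.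
  by apply/funext => n; exact: clipE.
by move=> l; apply: (cvg_unique _ l (lim nu)).
Qed.

(** Continuous functions with values in [[0, 1]] that tend pointwise to the indicator of the open
    half-line above [a]. *)
Definition ramp (n : nat) (a x : R) : R := Num.min 1 (Num.max 0 (n%:R * (x - a))).

Lemma continuous_ramp n a : continuous (ramp n a).
Proof.
move=> x; apply: (@continuous_min _ _ (fun=> 1) (fun x => Num.max 0 (n%:R * (x - a))) x); first exact: cvg_cst.
apply: (@continuous_max _ _ (fun=> 0) (fun x => n%:R * (x - a)) x); first exact: cvg_cst.
apply: (@contZ R R n%:R (fun x => x - a)) => y.
by apply: cvgB; [exact: cvg_id|exact: cvg_cst].
Qed.

Lemma ramp_bounded n a x : 0 <= ramp n a x <= 1.
Proof. by rewrite /ramp le_min ler01 le_max lexx ge_min lexx. Qed.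

Lemma ramp_cvg a x : ramp n a x @[n --> \oo] --> (\1_(`]a, +oo[%classic) x : R).
Proof.
rewrite indicE; have [xa|xa] := leP x a.
  rewrite memNset; last by rewrite /= in_itv /= andbT => /lt_geF; rewrite xa.
  apply: cvg_near_cst; apply: nearW => n; rewrite /ramp (max_idPl _) ?(min_idPr _) //.
  by rewrite mulr_ge0_le0 // subr_le0.
rewrite mem_set; last by rewrite /= in_itv /= andbT.
apply: cvg_near_cst; exists (Num.trunc (x - a)^-1).+1 => // n /= xn.
have xa0 : 0 < x - a by rewrite subr_gt0.
have : 1 <= n%:R * (x - a).
  rewrite -ler_pdivrMr // mul1r; apply/ltW; apply: lt_le_trans (truncnS_gt _) _.
  by rewrite ler_nat.
move=> n1; rewrite /ramp (max_idPr _) ?(min_idPl _) //.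
exact: le_trans n1.
Qed.

Lemma real_law_unique (mu nu : probability (measurableTypeR R) R) :
  (forall (f : R -> R) M, continuous f -> (forall x, `|f x| <= M) -> ev mu f = ev nu f) ->
  forall A : set R, measurable A -> mu A = nu A.
Proof.
move=> h A mA; apply: (@measure_unique _ R (measurableTypeR R) (@RGenOInfty.G R) (fun n : nat => `](- n%:R : R), +oo[%classic) _ _ _ _ mu nu) => //.
- exact: RGenOInfty.measurableE.
- move=> _ _ [a ->] [b ->]; exists (Num.max a b).
  by apply/seteqP; split => x /=; rewrite !in_itv /= !andbT gt_max => /andP.
- by move=> n; exists (- n%:R).
- rewrite -subTset => x _; exists (Num.trunc `|x|).+1 => //=.
  rewrite in_itv /= andbT ltrNl; apply: le_lt_trans (truncnS_gt _).
  by rewrite -normrN ler_norm.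
- move=> _ [a ->].
  have mi : measurable_fun [set: measurableTypeR R] (\1_(`]a, +oo[%classic) : R -> R).
    by apply: measurable_indic; exact: measurable_itv.
  have Li (m : probability (measurableTypeR R) R) : L1 m (\1_(`]a, +oo[%classic) : R -> R).
    apply: (@L1_bounded _ _ _ m _ 1) => // x; rewrite indicE.
    by case: (_ \in _); rewrite ?normr1 ?normr0.
  have lim (m : probability (measurableTypeR R) R) :
      ev m (ramp n a) @[n --> \oo] --> ev m (\1_(`]a, +oo[%classic) : R -> R).
    apply: (@cvg_ev _ _ _ m _ _ (fun=> 1)) => //.
    + by move=> n; apply: continuous_measurable_fun; exact: continuous_ramp.
    + exact: L1_cst.
    + by move=> x; exact: ramp_cvg.
    + by move=> n x; have /andP[r0 r1] := ramp_bounded n a x; rewrite ger0_norm.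
  have e : ev mu (\1_(`]a, +oo[%classic) : R -> R) = ev nu (\1_(`]a, +oo[%classic) : R -> R).
    have := lim mu; rewrite (_ : (fun n => _) = (fun n => ev nu (ramp n a))); last first.
      apply/funext => n; apply: (h _ 1); first exact: continuous_ramp.
      by move=> x; have /andP[r0 r1] := ramp_bounded n a x; rewrite ger0_norm.
    by move=> l; apply: (cvg_unique _ l (lim nu)).
  have im (m : probability (measurableTypeR R) R) :
      m `]a, +oo[%classic = (ev m (\1_(`]a, +oo[%classic) : R -> R))%:E.
    by rewrite -(ev_EFin (Li m)) integral_indic // setIT.
  exact: (etrans (im mu) (etrans (congr1 EFin e) (esym (im nu)))).
- move=> n; rewrite (le_lt_trans (probability_le1 mu _)) ?ltry //.
Qed.

Lemma real_law_unique_trig (mu nu : probability (measurableTypeR R) R) :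
  (forall c t, ev mu (fun x => cos (c + t * x)) = ev nu (fun x => cos (c + t * x))) ->
  forall A : set R, measurable A -> mu A = nu A.
Proof.
move=> h; apply: real_law_unique => f M cf fM.
have mcol : measurable_fun [set: measurableTypeR R]
    ((fun x => const_mx x : 'rV[R]_1) : R -> borel 'rV[R]_1).
  apply: measurable_rV => j; rewrite (_ : (fun _ => _) = id) //.
  by apply/funext => x; rewrite mxE.
have [mu1 [_ mu1E]] := law_exists mu mcol.
have [nu1 [_ nu1E]] := law_exists nu mcol.
have mf : measurable_fun [set: measurableTypeR R] f by exact: continuous_measurable_fun.
have cf1 : continuous (fun y : 'rV[R]_1 => f (y 0 0)).
  by apply: cont_comp => //; exact: coord_continuous.
have fE (m : probability (measurableTypeR R) R) (m1 : probability (borel 'rV[R]_1) R) :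
    (forall f : borel 'rV[R]_1 -> R, measurable_fun [set: borel 'rV[R]_1] f ->
      L1 m (f \o (fun x => const_mx x : 'rV[R]_1)) ->
      L1 m1 f /\ ev m1 f = ev m (f \o (fun x => const_mx x : 'rV[R]_1))) ->
    forall (g : R -> R) K, continuous g -> (forall x, `|g x| <= K) ->
      ev m1 (fun y : 'rV[R]_1 => g (y 0 0)) = ev m g.
  move=> H g K cg gK; rewrite (H _ _ _).2.
  + by apply: eq_ev => x; rewrite /= mxE.
  + by apply: continuous_real_measurable; apply: cont_comp => //; exact: coord_continuous.
  + apply: (@L1_bounded _ _ _ _ _ K) => [|x]; last exact: gK.
    rewrite (_ : _ \o _ = g); first exact: continuous_measurable_fun.
    by apply/funext => x; rewrite /= mxE.
rewrite -(fE _ _ mu1E _ M) // -(fE _ _ nu1E _ M) //.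
apply: (@ev_trig_ext 1 mu1 nu1 _ M) => // c t.
have E (y : 'rV[R]_1) : cos (c + dot t y) = (fun x => cos (c + t 0 0 * x)) (y 0 0).
  by rewrite dotE big_ord1 mulrC.
have cc : continuous (fun x : R => cos (c + t 0 0 * x)).
  apply: cont_comp; last exact: continuous_cos.
  by apply: contD; [exact: cst_continuous|apply: contZ; exact: continuous_idR].
have cb (x : R) : `|cos (c + t 0 0 * x)| <= 1 by exact: cos_max.
by rewrite (eq_ev mu1 E) (eq_ev nu1 E) (fE _ _ mu1E _ 1 cc cb) (fE _ _ nu1E _ 1 cc cb).
Qed.

End uniqueness.

(** * Gaussian vectors *)

Section gaussian_vectors.
Variables (R : realType) (s : nat).

(* Adding a vector a amounts to pushing mu x N(0, 1) forward along (x, z) |-> x + z a. *)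
Lemma gaussian_exists (L : seq 'rV[R]_s) : exists mu : probability (borel 'rV[R]_s) R,
  forall c t, ev mu (fun x => cos (c + dot t x)) =
    expR (- ((\sum_(a <- L) dot t a ^+ 2) / 2)) * cos c.
Proof.
pose N : probability (measurableTypeR R) R := normal_prob 0 1.
elim: L => [|a L [mu muE]].
  have m0 : measurable_fun [set: measurableTypeR R] ((fun=> 0) : R -> borel 'rV[R]_s).
    exact: measurable_cst.
  have [mu [_ muE]] := law_exists N m0.
  exists mu => c t; rewrite big_nil mul0r oppr0 expR0 mul1r.
  have mcos : measurable_fun [set: borel 'rV[R]_s] (fun x : 'rV[R]_s => cos (c + dot t x)).
    exact: (continuous_real_measurable (continuous_trig (trig_cos c t))).
  rewrite (muE _ mcos _).2; last by exact: (L1_cst N (cos (c + dot t 0))).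
  by rewrite -[RHS](ev_cst N); apply: eq_ev => x; rewrite /= dotC dot0l addr0.
pose Y (z : borel 'rV[R]_s * measurableTypeR R) : borel 'rV[R]_s := z.1 + (z.2 : R) *: a.
have mY : measurable_fun [set: borel 'rV[R]_s * measurableTypeR R] Y.
  apply: measurable_rV => j.
  rewrite (_ : (fun _ => _) = (fun z : borel 'rV[R]_s * measurableTypeR R =>
     (z.1 : 'rV[R]_s) 0 j + a 0 j * (z.2 : R))); last first.
    by apply/funext => z; rewrite !mxE mulrC.
  apply: measurable_funD; first exact: (measurable_coord j (@measurable_fst _ _ (borel 'rV[R]_s) (measurableTypeR R))).
  by apply: measurable_funM; [exact: measurable_cst|exact: measurable_snd].
have [nu [_ nuE]] := law_exists (mu \x N)%E mY.
exists nu => c t; rewrite big_cons.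
have -> : expR (- ((dot t a ^+ 2 + \sum_(b <- L) dot t b ^+ 2) / 2)) =
    expR (- (dot t a ^+ 2 / 2)) * expR (- ((\sum_(b <- L) dot t b ^+ 2) / 2)).
  by rewrite -expRD mulrDl opprD.
rewrite -(mulrA (expR _)) -(muE c t).
have mcos : measurable_fun [set: borel 'rV[R]_s] (fun x : 'rV[R]_s => cos (c + dot t x)).
  exact: (continuous_real_measurable (continuous_trig (trig_cos c t))).
have mcosY := measurableT_comp mcos mY.
rewrite (nuE _ mcos _).2; last by apply: (@L1_bounded _ _ _ _ _ 1) => // z; exact: cos_max.
rewrite (@ev_prod _ _ _ mu _ _ N _ 1) => //; last by move=> z; exact: cos_max.
rewrite -evZ; last by apply: (@L1_bounded _ _ _ _ _ 1) => // z; exact: cos_max.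
apply: eq_ev => x.
have -> : expR (- (dot t a ^+ 2 / 2)) * cos (c + dot t x) =
    expR (- (1 ^+ 2 * dot t a ^+ 2 / 2)) * cos (c + dot t x) by rewrite expr1n mul1r.
rewrite -(normal_cf ltr01); apply: eq_ev => y /=.
by rewrite /Y /= dotC dotDl dotZl ![dot _ t]dotC addrA mulrC.
Qed.

(** The cosines of the law of [dot t] at frequency [u] are those of [mu] at [u *: t], and they
    determine a law on the line. Zero variance is compared with the Dirac mass. *)
Lemma is_centered_gaussian_trig (L : seq 'rV[R]_s) (mu : probability (borel 'rV[R]_s) R) :
  (forall c t, ev mu (fun x => cos (c + dot t x)) =
    expR (- ((\sum_(a <- L) dot t a ^+ 2) / 2)) * cos c) ->
  is_centered_gaussian (\sum_(a <- L) a^T *m a) mu.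
Proof.
move=> muE; set S := \sum_(a <- L) _.
have quad t : (t *m S *m t^T) 0 0 = \sum_(a <- L) dot t a ^+ 2.
  rewrite /S mulmx_sumr mulmx_suml summxE; apply: eq_bigr => a _.
  rewrite mulmxA -mulmxA mxE big_ord1 expr2; congr (_ * _).
    by rewrite dotC.
split.
  split; first by rewrite /S raddf_sum; apply: eq_bigr => a _ /=; rewrite trmx_mul trmxK.
  by move=> t; rewrite quad; apply: sumr_ge0 => a _; rewrite sqr_ge0.
move=> t A mA; rewrite quad; set v := \sum_(a <- L) _.
have mdot : measurable_fun [set: borel 'rV[R]_s] (dot t : borel 'rV[R]_s -> measurableTypeR R).
  exact: (continuous_real_measurable (@continuous_dot R s t)).
have [m [mE mev]] := law_exists mu mdot.
transitivity (m A); first by rewrite mE.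
have v0 : 0 <= v by apply: sumr_ge0 => a _; rewrite sqr_ge0.
have mcf c u : ev m (fun x => cos (c + u * x)) = expR (- (u ^+ 2 * v / 2)) * cos c.
  have mc : measurable_fun [set: measurableTypeR R] (fun x : R => cos (c + u * x)).
    apply: continuous_measurable_fun; apply: cont_comp; last exact: continuous_cos.
    by apply: contD; [exact: cst_continuous|apply: contZ; exact: continuous_idR].
  rewrite (mev _ mc _).2; last first.
    apply: (@L1_bounded _ _ _ _ _ 1) => [|x]; last exact: cos_max.
    exact: measurableT_comp mc mdot.
  transitivity (ev mu (fun x => cos (c + dot (u *: t) x))).
    by apply: eq_ev => x; rewrite /= dotZl.
  rewrite muE; congr (expR (- (_ / 2)) * _); rewrite /v mulr_sumr.
  by apply: eq_bigr => a _; rewrite dotZl exprMn.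
rewrite /centered_normal; case: eqP => [ve|/eqP vn].
  pose D : probability (measurableTypeR R) R := \d_(0 : measurableTypeR R).
  rewrite -[RHS]/(D A).
  apply: real_law_unique_trig => // c u; rewrite mcf ve mulr0 mul0r oppr0 expR0 mul1r.
  have mc : measurable_fun [set: measurableTypeR R] (fun x : R => (cos (c + u * x))%:E).
    apply/measurable_EFinP; apply: continuous_measurable_fun; apply: cont_comp; last exact: continuous_cos.
    by apply: contD; [exact: cst_continuous|apply: contZ; exact: continuous_idR].
  rewrite /ev /Rintegral (integral_dirac _ _ mc) // diracT mul1e /= mulr0 addr0.
  by [].
have sv : 0 < Num.sqrt v by rewrite sqrtr_gt0 lt_def vn.
apply: (@real_law_unique_trig R m (normal_prob 0 (Num.sqrt v))) => // c u.
by rewrite mcf (normal_cf sv) sqr_sqrtr // [v * _]mulrC.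
Qed.

End gaussian_vectors.

Lemma mem_pair_seq k (e : 'I_k * 'I_k) : (e \in pair_seq k) = (e.1 < e.2)%N.
Proof.
case: e => a b; apply/allpairsPdep/idP => [[a' [b' [_ + [-> ->]]]]|ab].
  by rewrite mem_filter => /andP[].
exists a, b; split=> //; first by rewrite enumT mem_index_enum.
by rewrite mem_filter ab enumT mem_index_enum.
Qed.

Lemma uniq_pair_seq k : uniq (pair_seq k).
Proof.
apply: allpairs_uniq_dep => [|a _|]; first exact: enum_uniq.
  by rewrite filter_uniq ?enum_uniq.
by move=> [a b] [a' b'] _ _ /= [-> ->].
Qed.

(** * Transfer from the mixture model to the finite product space *)

Section one_hot_labels.
Variables (Q : nat) (q0 : 'I_Q).

Definition label (v : Q.-tuple bool) : 'I_Q := odflt q0 [pick q | tnth v q].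
Definition onehot (q : 'I_Q) : Q.-tuple bool := [tuple q' == q | q' < Q].

Lemma label_onehot q : label (onehot q) = q.
Proof.
rewrite /label; case: pickP => [q'|/(_ q)]; first by rewrite tnth_mktuple => /eqP.
by rewrite tnth_mktuple eqxx.
Qed.

Lemma one_hot_onehot q : one_hot (onehot q).
Proof.
rewrite /one_hot /= (bigD1 q) //= tnth_mktuple eqxx big1 // => q' /negbTE.
by rewrite tnth_mktuple => ->.
Qed.

Lemma onehot_label v : one_hot v -> v = onehot (label v).
Proof.
rewrite /one_hot /= => v1.
have : (#|[pred q | tnth v q]| == 1)%N.
  rewrite -sum1_card -v1; apply/eqP; rewrite big_mkcond /=.
  by apply: eq_bigr => q _; rewrite inE; case: (tnth v q).
move=> /card1P[q vq]; suff -> : v = onehot q by rewrite label_onehot.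
by apply: eq_from_tnth => q'; rewrite tnth_mktuple; have := vq q'; rewrite !inE.
Qed.

Lemma tnth_label v q : one_hot v -> tnth v q = (label v == q).
Proof. by move=> /onehot_label {1}->; rewrite tnth_mktuple eq_sym. Qed.

Lemma measurable_tnth_bool q : measurable [set v : Q.-tuple bool | tnth v q].
Proof.
rewrite -[X in measurable X]setTI (_ : [set v | _] = (@tnth _ _ ^~ q) @^-1` [set true]); last first.
  by apply/seteqP; split => v /=.
exact: measurable_tnth.
Qed.

End one_hot_labels.

Section model_law.
Context d (T : measurableType d) (R : realType) (P : probability T R).
Variables (X : normedModType R) (Q : nat) (q0 : 'I_Q).
Variables (pi : 'I_Q -> R) (Z : nat -> {RV P >-> Q.-tuple bool}).
Variables (x : nat -> nat -> {RV P >-> borel X}).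
Variable K : R.-pker (Q.-tuple bool * Q.-tuple bool)%type ~> borel X.
Hypothesis model : mixture_model pi Z x K.

Definition zlab i w : 'I_Q := label q0 (Z i w).
Definition kap q l : set (borel X) -> \bar R := K (onehot q, onehot l).

Lemma kap_sym q l A : measurable A -> kap q l A = kap l q A.
Proof. by move=> mA; apply: (kernel_sym model) => //; exact: one_hot_onehot. Qed.

Lemma kap_ge0 q l A : (0 <= kap q l A)%E.
Proof. exact: measure_ge0. Qed.

Lemma kap_setT q l : kap q l [set: X] = 1%E.
Proof. exact: prob_kernel. Qed.

Lemma zlab_onehot i w : Z i w = onehot (zlab i w).
Proof. by apply: onehot_label; apply: (latent_one_hot model). Qed.

Lemma tnth_Z i q w : tnth (Z i w) q = (zlab i w == q).
Proof. exact: tnth_label (latent_one_hot model i w). Qed.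

Lemma zlabE i q : [set w | zlab i w = q] = Z i @^-1` [set v : Q.-tuple bool | tnth v q].
Proof.
by apply/seteqP; split => w /=; rewrite tnth_Z => /eqP.
Qed.

Lemma measurable_zlab i q : measurable [set w | zlab i w = q].
Proof. by rewrite zlabE -[X in measurable X]setTI; apply: measurable_funPT => //; exact: measurable_tnth_bool. Qed.

Lemma zlab_law i q : P [set w | zlab i w = q] = (pi q)%:E.
Proof. by rewrite zlabE (latent_law model). Qed.

Section nodes.
Variables (k : nat) (f : 'I_k -> nat).
Hypothesis f_inj : injective f.

Definition labels_event (c : 'I_k -> 'I_Q) : set T := [set w | forall a, zlab (f a) w = c a].

Lemma measurable_labels_event c : measurable (labels_event c).
Proof.
rewrite (_ : labels_event c = \bigcap_(a in [set: 'I_k]) [set w | zlab (f a) w = c a]); last first.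
  by apply/seteqP; split=> w /= H; [move=> a _; exact: H|move=> a; exact: (H a I)].
by apply: fin_bigcap_measurable => // a _; exact: measurable_zlab.
Qed.

Lemma labels_law c : P (labels_event c) = (\prod_a pi (c a))%:E.
Proof.
pose inv i := [pick a | f a == i].
(* Independence takes one event for every natural number; nodes outside the image of [f] get the
   full set. *)
pose A i : set (Q.-tuple bool) := if inv i is Some a then [set v : Q.-tuple bool | tnth v (c a)] else [set: _].
have invf a : inv (f a) = Some a.
  by rewrite /inv; case: pickP => [b /eqP/f_inj ->//|/(_ a)]; rewrite eqxx.
pose J := seq_fset tt (map f (enum 'I_k)).
have mA i : measurable (A i).
  by rewrite /A; case: (inv i) => [a|]; [exact: measurable_tnth_bool|exact: measurableT].
have := latent_indep model J mA.
rewrite (_ : \bigcap_(i in _) _ = labels_event c); last first.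
  apply/seteqP; split => w /= H.
    move=> a; have /= := H (f a); rewrite /A invf /= tnth_Z => h.
    by apply/eqP; apply: h; rewrite seq_fsetE map_f // enumT mem_index_enum.
  move=> i /=; rewrite seq_fsetE => /mapP[a _ ->]; rewrite /A invf /= tnth_Z.
  by apply/eqP; exact: H.
move=> ->; rewrite (perm_big _ (seq_fset_perm _ _)) undup_id; last by rewrite map_inj_uniq ?enum_uniq.
rewrite big_map enumT.
rewrite -prodEFin; apply: eq_bigr => a _.
by rewrite /A invf -zlabE zlab_law.
Qed.

(** The conditional probability in [obs_cond_law] is constant on the event that fixes the labels,
    and this event lies in the sigma-algebra of the labels, so it can be integrated there. *)
Lemma model_law (c : 'I_k -> 'I_Q) (A : 'I_k * 'I_k -> set (borel X)) :
  (forall e, measurable (A e)) ->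
  P ((\bigcap_(e in [set` pair_seq k]) x (f e.1) (f e.2) @^-1` A e) `&` labels_event c) =
  ((\prod_a pi (c a))%:E * \prod_(e <- pair_seq k) kap (c e.1) (c e.2) (A e))%E.
Proof.
move=> mA.
(* The model describes increasing pairs of nodes while [f] need not be increasing; sorting is
   harmless because observations and kernel are symmetric. *)
pose sg (e : 'I_k * 'I_k) : nat * nat := if (f e.1 < f e.2)%N then (f e.1, f e.2) else (f e.2, f e.1).
have sg_inj : {in pair_seq k &, injective sg}.
  move=> [a b] [a' b']; rewrite !mem_pair_seq /= => ab ab'; rewrite /sg /=.
  case: ifP => h1; case: ifP => h2 [] /f_inj e1 /f_inj e2; subst => //;
  by move: (ltn_trans ab ab'); rewrite ltnn.
pose inv e' := [pick e | (e \in pair_seq k) && (sg e == e')].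
pose A' e' : set (borel X) := if inv e' is Some e then A e else [set: X].
have invs e : e \in pair_seq k -> inv (sg e) = Some e.
  move=> ek; rewrite /inv; case: pickP => [e' /andP[e'k /eqP/sg_inj ->//]|/(_ e)].
  by rewrite ek eqxx.
pose J := seq_fset tt (map sg (pair_seq k)).
have mA' e' : measurable (A' e') by rewrite /A'; case: (inv e').
have lt_sg e : e \in pair_seq k -> ((sg e).1 < (sg e).2)%N.
  rewrite mem_pair_seq /sg => e12; case: ifP => //= /negbT; rewrite -leqNgt leq_eqVlt.
  case/predU1P => // /f_inj ee; by move: e12; rewrite ee ltnn.
have Jlt e' : e' \in J -> (e'.1 < e'.2)%N.
  by rewrite seq_fsetE => /mapP[e ek ->]; exact: lt_sg.
have [_] := obs_cond_law model Jlt mA'.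
have xsg e : x (sg e).1 (sg e).2 = x (f e.1) (f e.2).
  by rewrite /sg; case: ifP => //= _; rewrite (obs_undirected model).
have -> : \bigcap_(e in [set` J]) x e.1 e.2 @^-1` A' e =
    \bigcap_(e in [set` pair_seq k]) x (f e.1) (f e.2) @^-1` A e.
  apply/seteqP; split => w /= H.
    move=> e /= ek; have /= := H (sg e); rewrite seq_fsetE map_f // xsg /A' invs //; exact.
  move=> e' /=; rewrite seq_fsetE => /mapP[e ek ->]; rewrite xsg /A' invs //; exact: H.
have sB : <<s \bigcup_i preimage_set_system [set: T] (Z i) measurable >> (labels_event c).
  pose T' := g_sigma_algebraType (\bigcup_i preimage_set_system [set: T] (Z i) measurable).
  change (measurable (labels_event c : set T')).
  rewrite (_ : labels_event c = \bigcap_(a in [set: 'I_k]) [set w | zlab (f a) w = c a]); last first.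
    by apply/seteqP; split=> w /= H; [move=> a _; exact: H|move=> a; exact: (H a I)].
  apply: fin_bigcap_measurable => // a _; apply: sub_sigma_algebra; exists (f a) => //.
  by exists [set v : Q.-tuple bool | tnth v (c a)]; [exact: measurable_tnth_bool|rewrite setTI zlabE].
move=> /(_ _ sB) ->.
rewrite (eq_integral (cst (\prod_(e <- pair_seq k) kap (c e.1) (c e.2) (A e))%E)); last first.
  move=> w; rewrite inE => wc; rewrite /cst /J.
  rewrite (perm_big _ (seq_fset_perm _ _)) undup_id; last by rewrite map_inj_in_uniq ?uniq_pair_seq.
  rewrite big_map; rewrite big_seq_cond [RHS]big_seq_cond; apply: eq_bigr => e /andP[ek _].
  rewrite /A' invs // !zlab_onehot -/(kap _ _ _) /sg; case: ifP => _ /=; rewrite !wc //.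
  exact: kap_sym.
rewrite integral_cst; last exact: measurable_labels_event.
by rewrite [X in (_ * X)%E](labels_law c) muleC.
Qed.

End nodes.
End model_law.

Section finite_valued.
Context d (T : measurableType d) (R : realType) (P : probability T R).

Lemma ev_indic (A : set T) : measurable A -> L1 P (\1_A : T -> R) /\ ev P (\1_A : T -> R) = fine (P A).
Proof.
move=> mA; split.
  apply: (@L1_bounded _ _ _ P _ 1); first exact: measurable_indic.
  by move=> w; rewrite indicE; case: (_ \in _); rewrite ?normr1 ?normr0.
by rewrite /ev /Rintegral integral_indic // setIT.
Qed.

Variables (O : finType) (Y : T -> O).
Hypothesis mY : forall o, measurable [set w | Y w = o].

Lemma finite_valuedE (G : O -> R) w : G (Y w) = \sum_o G o * \1_[set w | Y w = o] w.
Proof.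
rewrite (bigD1 (Y w)) //= indicE mem_set // mulr1 big1 ?addr0 // => o /eqP oY.
by rewrite indicE memNset ?mulr0 // => /= /esym.
Qed.

Lemma L1_finite (G : O -> R) : L1 P (fun w => G (Y w)).
Proof.
rewrite (_ : (fun w => _) = (fun w => \sum_o G o * \1_[set w | Y w = o] w)); last first.
  by apply/funext => w; exact: finite_valuedE.
by apply: L1_sum => o _; apply: L1Z; exact: (ev_indic (mY o)).1.
Qed.

Lemma ev_finite (G : O -> R) :
  ev P (fun w => G (Y w)) = \sum_o fine (P [set w | Y w = o]) * G o.
Proof.
rewrite (eq_ev P (finite_valuedE G)) ev_sum; last first.
  by move=> o _; apply: L1Z; exact: (ev_indic (mY o)).1.
apply: eq_bigr => o _; rewrite evZ; last exact: (ev_indic (mY o)).1.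
by rewrite (ev_indic (mY o)).2 mulrC.
Qed.

End finite_valued.

Section transfer.
Context d (T : measurableType d) (R : realType) (P : probability T R).
Variables (X : normedModType R) (Q : nat) (q0 : 'I_Q).
Variables (pi : 'I_Q -> R) (Z : nat -> {RV P >-> Q.-tuple bool}).
Variables (x : nat -> nat -> {RV P >-> borel X}).
Variable K : R.-pker (Q.-tuple bool * Q.-tuple bool)%type ~> borel X.
Hypothesis model : mixture_model pi Z x K.

Local Notation zlab := (zlab q0 Z).

Let pi0 := proportion_ge0 model.
Let pi1 := proportion_sum model.

Definition node_labels n (w : T) : {ffun 'I_n -> 'I_Q} := [ffun i : 'I_n => zlab i w].

Lemma node_labels_event n c :
  [set w | node_labels n w = c] = labels_event q0 Z (fun i : 'I_n => i : nat) c.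
Proof.
apply/seteqP; split=> w /= h; first by move=> a; rewrite -h ffunE.
by apply/ffunP => a; rewrite ffunE; exact: h.
Qed.

Lemma measurable_node_labels n c : measurable [set w | node_labels n w = c].
Proof. rewrite node_labels_event; exact: (measurable_labels_event q0 model). Qed.

Lemma node_labels_law n c : P [set w | node_labels n w = c] = (\prod_a pi (c a))%:E.
Proof. rewrite node_labels_event; exact: (labels_law q0 model (@val_inj _ _ _)). Qed.

(** The product stays indexed by sets of nodes although only singletons are read, so that the
    results on U-statistics apply with the labels as values. *)
Lemma label_transfer n (G : {ffun 'I_n -> 'I_Q} -> R) :
  ev P (fun w => G (node_labels n w)) =
  Ex pi (fun y : {ffun {set 'I_n} -> 'I_Q} => G [ffun a => y [set a]%SET]).
Proof.
rewrite (ev_finite P (@measurable_node_labels n)).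
pose nl (y : {ffun {set 'I_n} -> 'I_Q}) : {ffun 'I_n -> 'I_Q} := [ffun a => y [set a]%SET].
have E y : G (nl y) = \sum_o G o * (nl y == o)%:R.
  rewrite (bigD1 (nl y)) //= eqxx mulr1 big1 ?addr0 // => o /negbTE.
  by rewrite eq_sym => ->; rewrite mulr0.
rewrite (eq_Ex _ E) Ex_sum; apply: eq_bigr => o _.
rewrite ExZ mulrC; congr (_ * _); rewrite node_labels_law /=.
pose f (S : {set 'I_n}) (v : 'I_Q) : R := \prod_(i | S == [set i]%SET) (v == o i)%:R.
rewrite (eq_Ex _ (G := fun y => \prod_S f S (y S))); last first.
  move=> y; rewrite /f (exchange_big_dep xpredT) //=.
  rewrite (eq_bigr (fun i => (nl y i == o i)%:R)); last first.
    by move=> i _; rewrite (big_pred1 [set i]%SET) // ffunE.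
  have [/eqP ->|] := boolP (nl y == o); first by rewrite big1 // => i _; rewrite eqxx.
  move=> h; have [i] : exists i, nl y i != o i.
    by apply/existsP; apply: contraR h => /existsPn h'; apply/eqP/ffunP => i; apply/eqP; have := h' i; rewrite negbK.
  by move=> /negbTE yi; rewrite (bigD1 i) //= yi mul0r.
rewrite Ex_prod (eq_bigr (fun S : {set 'I_n} => \prod_(i | S == [set i]%SET) pi (o i))); last first.
  move=> S _; rewrite /f.
  have [/existsP[i /eqP Si]|/existsPn noi] := boolP [exists i, S == [set i]%SET].
    have ei i' : (S == [set i']%SET) = (i' == i).
      by rewrite Si; apply/eqP/eqP => [/finset.set1_inj ->|->].
    rewrite (big_pred1 i) //; under eq_bigr => a _ do rewrite (big_pred1 i) //.
    rewrite (bigD1 (o i)) //= eqxx mulr1 big1 ?addr0 // => v /negbTE ->.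
    by rewrite mulr0.
  have noi' i : (S == [set i]%SET) = false by exact/negbTE/noi.
  rewrite (big_pred0 _ _ _ _ noi') -[RHS]pi1; apply: eq_bigr => a _.
  by rewrite (big_pred0 _ _ _ _ noi') mulr1.
rewrite (exchange_big_dep xpredT) //=; apply: eq_bigr => i _.
by rewrite (big_pred1 [set i]%SET).
Qed.

Variables (W : finType) (pt : borel X -> W).
Hypothesis mpt : forall o, measurable [set y | pt y = o].

Definition kpt (u v : 'I_Q) (o : W) : R := fine (kap K u v [set y | pt y = o]).

Lemma kptE u v o : kap K u v [set y | pt y = o] = (kpt u v o)%:E.
Proof.
rewrite /kpt fineK // ge0_fin_numE; last exact: measure_ge0.
apply: (@le_lt_trans _ _ 1%E); last exact: ltry.
rewrite -[leRHS](kap_setT K u v); apply: le_measure; rewrite ?inE //; exact: measurableT.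
Qed.

Lemma kpt_ge0 u v o : 0 <= kpt u v o.
Proof. by apply: fine_ge0; exact: kap_ge0. Qed.

Lemma kpt_sym u v o : kpt u v o = kpt v u o.
Proof. by rewrite /kpt (kap_sym model). Qed.

Lemma kpt_sum u v : \sum_o kpt u v o = 1.
Proof.
apply: EFin_inj; rewrite -sumEFin -[RHS](kap_setT K u v).
have -> : [set: X] = \bigcup_(o in [set: W]) [set y : borel X | pt y = o].
  by apply/seteqP; split => // y _; exists (pt y).
rewrite /kap measure_fin_bigcup //; last first.
  by apply/trivIsetP => o o' _ _ oo'; apply/seteqP; split => // y [/= -> /eqP]; rewrite (negbTE oo').
  exact: finite_finset.
rewrite fsbig_finite /=; last exact: finite_finset.
under eq_bigr do rewrite -kptE.
apply: perm_big; apply: uniq_perm; [exact: index_enum_uniq|exact: fset_uniq|].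
by move=> o; rewrite mem_index_enum in_fset_set ?in_setT //; exact: finite_finset.
Qed.

(** The diagonal carries [pt 0], the default mark given to [marks] in the finite model. *)
Definition edge_marks n (w : T) : {ffun 'I_n * 'I_n -> W} :=
  [ffun e : 'I_n * 'I_n => if e.1 == e.2 then pt 0 else pt (x e.1 e.2 w)].

Lemma mark_table_edge n w : mark_table (pt 0) (edge_marks n w).
Proof.
apply/forallP => -[a b] /=; rewrite !ffunE /= (eq_sym b a) (obs_undirected model) eqxx.
by case: (a == b) => /=.
Qed.

Lemma marked_event n (c : {ffun 'I_n -> 'I_Q}) (m : {ffun 'I_n * 'I_n -> W}) :
  mark_table (pt 0) m -> [set w | (node_labels n w, edge_marks n w) = (c, m)] =
  (\bigcap_(e in [set` pair_seq n]) x (e.1 : 'I_n) (e.2 : 'I_n) @^-1` [set y | pt y = m e]) `&`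
    labels_event q0 Z (fun i : 'I_n => i : nat) c.
Proof.
move=> gm; rewrite -node_labels_event; apply/seteqP; split=> w /=.
  move=> [h1 h2]; split => // e; rewrite /= mem_pair_seq => e12 /=.
  by rewrite -h2 ffunE -val_eqE /= ltn_eqF.
move=> [h ->]; congr (_, _); apply/ffunP => e.
have key (e' : 'I_n * 'I_n) : (e'.1 < e'.2)%N -> edge_marks n w e' = m e'.
  move=> e12; rewrite ffunE -val_eqE /= ltn_eqF //; apply: h.
  by rewrite /= mem_pair_seq.
have [e12|e21|e12] := ltngtP e.1 e.2; first exact: key.
- have /forallP/(_ e)/andP[/eqP <- _] := gm.
  have /forallP/(_ e)/andP[/eqP <- _] := mark_table_edge n w.
  exact: key.
- have /forallP/(_ e)/andP[_ /implyP h1] := gm.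
  have /forallP/(_ e)/andP[_ /implyP h2] := mark_table_edge n w.
  by rewrite (eqP (h1 _)) ?(eqP (h2 _)) // (val_inj e12).
Qed.

Lemma measurable_marked n cm : measurable [set w | (node_labels n w, edge_marks n w) = cm].
Proof.
case: cm => c m; have [gm|gm] := boolP (mark_table (pt 0) m); last first.
  rewrite (_ : [set w | _] = set0) //; apply/seteqP; split=> // w [_ /= mE].
  by move: gm; rewrite -mE mark_table_edge.
rewrite (marked_event c gm); apply: measurableI; last exact: (measurable_labels_event q0 model).
apply: fin_bigcap_measurable => // e _; rewrite -[X in measurable X]setTI.
by apply: measurable_funPT => //; exact: mpt.
Qed.

Lemma marked_law n (c : {ffun 'I_n -> 'I_Q}) (m : {ffun 'I_n * 'I_n -> W}) :
  fine (P [set w | (node_labels n w, edge_marks n w) = (c, m)]) =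
  if mark_table (pt 0) m then
    (\prod_a pi (c a)) * \prod_(e : 'I_n * 'I_n | (e.1 < e.2)%N) kpt (c e.1) (c e.2) (m e)
  else 0.
Proof.
case: ifPn => gm; last first.
  rewrite (_ : [set w | _] = set0) ?measure0 //; apply/seteqP; split=> // w [_ /= mE].
  by move: gm; rewrite -mE mark_table_edge.
rewrite (marked_event c gm) (model_law q0 model (@val_inj _ _ _) c (A := fun e => [set y | pt y = m e])) //.
rewrite (eq_bigr (fun e : 'I_n * 'I_n => (kpt (c e.1) (c e.2) (m e))%:E)); last first.
  by move=> e _; exact: kptE.
rewrite prodEFin -EFinM /=; congr (_ * _).
rewrite -[RHS]big_filter; apply: perm_big; apply: uniq_perm; first exact: uniq_pair_seq.
  by rewrite filter_uniq // index_enum_uniq.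
by move=> e; rewrite mem_pair_seq mem_filter mem_index_enum andbT.
Qed.

(** Two functions are allowed because [cond_mean] and [mean_marks] agree only on labels of positive
    probability, and other labels carry no mass on either side. *)
Lemma marked_transfer n (G1 G2 : {ffun 'I_n -> 'I_Q} -> {ffun 'I_n * 'I_n -> W} -> R) :
  (forall (c : {ffun 'I_n -> 'I_Q}) m, (forall a, pi (c a) != 0) -> G1 c m = G2 c m) ->
  ev P (fun w => G1 (node_labels n w) (edge_marks n w)) =
  Ex (cell_law q0 pi kpt) (fun y : {ffun {set 'I_n} -> cell 'I_Q W} =>
    G2 (labels y) (marks (pt 0) y)).
Proof.
move=> G12.
rewrite (ev_finite P (@measurable_marked n) (fun cm => G1 cm.1 cm.2)).
pose Y (y : {ffun {set 'I_n} -> cell 'I_Q W}) := (labels y, marks (pt 0) y).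
have E y : G2 (labels y) (marks (pt 0) y) =
    \sum_(cm : {ffun 'I_n -> 'I_Q} * {ffun 'I_n * 'I_n -> W}) G2 cm.1 cm.2 *
     ((labels y == cm.1) && (marks (pt 0) y == cm.2))%:R.
  rewrite (bigD1 (Y y)) //= !eqxx mulr1 big1 ?addr0 // => -[c m] cm /=.
  suff -> : (labels y == c) && (marks (pt 0) y == m) = false by rewrite mulr0.
  apply/negbTE/negP => /andP[/eqP e1 /eqP e2]; move: cm; rewrite /Y e1 e2.
  by rewrite eqxx.
rewrite (eq_Ex _ E) Ex_sum; apply: eq_bigr => -[c m] _ /=.
rewrite ExZ (finite_law _ _ pi1 kpt_sum kpt_sym) marked_law [RHS]mulrC.
case: ifP => gm; last by rewrite !mul0r.
have [/existsP[a /eqP ca]|/existsPn h] := boolP [exists a, pi (c a) == 0].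
  by rewrite (bigD1 a) //= ca !mul0r.
by rewrite G12.
Qed.

End transfer.

Section law_transfer.
Context d (T : measurableType d) (R : realType) (P : probability T R).
Context d' (T' : measurableType d') (mu : probability T' R) (Y : T -> T').
Hypothesis mY : measurable_fun [set: T] Y.
Hypothesis muE : forall A, measurable A -> mu A = P (Y @^-1` A).

Lemma law_transfer (f : T' -> R) : L1 mu f -> L1 P (f \o Y) /\ ev P (f \o Y) = ev mu f.
Proof.
move=> Lf; have mf := L1_measurable Lf.
have mE : measurable_fun [set: T'] (EFin \o f) by apply/measurable_EFinP.
pose Y' : {mfun T >-> T'} := MeasurableFun.Pack (MeasurableFun.Class (isMeasurableFun.Build _ _ _ _ _ mY)).
have eq_int (g : T' -> \bar R) : (\int[mu]_x g x = \int[distribution P Y']_x g x)%E.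
  by apply: eq_measure_integral => A mA _; exact: muE.
have L : L1 P (f \o Y).
  apply/integrableP; split; first exact: measurableT_comp mE mY.
  have /integrableP[_] := Lf; rewrite eq_int ge0_integral_pushforward //.
  exact: measurableT_comp.
split => //; rewrite /ev /Rintegral eq_int (integral_pushforward mY mE) //.
Qed.

End law_transfer.

(** * Law of the observations induced by a tuple *)

Section observation_law.
Context d (T : measurableType d) (R : realType) (P : probability T R).
Variables (X : normedModType R) (Q : nat) (q0 : 'I_Q).
Variables (pi : 'I_Q -> R) (Z : nat -> {RV P >-> Q.-tuple bool}).
Variables (x : nat -> nat -> {RV P >-> borel X}).
Variable K : R.-pker (Q.-tuple bool * Q.-tuple bool)%type ~> borel X.
Hypothesis model : mixture_model pi Z x K.
Variable k : nat.

Lemma measurable_induced_obs (f : 'I_k -> nat) :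
  measurable_fun [set: T] (induced_obs x f : T -> 'C(k, 2).-tuple (borel X)).
Proof.
apply/measurable_fun_tnthP => i.
rewrite (_ : _ \o _ = x (f (tnth (pair_tuple k) i).1) (f (tnth (pair_tuple k) i).2)) //.
by apply/funext => w /=; rewrite tnth_map.
Qed.

Definition rect (A : 'I_k * 'I_k -> set (borel X)) : set ('C(k, 2).-tuple (borel X)) :=
  [set y | forall i, A (tnth (pair_tuple k) i) (tnth y i)].

Lemma rect_preimage (f : 'I_k -> nat) A : induced_obs x f @^-1` rect A =
  \bigcap_(e in [set` pair_seq k]) x (f e.1) (f e.2) @^-1` A e.
Proof.
apply/seteqP; split => w /= h => [e /= ek|i].
  have /tnthP[i ei] : e \in pair_tuple k by [].
  by have := h i; rewrite tnth_map -ei.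
by rewrite tnth_map; apply: h => /=; exact: (mem_tnth i (pair_tuple k)).
Qed.

Lemma rect_law (f : 'I_k -> nat) A : injective f -> (forall e, measurable (A e)) ->
  P (induced_obs x f @^-1` rect A) =
  (\sum_(c : {ffun 'I_k -> 'I_Q}) (\prod_a pi (c a))%:E *
     \prod_(e <- pair_seq k) kap K (c e.1) (c e.2) (A e))%E.
Proof.
move=> f_inj mA; rewrite rect_preimage; set E := \bigcap_(e in _) _.
have mE : measurable E.
  apply: fin_bigcap_measurable => // e _; rewrite -[X in measurable X]setTI.
  by apply: measurable_funPT => //; exact: mA.
have -> : E = \bigcup_(c in [set: {ffun 'I_k -> 'I_Q}]) (E `&` labels_event q0 Z f c).
  apply/seteqP; split=> [w Ew|w [c _ []//]].
  by exists [ffun a => zlab q0 Z (f a) w] => //; split => // a; rewrite ffunE.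
rewrite measure_fin_bigcup; last first.
- move=> c _; apply: measurableI => //; exact: (measurable_labels_event q0 model).
- apply/trivIsetP => c c' _ _ cc'; apply/seteqP; split => // w [[_ wc] [_ wc']].
  by case/eqP: cc'; apply/ffunP => a; rewrite -wc -wc'.
- exact: finite_finset.
rewrite fsbig_finite /=; last exact: finite_finset.
transitivity (\sum_(c <- fset_set [set: {ffun 'I_k -> 'I_Q}]) ((\prod_a pi (c a))%:E *
    \prod_(e <- pair_seq k) kap K (c e.1) (c e.2) (A e)))%E.
  by apply: eq_bigr => c _; rewrite /E (model_law q0 model f_inj).
apply: perm_big; apply: uniq_perm; [exact: fset_uniq|exact: index_enum_uniq|].
by move=> o; rewrite mem_index_enum in_fset_set ?in_setT //; exact: finite_finset.
Qed.

(** Rectangles form a pi-system that generates the product sigma-algebra, and their probability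
    computed in [rect_law] does not involve [f]. *)
Lemma obs_law_unique (f : 'I_k -> nat) (mu : probability ('C(k, 2).-tuple (borel X)) R) :
  injective f -> (forall A, measurable A -> mu A = P (induced_obs x (@first_nodes k) @^-1` A)) ->
  forall A, measurable A -> mu A = P (induced_obs x f @^-1` A).
Proof.
move=> f_inj muE A mA; have [nu [nuE _]] := law_exists P (measurable_induced_obs f).
rewrite -nuE.
pose G : set (set ('C(k, 2).-tuple (borel X))) :=
  [set B | exists2 A, (forall e, measurable (A e)) & B = rect A].
have mrect A0 : (forall e, measurable (A0 e)) -> measurable (rect A0).
  move=> mA0; rewrite (_ : rect A0 = \bigcap_(i in [set: 'I_('C(k, 2))])
      (@tnth _ _ ^~ i) @^-1` A0 (tnth (pair_tuple k) i)); last first.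
    by apply/seteqP; split => y /= h; [move=> i _; exact: h|move=> i; exact: (h i I)].
  apply: fin_bigcap_measurable => // i _; rewrite -[X in measurable X]setTI.
  exact: measurable_tnth.
apply: (@measure_unique _ R _ G (fun=> [set: 'C(k, 2).-tuple (borel X)]) _ _ _ _ mu nu) => //.
- apply/seteqP; split; last first.
    by apply: smallest_sub; [exact: sigma_algebra_measurable|move=> B [A0 mA0 ->]; exact: mrect].
  apply: smallest_sub; first exact: smallest_sigma_algebra.
  move=> B; rewrite -bigcup_seq /= => -[i _] [C mC <-]; rewrite setTI; apply: sub_sigma_algebra.
  exists (fun e => if e == tnth (pair_tuple k) i then C else [set: X]).
    by move=> e; case: ifP.
  apply/seteqP; split => y /= h; last by have := h i; rewrite eqxx.
  move=> j; case: ifP => // /eqP ji; suff -> : j = i by [].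
  by apply: tuple_uniqP ji; exact: uniq_pair_seq.
- move=> _ _ [A1 mA1 ->] [A2 mA2 ->]; exists (fun e => A1 e `&` A2 e).
    by move=> e; apply: measurableI.
  by apply/seteqP; split => y /= => [[h1 h2] i|h]; [split; [exact: h1|exact: h2]|
    split=> i; have [] := h i].
- by move=> _; exists (fun=> [set: X]) => //; apply/seteqP; split.
- by rewrite bigcup_const.
- move=> _ [A0 mA0 ->]; rewrite [RHS]nuE [LHS]muE; last exact: mrect.
  by rewrite !rect_law //; exact: val_inj.
- by move=> n; rewrite (le_lt_trans (probability_le1 mu _)) ?ltry.
Qed.

End observation_law.

(** * Density of finitary functions *)

Section square_integrable.
Context d (T : measurableType d) (R : realType) (P : probability T R).
Implicit Types u v w : T -> R.

Definition L2 u := measurable_fun [set: T] u /\ L1 P (fun y => u y ^+ 2).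

Definition sqdist u v : R := ev P (fun y => (u y - v y) ^+ 2).

Lemma sqr_add_le (a b : R) : (a + b) ^+ 2 <= 2 * a ^+ 2 + 2 * b ^+ 2.
Proof. by rewrite -subr_ge0; have := sqr_ge0 (a - b); congr (0 <= _); ring. Qed.

Lemma L2_bounded u M : measurable_fun [set: T] u -> (forall y, `|u y| <= M) -> L2 u.
Proof.
move=> mu uM; split=> //; apply: (@L1_bounded _ _ _ P _ (M ^+ 2)).
  exact: measurable_funX.
move=> y; rewrite normrX; apply: lerXn2r; rewrite ?nnegrE //.
exact: le_trans (uM y).
Qed.

Lemma L2_cst c : L2 (fun=> c).
Proof. by apply: (@L2_bounded _ `|c|) => //; exact: measurable_cst. Qed.

Lemma L2D u v : L2 u -> L2 v -> L2 (fun y => u y + v y).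
Proof.
move=> [mu Lu] [mv Lv]; have m := measurable_funD mu mv; split=> //.
apply: le_L1 (L1D (L1Z 2 Lu) (L1Z 2 Lv)) => [|y]; first exact: measurable_funX.
by rewrite ger0_norm ?sqr_ge0 // sqr_add_le.
Qed.

Lemma L2Z a u : L2 u -> L2 (fun y => a * u y).
Proof.
move=> [mu Lu]; split; first by apply: measurable_funM => //; exact: measurable_cst.
by have := L1Z (a ^+ 2) Lu; congr (L1 P _); apply/funext => y; rewrite exprMn.
Qed.

Lemma L2B u v : L2 u -> L2 v -> L2 (fun y => u y - v y).
Proof.
move=> Lu Lv; have := L2D Lu (L2Z (- 1) Lv); congr L2; apply/funext => y.
by rewrite mulN1r.
Qed.

Lemma L2_sum (I : Type) (s : seq I) (F : I -> T -> R) :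
  (forall i, L2 (F i)) -> L2 (fun y => \sum_(i <- s) F i y).
Proof.
move=> LF; elim: s => [|i s IH].
  by rewrite (_ : (fun y => _) = (fun=> 0)); [exact: L2_cst|apply/funext => y; rewrite big_nil].
by have := L2D (LF i) IH; congr L2; apply/funext => y; rewrite big_cons.
Qed.

Lemma L2_mul u v : L2 u -> L2 v -> L1 P (fun y => u y * v y).
Proof.
move=> [mu Lu] [mv Lv]; apply: le_L1 (L1D Lu Lv) => [|y]; first exact: measurable_funM.
have h : 0 <= (`|u y| - `|v y|) ^+ 2 by rewrite sqr_ge0.
rewrite normrM -(real_normK (num_real (u y))) -(real_normK (num_real (v y))).
apply: le_trans (_ : 2 * (`|u y| * `|v y|) <= _).
  by rewrite ler_peMl ?mulr_ge0 // ler1n.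
by rewrite -subr_ge0; move: h; congr (0 <= _); ring.
Qed.

Lemma L2_L1 u : L2 u -> L1 P u.
Proof.
move=> Lu; have := L2_mul Lu (L2_cst 1); congr L1; apply/funext => y.
by rewrite mulr1.
Qed.

Lemma sqdist_ge0 u v : 0 <= sqdist u v.
Proof. by apply: ev_ge0 => y; rewrite sqr_ge0. Qed.

Lemma sqdist_eq0 u v : u =1 v -> sqdist u v = 0.
Proof.
move=> uv; rewrite -[RHS](ev_cst P); apply: eq_ev => y.
by rewrite uv subrr expr0n.
Qed.

Lemma sqdist_triangle u v w : L2 u -> L2 v -> L2 w ->
  sqdist u w <= 2 * sqdist u v + 2 * sqdist v w.
Proof.
move=> Lu Lv Lw; have [_ L1uv] := L2B Lu Lv; have [_ L1vw] := L2B Lv Lw.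
rewrite /sqdist -!evZ // -evD; [|exact: L1Z..].
apply: le_ev; [exact: (L2B Lu Lw).2|by apply: L1D; exact: L1Z|].
by move=> y; rewrite (_ : u y - w y = (u y - v y) + (v y - w y)) ?sqr_add_le //; ring.
Qed.

Lemma ev_sqr_le u : L2 u -> ev P u ^+ 2 <= ev P (fun y => u y ^+ 2).
Proof.
move=> Lu; have [mu L1u2] := Lu; have L1u := L2_L1 Lu.
have : 0 <= ev P (fun y => u y ^+ 2 - 2 * ev P u * u y + ev P u ^+ 2).
  apply: ev_ge0 => y; rewrite (_ : _ + _ = (u y - ev P u) ^+ 2) ?sqr_ge0 //; ring.
rewrite evD; [|by apply: L1B => //; exact: L1Z|exact: L1_cst].
rewrite evB ?evZ ?ev_cst //; last exact: L1Z.
by move=> h; rewrite -subr_ge0; move: h; congr (0 <= _); ring.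
exact: L1_cst.
Qed.

End square_integrable.

Import HBNNSimple.

Section finitary_functions.
Context d (E : measurableType d) (n : nat).

(* [u] only depends on which of finitely many measurable sets each coordinate belongs to. *)
Definition finitary (C : Type) (u : n.-tuple E -> C) : Prop :=
  exists (W : finType) (p : E -> W), (forall o, measurable [set y | p y = o]) /\
    exists h : n.-tuple W -> C, forall y, u y = h (map_tuple p y).

Lemma finitary_cst C (c : C) : finitary (fun=> c).
Proof.
exists unit, (fun=> tt); split; last by exists (fun=> c).
by case; rewrite (_ : [set y | _] = setT) //; apply/seteqP.
Qed.

(** Two finite partitions have a common finite refinement, given by the pair of their class maps. *)
Lemma finitary_comp A B C (F : A -> B -> C) u v : finitary u -> finitary v ->
  finitary (fun y => F (u y) (v y)).
Proof.
move=> [W [p [mp [h hE]]]] [W' [p' [mp' [h' h'E]]]].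
exists (W * W')%type, (fun y => (p y, p' y)); split.
  move=> [a1 a2]; rewrite (_ : [set y | _] = [set y | p y = a1] `&` [set y | p' y = a2]).
    exact: measurableI.
  by apply/seteqP; split => y /= => [[-> ->]//|[-> ->]].
exists (fun t => F (h (map_tuple fst t)) (h' (map_tuple snd t))) => y.
rewrite hE h'E; congr F; congr (_ _); apply: eq_from_tnth => i; by rewrite !tnth_map.
Qed.

Lemma finitary_comp1 A C (F : A -> C) u : finitary u -> finitary (fun y => F (u y)).
Proof. by move=> fu; exact: (finitary_comp (fun a _ => F a) fu fu). Qed.

Lemma finitary_coord (A : set E) i : measurable A -> finitary (fun y => `[< A (tnth y i) >]).
Proof.
move=> mA; exists bool, (fun y => `[< A y >]); split.
  move=> [].
    rewrite (_ : [set y | _] = A) //; apply/seteqP; split => y /=; first by move/asboolP.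
    by move=> Ay; apply/asboolP.
  rewrite (_ : [set y | _] = ~` A); first exact: measurableC.
  by apply/seteqP; split => y /=; [move/asboolPn|move=> Ay; apply/asboolPn].
by exists (fun t => tnth t i) => y; rewrite tnth_map.
Qed.

Lemma finitary_seq (I : Type) C (s : seq I) (u : I -> n.-tuple E -> C) :
  (forall i, finitary (u i)) -> finitary (fun y => [seq u i y | i <- s]).
Proof.
move=> fu; elim: s => [|i s IH]; first exact: finitary_cst.
exact: (finitary_comp cons (fu i) IH).
Qed.

Variable R : realType.

Lemma finitary_measurable_pre C (u : n.-tuple E -> C) (A : set C) : finitary u ->
  measurable (u @^-1` A).
Proof.
move=> [W [p [mp [h hE]]]].
rewrite (_ : u @^-1` A = \bigcup_(t in [set t | A (h t)]) [set y | map_tuple p y = t]); last first.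
  apply/seteqP; split => y /=; first by rewrite hE => Ay; exists (map_tuple p y).
  by move=> [t At /= yt]; rewrite hE yt.
apply: fin_bigcup_measurable => [|t _]; first exact: finite_finset.
rewrite (_ : [set y | _] = \bigcap_(i in [set: 'I_n]) (@tnth _ _ ^~ i) @^-1` [set y | p y = tnth t i]); last first.
  apply/seteqP; split => y /=; first by move=> <- i _ /=; rewrite tnth_map.
  by move=> h'; apply: eq_from_tnth => i; rewrite tnth_map; exact: (h' i I).
apply: fin_bigcap_measurable => // i _; rewrite -[X in measurable X]setTI.
exact: measurable_tnth.
Qed.

Lemma finitary_measurable (u : n.-tuple E -> R) : finitary u -> measurable_fun [set: n.-tuple E] u.
Proof. by move=> fu _ A mA; rewrite setTI; exact: finitary_measurable_pre. Qed.

Lemma finitary_bounded (u : n.-tuple E -> R) : finitary u -> exists M, forall y, `|u y| <= M.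
Proof.
move=> [W [p [mp [h hE]]]]; exists (\sum_t `|h t|) => y.
rewrite hE (bigD1 (map_tuple p y)) //= lerDl; exact: sumr_ge0.
Qed.

Variable mu : probability (n.-tuple E) R.

Lemma finitary_L2 (u : n.-tuple E -> R) : finitary u -> L2 mu u.
Proof.
move=> fu; have [M uM] := finitary_bounded fu.
by apply: L2_bounded uM; exact: finitary_measurable.
Qed.

Definition approximable (u : n.-tuple E -> R) : Prop :=
  L2 mu u /\ forall e, 0 < e -> exists2 v, finitary v & sqdist mu u v <= e.

Lemma approximable_lim u : L2 mu u ->
  (forall e, 0 < e -> exists2 v, approximable v & sqdist mu u v <= e) -> approximable u.
Proof.
move=> Lu h; split=> // e e0; have e40 : 0 < e / 4 by rewrite divr_gt0.
have [v [Lv av] uv] := h _ e40; have [w fw vw] := av _ e40.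
exists w => //; apply: le_trans (sqdist_triangle Lu Lv (finitary_L2 fw)) _.
apply: le_trans (_ : 2 * (e / 4) + 2 * (e / 4) <= _); first by rewrite lerD // ler_wpM2l.
by rewrite le_eqVlt; apply/orP; left; apply/eqP; field.
Qed.

Lemma approximableD u v : approximable u -> approximable v -> approximable (fun y => u y + v y).
Proof.
move=> [Lu au] [Lv av]; split; first exact: L2D.
move=> e e0; have e40 : 0 < e / 4 by rewrite divr_gt0.
have [u' fu' uu'] := au _ e40; have [v' fv' vv'] := av _ e40.
have Lu' := finitary_L2 fu'; have Lv' := finitary_L2 fv'.
exists (fun y => u' y + v' y); first exact: (finitary_comp +%R fu' fv').
have := sqdist_triangle (L2D Lu Lv) (L2D Lu' Lv) (L2D Lu' Lv') => /le_trans; apply.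
have -> : sqdist mu (fun y => u y + v y) (fun y => u' y + v y) = sqdist mu u u'.
  by apply: eq_ev => y; congr (_ ^+ 2); ring.
have -> : sqdist mu (fun y => u' y + v y) (fun y => u' y + v' y) = sqdist mu v v'.
  by apply: eq_ev => y; congr (_ ^+ 2); ring.
apply: le_trans (_ : 2 * (e / 4) + 2 * (e / 4) <= _); first by rewrite lerD // ler_wpM2l.
by rewrite le_eqVlt; apply/orP; left; apply/eqP; field.
Qed.

Lemma finitary_approximable u : finitary u -> approximable u.
Proof.
move=> fu; split; first exact: finitary_L2.
move=> e e0; exists u => //; by rewrite sqdist_eq0 ?ltW // => y.
Qed.

Lemma approximableZ a u : approximable u -> approximable (fun y => a * u y).
Proof.
move=> [Lu au]; split; first exact: L2Z.
move=> e e0; have c0 : 0 < 1 + a ^+ 2 by rewrite ltr_pwDl // sqr_ge0.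
have [v fv uv] := au _ (divr_gt0 e0 c0).
exists (fun y => a * v y); first exact: (finitary_comp1 _ fv).
have -> : sqdist mu (fun y => a * u y) (fun y => a * v y) = a ^+ 2 * sqdist mu u v.
  rewrite /sqdist -evZ; last by have [] := L2B Lu (finitary_L2 fv).
  by apply: eq_ev => y; rewrite -exprMn; congr (_ ^+ 2); ring.
apply: le_trans (_ : (1 + a ^+ 2) * sqdist mu u v <= _).
  by rewrite ler_wpM2r ?sqdist_ge0 // lerDr.
by rewrite mulrC -ler_pdivlMr.
Qed.

Lemma approximable_sum (I : Type) (s : seq I) (F : I -> n.-tuple E -> R) :
  (forall i, approximable (F i)) -> approximable (fun y => \sum_(i <- s) F i y).
Proof.
move=> aF; elim: s => [|i s IH].
  rewrite (_ : (fun y => _) = (fun=> 0)); first exact/finitary_approximable/finitary_cst.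
  by apply/funext => y; rewrite big_nil.
by have := approximableD (aF i) IH; congr approximable; apply/funext => y; rewrite big_cons.
Qed.

Let ind (A : set (n.-tuple E)) : n.-tuple E -> R := \1_A.

Let ind_asbool A y : ind A y = (`[< A y >] : nat)%:R.
Proof. by rewrite /ind indicE; congr (_ : nat)%:R; apply/idP/asboolP; rewrite inE. Qed.

Let ind01 A y : 0 <= ind A y <= 1.
Proof. by rewrite ind_asbool; case: (`[< _ >]); rewrite ler01 lexx. Qed.

Let ind_L2 A : measurable A -> L2 mu (ind A).
Proof.
move=> mA; apply: (@L2_bounded _ _ _ _ _ 1); first exact: measurable_indic.
by move=> y; have /andP[a b] := ind01 A y; rewrite ger0_norm.
Qed.

(** Requiring Boolean approximants makes complements and unions immediate. Countable unions follow
    by domination, so these sets form a sigma-algebra, which contains the cylinders. *)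
Let near_ind (A : set (n.-tuple E)) : Prop := measurable A /\
  forall e, 0 < e -> exists2 b : n.-tuple E -> bool, finitary b &
    sqdist mu (ind A) (fun y => (b y)%:R) <= e.

Let bool_L2 (b : n.-tuple E -> bool) : finitary b -> L2 mu (fun y => (b y)%:R : R).
Proof. by move=> fb; apply: finitary_L2; exact: (finitary_comp1 (fun b : bool => b%:R) fb). Qed.

Let near_indC A : near_ind A -> near_ind (~` A).
Proof.
move=> [mA aA]; split; first exact: measurableC.
move=> e e0; have [b fb Ab] := aA e e0; exists (fun y => ~~ b y); first exact: (finitary_comp1 negb fb).
apply: le_trans Ab; rewrite le_eqVlt; apply/orP; left; apply/eqP; apply: eq_ev => y.
rewrite !ind_asbool asbool_neg; case: (b y); case: (`[< _ >]); rewrite /=; ring.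
Qed.

Let near_indU A B : near_ind A -> near_ind B -> near_ind (A `|` B).
Proof.
move=> [mA aA] [mB aB]; split; first exact: measurableU.
move=> e e0; have e20 : 0 < e / 2 by rewrite divr_gt0.
have [b fb Ab] := aA _ e20; have [c fc Bc] := aB _ e20.
exists (fun y => b y || c y); first exact: (finitary_comp orb fb fc).
apply: le_trans (_ : sqdist mu (ind A) (fun y => (b y)%:R) + sqdist mu (ind B) (fun y => (c y)%:R) <= _); last first.
  by rewrite [leRHS]splitr lerD.
have [_ L1b] := L2B (ind_L2 mA) (bool_L2 fb); have [_ L1c] := L2B (ind_L2 mB) (bool_L2 fc).
rewrite /sqdist -evD //; apply: le_ev.
- by have [] := L2B (ind_L2 (measurableU _ _ mA mB)) (bool_L2 (finitary_comp orb fb fc)).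
- exact: L1D.
- move=> y; rewrite !ind_asbool asbool_or.
  by case: (`[< A y >]); case: (`[< B y >]); case: (b y); case: (c y); rewrite /=; lra.
Qed.

Let near_ind_bigcup (F : (set (n.-tuple E))^nat) : (forall i, near_ind (F i)) -> near_ind (\bigcup_i F i).
Proof.
move=> aF; have mU : measurable (\bigcup_i F i) by apply: bigcup_measurable => i _; case: (aF i).
split=> // e e0; have e40 : 0 < e / 4 by rewrite divr_gt0.
pose G m := \big[setU/set0]_(i < m) F i.
have aG m : near_ind (G m).
  rewrite /G; elim: m => [|m IH]; last by rewrite big_ord_recr; exact: near_indU.
  rewrite big_ord0; split=> // e' e'0; exists (fun=> false); first exact: finitary_cst.
  rewrite sqdist_eq0 ?ltW // => y.
  by rewrite ind_asbool asboolF.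
have lim : ev mu (fun y => (ind (\bigcup_i F i) y - ind (G m) y) ^+ 2) @[m --> \oo] --> ev mu (fun=> 0).
  apply: (@cvg_ev _ _ _ mu _ _ (fun=> 1)).
  - by move=> m; have [] := L2B (ind_L2 mU) (ind_L2 (aG m).1) => _ /L1_measurable.
  - exact: measurable_cst.
  - exact: L1_cst.
  - move=> y; apply: cvg_near_cst.
    have [[i _ Fi]|nF] := pselect ((\bigcup_i F i) y).
      exists i.+1 => // m /= im; rewrite !ind_asbool !asboolT ?subrr ?expr0n //.
        by rewrite /G -bigcup_mkord; exists i.
      by exists i.
    apply: nearW => m; rewrite !ind_asbool !asboolF ?subrr ?expr0n //.
    by rewrite /G -bigcup_mkord => -[i _ Fi]; apply: nF; exists i.
  - move=> m y; rewrite !ind_asbool; case: (`[< _ >]); case: (`[< _ >]); rewrite ger0_norm ?sqr_ge0 //=; lra.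
move: lim; rewrite ev_cst => /cvgrPdist_le/(_ _ e40)[m _ /(_ m (leqnn m))].
rewrite sub0r normrN ger0_norm; last exact: sqdist_ge0.
move=> Um; have [b fb Gb] := (aG m).2 _ e40; exists b => //.
have := sqdist_triangle (ind_L2 mU) (ind_L2 (aG m).1) (bool_L2 fb) => /le_trans; apply.
apply: le_trans (_ : 2 * (e / 4) + 2 * (e / 4) <= _); first by rewrite lerD // ler_wpM2l.
by rewrite le_eqVlt; apply/orP; left; apply/eqP; field.
Qed.

Lemma approximable_indic A : measurable A -> approximable (\1_A : _ -> R).
Proof.
move=> mA; split; first exact: ind_L2.
suff [_ H] : near_ind A.
  move=> e e0; have [b fb Ab] := H e e0; exists (fun y => (b y)%:R) => //.
  exact: (finitary_comp1 (fun b : bool => b%:R) fb).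
suff : measurable `<=` near_ind by apply.
apply: smallest_sub.
  split.
  - split => // e e0; exists (fun=> false); first exact: finitary_cst.
    rewrite sqdist_eq0 ?ltW // => y.
    by rewrite ind_asbool asboolF.
  - by move=> B aB; rewrite setTD; exact: near_indC.
  - exact: near_ind_bigcup.
move=> B; rewrite -bigcup_seq /= => -[i _] [C mC <-]; rewrite setTI; split.
  by rewrite -[X in measurable X]setTI; exact: measurable_tnth.
move=> e e0; exists (fun y => `[< C (tnth y i) >]); first exact: finitary_coord.
rewrite sqdist_eq0 ?ltW // => y.
Qed.

(** A nonnegative function is the limit of an increasing sequence of simple functions, with squared
    errors dominated by its square; the general case splits the sign. *)
Theorem L2_approximable u : L2 mu u -> approximable u.
Proof.
have pos w : L2 mu w -> (forall y, 0 <= w y) -> approximable w.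
  move=> Lw w0; have [mw L1w] := Lw.
  have mE : measurable_fun [set: n.-tuple E] (EFin \o w) by apply/measurable_EFinP.
  pose f m : n.-tuple E -> R := nnsfun_approx measurableT mE m.
  have af m : approximable (f m).
    rewrite (_ : f m = (fun y => \sum_(r <- fset_set (range (f m))) r * \1_(f m @^-1` [set r]) y)); last first.
      by apply/funext => y; rewrite /f fimfunE fsbig_finite.
    apply: approximable_sum => r; apply: approximableZ; apply: approximable_indic.
    by rewrite -[X in measurable X]setTI; apply: measurable_funPT.
  have fcvg y : f m y @[m --> \oo] --> w y.
    have := @cvg_nnsfun_approx _ _ _ _ measurableT _ mE (fun x _ => w0 x) y I.
    by move/fine_cvgP => [_].
  have fle m y : 0 <= f m y <= w y.
    apply/andP; split; first exact: fun_ge0.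
    rewrite -(cvg_lim _ (fcvg y)) //; apply: (@nondecreasing_cvgn_le _ (fun m => f m y)).
      by move=> a b ab; have /lefP := nd_nnsfun_approx measurableT mE ab; exact.
    by apply/cvg_ex; exists (w y); exact: fcvg.
  apply: approximable_lim => // e e0.
  have : ev mu (fun y => (w y - f m y) ^+ 2) @[m --> \oo] --> ev mu (fun=> 0).
    apply: (@cvg_ev _ _ _ mu _ _ (fun y => w y ^+ 2)) => //.
    - by move=> m; have [] := L2B Lw (af m).1 => _ /L1_measurable.
    - move=> y; rewrite -[X in _ --> X](expr0n R 2) -[X in X ^+ 2](subrr (w y)).
      apply: (@cvg_comp _ _ _ _ (fun z : R => z ^+ 2)); last exact: exprn_continuous.
      by apply: cvgB; [exact: cvg_cst|exact: fcvg].
    - move=> m y; have /andP[a b] := fle m y; rewrite ger0_norm ?sqr_ge0 //.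
      by apply: lerXn2r; rewrite ?nnegrE ?subr_ge0 // lerBlDr lerDl.
  rewrite ev_cst => /cvgrPdist_le/(_ _ e0)[m _ /(_ m (leqnn m))].
  rewrite sub0r normrN ger0_norm; last exact: sqdist_ge0.
  by exists (f m).
move=> Lu; have [mu' L1u] := Lu.
have maxL2 (v : n.-tuple E -> R) : L2 mu v -> L2 mu (fun y => Num.max (v y) 0).
  move=> [mv Lv]; have m : measurable_fun [set: n.-tuple E] (fun y => Num.max (v y) 0).
    by apply: measurable_maxr => //; exact: measurable_cst.
  split=> //; apply: le_L1 Lv => [|y]; first exact: measurable_funX.
  rewrite ger0_norm ?sqr_ge0 // -[leRHS]real_normK ?num_real //.
  apply: lerXn2r; rewrite ?nnegrE // ?le_max ?lexx ?orbT //.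
  by rewrite ge_max ler_norm normr_ge0.
have Lp := maxL2 _ Lu; have Ln := maxL2 _ (L2Z (- 1) Lu).
have ap := pos _ Lp (fun y => ltac:(by rewrite le_max lexx orbT)).
have an := pos _ Ln (fun y => ltac:(by rewrite le_max lexx orbT)).
have := approximableD ap (approximableZ (- 1) an); congr approximable; apply/funext => y.
by rewrite !mulN1r; have [h|h] := leP 0 (u y); [rewrite (max_idPr _) ?oppr_le0 // oppr0 addr0|
    rewrite (max_idPl _) ?oppr_ge0 ?(ltW h) // add0r opprK].
Qed.

End finitary_functions.

(** * Exchange of limits and limits of quadratic forms *)

Section limits.
Variable R : realType.

(** The error [del m] is uniform in [n]: hence [a] is Cauchy, and its limit lies within [del m] of
    [L m]. *)
Lemma double_limit (a : nat -> R) (b : nat -> nat -> R) (L del : nat -> R) :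
  (forall m, b m n @[n --> \oo] --> L m) -> (forall m n, `|a n - b m n| <= del m) ->
  del m @[m --> \oo] --> 0 ->
  exists l : R, L m @[m --> \oo] --> l /\ a n @[n --> \oo] --> l.
Proof.
move=> bL ab del0.
have ca : cvg (a n @[n --> \oo]).
  apply: cauchy_cvg; apply: cauchy_exP => e e0.
  have e20 : 0 < e / 2 by rewrite divr_gt0.
  have /cvgrPdist_lt/(_ _ e20)[m _ /(_ m (leqnn m))] := del0.
  rewrite sub0r normrN => dm; exists (L m).
  have /cvgrPdist_lt/(_ _ e20) := bL m; apply: filterS => n Lb.
  rewrite -ball_normE /= (_ : L m - a n = (L m - b m n) - (a n - b m n)); last by ring.
  apply: le_lt_trans (ler_normB _ _) _; rewrite [ltRHS]splitr ltr_leD //.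
  by apply: le_trans (ab m n) _; apply: le_trans (ler_norm _) (ltW dm).
exists (limn a); split; last exact: ca.
have near m : `|limn a - L m| <= del m.
  have lim : `|a n - b m n| @[n --> \oo] --> `|limn a - L m|.
    by apply: cvg_norm; apply: cvgB; [exact: ca|exact: bL].
  by apply: (cvgr_to_le lim); apply: nearW.
apply/cvgrPdist_le => e e0; have /cvgrPdist_le/(_ _ e0) := del0.
apply: filterS => m; rewrite sub0r normrN distrC => dm.
by rewrite distrC; apply: le_trans (near m) _; apply: le_trans (ler_norm _) dm.
Qed.

Lemma cvg_sum_fin (I : Type) (r : seq I) (F : nat -> I -> R) (l : I -> R) :
  (forall i, F n i @[n --> \oo] --> l i) -> \sum_(i <- r) F n i @[n --> \oo] --> \sum_(i <- r) l i.
Proof.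
move=> Fl; elim: r => [|i r IH].
  by rewrite big_nil; under eq_fun do rewrite big_nil; exact: cvg_cst.
by rewrite big_cons; under eq_fun do rewrite big_cons; apply: cvgD.
Qed.

Definition quad s (G : 'M[R]_s) (r : 'rV[R]_s) : R := (r *m G *m r^T) 0 0.

Lemma quadE s (G : 'M[R]_s) (r : 'rV[R]_s) :
  quad G r = \sum_i \sum_j r 0 i * r 0 j * G i j.
Proof.
rewrite /quad mxE exchange_big /=; apply: eq_bigr => j _.
rewrite !mxE mulr_suml; apply: eq_bigr => i _; ring.
Qed.

Lemma quadZ s (G : 'M[R]_s) a (r : 'rV[R]_s) : quad G (a *: r) = a ^+ 2 * quad G r.
Proof.
rewrite !quadE mulr_sumr; apply: eq_bigr => i _; rewrite mulr_sumr; apply: eq_bigr => j _.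
rewrite !mxE; ring.
Qed.

Lemma quad_polar s (G : 'M[R]_s) i j : G^T = G ->
  G i j = 2^-1 * (quad G (delta_mx 0 i + delta_mx 0 j) - quad G (delta_mx 0 i) - quad G (delta_mx 0 j)).
Proof.
move=> Gs.
have E a b : ((delta_mx 0 a : 'rV[R]_s) *m G *m (delta_mx 0 b : 'rV[R]_s)^T) 0 0 = G a b.
  by rewrite trmx_delta -rowE -colE !mxE.
have D (A B : 'M[R]_1) : (A + B) 0 0 = A 0 0 + B 0 0 by rewrite mxE.
rewrite /quad linearD /= mulmxDr !mulmxDl !D !E.
have -> : G j i = G i j by rewrite -{1}Gs mxE.
by field.
Qed.

(* A sequence of quadratic forms whose Gaussian characteristic functions converge to limits that
   are positive near the origin converges. *)
Lemma psd_limit s (G : nat -> 'M[R]_s) (l : 'rV[R]_s -> R) :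
  (forall m, (G m)^T = G m) -> (forall m r, 0 <= quad (G m) r) ->
  (forall r, expR (- (2^-1 * quad (G m) r)) @[m --> \oo] --> l r) ->
  (forall r, exists2 eta, 0 < eta & 0 < l (eta *: r)) ->
  exists H : 'M[R]_s, [/\ H^T = H, forall r, 0 <= quad H r &
    forall r, quad (G m) r @[m --> \oo] --> quad H r].
Proof.
move=> Gs G0 Gl lpos.
have Qcvg r : exists q : R, quad (G m) r @[m --> \oo] --> q.
  (* The logarithm is taken at [eta *: r], where the limit is positive; homogeneity of degree 2
     brings it back to [r]. *)
  have [eta eta0 lr] := lpos r; exists (- (2 / eta ^+ 2) * ln (l (eta *: r))).
  rewrite (_ : (fun m => _) = (fun m => - (2 / eta ^+ 2) * ln (expR (- (2^-1 * quad (G m) (eta *: r)))))); last first.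
    by apply/funext => m; rewrite expRK quadZ; field; rewrite gt_eqF.
  by apply: cvgMr; apply: continuous_cvg; [exact: continuous_ln|exact: Gl].
have /choice[q qP] := Qcvg.
pose H : 'M[R]_s := \matrix_(i, j) (2^-1 * (q (delta_mx 0 i + delta_mx 0 j) - q (delta_mx 0 i) - q (delta_mx 0 j))).
have GH i j : G m i j @[m --> \oo] --> H i j.
  under eq_fun do rewrite (quad_polar _ _ (Gs _)).
  by rewrite mxE; apply: cvgMr; apply: cvgB; [apply: cvgB|]; exact: qP.
have QH r : quad (G m) r @[m --> \oo] --> quad H r.
  rewrite quadE; under eq_fun do rewrite quadE.
  by apply: cvg_sum_fin => i; apply: cvg_sum_fin => j; apply: cvgMr; exact: GH.
exists H; split => //.
- apply/matrixP => i j; rewrite mxE; have := GH j i.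
  rewrite (_ : (fun m => _) = (fun m => G m i j)); last first.
    by apply/funext => m; rewrite -{1}(Gs m) mxE.
  by move=> h; apply: (cvg_unique _ h (GH i j)).
- by move=> r; apply: (cvgr_to_ge (QH r)); apply: nearW => m; exact: G0.
Qed.

End limits.

(** * Fluctuations given the labels *)

Section residual.
Context d (T : measurableType d) (R : realType) (P : probability T R).
Variables (X : normedModType R) (Q : nat) (q0 : 'I_Q).
Variables (pi : 'I_Q -> R) (Z : nat -> {RV P >-> Q.-tuple bool}).
Variables (x : nat -> nat -> {RV P >-> borel X}).
Variable K : R.-pker (Q.-tuple bool * Q.-tuple bool)%type ~> borel X.
Hypothesis model : mixture_model pi Z x K.
Variable k : nat.
Hypothesis k0 : (0 < k)%N.
Implicit Types (u v : 'C(k, 2).-tuple (borel X) -> R).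

Let pi0 := proportion_ge0 model.
Let pi1 := proportion_sum model.

Local Notation labs := (node_labels q0 Z).

Definition obs n (f : {ffun 'I_k -> 'I_n}) (w : T) : 'C(k, 2).-tuple (borel X) :=
  induced_obs x (fun a => f a) w.

Definition labs_at n (f : {ffun 'I_k -> 'I_n}) (w : T) : {ffun 'I_k -> 'I_Q} :=
  [ffun a => labs n w (f a)].

Definition prob_labs (c : {ffun 'I_k -> 'I_Q}) : R := \prod_a pi (c a).

(* The conditional mean of u(X^i) given Z^i = c (0 when that event is null). *)
Definition cond_mean u (c : {ffun 'I_k -> 'I_Q}) : R :=
  ev P (fun w => u (induced_obs x (@first_nodes k) w) * (labs k w == c)%:R) / prob_labs c.

(** The quantity n (m^ - A) of the overview, for the real-valued function [u]. *)
Definition res u n (w : T) : R :=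
  n%:R * avg (fun f : {ffun 'I_k -> 'I_n} => u (obs f w) - cond_mean u (labs_at f w)).

Section finitary_residual.
Variables (W : finType) (pt : borel X -> W).
Hypothesis mpt : forall o, measurable [set y | pt y = o].

Local Notation kpt := (kpt K pt).
Let mu : cell 'I_Q W -> R := cell_law q0 pi kpt.
Let mu0 : forall a, 0 <= mu a.
Proof. by move=> a; apply: cell_law_ge0 => // *; exact: kpt_ge0. Qed.
Let mu1 : \sum_a mu a = 1.
Proof. by apply: cell_law_sum => // *; exact: kpt_sum. Qed.

Definition read_table (m : {ffun 'I_k * 'I_k -> W}) : 'C(k, 2).-tuple W :=
  map_tuple m (pair_tuple k).

Lemma read_table_obs n (f : {ffun 'I_k -> 'I_n}) w : injective f ->
  map_tuple pt (obs f w) = read_table [ffun e => edge_marks x pt n w (f e.1, f e.2)].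
Proof.
move=> f_inj; apply: eq_from_tnth => i; rewrite !tnth_map !ffunE /= (inj_eq f_inj).
have : tnth (pair_tuple k) i \in pair_seq k by exact: mem_tnth.
by rewrite mem_pair_seq -val_eqE /= => /ltn_eqF ->.
Qed.

Lemma read_table_first w :
  map_tuple pt (induced_obs x (@first_nodes k) w) = read_table (edge_marks x pt k w).
Proof.
apply: eq_from_tnth => i; rewrite !tnth_map !ffunE /=.
have : tnth (pair_tuple k) i \in pair_seq k by exact: mem_tnth.
by rewrite mem_pair_seq -val_eqE /= => /ltn_eqF ->.
Qed.

Section one_function.
Variable h : 'C(k, 2).-tuple W -> R.

Let u (y : 'C(k, 2).-tuple (borel X)) : R := h (map_tuple pt y).

Let hm (m : {ffun 'I_k * 'I_k -> W}) : R := h (read_table m).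

Definition table_fun (y : {ffun {set 'I_k} -> cell 'I_Q W}) : R := hm (marks (pt 0) y).

Lemma cond_mean_marks c : prob_labs c != 0 -> cond_mean u c = mean_marks (pt 0) q0 pi kpt hm c.
Proof.
move=> c0; rewrite /cond_mean; apply: (mulIf c0); rewrite mulfVK //.
rewrite -(Ex_marks_labels (pt 0) q0 pi1 (kpt_sum K mpt) hm c).
rewrite -(marked_transfer q0 model mpt (n := k) (G1 := fun l m => hm m * (l == c)%:R) (G2 := fun l m => hm m * (l == c)%:R)) //.
by apply: eq_ev => w; rewrite /u read_table_first.
Qed.

Lemma table_fun_sqr : Ex mu (fun y => table_fun y ^+ 2) =
  ev P (fun w => u (induced_obs x (@first_nodes k) w) ^+ 2).
Proof.
rewrite -(marked_transfer q0 model mpt (n := k) (G1 := fun l m => hm m ^+ 2) (G2 := fun l m => hm m ^+ 2)) //.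
by apply: eq_ev => w; rewrite /u read_table_first.
Qed.

(** [G] keeps the labels beside the residual, which serves the joint limit. The conditional mean
    given the labels becomes the projection on node cells. *)
Lemma res_transfer n (G : {ffun 'I_n -> 'I_Q} -> R -> R) :
  ev P (fun w => G (labs n w) (res u n w)) =
  Ex mu (fun y : {ffun {set 'I_n} -> cell 'I_Q W} =>
    G (labels y) (n%:R * Uavg (nres mu table_fun) y)).
Proof.
pose G1 (ph : {ffun 'I_k -> 'I_Q} -> R) (l : {ffun 'I_n -> 'I_Q}) (m : {ffun 'I_n * 'I_n -> W}) : R :=
  G l (n%:R * avg (fun f : {ffun 'I_k -> 'I_n} => hm [ffun e => m (f e.1, f e.2)] - ph [ffun a => l (f a)])).
transitivity (ev P (fun w => G1 (cond_mean u) (labs n w) (edge_marks x pt n w))).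
  apply: eq_ev => w; congr (G _ (_ * (_ * _))); apply: eq_bigr => f /injectiveP f_inj.
  by rewrite /u read_table_obs.
rewrite (marked_transfer q0 model mpt (G2 := G1 (mean_marks (pt 0) q0 pi kpt hm))); last first.
  move=> c m c0; congr (G _ (_ * (_ * _))); apply: eq_bigr => f _; congr (_ - _).
  by rewrite cond_mean_marks //; apply/prodf_neq0 => a _; rewrite ffunE.
apply: eq_Ex => y; congr (G _ (_ * (_ * _))); apply: eq_bigr => f /injectiveP f_inj.
rewrite /nres Pr_nodes_marks labels_restr; congr (_ - _).
by rewrite /table_fun marks_restr.
Qed.

(** The constant involves neither the partition nor [h]; this uniformity allows the extension to all
    square integrable functions. *)
Lemma finitary_res_variance n :
  ev P (fun w => res u n w ^+ 2) <=
  Cst R k * ev P (fun w => u (induced_obs x (@first_nodes k) w) ^+ 2).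
Proof.
case: n => [|n].
  rewrite (@eq_ev _ _ _ P _ (fun=> 0)) ?ev_cst; last by move=> w; rewrite /res mul0r expr0n.
  by rewrite mulr_ge0 ?ler0n //; apply: ev_ge0 => w; rewrite sqr_ge0.
rewrite (res_transfer (fun _ r => r ^+ 2)) -table_fun_sqr.
by apply: nres_variance => //; exact: dep_marks.
Qed.

End one_function.

Lemma finitary_res_clt s (h : 'C(k, 2).-tuple W -> 'rV[R]_s) :
  exists G : 'M[R]_s, [/\ G^T = G, forall r, 0 <= quad G r &
    forall (t : 'I_Q -> R) r c0, \sum_q pi q * t q = 0 ->
      ev P (fun w => cos (c0 + (Num.sqrt n%:R)^-1 * (\sum_i t (labs n w i)) +
        res (fun y => dot r (h (map_tuple pt y))) n w)) @[n --> \oo] -->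
      expR (- (2^-1 * \sum_q pi q * t q ^+ 2) - 2^-1 * quad G r) * cos c0].
Proof.
pose F j := table_fun (fun m => h m 0 j).
pose G : 'M[R]_s := \matrix_(i, j) gcov mu (F i) (F j).
have FE r (y : {ffun {set 'I_k} -> cell 'I_Q W}) :
    table_fun (fun m => dot r (h m)) y = \sum_j r 0 j * F j y.
  by rewrite /table_fun dotE; apply: eq_bigr => j _; rewrite mulrC.
have GE r : gcov mu (table_fun (fun m => dot r (h m))) (table_fun (fun m => dot r (h m))) = quad G r.
  have -> : table_fun (fun m => dot r (h m)) = (fun y => \sum_j r 0 j * F j y).
    by apply/funext => y; exact: FE.
  rewrite gcov_quadratic // quadE; apply: eq_bigr => i _; apply: eq_bigr => j _.
  by rewrite mxE.
exists G; split.
- by apply/matrixP => i j; rewrite !mxE gcovC.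
- by move=> r; rewrite -GE gcov_ge0.
- move=> t r c0 t0.
  have ta : \sum_a mu a * t a.1 = 0.
    by rewrite (cell_law_label q0 pi (kpt_sum K mpt) t).
  have [C HC] := nres_clt mu0 mu1 c0 k0 (dep_marks (pt 0) (fun m => dot r (h (read_table m)))) ta.
  apply/cvgrPdist_le => e e0.
  have ta2 : \sum_a mu a * t a.1 ^+ 2 = \sum_q pi q * t q ^+ 2.
    by rewrite (cell_law_label q0 pi (kpt_sum K mpt) (fun q => t q ^+ 2)).
  exists (maxn k.+1 (Num.trunc ((C / e) ^+ 2)).+1) => // n /=; rewrite geq_max => /andP[kn n2].
  have := HC n kn; rewrite distrC ta2 -/(table_fun (fun m => dot r (h m))) GE.
  have E := @res_transfer (fun m => dot r (h m)) n (fun l z => cos (c0 + (Num.sqrt n%:R)^-1 * (\sum_i t (l i)) + z)).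
  rewrite (etrans E (_ : _ = Ex mu (fun y : {ffun {set 'I_n} -> cell 'I_Q W} =>
     cos (c0 + (Num.sqrt n%:R)^-1 * (\sum_i t (y [set i]%SET).1) + n%:R *
       Uavg (nres mu (table_fun (fun m => dot r (h m)))) y)))); last first.
    by apply: eq_Ex => y; congr (cos (_ + _ * _ + _)); apply: eq_bigr => i _; rewrite ffunE.
  move=> /le_trans; apply.
  have n0 : 0 < Num.sqrt n%:R :> R by rewrite sqrtr_gt0 ltr0n; apply: leq_trans n2.
  rewrite ler_pdivrMr // mulrC -ler_pdivrMr //.
  apply: le_trans (ler_norm _) _; rewrite -sqrtr_sqr ler_sqrt ?ler0n //.
  by apply: ltW; apply: lt_le_trans (truncnS_gt _) _; rewrite ler_nat.
Qed.

End finitary_residual.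
End residual.

Lemma sqr_sum_le (R : realFieldType) (I : finType) (Q : pred I) (a : I -> R) :
  (\sum_(i | Q i) a i) ^+ 2 <= #|I|%:R * \sum_(i | Q i) a i ^+ 2.
Proof.
apply: le_trans (_ : #|Q|%:R * \sum_(i | Q i) a i ^+ 2 <= _); last first.
  by rewrite ler_wpM2r ?sumr_ge0 // => [i _|]; [exact: sqr_ge0|rewrite ler_nat max_card].
rewrite expr2 big_distrlr /=.
have -> : #|Q|%:R * \sum_(i | Q i) a i ^+ 2 =
    \sum_(i | Q i) \sum_(j | Q j) 2^-1 * (a i ^+ 2 + a j ^+ 2).
  transitivity (2^-1 * (\sum_(i | Q i) \sum_(j | Q j) a i ^+ 2 + \sum_(i | Q i) \sum_(j | Q j) a j ^+ 2)).
    rewrite sumr_const -[X in _ + X]mulr_natl.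
    have E i : \sum_(j | Q j) a i ^+ 2 = #|Q|%:R * a i ^+ 2 by rewrite sumr_const mulr_natl.
    by rewrite (eq_bigr _ (fun i _ => E i)) -mulr_sumr; field.
  rewrite -big_split mulr_sumr; apply: eq_bigr => i _ /=; rewrite -big_split mulr_sumr.
  by apply: eq_bigr.
apply: ler_sum => i _; apply: ler_sum => j _.
rewrite -subr_ge0 (_ : _ - _ = 2^-1 * (a i - a j) ^+ 2); last by field.
by rewrite mulr_ge0 ?sqr_ge0 ?invr_ge0.
Qed.

(** * Variance bound for square integrable functions *)

Section general_residual.
Context d (T : measurableType d) (R : realType) (P : probability T R).
Variables (X : normedModType R) (Q : nat) (q0 : 'I_Q).
Variables (pi : 'I_Q -> R) (Z : nat -> {RV P >-> Q.-tuple bool}).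
Variables (x : nat -> nat -> {RV P >-> borel X}).
Variable K : R.-pker (Q.-tuple bool * Q.-tuple bool)%type ~> borel X.
Hypothesis model : mixture_model pi Z x K.
Variable k : nat.
Hypothesis k0 : (0 < k)%N.
Variable nu : probability ('C(k, 2).-tuple (borel X)) R.
Hypothesis nuE : forall A, measurable A -> nu A = P (induced_obs x (@first_nodes k) @^-1` A).
Implicit Types (u v : 'C(k, 2).-tuple (borel X) -> R).

Local Notation labs := (node_labels q0 Z).
Local Notation res := (res q0 pi Z x).
Local Notation cond_mean := (cond_mean q0 pi Z x).
Local Notation first := (induced_obs x (@first_nodes k)).

Lemma measurable_obs n (f : {ffun 'I_k -> 'I_n}) :
  measurable_fun [set: T] (obs x f : T -> 'C(k, 2).-tuple (borel X)).
Proof. exact: measurable_induced_obs. Qed.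

Lemma obs_law n (f : {ffun 'I_k -> 'I_n}) : injective f ->
  forall A, measurable A -> nu A = P (obs x f @^-1` A).
Proof.
move=> f_inj; apply: (obs_law_unique q0 model) => // a b /val_inj; exact: f_inj.
Qed.

Lemma obs_L1 u n (f : {ffun 'I_k -> 'I_n}) : injective f -> L1 nu u ->
  L1 P (fun w => u (obs x f w)) /\ ev P (fun w => u (obs x f w)) = ev nu u.
Proof. by move=> f_inj Lu; exact: (law_transfer (measurable_obs f) (obs_law f_inj) Lu). Qed.

Lemma first_L1 u : L1 nu u -> L1 P (fun w => u (first w)) /\ ev P (fun w => u (first w)) = ev nu u.
Proof. by move=> Lu; exact: (law_transfer (measurable_induced_obs x _) nuE Lu). Qed.

Lemma obs_L2 u n (f : {ffun 'I_k -> 'I_n}) : injective f -> L2 nu u ->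
  L2 P (fun w => u (obs x f w)) /\ ev P (fun w => u (obs x f w) ^+ 2) = ev nu (fun y => u y ^+ 2).
Proof.
move=> f_inj [mu Lu]; have [L e] := obs_L1 f_inj Lu; split => //; split => //.
exact: measurableT_comp mu (measurable_obs f).
Qed.

Lemma first_L2 u : L2 nu u ->
  L2 P (fun w => u (first w)) /\ ev P (fun w => u (first w) ^+ 2) = ev nu (fun y => u y ^+ 2).
Proof.
move=> [mu Lu]; have [L e] := first_L1 Lu; split => //; split => //.
exact: measurableT_comp mu (measurable_induced_obs x _).
Qed.

Lemma labs_L2 n (G : {ffun 'I_n -> 'I_Q} -> R) : L2 P (fun w => G (labs n w)).
Proof.
split; last by apply: (L1_finite P (fun c => measurable_node_labels q0 model c) (fun l : {ffun 'I_n -> 'I_Q} => G l ^+ 2)).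
by apply: (L1_measurable (P := P)); exact: (L1_finite P (fun c => measurable_node_labels q0 model c) G).
Qed.

Lemma labs_at_L2 n (f : {ffun 'I_k -> 'I_n}) (G : {ffun 'I_k -> 'I_Q} -> R) :
  L2 P (fun w => G (labs_at q0 Z f w)).
Proof. exact: (labs_L2 (fun l => G [ffun a => l (f a)])). Qed.

Lemma avg_L2 n (F : {ffun 'I_k -> 'I_n} -> T -> R) : (forall f : {ffun 'I_k -> 'I_n}, injective f -> L2 P (F f)) ->
  L2 P (fun w => avg (fun f => F f w)).
Proof.
move=> LF; apply: L2Z.
rewrite (_ : (fun w => _) = (fun w => \sum_(f : {ffun 'I_k -> 'I_n}) if injectiveb f then F f w else 0)); last first.
  by apply/funext => w; rewrite -big_mkcond.
apply: (@L2_sum _ _ _ P _ _ (fun (f : {ffun 'I_k -> 'I_n}) w => if injectiveb f then F f w else 0)) => f.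
by case: (boolP (injectiveb f)) => [/injectiveP|_]; [exact: LF|exact: L2_cst].
Qed.

Lemma res_L2 u n : L2 nu u -> L2 P (res u n).
Proof.
move=> Lu; apply: L2Z; apply: avg_L2 => f f_inj.
by apply: L2B; [have [] := obs_L2 f_inj Lu|exact: labs_at_L2].
Qed.

Lemma cond_meanB u v c : L2 nu u -> L2 nu v ->
  cond_mean (fun y => u y - v y) c = cond_mean u c - cond_mean v c.
Proof.
move=> Lu Lv; rewrite /cond_mean -mulrBl -evB.
- by congr (_ / _); apply: eq_ev => w; rewrite mulrBl.
- by apply: L2_mul; [have [] := first_L2 Lu|exact: (labs_L2 (fun l => (l == c)%:R))].
- by apply: L2_mul; [have [] := first_L2 Lv|exact: (labs_L2 (fun l => (l == c)%:R))].
Qed.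

Lemma resB u v n w : L2 nu u -> L2 nu v ->
  res (fun y => u y - v y) n w = res u n w - res v n w.
Proof.
move=> Lu Lv; rewrite /res -mulrBr -avgB; congr (_ * (_ * _)); apply: eq_bigr => f _.
by rewrite cond_meanB //; ring.
Qed.

Lemma cond_mean_sqr_le u c : L2 nu u ->
  cond_mean u c ^+ 2 <= (prob_labs pi c)^-1 ^+ 2 * ev nu (fun y => u y ^+ 2).
Proof.
move=> Lu; have [Lf <-] := first_L2 Lu.
rewrite /cond_mean exprMn mulrC ler_wpM2l ?sqr_ge0 //.
have Lm : L2 P (fun w => u (first w) * (labs k w == c)%:R).
  split; first by apply: measurable_funM; [case: Lf|case: (labs_L2 (fun l => (l == c)%:R))].
  apply: le_L1 Lf.2 => [|w].
    apply: measurable_funX; apply: measurable_funM; [by case: Lf|by case: (labs_L2 (fun l => (l == c)%:R))].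
  rewrite ger0_norm ?sqr_ge0 // exprMn ler_piMr ?sqr_ge0 //.
  by case: (_ == _); rewrite ?expr1n ?expr0n.
apply: le_trans (ev_sqr_le Lm) _; apply: le_ev; [exact: Lm.2|exact: Lf.2|].
move=> w; rewrite exprMn ler_piMr ?sqr_ge0 //.
by case: (_ == _); rewrite ?expr1n ?expr0n.
Qed.

(** Continuity of [u |-> res u n] at fixed [n], with a constant that grows with [n]. It only serves
    to absorb an approximation error in [res_variance]. *)
Lemma res_crude n : exists2 D, 0 <= D & forall u, L2 nu u ->
  ev P (fun w => res u n w ^+ 2) <= D * ev nu (fun y => u y ^+ 2).
Proof.
pose S := \sum_(c : {ffun 'I_k -> 'I_Q}) (prob_labs pi c)^-1 ^+ 2.
have S0 : 0 <= S by apply: sumr_ge0 => c _; rewrite sqr_ge0.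
pose N := #|{ffun 'I_k -> 'I_n}|; pose kp := (n%:R * (n ^_ k)%:R^-1 : R).
exists (kp ^+ 2 * (N%:R * (N%:R * (2 + 2 * S)))).
  by rewrite !mulr_ge0 ?sqr_ge0 ?ler0n ?addr_ge0 ?mulr_ge0.
move=> u Lu; set M := ev nu _.
have M0 : 0 <= M by apply: ev_ge0 => y; rewrite sqr_ge0.
have resE w : res u n w ^+ 2 = kp ^+ 2 *
    (\sum_(f : {ffun 'I_k -> 'I_n} | injectiveb f) (u (obs x f w) - cond_mean u (labs_at q0 Z f w))) ^+ 2.
  by rewrite -exprMn /kp /res /avg mulrA.
pose F (f : {ffun 'I_k -> 'I_n}) w : R := (u (obs x f w) - cond_mean u (labs_at q0 Z f w)) ^+ 2.
have LF (f : {ffun 'I_k -> 'I_n}) : injectiveb f -> L1 P (F f).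
  move=> /injectiveP f_inj; suff [] : L2 P (fun w => u (obs x f w) - cond_mean u (labs_at q0 Z f w)) by [].
  by apply: L2B; [have [] := obs_L2 f_inj Lu|exact: labs_at_L2].
apply: le_trans (_ : ev P (fun w => kp ^+ 2 * (N%:R * \sum_(f : {ffun 'I_k -> 'I_n} | injectiveb f) F f w)) <= _).
  apply: le_ev; [exact: (res_L2 n Lu).2|by do 2 apply: L1Z; apply: L1_sum|].
  by move=> w; rewrite resE ler_wpM2l ?sqr_ge0 // sqr_sum_le.
rewrite evZ; last by apply: L1Z; apply: L1_sum.
rewrite -(mulrA (kp ^+ 2)) ler_wpM2l ?sqr_ge0 // evZ; last by apply: L1_sum.
rewrite -(mulrA N%:R) ler_wpM2l ?ler0n // ev_sum //.
apply: le_trans (_ : \sum_(f : {ffun 'I_k -> 'I_n}) (2 + 2 * S) * M <= _); last first.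
  by rewrite sumr_const -(mulr_natl (_ * M)) mulrA.
rewrite big_mkcond; apply: ler_sum => f _; case: ifP => [/injectiveP f_inj|_]; last first.
  by rewrite mulr_ge0 ?addr_ge0 ?mulr_ge0.
have [Lo oE] := obs_L2 f_inj Lu.
apply: le_trans (_ : ev P (fun w => 2 * u (obs x f w) ^+ 2 + 2 * (S * M)) <= _); last first.
  rewrite evD; [|by apply: L1Z; exact: Lo.2|exact: L1_cst].
  by rewrite evZ ?ev_cst ?oE ?mulrDl -?mulrA //; exact: Lo.2.
apply: le_ev; [by apply: LF; apply/injectiveP|by apply: L1D; [apply: L1Z; exact: Lo.2|exact: L1_cst]|].
move=> w; rewrite /F -[- cond_mean _ _]mulN1r; apply: le_trans (sqr_add_le _ _) _.
rewrite lerD2l mulN1r sqrrN ler_wpM2l // mulr_suml.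
apply: le_trans (cond_mean_sqr_le _ Lu) _.
rewrite (bigD1 (labs_at q0 Z f w)) //= lerDl; apply: sumr_ge0 => c _.
by rewrite mulr_ge0 ?sqr_ge0.
Qed.

Lemma ev_sqr_le2 (a b : T -> R) c : L2 P a -> L2 P b -> L2 P c -> (forall w, c w = a w + b w) ->
  ev P (fun w => c w ^+ 2) <= 2 * ev P (fun w => a w ^+ 2) + 2 * ev P (fun w => b w ^+ 2).
Proof.
move=> [_ La] [_ Lb] [_ Lc] cE.
rewrite -(evZ 2 La) -(evZ 2 Lb) -evD; [|exact: L1Z..].
by apply: le_ev => //; [apply: L1D; exact: L1Z|move=> w; rewrite cE sqr_add_le].
Qed.

Lemma res_variance u n : L2 nu u ->
  ev P (fun w => res u n w ^+ 2) <= 4 * Cst R k * ev nu (fun y => u y ^+ 2).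
Proof.
move=> Lu; have [D D0 crude] := res_crude n.
set C := Cst R k; have C0 : 0 <= C by rewrite ler0n.
set M := ev nu _; apply/ler_addgt0Pl => e e0.
(* Writing [u = v + (u - v)] with [v] finitary, the uniform constant handles [v] and the crude one
   handles [u - v]; [4 * C + 2 * D] is the resulting coefficient of [sqdist nu u v]. The
   approximation depends on [n] through [D], yet the final bound does not. Its factor 4 is
   [sqr_add_le] used twice. *)
pose c := 4 * C + 2 * D + 1; have c0 : 0 < c by rewrite ltr_wpDl // addr_ge0 // mulr_ge0.
have [_ H] := L2_approximable Lu; have [v fv uv] := H _ (divr_gt0 e0 c0).
have Lv := finitary_L2 nu fv.
have vM : ev nu (fun y => v y ^+ 2) <= 2 * M + 2 * sqdist nu u v.
  rewrite /M /sqdist -evZ; last exact: Lu.2.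
  rewrite -evZ; last exact: (L2B Lu Lv).2.
  rewrite -evD; [|by apply: L1Z; exact: Lu.2|by apply: L1Z; exact: (L2B Lu Lv).2].
  apply: le_ev; [exact: Lv.2|by apply: L1D; apply: L1Z; [exact: Lu.2|exact: (L2B Lu Lv).2]|].
  move=> y; have -> : v y ^+ 2 = (u y + - (u y - v y)) ^+ 2 by congr (_ ^+ 2); ring.
  by apply: le_trans (sqr_add_le _ _) _; rewrite sqrrN.
have rv : ev P (fun w => res v n w ^+ 2) <= C * ev nu (fun y => v y ^+ 2).
  have [W [pt [mpt [h vE]]]] := fv.
  have -> : v = (fun y => h (map_tuple pt y)) by apply/funext.
  rewrite -(first_L2 (finitary_L2 nu (ex_intro _ W (ex_intro _ pt (conj mpt (ex_intro _ h (fun y => erefl))))))).2.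
  exact: (finitary_res_variance q0 model k0 mpt).
have Lr := res_L2 n Lu; have Lrv := res_L2 n Lv; have Luv := L2B Lu Lv.
apply: le_trans (_ : 2 * (C * (2 * M + 2 * sqdist nu u v)) + 2 * (D * sqdist nu u v) <= _); last first.
  apply: le_trans (_ : 4 * C * M + c * sqdist nu u v <= _).
    rewrite -subr_ge0 (_ : _ - _ = sqdist nu u v); first exact: sqdist_ge0.
    rewrite /c; ring.
  by rewrite addrC lerD2r mulrC -ler_pdivlMr.
have cr := crude _ Luv.
apply: le_trans (_ : 2 * ev P (fun w => res v n w ^+ 2) + 2 * ev P (fun w => res (fun y => u y - v y) n w ^+ 2) <= _).
  apply: (ev_sqr_le2 Lrv (res_L2 n Luv) Lr) => w; rewrite resB //; ring.
by apply: lerD; rewrite ler_wpM2l //; apply: le_trans rv _; rewrite ler_wpM2l.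
Qed.

End general_residual.

(** * Limit law of the residual *)

Section residual_clt.
Context d (T : measurableType d) (R : realType) (P : probability T R).
Variables (X : normedModType R) (Q : nat) (q0 : 'I_Q).
Variables (pi : 'I_Q -> R) (Z : nat -> {RV P >-> Q.-tuple bool}).
Variables (x : nat -> nat -> {RV P >-> borel X}).
Variable K : R.-pker (Q.-tuple bool * Q.-tuple bool)%type ~> borel X.
Hypothesis model : mixture_model pi Z x K.
Variable k : nat.
Hypothesis k0 : (0 < k)%N.
Variable nu : probability ('C(k, 2).-tuple (borel X)) R.
Hypothesis nuE : forall A, measurable A -> nu A = P (induced_obs x (@first_nodes k) @^-1` A).

Local Notation labs := (node_labels q0 Z).
Local Notation res := (res q0 pi Z x).

Lemma ev_cos_lipschitz (a b : T -> R) : L2 P a -> L2 P b ->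
  `|ev P (fun w => cos (a w)) - ev P (fun w => cos (b w))| <=
  Num.sqrt (ev P (fun w => (a w - b w) ^+ 2)).
Proof.
move=> La Lb.
have Lcos (f : T -> R) : L2 P f -> L1 P (fun w => cos (f w)).
  move=> [mf _]; apply: (@L1_bounded _ _ _ P _ 1); last by move=> w; exact: cos_max.
  exact: (measurableT_comp (continuous_measurable_fun (@continuous_cos R)) mf).
rewrite -evB; [|exact: Lcos..].
have Lab := L2B La Lb.
have Ln : L2 P (fun w => `|a w - b w|).
  split; first exact: (L1_measurable (L1_norm (L2_L1 Lab))).
  by have := Lab.2; congr (L1 P _); apply/funext => w; rewrite real_normK ?num_real.
apply: le_trans (norm_ev (L1B (Lcos _ La) (Lcos _ Lb))) _.
apply: le_trans (_ : ev P (fun w => `|a w - b w|) <= _).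
  apply: le_ev; [by apply/L1_norm; apply: L1B; exact: Lcos|exact: L2_L1 Ln|].
  by move=> w; exact: cos_lipschitz.
rewrite -[leLHS]ger0_norm; last by apply: ev_ge0.
rewrite -sqrtr_sqr ler_sqrt; last by apply: ev_ge0 => w; rewrite sqr_ge0.
apply: le_trans (ev_sqr_le Ln) _; rewrite le_eqVlt; apply/orP; left; apply/eqP.
by apply: eq_ev => w; rewrite real_normK ?num_real.
Qed.

Lemma dot_L2 s (g : 'C(k, 2).-tuple (borel X) -> 'rV[R]_s) r : (forall j, L2 nu (fun y => g y 0 j)) ->
  L2 nu (fun y => dot r (g y)).
Proof.
move=> Lg; rewrite (_ : (fun y => _) = (fun y => \sum_j r 0 j * g y 0 j)); last first.
  by apply/funext => y; rewrite dotE; apply: eq_bigr => j _; rewrite mulrC.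
by apply: L2_sum => j; exact: L2Z.
Qed.

Lemma dot_sqdist s (g h : 'C(k, 2).-tuple (borel X) -> 'rV[R]_s) r e :
  (forall j, L2 nu (fun y => g y 0 j)) -> (forall j, L2 nu (fun y => h y 0 j)) ->
  (forall j, sqdist nu (fun y => g y 0 j) (fun y => h y 0 j) <= e) ->
  sqdist nu (fun y => dot r (g y)) (fun y => dot r (h y)) <=
  s%:R * (\sum_j r 0 j ^+ 2) * e.
Proof.
move=> Lg Lh gh.
have LB j := L2B (Lg j) (Lh j).
apply: le_trans (_ : ev nu (fun y => s%:R * \sum_j r 0 j ^+ 2 * (g y 0 j - h y 0 j) ^+ 2) <= _).
  apply: le_ev; [exact: (L2B (dot_L2 r Lg) (dot_L2 r Lh)).2| |].
    by apply: L1Z; apply: L1_sum => j _; apply: L1Z; exact: (LB j).2.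
  move=> y; rewrite !dotE -sumrB.
  rewrite (eq_bigr (fun j => r 0 j * (g y 0 j - h y 0 j))); last by move=> j _; ring.
  have := sqr_sum_le xpredT (fun j : 'I_s => r 0 j * (g y 0 j - h y 0 j)); rewrite card_ord.
  move=> /le_trans; apply; rewrite le_eqVlt; apply/orP; left; apply/eqP.
  by congr (_ * _); apply: eq_bigr => j _; rewrite exprMn.
rewrite evZ; last by apply: L1_sum => j _; apply: L1Z; exact: (LB j).2.
rewrite ev_sum; last by move=> j _; apply: L1Z; exact: (LB j).2.
rewrite -(mulrA s%:R) ler_wpM2l ?ler0n // mulr_suml; apply: ler_sum => j _.
by rewrite evZ ?ler_wpM2l ?sqr_ge0 //; [exact: gh|exact: (LB j).2].
Qed.

Lemma finitary_vector s (g : 'C(k, 2).-tuple (borel X) -> 'rV[R]_s) e : 0 < e ->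
  (forall j, L2 nu (fun y => g y 0 j)) ->
  exists2 h : 'C(k, 2).-tuple (borel X) -> 'rV[R]_s, finitary h &
    forall j, L2 nu (fun y => h y 0 j) /\ sqdist nu (fun y => g y 0 j) (fun y => h y 0 j) <= e.
Proof.
move=> e0 Lg.
have /choice[v vP] j : exists v : 'C(k, 2).-tuple (borel X) -> R,
    finitary v /\ sqdist nu (fun y => g y 0 j) v <= e.
  by have [_ /(_ e e0)[v fv gv]] := L2_approximable (Lg j); exists v.
exists (fun y => \row_j v j y).
  (* The coordinates are approximated over different partitions; [finitary_seq] puts them over a
     common one. *)
  rewrite (_ : (fun y => _) = (fun y => (fun sq : seq R => \row_j nth 0 sq (index j (enum 'I_s)))
      [seq v j y | j <- enum 'I_s])).
    exact: (finitary_comp1 (fun sq : seq R => \row_j nth 0 sq (index j (enum 'I_s)))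
      (finitary_seq (enum 'I_s) (fun j => (vP j).1))).
  apply/funext => y; apply/rowP => j; rewrite !mxE (nth_map j) ?index_mem ?enumT ?mem_index_enum //.
  by rewrite nth_index // mem_index_enum.
move=> j; have -> : (fun y => (\row_j v j y) 0 j) = v j by apply/funext => y; rewrite mxE.
by have [fv gv] := vP j; split => //; exact: finitary_L2.
Qed.

(** Finitary approximations [g' m] change the expected cosine by at most [del r m], uniformly in [n]
    by [res_variance]. So [double_limit] gives a limit, and [psd_limit] identifies it as
    Gaussian. *)
Theorem res_clt s (g : 'C(k, 2).-tuple (borel X) -> 'rV[R]_s) : (forall j, L2 nu (fun y => g y 0 j)) ->
  exists G : 'M[R]_s, [/\ G^T = G, forall r, 0 <= quad G r &
    forall (t : 'I_Q -> R) r c0, \sum_q pi q * t q = 0 ->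
      ev P (fun w => cos (c0 + (Num.sqrt n%:R)^-1 * (\sum_i t (labs n w i)) +
        res (fun y => dot r (g y)) n w)) @[n --> \oo] -->
      expR (- (2^-1 * \sum_q pi q * t q ^+ 2) - 2^-1 * quad G r) * cos c0].
Proof.
move=> Lg.
have /choice[g' g'P] m : exists h : 'C(k, 2).-tuple (borel X) -> 'rV[R]_s, finitary h /\
    forall j, L2 nu (fun y => h y 0 j) /\ sqdist nu (fun y => g y 0 j) (fun y => h y 0 j) <= m.+1%:R^-1.
  have m0 : 0 < m.+1%:R^-1 :> R by rewrite invr_gt0.
  by have [h fh hP] := finitary_vector m0 Lg; exists h.
have /choice[G GP] m : exists G : 'M[R]_s, [/\ G^T = G, forall r, 0 <= quad G r &
    forall (t : 'I_Q -> R) r c0, \sum_q pi q * t q = 0 ->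
      ev P (fun w => cos (c0 + (Num.sqrt n%:R)^-1 * (\sum_i t (labs n w i)) +
        res (fun y => dot r (g' m y)) n w)) @[n --> \oo] -->
      expR (- (2^-1 * \sum_q pi q * t q ^+ 2) - 2^-1 * quad G r) * cos c0].
  have [[W [pt [mpt [h hE]]]] _] := g'P m.
  have -> : g' m = (fun y => h (map_tuple pt y)) by apply/funext.
  exact: (finitary_res_clt q0 model k0 mpt).
pose A (t : 'I_Q -> R) n w := (Num.sqrt n%:R)^-1 * (\sum_i t (labs n w i)) : R.
have LA t c0 n : L2 P (fun w => c0 + A t n w).
  apply: L2D; first exact: L2_cst.
  exact: (labs_L2 q0 model (fun l : {ffun 'I_n -> 'I_Q} => (Num.sqrt n%:R)^-1 * (\sum_i t (l i)))).
pose C := 4 * Cst R k; have C0 : 0 <= C by rewrite mulr_ge0 // ler0n.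
pose del (r : 'rV[R]_s) m := Num.sqrt (C * (s%:R * (\sum_j r 0 j ^+ 2)) * m.+1%:R^-1).
have close t r c0 m n :
    `|ev P (fun w => cos (c0 + A t n w + res (fun y => dot r (g y)) n w)) -
      ev P (fun w => cos (c0 + A t n w + res (fun y => dot r (g' m y)) n w))| <= del r m.
  have Lu := dot_L2 r Lg; have Lv := dot_L2 r (fun j => ((g'P m).2 j).1).
  apply: le_trans (ev_cos_lipschitz (L2D (LA t c0 n) (res_L2 q0 model nuE n Lu))
    (L2D (LA t c0 n) (res_L2 q0 model nuE n Lv))) _.
  rewrite ler_sqrt; last by rewrite !mulr_ge0 ?sumr_ge0 ?ler0n ?invr_ge0 // => j _; rewrite sqr_ge0.
  rewrite (@eq_ev _ _ _ P _ (fun w => res (fun y => dot r (g y) - dot r (g' m y)) n w ^+ 2)); last first.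
    by move=> w; rewrite (resB q0 model nuE) //; congr (_ ^+ 2); ring.
  apply: le_trans (res_variance q0 model k0 nuE n (L2B Lu Lv)) _.
  rewrite -/C -(mulrA C) ler_wpM2l //.
  by apply: dot_sqdist => //; move=> j; have [] := (g'P m).2 j.
have del0 r : del r m @[m --> \oo] --> 0.
  rewrite -[X in _ --> X](sqrtr0 R) -[X in Num.sqrt X](mulr0 (C * (s%:R * (\sum_j r 0 j ^+ 2)))).
  have h : C * (s%:R * (\sum_j r 0 j ^+ 2)) * m.+1%:R^-1 @[m --> \oo] --> C * (s%:R * (\sum_j r 0 j ^+ 2)) * 0.
    by apply: cvgMr; exact: cvg_harmonic.
  exact: (continuous_cvg _ (@sqrt_continuous R _) h).
have dl t r c0 : \sum_q pi q * t q = 0 ->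
    exists l : R, expR (- (2^-1 * \sum_q pi q * t q ^+ 2) - 2^-1 * quad (G m) r) * cos c0 @[m --> \oo] --> l /\
      ev P (fun w => cos (c0 + A t n w + res (fun y => dot r (g y)) n w)) @[n --> \oo] --> l.
  move=> t0; apply: (@double_limit _ _ (fun m n =>
    ev P (fun w => cos (c0 + A t n w + res (fun y => dot r (g' m y)) n w))) _ (del r)) => //.
  by move=> m; have [_ _ h] := GP m; exact: h.
have z0 : \sum_(q < Q) pi q * 0 = 0 by rewrite big1 // => q _; rewrite mulr0.
have /choice[l lP] r : exists l : R, expR (- (2^-1 * quad (G m) r)) @[m --> \oo] --> l /\
      ev P (fun w => cos (0 + A (fun=> 0) n w + res (fun y => dot r (g y)) n w)) @[n --> \oo] --> l.
  have [l [l1 l2]] := dl (fun=> 0) r 0 z0; exists l; split => //.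
  move: l1; rewrite (_ : (fun m => _) = (fun m => expR (- (2^-1 * quad (G m) r)))) //.
  apply/funext => m; rewrite cos0 mulr1 [X in 2^-1 * X]big1; first by rewrite mulr0 oppr0 add0r.
  by move=> q _; rewrite expr0n mulr0.
have [H [Hs H0 GH]] : exists H : 'M[R]_s, [/\ H^T = H, forall r, 0 <= quad H r &
    forall r, quad (G m) r @[m --> \oo] --> quad H r].
  apply: (@psd_limit _ _ _ l).
  - by move=> m; case: (GP m).
  - by move=> m r; have [_ h _] := GP m.
  - by move=> r; case: (lP r).
  - move=> r; pose E := ev nu (fun y => dot r (g y) ^+ 2).
    have E0 : 0 <= E by apply: ev_ge0 => y; rewrite sqr_ge0.
    (* This makes [C * eta ^+ 2 * E <= 1], so the residual has second moment at most 1 and, by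
       [cos_ge], an expected cosine of at least 1/2 for every [n]. *)
    pose eta := (1 + C * E)^-1; have CE0 : 0 < 1 + C * E by rewrite ltr_pwDl // mulr_ge0.
    exists eta; first by rewrite invr_gt0.
    apply: (@lt_le_trans _ _ 2^-1); first by rewrite invr_gt0.
    have [_ lim] := lP (eta *: r); apply: (cvgr_to_ge lim); apply: nearW => n.
    have Lu := dot_L2 (eta *: r) Lg; have Lr := res_L2 q0 model nuE n Lu.
    have LcosL : L1 P (fun w => cos (0 + A (fun=> 0) n w + res (fun y => dot (eta *: r) (g y)) n w)).
      apply: (@L1_bounded _ _ _ P _ 1); last by move=> w; exact: cos_max.
      exact: (measurableT_comp (continuous_measurable_fun (@continuous_cos R)) (L2D (LA _ 0 n) Lr).1).
    apply: le_trans (_ : ev P (fun w => 1 - 2^-1 * res (fun y => dot (eta *: r) (g y)) n w ^+ 2) <= _); last first.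
      apply: le_ev => //; first by apply: L1B; [exact: L1_cst|apply: L1Z; exact: Lr.2].
      move=> w; have -> : A (fun=> 0) n w = 0 by rewrite /A big1 ?mulr0.
      rewrite !add0r mulrC.
      have := cos_ge (normr_ge0 (res (fun y => dot (eta *: r) (g y)) n w)).
      by rewrite real_normK ?num_real //; case: ler0P => //; rewrite cosN.
    rewrite evB; [|exact: L1_cst|by apply: L1Z; exact: Lr.2].
    rewrite ev_cst evZ; last exact: Lr.2.
    suff : ev P (fun w => res (fun y => dot (eta *: r) (g y)) n w ^+ 2) <= 1 by move=> h; lra.
    apply: le_trans (res_variance q0 model k0 nuE n Lu) _; rewrite -/C.
    rewrite (@eq_ev _ _ _ nu _ (fun y => eta ^+ 2 * dot r (g y) ^+ 2)); last first.
      by move=> y; rewrite dotZl exprMn.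
    rewrite evZ; last exact: (dot_L2 r Lg).2.
    rewrite -/E mulrCA; apply: le_trans (_ : eta * (1 + C * E) <= _); last by rewrite mulVf // gt_eqF.
    rewrite expr2 -mulrA ler_wpM2l ?invr_ge0 ?(ltW CE0) //.
    apply: le_trans (_ : 1 * (C * E) <= _); last by rewrite mul1r lerDr.
    by rewrite ler_wpM2r ?mulr_ge0 // invf_le1 // lerDl mulr_ge0.
exists H; split => // t r c0 t0.
have [l' [l1 l2]] := dl t r c0 t0.
suff -> : expR (- (2^-1 * \sum_q pi q * t q ^+ 2) - 2^-1 * quad H r) * cos c0 = l' by [].
apply: (cvg_unique _ _ l1) => //; apply: cvgMl.
apply: continuous_cvg; first exact: continuous_expR.
apply: cvgB; first exact: cvg_cst.
by apply: cvgMr; exact: GH.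
Qed.

End residual_clt.

(** * Almost sure convergence *)

Section motif_averages.
Context d (T : measurableType d) (R : realType) (P : probability T R).
Variables (X : normedModType R) (Q : nat) (q0 : 'I_Q).
Variables (pi : 'I_Q -> R) (Z : nat -> {RV P >-> Q.-tuple bool}).
Variables (x : nat -> nat -> {RV P >-> borel X}).
Variable K : R.-pker (Q.-tuple bool * Q.-tuple bool)%type ~> borel X.
Hypothesis model : mixture_model pi Z x K.
Variable k : nat.
Hypothesis k0 : (0 < k)%N.
Variable nu : probability ('C(k, 2).-tuple (borel X)) R.
Hypothesis nuE : forall A, measurable A -> nu A = P (induced_obs x (@first_nodes k) @^-1` A).
Implicit Types (u v : 'C(k, 2).-tuple (borel X) -> R).

Let pi0 := proportion_ge0 model.
Let pi1 := proportion_sum model.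

Local Notation labs := (node_labels q0 Z).
Local Notation res := (res q0 pi Z x).
Local Notation cond_mean := (cond_mean q0 pi Z x).
Local Notation first := (induced_obs x (@first_nodes k)).

Definition node_fun (psi : {ffun 'I_k -> 'I_Q} -> R) (y : {ffun {set 'I_k} -> 'I_Q}) : R :=
  psi [ffun a => y [set a]%SET].

Lemma dep_node_fun psi : dep (nodes k) (node_fun psi).
Proof.
move=> y y'; congr psi; apply/ffunP => a; rewrite !ffunE.
by rewrite inE cards1 eqxx.
Qed.

Definition label_avg n psi (w : T) : R := avg (fun f : {ffun 'I_k -> 'I_n} => psi (labs_at q0 Z f w)).

Lemma label_avg_transfer n psi (G : {ffun 'I_n -> 'I_Q} -> R -> R) :
  ev P (fun w => G (labs n w) (label_avg n psi w)) =
  Ex pi (fun y : {ffun {set 'I_n} -> 'I_Q} => G [ffun a => y [set a]%SET] (Uavg (node_fun psi) y)).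
Proof.
rewrite (label_transfer q0 model (fun l : {ffun 'I_n -> 'I_Q} =>
  G l (avg (fun f : {ffun 'I_k -> 'I_n} => psi [ffun a => l (f a)])))).
apply: eq_Ex => y; congr (G _ _); apply: eq_avg => f; rewrite /node_fun; congr psi.
by apply/ffunP => a; rewrite !ffunE /simg imset_set1.
Qed.

Lemma label_avg_L2 n psi : L2 P (label_avg n psi).
Proof. by apply: avg_L2 => f _; exact: (labs_at_L2 q0 model). Qed.

Lemma mean_node_fun psi : Ex pi (node_fun psi) = \sum_c prob_labs pi c * psi c.
Proof.
rewrite -(label_transfer q0 model psi) (ev_finite P (fun c => measurable_node_labels q0 model c)).
by apply: eq_bigr => c _; rewrite (node_labels_law q0 model).
Qed.

(** At null labels [cond_mean] is 0 through division by 0; the tower property [mean_cond_mean]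
    requires the mass it replaces to be 0 as well. *)
Lemma null_labels_mean u c : L2 nu u -> prob_labs pi c = 0 ->
  ev P (fun w => u (first w) * (labs k w == c)%:R) = 0.
Proof.
move=> Lu c0; rewrite -[RHS](ev_cst P); rewrite /ev /Rintegral; congr fine.
have [Lf _] := first_L2 nuE Lu.
apply: ae_eq_integral => //.
- apply/measurable_EFinP; apply: measurable_funM; first by case: Lf.
  by case: (labs_L2 q0 model (fun l : {ffun 'I_k -> 'I_Q} => (l == c)%:R)).
- exists [set w | labs k w = c]; split.
  + exact: (measurable_node_labels q0 model).
  + exact: (etrans (node_labels_law q0 model c) (congr1 EFin c0)).
  + move=> w /= h; apply: contrapT => /eqP wc; apply: h => _.
    by rewrite (negbTE wc) mulr0.
Qed.

Lemma mean_cond_mean u : L2 nu u -> Ex pi (node_fun (cond_mean u)) = ev nu u.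
Proof.
move=> Lu; rewrite mean_node_fun; have [Lf _] := first_L2 nuE Lu.
have LM c : L1 P (fun w => u (first w) * (labs k w == c)%:R).
  by apply: L2_mul => //; exact: (labs_L2 q0 model (fun l : {ffun 'I_k -> 'I_Q} => (l == c)%:R)).
transitivity (\sum_c ev P (fun w => u (first w) * (labs k w == c)%:R)).
  apply: eq_bigr => c _; rewrite /cond_mean.
  have [c0|c0] := eqVneq (prob_labs pi c) 0; last by rewrite mulrC mulfVK.
  by rewrite c0 mul0r null_labels_mean.
rewrite -ev_sum // -(first_L1 nuE (L2_L1 Lu)).2; apply: eq_ev => w.
rewrite -mulr_sumr (bigD1 (labs k w)) //= eqxx big1 ?addr0 ?mulr1 // => c /negbTE.
by rewrite eq_sym => ->.
Qed.

Definition motif_avg u n (w : T) : R := avg (fun f : {ffun 'I_k -> 'I_n} => u (obs x f w)).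

Lemma motif_avg_L2 u n : L2 nu u -> L2 P (motif_avg u n).
Proof. by move=> Lu; apply: avg_L2 => f f_inj; case: (obs_L2 q0 model nuE f_inj Lu). Qed.

Lemma motif_avgE u n w : (0 < n)%N ->
  motif_avg u n w = n%:R^-1 * res u n w + label_avg n (cond_mean u) w.
Proof.
move=> n0; rewrite /res mulKf ?pnatr_eq0 -?lt0n // avgB.
by rewrite subrK.
Qed.

Lemma Uavg_center n psi (y : {ffun {set 'I_n} -> 'I_Q}) : (k <= n)%N ->
  Uavg (centered pi (node_fun psi)) y = Uavg (node_fun psi) y - Ex pi (node_fun psi).
Proof. by move=> kn; rewrite /Uavg avgB avg_cst. Qed.

Lemma label_avg_variance n psi : (k < n)%N ->
  ev P (fun w => (label_avg n psi w - Ex pi (node_fun psi)) ^+ 2) <=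
  Cst R k * Ex pi (fun y => node_fun psi y ^+ 2) / n%:R.
Proof.
move=> kn; have n0 : (0 < n)%N by apply: leq_ltn_trans kn.
rewrite (label_avg_transfer psi (fun (_ : {ffun 'I_n -> 'I_Q}) z => (z - Ex pi (node_fun psi)) ^+ 2)).
rewrite ler_pdivlMr ?ltr0n //.
apply: le_trans (center_variance pi0 pi1 k0 (dep_node_fun psi) n0).
rewrite le_eqVlt; apply/orP; left; apply/eqP; congr (_ * _); apply: eq_Ex => y.
by rewrite Uavg_center // ltnW.
Qed.

Lemma motif_variance u : L2 nu u -> exists2 C, 0 <= C & forall n, (k < n)%N ->
  ev P (fun w => (motif_avg u n w - ev nu u) ^+ 2) <= C / n%:R.
Proof.
move=> Lu; pose psi := cond_mean u.
pose C1 := 4 * Cst R k * ev nu (fun y => u y ^+ 2).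
pose C2 := Cst R k * Ex pi (fun y => node_fun psi y ^+ 2).
have C10 : 0 <= C1 by rewrite !mulr_ge0 ?ler0n //; apply: ev_ge0 => y; rewrite sqr_ge0.
have C20 : 0 <= C2 by rewrite !mulr_ge0 ?ler0n //; apply: Ex_ge0 => // y; rewrite sqr_ge0.
exists (2 * C1 + 2 * C2) => [|n kn]; first by rewrite addr_ge0 // mulr_ge0.
have n0 : (0 < n)%N by apply: leq_ltn_trans kn.
have n1 : 0 < n%:R :> R by rewrite ltr0n.
have Lr := L2Z n%:R^-1 (res_L2 q0 model nuE n Lu).
have La := L2B (label_avg_L2 n psi) (L2_cst P (ev nu u)).
have Lm := L2B (motif_avg_L2 n Lu) (L2_cst P (ev nu u)).
apply: le_trans (ev_sqr_le2 Lr La Lm _) _.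
  by move=> w; rewrite motif_avgE //; ring.
rewrite [leRHS]mulrDl; apply: lerD; rewrite -mulrA ler_wpM2l //.
  rewrite (@eq_ev _ _ _ P _ (fun w => n%:R^-1 ^+ 2 * res u n w ^+ 2)); last by move=> w; rewrite exprMn.
  rewrite evZ; last exact: (res_L2 q0 model nuE n Lu).2.
  rewrite mulrC; apply: le_trans (ler_wpM2r _ (res_variance q0 model k0 nuE n Lu)) _.
    by rewrite sqr_ge0.
  rewrite ler_wpM2l // expr2 ler_piMl ?invr_ge0 ?(ltW n1) // invf_le1 // ler1n //.
by rewrite -(mean_cond_mean Lu); exact: label_avg_variance.
Qed.

End motif_averages.

(** * Interpolation between squares *)

Section square_subsequence.
Variable R : realType.

Lemma sum_inv_sqr_le n : \sum_(0 <= m < n) (m.+1%:R ^+ 2)^-1 <= 2 :> R.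
Proof.
case: n => [|n]; first by rewrite big_geq.
suff h : \sum_(0 <= m < n.+1) (m.+1%:R ^+ 2)^-1 <= 2 - n.+1%:R^-1 :> R.
  by apply: le_trans h _; rewrite gerBl invr_ge0.
elim: n => [|n IH]; first by rewrite big_nat1 expr1n invr1; lra.
rewrite big_nat_recr //=; apply: le_trans (lerD IH (lexx _)) _.
have a0 : 0 < n.+1%:R :> R by [].
have a1 : n.+2%:R = n.+1%:R + 1 :> R by rewrite -(natr1 n.+1).
rewrite a1; move: (n.+1%:R : R) a0 => a a0; rewrite -subr_ge0.
have a10 : 0 < a + 1 by rewrite addr_gt0.
have -> : 2 - (a + 1)^-1 - (2 - a^-1 + ((a + 1) ^+ 2)^-1) = (a * (a + 1) ^+ 2)^-1.
  by field; rewrite !gt_eqF.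
by rewrite invr_ge0 mulr_ge0 ?sqr_ge0 // ltW.
Qed.

Lemma exists_sqrt n : exists m, (m ^ 2 <= n < m.+1 ^ 2)%N.
Proof.
elim: n => [|n [m /andP[mn nm]]]; first by exists 0%N.
have [h|h] := leqP (m.+1 ^ 2)%N n.+1; last by exists m; rewrite (leq_trans mn) //= h.
exists m.+1; rewrite h /=; apply: leq_ltn_trans nm _.
by rewrite ltn_exp2r.
Qed.

Lemma ffact_ratio k : ((m.+1 ^ 2) ^_ k)%:R / ((m ^ 2) ^_ k)%:R @[m --> \oo] --> (1 : R).
Proof.
elim: k => [|k IH].
  rewrite (_ : (fun m => _) = (fun=> 1)); first exact: cvg_cst.
  by apply/funext => m; rewrite !ffactn0 divr1.
have lin : ((m.+1 ^ 2 - k)%N%:R / (m ^ 2 - k)%N%:R : R) @[m --> \oo] --> (1 : R).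
  apply/cvgrPdist_le => e e0.
  (* From [k + 2 <= m] follows [2 * k <= m ^ 2], so the denominator is at least [m ^+ 2 / 2]; the
     difference from 1 is then at most [3 * m / (m ^+ 2 / 2) = 6 / m]. *)
  exists (k + 2 + (Num.trunc (6 / e)).+1)%N => // m /= mk.
  have m0 : (0 < m)%N by apply: leq_trans mk; rewrite addnS.
  have m1 : 0 < m%:R :> R by rewrite ltr0n.
  have mk2 : (2 * k <= m ^ 2)%N.
    have h : (k + 2 <= m)%N by apply: leq_trans mk; exact: leq_addr.
    apply: leq_trans (_ : (k + 2) ^ 2 <= _)%N; last by rewrite leq_exp2r.
    by rewrite sqrnD; lia.
  have km : (k <= m ^ 2)%N by apply: leq_trans mk2; rewrite leq_pmull.
  have km1 : (k <= m.+1 ^ 2)%N by apply: leq_trans km _; rewrite leq_exp2r.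
  have den : m%:R ^+ 2 / 2 <= (m ^ 2 - k)%N%:R :> R.
    rewrite natrB // natrX; have : (2 * k)%:R <= m%:R ^+ 2 :> R by rewrite -natrX ler_nat.
    by rewrite natrM; lra.
  have den0 : 0 < (m ^ 2 - k)%N%:R :> R.
    by apply: lt_le_trans den; rewrite divr_gt0 // exprn_gt0.
  have -> : 1 - (m.+1 ^ 2 - k)%N%:R / (m ^ 2 - k)%N%:R = - ((2 * m%:R + 1) / (m ^ 2 - k)%N%:R) :> R.
    have h : (m.+1 ^ 2 - k)%N%:R = (m ^ 2 - k)%N%:R + (2 * m%:R + 1) :> R.
      rewrite !natrB // !natrX -natr1; ring.
    by rewrite h; field; rewrite gt_eqF.
  rewrite normrN ger0_norm; last by rewrite divr_ge0 ?addr_ge0 ?mulr_ge0 ?ler0n.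
  rewrite ler_pdivrMr //; apply: le_trans (_ : e * (m%:R ^+ 2 / 2) <= _); last by rewrite ler_wpM2l // ltW.
  have em : 6 <= e * m%:R.
    rewrite mulrC -ler_pdivrMr //; apply: ltW; apply: lt_le_trans (truncnS_gt _) _.
    by rewrite ler_nat; apply: leq_trans mk; exact: leq_addl.
  apply: le_trans (_ : 3 * m%:R <= _).
    have : 1 <= m%:R :> R by rewrite ler1n.
    by lra.
  rewrite (_ : e * (m%:R ^+ 2 / 2) = (e * m%:R) / 2 * m%:R); last by rewrite expr2; ring.
  by rewrite ler_wpM2r ?ler0n //; lra.
rewrite (_ : (fun m => _) = (fun m => ((m.+1 ^ 2) ^_ k)%:R / ((m ^ 2) ^_ k)%:R *
   ((m.+1 ^ 2 - k)%N%:R / (m ^ 2 - k)%N%:R) : R)); last first.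
  by apply/funext => m; rewrite !ffactnSr !natrM invfM; ring.
by rewrite -[X in _ --> X]mulr1; exact: cvgM.
Qed.

(** Between two consecutive squares, monotonicity encloses the quotient between [S] at the lower
    square over the larger falling factorial and [S] at the upper square over the smaller one. The
    ratio of the two factorials tends to 1. *)
Lemma cvg_square_interpolation (S : nat -> R) k (l : R) : (forall n, 0 <= S n) ->
  (forall n, S n <= S n.+1) -> S (m ^ 2)%N / ((m ^ 2) ^_ k)%:R @[m --> \oo] --> l ->
  S n / (n ^_ k)%:R @[n --> \oo] --> l.
Proof.
move=> S0 S1 Sl; have mS a b : (a <= b)%N -> S a <= S b.
  by move=> ab; rewrite -(subnKC ab); elim: (b - a)%N => [|i IH]; rewrite ?addn0 // addnS (le_trans IH).
have [r rP] := choice exists_sqrt.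
have r_oo : r n @[n --> \oo] --> \oo.
  apply/cvgnyPge => M; exists (M ^ 2)%N => // n /= Mn; have /andP[_ nr] := rP n.
  by have := leq_ltn_trans Mn nr; rewrite ltn_exp2r // ltnS.
have up : S (m.+1 ^ 2)%N / ((m.+1 ^ 2) ^_ k)%:R * (((m.+1 ^ 2) ^_ k)%:R / ((m ^ 2) ^_ k)%:R) @[m --> \oo] --> l.
  rewrite -[X in _ --> X]mulr1; apply: cvgM; last exact: ffact_ratio.
  by have := Sl; rewrite -(cvg_shiftS (fun m => S (m ^ 2)%N / ((m ^ 2) ^_ k)%:R)).
have lo : S (m ^ 2)%N / ((m ^ 2) ^_ k)%:R * (((m.+1 ^ 2) ^_ k)%:R / ((m ^ 2) ^_ k)%:R)^-1 @[m --> \oo] --> l.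
  rewrite -[X in _ --> X]mulr1 -[X in _ * X]invr1; apply: cvgM => //.
  by apply: cvgV; [exact: oner_neq0|exact: ffact_ratio].
have up' := cvg_comp _ _ r_oo up; have lo' := cvg_comp _ _ r_oo lo.
apply: (@squeeze_cvgr _ _ _ _ _ _ _ _ _ lo' up').
exists (k.+1 ^ 2)%N => // n /= kn; have /andP[rn nr] := rP n.
have kr : (k <= r n)%N by have := leq_ltn_trans kn nr; rewrite ltn_exp2r // ltnS => /ltnW.
have cpos N : (k <= N)%N -> 0 < (N ^_ k)%:R :> R by rewrite ltr0n ffact_gt0.
have le_sq : (k <= (r n) ^ 2)%N.
  by apply: leq_trans kr _; rewrite expnS expn1; case: (r n) => // j; rewrite leq_pmulr.
have c1 := cpos _ le_sq; have c2 := cpos _ (leq_trans le_sq rn).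
have c3 := cpos _ (leq_trans le_sq (leq_trans rn (ltnW nr))).
have mono a b : (a <= b)%N -> (a ^_ k)%:R <= (b ^_ k)%:R :> R.
  by move=> ab; rewrite ler_nat; elim: (k) => // i IH; rewrite !ffactnSr leq_mul // leq_sub2r.
rewrite /=; apply/andP; split.
  rewrite invf_div mulrA mulfVK ?gt_eqF //.
  by apply: ler_pM => //; rewrite ?invr_ge0 ?ler0n ?mS // lef_pV2 ?posrE // mono // ltnW.
rewrite mulrA mulfVK ?gt_eqF //.
by apply: ler_pM => //; rewrite ?invr_ge0 ?ler0n ?mS ?(ltnW nr) // lef_pV2 ?posrE // mono.
Qed.

End square_subsequence.

Section almost_sure.
Context d (T : measurableType d) (R : realType) (P : probability T R).

(** The series of the squares has finite expectation, hence converges almost everywhere, so its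
    terms tend to 0. *)
Lemma ae_cvg0 (V : nat -> T -> R) C : 0 <= C -> (forall m, L2 P (V m)) ->
  (forall m, ev P (fun w => V m w ^+ 2) <= C * (m.+1%:R ^+ 2)^-1) ->
  {ae P, forall w, V m w @[m --> \oo] --> (0 : R)}.
Proof.
move=> C0 LV VC; pose h m w : \bar R := (V m w ^+ 2)%:E.
have mh m : measurable_fun [set: T] (h m).
  by apply/measurable_EFinP; apply: measurable_funX; case: (LV m).
have h0 m w : [set: T] w -> (0 <= h m w)%E by rewrite lee_fin sqr_ge0.
pose H w := (\sum_(0 <= m <oo) h m w)%E.
have H0 w : (0 <= H w)%E by apply: nneseries_ge0 => m _ _; exact: h0.
have mH : measurable_fun [set: T] H by apply: ge0_emeasurable_sum => [m w Dw _|m _]; [exact: h0|exact: mh].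
have intH : P.-integrable [set: T] H.
  apply/integrableP; split => //.
  rewrite (_ : (fun w => `|H w|%E) = H); last by apply/funext => w; rewrite gee0_abs.
  rewrite /H integral_nneseries //.
  apply: (@le_lt_trans _ _ (C * 2)%:E); last exact: ltry.
  apply: lime_le; first by apply: is_cvg_nneseries => m _ _; apply: integral_ge0 => w Dw; exact: h0.
  apply: nearW => n.
  rewrite (eq_bigr (fun m => (ev P (fun w => V m w ^+ 2))%:E)); last first.
    by move=> m _; rewrite /h ev_EFin //; case: (LV m).
  rewrite sumEFin lee_fin.
  apply: le_trans (_ : \sum_(0 <= m < n) C * (m.+1%:R ^+ 2)^-1 <= _); first exact: ler_sum.
  by rewrite -mulr_sumr ler_wpM2l // sum_inv_sqr_le.
have := integrable_ae measurableT intH; apply: filterS => w /(_ I) Hw.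
have cvg2 : V m w ^+ 2 @[m --> \oo] --> (0 : R).
  apply: cvg_series_cvg_0; apply: nondecreasing_is_cvgn.
    by apply/nondecreasing_seqP => n; rewrite /series /= big_nat_recr //= lerDl sqr_ge0.
  exists (fine (H w)) => _ [n _ <-]; rewrite -lee_fin fineK // /series /= -sumEFin.
  by apply: nneseries_lim_ge => m _ _; exact: h0.
have cvg1 : Num.sqrt (V m w ^+ 2) @[m --> \oo] --> (Num.sqrt 0 : R).
  by apply: continuous_cvg => //; exact: sqrt_continuous.
apply: norm_cvg0; move: cvg1; rewrite sqrtr0; apply: cvg_trans; apply: near_eq_cvg.
by apply: nearW => m; rewrite sqrtr_sqr.
Qed.

End almost_sure.

Section strong_law.
Context d (T : measurableType d) (R : realType) (P : probability T R).
Variables (X : normedModType R) (Q : nat) (q0 : 'I_Q).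
Variables (pi : 'I_Q -> R) (Z : nat -> {RV P >-> Q.-tuple bool}).
Variables (x : nat -> nat -> {RV P >-> borel X}).
Variable K : R.-pker (Q.-tuple bool * Q.-tuple bool)%type ~> borel X.
Hypothesis model : mixture_model pi Z x K.
Variable k : nat.
Hypothesis k0 : (0 < k)%N.
Variable nu : probability ('C(k, 2).-tuple (borel X)) R.
Hypothesis nuE : forall A, measurable A -> nu A = P (induced_obs x (@first_nodes k) @^-1` A).
Implicit Types (u v : 'C(k, 2).-tuple (borel X) -> R).

Lemma motif_sum_le u n w : (forall y, 0 <= u y) ->
  \sum_(f : {ffun 'I_k -> 'I_n} | injectiveb f) u (obs x f w) <=
  \sum_(f : {ffun 'I_k -> 'I_n.+1} | injectiveb f) u (obs x f w).
Proof.
move=> u0; pose h (f : {ffun 'I_k -> 'I_n}) : {ffun 'I_k -> 'I_n.+1} :=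
  [ffun a => widen_ord (leqnSn n) (f a)].
have h_inj : injective h.
  move=> f g /ffunP fg; apply/ffunP => a; have := fg a; rewrite !ffunE => /(congr1 val) /= e.
  exact: val_inj.
have hu f : u (obs x (h f) w) = u (obs x f w).
  by congr u; apply: eq_from_tnth => e; rewrite !tnth_map !ffunE.
rewrite -(eq_bigr _ (fun f _ => hu f)).
pose I : {set {ffun 'I_k -> 'I_n}} := [set f : {ffun 'I_k -> 'I_n} | injectiveb f]%SET.
pose J : {set {ffun 'I_k -> 'I_n.+1}} := [set h f | f in I]%SET.
have -> : \sum_(f : {ffun 'I_k -> 'I_n} | injectiveb f) u (obs x (h f) w) = \sum_(f' in J) u (obs x f' w).
  rewrite big_imset /=; last by move=> f g _ _; exact: h_inj.
  by apply: eq_bigl => f; rewrite inE.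
rewrite [leRHS](bigID (fun f' : {ffun 'I_k -> 'I_n.+1} => f' \in J)) /=.
rewrite -[leLHS]addr0; apply: lerD; last by apply: sumr_ge0 => f _.
rewrite le_eqVlt; apply/orP; left; apply/eqP; apply: eq_bigl => f'.
apply/idP/andP => [f'h|[]//]; split => //; case/imsetP: f'h => f; rewrite inE => /injectiveP f_inj ->.
by apply/injectiveP => a b; rewrite !ffunE => /(congr1 val) /= e; apply: f_inj; exact: val_inj.
Qed.

Lemma motif_slln_ge0 u : L2 nu u -> (forall y, 0 <= u y) ->
  {ae P, forall w, motif_avg x u n w @[n --> \oo] --> ev nu u}.
Proof.
move=> Lu u0; have [C C0 var] := motif_variance q0 model k0 nuE Lu.
(* The shift by [k.+1] keeps every index above [k], as [motif_variance] requires, and at least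
   [m.+1 ^ 2]. *)
pose V m w := motif_avg x u ((m + k.+1) ^ 2)%N w - ev nu u.
have LV m : L2 P (V m) by apply: L2B; [exact: (motif_avg_L2 q0 model nuE)|exact: L2_cst].
have VC m : ev P (fun w => V m w ^+ 2) <= C * (m.+1%:R ^+ 2)^-1.
  apply: le_trans (var _ _) _.
    by rewrite expnS expn1; apply: leq_trans (leq_addl m k.+1) _; rewrite leq_pmulr // addnS.
  rewrite ler_wpM2l // lef_pV2 ?posrE ?exprn_gt0 ?ltr0n ?expn_gt0 ?addnS //.
  by rewrite natrX lerXn2r ?nnegrE ?ler0n // ler_nat ltnS leq_addr.
have := ae_cvg0 C0 LV VC; apply: filterS => w Vw.
have e n : motif_avg x u n w = (\sum_(f : {ffun 'I_k -> 'I_n} | injectiveb f) u (obs x f w)) / (n ^_ k)%:R.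
  by rewrite /motif_avg /avg mulrC.
rewrite (funext e); apply: cvg_square_interpolation.
- by move=> n; apply: sumr_ge0.
- by move=> n; exact: motif_sum_le.
have c : (fun m => motif_avg x u ((m + k.+1) ^ 2)%N w) @ \oo --> ev nu u.
  rewrite (_ : (fun m => _) = (fun m => V m w + ev nu u)); last by apply/funext => m; rewrite subrK.
  by rewrite -[X in _ --> X]add0r; apply: cvgD => //; exact: cvg_cst.
rewrite (cvg_shiftn k.+1 (fun m => motif_avg x u (m ^ 2)%N w)) in c.
by move: c; rewrite (funext (fun m => e (m ^ 2)%N)).
Qed.

Lemma motif_slln u : L2 nu u ->
  {ae P, forall w, motif_avg x u n w @[n --> \oo] --> ev nu u}.
Proof.
move=> Lu; have La : L2 nu (fun y => `|u y|).
  case: Lu => mu iu; split; first exact: measurableT_comp.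
  by rewrite (_ : (fun y => _) = (fun y => u y ^+ 2)) //; apply/funext => y; rewrite real_normK // num_real.
(* [u] is the difference of the nonnegative functions [|u| + u] and [|u|]. *)
have Ls := L2D La Lu.
have := motif_slln_ge0 La (fun y => normr_ge0 _).
have s0 y : 0 <= `|u y| + u y by rewrite -lerBlDr sub0r -normrN ler_norm.
have := motif_slln_ge0 Ls s0.
apply: filterS2 => w c1 c2.
have -> : ev nu u = ev nu (fun y => `|u y| + u y) - ev nu (fun y => `|u y|).
  by have -> := evD (L2_L1 La) (L2_L1 Lu); rewrite addrC addKr.
have e n : motif_avg x u n w = motif_avg x (fun y => `|u y| + u y) n w - motif_avg x (fun y => `|u y|) n w.
  by rewrite /motif_avg -avgB; apply: eq_avg => f; ring.
by rewrite (funext e); apply: cvgB.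
Qed.

End strong_law.

Lemma cvg_rV (R : realType) s (Y : nat -> 'rV[R]_s) (l : 'rV[R]_s) :
  (forall j, Y n 0 j @[n --> \oo] --> l 0 j) -> Y n @[n --> \oo] --> l.
Proof.
move=> h; apply/cvgrPdist_le => e e0.
have all_close : \forall n \near \oo, forall j, `|l 0 j - Y n 0 j| <= e.
  by apply: filter_forall => j; have /cvgrPdist_le := h j; apply.
apply: filterS all_close => n hn; apply: rV_norm_le => [|j]; first exact: ltW.
by rewrite !mxE.
Qed.

(** * The Gaussian limit *)

Section vector_moments.
Context d (T : measurableType d) (R : realType) (P : probability T R).
Variables (X : normedModType R) (Q : nat) (q0 : 'I_Q).
Variables (pi : 'I_Q -> R) (Z : nat -> {RV P >-> Q.-tuple bool}).
Variables (x : nat -> nat -> {RV P >-> borel X}).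
Variable K : R.-pker (Q.-tuple bool * Q.-tuple bool)%type ~> borel X.
Hypothesis model : mixture_model pi Z x K.
Variable k : nat.
Hypothesis k0 : (0 < k)%N.
Variable nu : probability ('C(k, 2).-tuple (borel X)) R.
Hypothesis nuE : forall A, measurable A -> nu A = P (induced_obs x (@first_nodes k) @^-1` A).
Variables (s : nat) (g : 'C(k, 2).-tuple (borel X) -> 'rV[R]_s).
Hypothesis Lg : forall j, L2 nu (fun y => g y 0 j).

Let pi0 := proportion_ge0 model.
Let pi1 := proportion_sum model.

Local Notation labs := (node_labels q0 Z).
Local Notation res := (res q0 pi Z x).
Local Notation cond_mean := (cond_mean q0 pi Z x).
Local Notation gj j := (fun y => g y 0 j).
Local Notation gdot t := (fun y => dot t (g y)).

(** For [k <= n] the two normalizations coincide; for [n < k] they differ, but there is no injective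
    tuple and both sums are empty. *)
Lemma empirical_momentE n w j :
  empirical_moment x g n w 0 j = motif_avg x (gj j) n w.
Proof.
rewrite /empirical_moment mxE summxE /motif_avg /avg; have [kn|nk] := leqP k n.
  congr (_ * _); apply: (@mulfI _ (n ^_ k)%:R); first by rewrite pnatr_eq0 -lt0n ffact_gt0.
  rewrite mulfV ?pnatr_eq0 -?lt0n ?ffact_gt0 // mulrA -natrM ffact_fact // mulfV //.
have no_inj (f : {ffun 'I_k -> 'I_n}) : injectiveb f = false.
  apply/negbTE/injectiveP => /leq_card; rewrite !card_ord => h.
  by rewrite leqNgt nk in h.
by rewrite !big_pred0 ?mulr0.
Qed.

Lemma momentE j : moment x g 0 j = ev nu (gj j).
Proof. by rewrite /moment mxE unlock -(first_L1 nuE (L2_L1 (Lg j))).2. Qed.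

Lemma ev_dot t : ev nu (gdot t) = dot t (moment x g).
Proof.
rewrite dotE (@eq_ev _ _ _ nu _ (fun y => \sum_j t 0 j * g y 0 j)); last first.
  by move=> y; rewrite dotE; apply: eq_bigr => j _; rewrite mulrC.
rewrite ev_sum => [|j _]; last by apply: L1Z; exact: L2_L1.
by apply: eq_bigr => j _; rewrite evZ ?momentE 1?mulrC //; exact: L2_L1.
Qed.

Lemma dot_motif t n w : dot t (empirical_moment x g n w) = motif_avg x (gdot t) n w.
Proof.
rewrite dotE /motif_avg.
transitivity (avg (fun f : {ffun 'I_k -> 'I_n} => \sum_j t 0 j * g (obs x f w) 0 j)).
  rewrite avg_sum; apply: eq_bigr => j _; rewrite empirical_momentE mulrC /motif_avg.
  by rewrite -avgZ.
by apply: eq_avg => f; rewrite dotE; apply: eq_bigr => j _; rewrite mulrC.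
Qed.

Lemma moment_slln : {ae P, forall w, empirical_moment x g n w @[n --> \oo] --> moment x g}.
Proof.
have all_close : {ae P, forall w, forall j, motif_avg x (gj j) n w @[n --> \oo] --> ev nu (gj j)}.
  by apply: filter_forall => j; exact: (motif_slln q0 model k0 nuE).
apply: filterS all_close => w hw; apply: cvg_rV => j.
rewrite momentE (_ : (fun n => _) = (fun n => motif_avg x (gj j) n w)) //.
by apply/funext => n; exact: empirical_momentE.
Qed.

Lemma cond_mean_dot t c : cond_mean (gdot t) c = \sum_j t 0 j * cond_mean (gj j) c.
Proof.
rewrite /cond_mean.
have LM j : L1 P (fun w => g (induced_obs x (@first_nodes k) w) 0 j * (labs k w == c)%:R).
  apply: L2_mul; first by case: (first_L2 nuE (Lg j)).
  exact: (labs_L2 q0 model (fun l : {ffun 'I_k -> 'I_Q} => (l == c)%:R)).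
under eq_bigr do rewrite mulrA.
rewrite -mulr_suml; congr (_ / _).
rewrite (eq_bigr (fun j => ev P (fun w => t 0 j * (g (induced_obs x (@first_nodes k) w) 0 j * (labs k w == c)%:R)))); last first.
  by move=> j _; rewrite evZ.
rewrite -ev_sum => [|j _]; last exact: L1Z.
apply: eq_ev => w; rewrite dotE mulr_suml; apply: eq_bigr => j _.
by rewrite mulrCA mulrA.
Qed.

Lemma center_dot t y : centered pi (node_fun (cond_mean (gdot t))) y =
  \sum_j t 0 j * centered pi (node_fun (cond_mean (gj j))) y.
Proof.
rewrite /centered.
have -> : Ex pi (node_fun (cond_mean (gdot t))) =
    \sum_j t 0 j * Ex pi (node_fun (cond_mean (gj j))).
  rewrite (mean_cond_mean q0 model nuE (dot_L2 t Lg)) ev_dot dotE; apply: eq_bigr => j _.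
  by rewrite momentE mulrC (mean_cond_mean q0 model nuE (Lg j)).
by rewrite /node_fun cond_mean_dot -sumrB; apply: eq_bigr => j _; rewrite mulrBr.
Qed.

Lemma Pr_center_dot t S y : Pr pi S (centered pi (node_fun (cond_mean (gdot t)))) y =
  \sum_j t 0 j * Pr pi S (centered pi (node_fun (cond_mean (gj j)))) y.
Proof.
rewrite (_ : centered pi (node_fun (cond_mean (gdot t))) =
  (fun z => \sum_j t 0 j * centered pi (node_fun (cond_mean (gj j))) z)); last first.
  by apply/funext => z; exact: center_dot.
by rewrite Pr_sum; apply: eq_bigr => j _; rewrite PrZ.
Qed.

Definition influence q : 'rV[R]_s := \row_j proj1 pi (node_fun (cond_mean (gj j))) q.

Lemma proj1_dot t q : proj1 pi (node_fun (cond_mean (gdot t))) q = dot t (influence q).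
Proof.
rewrite dotE /proj1 (eq_bigr (fun a : 'I_k => \sum_j t 0 j * Pr pi (cells [set a]%SET)
  (centered pi (node_fun (cond_mean (gj j)))) [ffun=> q])); last first.
  by move=> a _; exact: Pr_center_dot.
rewrite exchange_big; apply: eq_bigr => j _; rewrite mxE -mulr_sumr mulrC.
by rewrite /proj1.
Qed.

Lemma motif_decomposition t n w : (k < n)%N ->
  dot t (n%:R *: (empirical_moment x g n w - moment x g)) =
  res (gdot t) n w + n%:R * (label_avg q0 Z n (cond_mean (gdot t)) w -
     Ex pi (node_fun (cond_mean (gdot t)))).
Proof.
move=> kn; have n0 : (0 < n)%N by apply: leq_ltn_trans kn.
have n1 : n%:R != 0 :> R by rewrite pnatr_eq0 -lt0n.
rewrite dotC dotZl dotDl dotNl !(dotC _ t) dot_motif (mean_cond_mean q0 model nuE (dot_L2 t Lg)).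
by rewrite ev_dot (motif_avgE q0 pi Z) //; field.
Qed.

Lemma scaled_moment_measurable (a : nat -> R) n : measurable_fun [set: T]
  (fun w => a n *: (empirical_moment x g n w - moment x g) : borel 'rV[R]_s).
Proof.
apply: measurable_rV => j; have [m _] := L2Z (a n) (L2B (motif_avg_L2 q0 model nuE n (Lg j)) (L2_cst P (moment x g 0 j))).
by move: m; congr measurable_fun; apply/funext => w; rewrite -empirical_momentE !mxE.
Qed.

Lemma scaled_moment_sqr (a : nat -> R) n j :
  (fun w => (a n *: (empirical_moment x g n w - moment x g)) 0 j ^+ 2) =
  (fun w => a n ^+ 2 * (motif_avg x (gj j) n w - ev nu (gj j)) ^+ 2).
Proof. by apply/funext => w; rewrite !mxE -exprMn -empirical_momentE -momentE !mxE. Qed.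

(** Their outer squares add up to Sigma_g, the covariance of the influence vector at a random label;
    its mean is 0. *)
Definition clt_factors := [seq Num.sqrt (pi q) *: influence q | q <- enum 'I_Q].

Lemma dot_clt_factors t : \sum_(a <- clt_factors) dot t a ^+ 2 = \sum_q pi q * dot t (influence q) ^+ 2.
Proof.
rewrite big_map big_enum; apply: eq_bigr => q _.
by rewrite dotC dotZl exprMn sqr_sqrtr // dotC.
Qed.

Lemma sqrt_nat_cvg0 C : C * (Num.sqrt n%:R)^-1 @[n --> \oo] --> (0 : R).
Proof.
have h : (Num.sqrt n%:R)^-1 @[n --> \oo] --> (0 : R).
  apply/cvgrPdist_le => e e0; exists (Num.trunc (e^-1 ^+ 2)).+2 => // n /= en.
  have n0 : 0 < n%:R :> R by rewrite ltr0n; apply: leq_trans en.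
  have s0 : 0 < Num.sqrt n%:R :> R by rewrite sqrtr_gt0.
  rewrite sub0r normrN ger0_norm ?invr_ge0 ?sqrtr_ge0 // -[leRHS]invrK lef_pV2 ?posrE ?invr_gt0 //.
  rewrite -(@ler_pXn2r _ 2) ?nnegrE ?invr_ge0 ?(ltW e0) ?(ltW s0) // sqr_sqrtr ?(ltW n0) //.
  apply: ltW; apply: lt_le_trans (truncnS_gt _) _; rewrite ler_nat.
  exact: leq_trans en.
by rewrite -[X in _ --> X](mulr0 C); apply: cvgM => //; exact: cvg_cst.
Qed.

Lemma moment_clt : exists2 mu : probability (borel 'rV[R]_s) R,
  is_centered_gaussian (\sum_(a <- clt_factors) a^T *m a) mu &
  cvg_in_distribution P
    (fun n w => Num.sqrt n%:R *: (empirical_moment x g n w - moment x g)) mu.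
Proof.
have [mu muE] := gaussian_exists clt_factors; exists mu; first exact: is_centered_gaussian_trig.
have /choice[C CP] j := let: ex_intro2 C C0 h := motif_variance q0 model k0 nuE (Lg j) in
  ex_intro (fun C => 0 <= C /\ forall n, (k < n)%N ->
    ev P (fun w => (motif_avg x (gj j) n w - ev nu (gj j)) ^+ 2) <= C / n%:R) C (conj C0 h).
have LV n j : L1 P (fun w => (motif_avg x (gj j) n w - ev nu (gj j)) ^+ 2).
  by case: (L2B (motif_avg_L2 q0 model nuE n (Lg j)) (L2_cst P (ev nu (gj j)))).
apply: (@weak_cvg_trig _ _ _ _ _ _ _ (\sum_j C j) k.+1).
- exact: (scaled_moment_measurable (fun n => Num.sqrt n%:R)).
- move=> n j; rewrite (scaled_moment_sqr (fun n => Num.sqrt n%:R)).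
  exact: L1Z.
- move=> n j kn; rewrite (scaled_moment_sqr (fun n => Num.sqrt n%:R)) evZ // sqr_sqrtr ?ler0n //.
  have n1 : 0 < n%:R :> R by rewrite ltr0n; apply: leq_ltn_trans kn.
  apply: le_trans (ler_wpM2l (ltW n1) ((CP j).2 n kn)) _.
  rewrite mulrCA mulfV ?gt_eqF // mulr1 (bigD1 j) //= lerDl.
  by apply: sumr_ge0 => i _; case: (CP i).
move=> c t; rewrite muE dot_clt_factors.
set psi := node_fun (cond_mean (gdot t)).
have [K1 K1P] := sum_proj1_clt pi0 pi1 k0 (dep_node_fun (cond_mean (gdot t))) c 1.
(* [D n] is the total error: the first term comes from the linear statistic of the labels, the
   second from the residual, whose contribution at the scale of the square root of [n] is negligible
   by [res_variance]. *)
pose C2 := Num.sqrt (4 * Cst R k * ev nu (fun y => dot t (g y) ^+ 2)).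
pose D n := `|K1 * (Num.sqrt n%:R)^-1| + C2 * (Num.sqrt n%:R)^-1.
have D0 : D n @[n --> \oo] --> (0 : R).
  rewrite -[X in _ --> X](addr0 (0 : R)); apply: cvgD; last exact: sqrt_nat_cvg0.
  by rewrite -[X in _ --> X](@normr0 _ R); apply: cvg_norm; exact: sqrt_nat_cvg0.
apply/cvgrPdist_le => e e0; move/cvgrPdist_le : D0 => /(_ e e0) De.
near=> n.
have kn : (k < n)%N by near: n; exact: nbhs_infty_gt.
have n0 : (0 < n)%N by apply: leq_ltn_trans kn.
have n1 : 0 < n%:R :> R by rewrite ltr0n.
have s0 : 0 < Num.sqrt n%:R :> R by rewrite sqrtr_gt0.
have De' : D n <= e.
  have : `|0 - D n| <= e by near: n.
  by rewrite sub0r normrN; apply: le_trans; exact: ler_norm.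
apply: le_trans De'; rewrite distrC.
pose B w := Num.sqrt n%:R * (label_avg q0 Z n (cond_mean (gdot t)) w - Ex pi psi).
have LB : L2 P (fun w => c + B w).
  by apply: L2D; [exact: L2_cst|apply: L2Z; apply: L2B; [exact: (label_avg_L2 q0 model)|exact: L2_cst]].
pose r w := (Num.sqrt n%:R)^-1 * res (gdot t) n w.
have Lr : L2 P r by apply: L2Z; exact: (res_L2 q0 model nuE n (dot_L2 t Lg)).
have YE w : c + dot t (Num.sqrt n%:R *: (empirical_moment x g n w - moment x g)) = c + B w + r w.
  have h := motif_decomposition t w kn; rewrite (dotC t) dotZl (dotC _ t) -/psi in h.
  rewrite (dotC t) dotZl (dotC _ t) /B /r.
  have nE : n%:R = Num.sqrt n%:R ^+ 2 :> R by rewrite sqr_sqrtr // ltW.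
  move: h; rewrite {1 2}nE; move: (Num.sqrt n%:R : R) s0 => q q00 h.
  rewrite -addrA (_ : q * dot t _ = q^-1 * (q ^+ 2 * dot t (empirical_moment x g n w - moment x g))); last by field; rewrite gt_eqF.
  by rewrite h; field; rewrite gt_eqF.
rewrite (@eq_ev _ _ _ P _ (fun w => cos (c + B w + r w))); last by move=> w; rewrite YE.
apply: le_trans (ler_distD (ev P (fun w => cos (c + B w))) _ _) _.
rewrite /D addrC; apply: lerD; last first.
  apply: le_trans (ev_cos_lipschitz (L2D LB Lr) LB) _.
  rewrite (@eq_ev _ _ _ P _ (fun w => (Num.sqrt n%:R)^-1 ^+ 2 * res (gdot t) n w ^+ 2)); last first.
    by move=> w; rewrite addrC addKr exprMn.
  rewrite evZ; last exact: (res_L2 q0 model nuE n (dot_L2 t Lg)).2.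
  rewrite sqrtrM ?sqr_ge0 // sqrtr_sqr ger0_norm ?invr_ge0 ?sqrtr_ge0 // mulrC.
  rewrite ler_wpM2r ?invr_ge0 ?sqrtr_ge0 // /C2 ler_wsqrtr //.
  exact: (res_variance q0 model k0 nuE n (dot_L2 t Lg)).
apply: le_trans (ler_norm _); apply: le_trans (K1P n kn).
rewrite (label_avg_transfer q0 model (cond_mean (gdot t)) (fun (_ : {ffun 'I_n -> 'I_Q}) z =>
  cos (c + Num.sqrt n%:R * (z - Ex pi psi)))).
rewrite le_eqVlt; apply/orP; left; apply/eqP; congr (`| _ - expR (- _) * _|).
  by apply: eq_Ex => y; rewrite mul1r Uavg_center // ltnW.
rewrite mulrC; congr (_ * _); apply: eq_bigr => q _.
by rewrite mul1r proj1_dot.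
Unshelve. all: by end_near.
Qed.

End vector_moments.

(** * Affiliation *)

Section exchangeable_labels.
Variables (R : realType) (A : finType) (mu : A -> R).
Hypotheses (mu_ge0 : forall a, 0 <= mu a) (mu_sum : \sum_a mu a = 1).

Lemma Ex_relabel (I : finType) (s : {perm A}) (F : {ffun I -> A} -> R) : (forall a, mu (s a) = mu a) ->
  Ex mu (fun y : {ffun I -> A} => F [ffun i => s (y i)]) = Ex mu F.
Proof.
move=> mus; pose h (y : {ffun I -> A}) : {ffun I -> A} := [ffun i => s (y i)].
have h_inj : injective h.
  by move=> y z /ffunP yz; apply/ffunP => i; have := yz i; rewrite !ffunE => /perm_inj.
rewrite /Ex [RHS](reindex_inj h_inj) /=; apply: eq_bigr => y _.
by congr (_ * _); apply: eq_bigr => i _; rewrite ffunE mus.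
Qed.

Variable k : nat.
Variable F : {ffun {set 'I_k} -> A} -> R.
Hypothesis mu_const : forall a b, mu a = mu b.
Hypothesis F_sym : forall (s : {perm A}) (y : {ffun {set 'I_k} -> A}), F [ffun B => s (y B)] = F y.

Lemma Pr_relabel (s : {perm A}) S (y : {ffun {set 'I_k} -> A}) :
  Pr mu S (centered mu F) [ffun B => s (y B)] = Pr mu S (centered mu F) y.
Proof.
rewrite /Pr -(Ex_relabel (s := s)) //; apply: eq_Ex => z; rewrite /centered; congr (_ - _).
rewrite -[RHS](F_sym s); congr F; apply/ffunP => B; rewrite !ffunE.
by case: ifP => _; rewrite ?ffunE.
Qed.

(** The projection on one node is invariant under relabelling, and a transposition sends any label
    to any other; so it is constant, equal to its mean 0. *)
Lemma Pr_relabel1 a (y : {ffun {set 'I_k} -> A}) : Pr mu (cells [set a]%SET) (centered mu F) y = 0.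
Proof.
have cst z : Pr mu (cells [set a]%SET) (centered mu F) z = Pr mu (cells [set a]%SET) (centered mu F) y.
  rewrite -(Pr_relabel (tperm (z [set a]%SET) (y [set a]%SET))).
  apply: dep_eq (dep_Pr mu _ _) _ => B /mem_cells1 ->.
  by rewrite ffunE tpermL.
have -> : Pr mu (cells [set a]%SET) (centered mu F) y = Ex mu (Pr mu (cells [set a]%SET) (centered mu F)).
  by rewrite (eq_Ex mu cst) Ex_cst.
by rewrite Ex_Pr // /centered ExB Ex_cst // subrr.
Qed.

Lemma degen_relabel : degen mu 2 (centered mu F).
Proof.
move=> S; rewrite ltnS leq_eqVlt => /orP[/cards1P[a ->]|S0] y; first exact: Pr_relabel1.
exact: (center_degen mu_sum F).
Qed.

Lemma proj1_relabel q : proj1 mu F q = 0.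
Proof. by rewrite /proj1 big1 // => a _; exact: Pr_relabel1. Qed.

End exchangeable_labels.

Section affiliation_kernel.
Context d (T : measurableType d) (R : realType) (P : probability T R).
Variables (X : normedModType R) (Q : nat) (q0 : 'I_Q).
Variables (pi : 'I_Q -> R) (Z : nat -> {RV P >-> Q.-tuple bool}).
Variables (x : nat -> nat -> {RV P >-> borel X}).
Variable K : R.-pker (Q.-tuple bool * Q.-tuple bool)%type ~> borel X.
Hypothesis model : mixture_model pi Z x K.
Hypothesis aff : affiliation Z x.
Hypothesis pi_gt0 : forall q, 0 < pi q.

Local Notation kap := (kap K).
Local Notation zlab := (zlab q0 Z).

Let two_labels q l : 'I_2 -> 'I_Q := fun a => if a == ord0 then q else l.
Let Eql q l : set T := labels_event q0 Z (@nat_of_ord 2) (two_labels q l).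

Lemma Eql_zlab q l w : Eql q l w -> zlab 0 w = q /\ zlab 1 w = l.
Proof. by move=> h; split; [exact: (h ord0)|exact: (h (lift ord0 ord0))]. Qed.

Lemma Eql_law q l : P (Eql q l) = (pi q * pi l)%:E.
Proof.
apply: (etrans (labels_law q0 model (@val_inj _ _ _) (two_labels q l))).
by rewrite big_ord_recl big_ord1.
Qed.

Lemma pair_seq2 : pair_seq 2 = [:: (ord0, lift ord0 ord0)].
Proof.
apply: perm_small_eq => //; apply: uniq_perm; [exact: uniq_pair_seq|by []|].
move=> [a b]; rewrite mem_pair_seq inE xpair_eqE -!val_eqE /=.
by case: a => [[|[|]]] //=; case: b => [[|[|]]].
Qed.

Lemma kap_Eql q l A : measurable A ->
  P (x 0 1 @^-1` A `&` Eql q l) = ((pi q * pi l)%:E * kap q l A)%E.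
Proof.
move=> mA; have := model_law q0 model (@val_inj _ _ _) (two_labels q l) (fun (_ : 'I_2 * 'I_2) => mA).
rewrite pair_seq2 big_seq1 big_ord_recl big_ord1 => h.
apply: (etrans _ h); congr (P (_ `&` _)); apply/seteqP; split => [w Aw e|w /(_ (ord0, lift ord0 ord0))].
  by rewrite /= inE => /eqP ->.
by apply; rewrite /= inE.
Qed.

(* The common version p of the conditional probability is a function of 1_(Z 0 = Z 1), so its
   integral over {Z 0 = q, Z 1 = l} identifies the kernel at (q, l) with a value of p. *)
Lemma kap_affiliation q l q' l' A : measurable A -> (q == l) = (q' == l') -> kap q l A = kap q' l' A.
Proof.
move=> mA ql; have [p [[mp pE] [mp' _]]] := aff (isT : (0 < 1)%N) mA.
(* The set where [p] takes the value [p w'] belongs to the sigma-algebra of the Boolean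
   [Z 0 == Z 1], hence is a preimage of a set of Booleans. *)
have p_const w w' : (Z 0 w == Z 1 w) = (Z 0 w' == Z 1 w') -> p w = p w'.
  move=> ww'; have m1 : measurable [set p w'] by exact: emeasurable_set1.
  have := mp' measurableT _ m1; rewrite setTI.
  rewrite /measurable /= sigma_algebra_id; last by apply: sigma_algebra_preimage; exact: sigma_algebra_measurable.
  move=> [B _]; rewrite setTI => BE.
  have : (p @^-1` [set p w']) w' by [].
  by rewrite -BE /= -ww' => h; have : (p @^-1` [set p w']) w by rewrite -BE.
have kapE a b w : Eql a b w -> kap a b A = p w.
  move=> Ew; have [za zb] := Eql_zlab Ew.
  have mE : measurable (Eql a b) := measurable_labels_event q0 model _ _.
  have sE : <<s preimage_set_system [set: T] (fun w => (Z 0 w, Z 1 w)) measurable >> (Eql a b).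
    apply: sub_sigma_algebra; exists ([set v : Q.-tuple bool | tnth v a] `*` [set v : Q.-tuple bool | tnth v b]).
      by apply: measurableX; exact: measurable_tnth_bool.
    rewrite setTI; apply/seteqP; split => [v [/=]|v Ev].
      rewrite !(tnth_Z q0 model) => /eqP h1 /eqP h2 c.
      by case: c => [[|[|]]].
    by have [h1 h2] := Eql_zlab Ev; split; rewrite /= (tnth_Z q0 model) ?h1 ?h2.
  have h := pE _ sE; rewrite kap_Eql // in h.
  rewrite (eq_integral (cst (p w))) in h; last first.
    move=> v; rewrite inE => Ev; apply: p_const; have [h1 h2] := Eql_zlab Ev.
    by rewrite !(zlab_onehot q0 model) h1 h2 za zb.
  have {}h : (kap a b A * (pi a * pi b)%:E = p w * (pi a * pi b)%:E)%E.
    by rewrite muleC h integral_cst //; congr (_ * _)%E; exact: Eql_law.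
  have r0 : pi a * pi b != 0 by rewrite mulf_neq0 // gt_eqF.
  have : (((pi a * pi b)^-1)%:E * (kap a b A * (pi a * pi b)%:E) = ((pi a * pi b)^-1)%:E * (p w * (pi a * pi b)%:E))%E by rewrite h.
  by rewrite ![(_ * (pi a * pi b)%:E)%E]muleC !muleA -EFinM mulVf // !mul1e.
have nonempty a b : exists w, Eql a b w.
  apply: contrapT => /forallNP h; have := Eql_law a b.
  rewrite (_ : Eql a b = set0); last by apply/seteqP; split => // w /h.
  by rewrite measure0 => -[] /eqP; rewrite eq_sym gt_eqF // mulr_gt0.
have [w Ew] := nonempty q l; have [w' Ew'] := nonempty q' l'.
rewrite (kapE _ _ _ Ew) (kapE _ _ _ Ew'); apply: p_const.
have onehot_inj : injective (@onehot Q) := can_inj (label_onehot q0).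
have [z1 z2] := Eql_zlab Ew; have [z1' z2'] := Eql_zlab Ew'.
by rewrite !(zlab_onehot q0 model) z1 z2 z1' z2' !(inj_eq onehot_inj).
Qed.

Hypothesis pi_const : forall q l, pi q = pi l.
Variable k : nat.
Hypothesis k0 : (0 < k)%N.
Variable nu : probability ('C(k, 2).-tuple (borel X)) R.
Hypothesis nuE : forall A, measurable A -> nu A = P (induced_obs x (@first_nodes k) @^-1` A).
Implicit Types (u v : 'C(k, 2).-tuple (borel X) -> R).

Local Notation cond_mean := (cond_mean q0 pi Z x).

Lemma prob_labs_gt0 (c : {ffun 'I_k -> 'I_Q}) : 0 < prob_labs pi c.
Proof. by apply: prodr_gt0. Qed.

Lemma prob_labs_const (c c' : {ffun 'I_k -> 'I_Q}) : prob_labs pi c = prob_labs pi c'.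
Proof. by apply: eq_bigr. Qed.

(** The conditional mean is a quotient whose numerator is a finite sum of products of kernel values.
    These depend only on which labels coincide, a pattern that a permutation preserves. *)
Lemma finitary_cond_mean_relabel u (s : {perm 'I_Q}) (c : {ffun 'I_k -> 'I_Q}) : finitary u ->
  cond_mean u [ffun a => s (c a)] = cond_mean u c.
Proof.
move=> [W [pt [mpt [h uE]]]].
pose hm m := h (read_table m).
have E c' : cond_mean u c' = (\sum_m (if mark_table (pt 0) m then
    (\prod_a pi (c' a)) * \prod_(e : 'I_k * 'I_k | (e.1 < e.2)%N) kpt K pt (c' e.1) (c' e.2) (m e)
    else 0) * hm m) / prob_labs pi c'.
  rewrite /cond_mean; congr (_ / _).
  rewrite (@eq_ev _ _ _ P _ (fun w => (fun cm : {ffun 'I_k -> 'I_Q} * {ffun 'I_k * 'I_k -> W} => hm cm.2 * (cm.1 == c')%:R)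
    (node_labels q0 Z k w, edge_marks x pt k w))); last first.
    by move=> w; rewrite /= uE read_table_first.
  rewrite (ev_finite P (@measurable_marked _ _ _ _ _ _ q0 _ _ _ _ model _ _ mpt k) (fun cm : {ffun 'I_k -> 'I_Q} * {ffun 'I_k * 'I_k -> W} => hm cm.2 * (cm.1 == c')%:R)).
  transitivity (\sum_(l : {ffun 'I_k -> 'I_Q}) \sum_(m : {ffun 'I_k * 'I_k -> W})
      fine (P [set w | (node_labels q0 Z k w, edge_marks x pt k w) = (l, m)]) * (hm m * (l == c')%:R)).
    by rewrite pair_bigA; apply: eq_bigr => -[l m].
  rewrite (bigD1 c') //= [X in _ + X]big1 ?addr0; last first.
    by move=> l /negbTE lc; rewrite big1 // => m _; rewrite lc !mulr0.
  by apply: eq_bigr => m _; rewrite eqxx mulr1 (marked_law q0 model mpt).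
rewrite !E (prob_labs_const _ c); congr (_ / _); apply: eq_bigr => m _; congr (_ * _).
case: ifP => // _; congr (_ * _); first exact: prob_labs_const.
apply: eq_bigr => e _; rewrite !ffunE /kpt; congr fine; apply: kap_affiliation; first exact: mpt.
by rewrite (inj_eq perm_inj).
Qed.

Lemma cond_mean_relabel u (s : {perm 'I_Q}) (c : {ffun 'I_k -> 'I_Q}) : L2 nu u ->
  cond_mean u [ffun a => s (c a)] = cond_mean u c.
Proof.
move=> Lu; set c' := [ffun a => s (c a)].
apply/eqP; rewrite -subr_eq0 -sqrf_eq0 eq_le sqr_ge0 andbT.
apply/ler_addgt0Pl => e e0; rewrite addr0.
pose b := (prob_labs pi c)^-1 ^+ 2; have b0 : 0 < b by rewrite exprn_gt0 // invr_gt0 prob_labs_gt0.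
have [_ dens] := L2_approximable Lu.
(* All labels have the same probability, so [b] serves both [c] and its relabelling; the two squared
   errors, [e / 4] each and doubled by [sqr_add_le], add up to [e]. *)
have [v fv uv] := dens (e / (4 * b)) (divr_gt0 e0 (mulr_gt0 (ltr0n _ 4) b0)).
have Lv := finitary_L2 nu fv; have Luv := L2B Lu Lv.
have B a : cond_mean (fun y => u y - v y) a ^+ 2 <= b * (e / (4 * b)).
  apply: le_trans (cond_mean_sqr_le q0 model nuE a Luv) _.
  by rewrite (prob_labs_const a c) -/b ler_wpM2l // ltW.
have -> : cond_mean u c' - cond_mean u c = cond_mean (fun y => u y - v y) c' + - cond_mean (fun y => u y - v y) c.
  rewrite !(cond_meanB q0 model nuE _ Lu Lv) (finitary_cond_mean_relabel s c fv); ring.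
apply: le_trans (sqr_add_le _ _) _; rewrite sqrrN.
have := B c'; have := B c; have -> : b * (e / (4 * b)) = e / 4 by field; rewrite gt_eqF.
by move=> h1 h2; lra.
Qed.

Lemma node_fun_relabel u (s : {perm 'I_Q}) (y : {ffun {set 'I_k} -> 'I_Q}) : L2 nu u ->
  node_fun (cond_mean u) [ffun B => s (y B)] = node_fun (cond_mean u) y.
Proof.
move=> Lu; rewrite /node_fun -[RHS](cond_mean_relabel s _ Lu); congr (cond_mean u).
by apply/ffunP => a; rewrite !ffunE.
Qed.

End affiliation_kernel.

Lemma quad_gram (R : realType) s (L : seq 'rV[R]_s) r :
  quad (\sum_(a <- L) a^T *m a) r = \sum_(a <- L) dot r a ^+ 2.
Proof.
rewrite /quad mulmx_sumr mulmx_suml summxE; apply: eq_bigr => a _.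
rewrite mulmxA -mulmxA mxE big_ord1 expr2; congr (_ * _).
exact: dotC.
Qed.

Lemma dot_row_mx (R : realType) m s (a b : 'rV[R]_m) (r v : 'rV[R]_s) :
  dot (row_mx a r) (row_mx b v) = dot a b + dot r v.
Proof.
rewrite !dotE big_split_ord /=; congr (_ + _); apply: eq_bigr => j _.
  by rewrite !row_mxEl.
by rewrite !row_mxEr.
Qed.

(** * Second-order limit in the degenerate case *)

Section affiliation_limit.
Context d (T : measurableType d) (R : realType) (P : probability T R).
Variables (X : normedModType R) (Q : nat) (q0 : 'I_Q).
Variables (pi : 'I_Q -> R) (Z : nat -> {RV P >-> Q.-tuple bool}).
Variables (x : nat -> nat -> {RV P >-> borel X}).
Variable K : R.-pker (Q.-tuple bool * Q.-tuple bool)%type ~> borel X.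
Hypothesis model : mixture_model pi Z x K.
Variable k : nat.
Hypothesis k0 : (0 < k)%N.
Variable nu : probability ('C(k, 2).-tuple (borel X)) R.
Hypothesis nuE : forall A, measurable A -> nu A = P (induced_obs x (@first_nodes k) @^-1` A).
Variables (s : nat) (g : 'C(k, 2).-tuple (borel X) -> 'rV[R]_s).
Hypothesis Lg : forall j, L2 nu (fun y => g y 0 j).

Let pi0 := proportion_ge0 model.
Let pi1 := proportion_sum model.

Local Notation labs := (node_labels q0 Z).
Local Notation res := (res q0 pi Z x).
Local Notation cond_mean := (cond_mean q0 pi Z x).
Local Notation gj j := (fun y => g y 0 j).
Local Notation gdot t := (fun y => dot t (g y)).

Lemma res_dot t n w : res (gdot t) n w = \sum_j t 0 j * res (gj j) n w.
Proof.
rewrite /res; under [RHS]eq_bigr do rewrite mulrCA -avgZ.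
rewrite -mulr_sumr -avg_sum; congr (_ * _); apply: eq_avg => f.
rewrite dotE (cond_mean_dot q0 model nuE Lg) -sumrB; apply: eq_bigr => j _.
by rewrite mulrBr mulrC.
Qed.

Definition label_counts n (w : T) : 'rV[R]_Q :=
  \row_q ((Num.sqrt n%:R)^-1 * \sum_i ((labs n w i == q)%:R - pi q)).

Definition residuals n (w : T) : 'rV[R]_s := \row_j res (gj j) n w.

Definition joint n (w : T) : 'rV[R]_(Q + s) := row_mx (label_counts n w) (residuals n w).

(** Pairing [a] with the centered counts amounts to summing this mean-zero function of the labels,
    the form in which [res_clt] takes its linear part. *)
Let recenter (a : 'rV[R]_Q) q : R := a 0 q - \sum_q' a 0 q' * pi q'.

Lemma recenter_mean a : \sum_q pi q * recenter a q = 0.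
Proof.
rewrite /recenter; under eq_bigr do rewrite mulrBr.
rewrite sumrB -mulr_suml pi1 mul1r; apply/eqP; rewrite subr_eq0; apply/eqP.
by apply: eq_bigr => q _; rewrite mulrC.
Qed.

Lemma dot_label_counts a n w :
  dot a (label_counts n w) = (Num.sqrt n%:R)^-1 * \sum_i recenter a (labs n w i).
Proof.
rewrite dotE; under eq_bigr do rewrite mxE mulrAC -mulrA mulr_sumr.
rewrite -mulr_sumr exchange_big /=; congr (_ * _); apply: eq_bigr => i _.
under eq_bigr do rewrite mulrBr.
rewrite sumrB /recenter (bigD1 (labs n w i)) //= eqxx mulr1 big1 ?addr0 // => q /negbTE.
by rewrite eq_sym => ->; rewrite mulr0.
Qed.

Lemma dot_joint a r n w : dot (row_mx a r) (joint n w) =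
  (Num.sqrt n%:R)^-1 * (\sum_i recenter a (labs n w i)) + res (gdot r) n w.
Proof.
rewrite dot_row_mx dot_label_counts res_dot; congr (_ + _).
by rewrite dotE; apply: eq_bigr => j _; rewrite mxE mulrC.
Qed.

Lemma label_counts_sqr q n : (1 < n)%N -> ev P (fun w => label_counts n w 0 q ^+ 2) <= Cst R 1.
Proof.
move=> n1; have n0 : (0 < n)%N by apply: leq_trans n1.
have nn : 0 < n%:R :> R by rewrite ltr0n.
(* The frequency of a label is a U-statistic with one position, so [label_avg_variance] applies to
   it. *)
pose psi (l : {ffun 'I_1 -> 'I_Q}) : R := (l ord0 == q)%:R.
have mpsi : Ex pi (node_fun psi) = pi q.
  transitivity (\sum_b pi b * (b == q)%:R); last first.
    by rewrite (bigD1 q) //= eqxx mulr1 big1 ?addr0 // => b /negbTE ->; rewrite mulr0.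
  rewrite -(Ex_coord pi1 [set ord0 : 'I_1]%SET (fun b => (b == q)%:R)); apply: eq_Ex => y.
  by rewrite /node_fun /psi ffunE.
have E w : label_counts n w 0 q ^+ 2 = n%:R * (label_avg q0 Z n psi w - Ex pi (node_fun psi)) ^+ 2.
  have -> : label_avg q0 Z n psi w = n%:R^-1 * \sum_i (labs n w i == q)%:R.
    rewrite -(avg_marginal1 ord0 (fun i => (labs n w i == q)%:R : R) n0) /label_avg /psi.
    by apply: eq_avg => f; rewrite ffunE.
  rewrite mxE mpsi sumrB sumr_const card_ord -mulr_natl exprMn exprVn sqr_sqrtr ?ler0n //.
  by field; rewrite gt_eqF.
rewrite (@eq_ev _ _ _ P _ _ E) evZ; last first.
  by case: (L2B (label_avg_L2 q0 model n psi) (L2_cst P (Ex pi (node_fun psi)))).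
rewrite mulrC -ler_pdivlMr //; apply: le_trans (label_avg_variance q0 model (ltn0Sn 0) psi n1) _.
rewrite ler_wpM2r ?invr_ge0 ?ler0n // ler_piMr ?ler0n //.
have {1}<- : Ex pi (fun=> 1 : R) = 1 :> R := Ex_cst {set 'I_1} pi1 1.
by apply: le_Ex => // y; rewrite /node_fun /psi; case: eqP; rewrite ?expr1n ?expr0n.
Qed.

Lemma joint_L2 n j : L2 P (fun w => joint n w 0 j).
Proof.
case: (split_ordP j) => i ->.
  rewrite (_ : (fun w => _) = (fun w => (fun l : {ffun 'I_n -> 'I_Q} =>
     (Num.sqrt n%:R)^-1 * \sum_i' ((l i' == i)%:R - pi i)) (labs n w))); last first.
    by apply/funext => w; rewrite /joint row_mxEl mxE.
  exact: (labs_L2 q0 model (fun l : {ffun 'I_n -> 'I_Q} => (Num.sqrt n%:R)^-1 * \sum_i' ((l i' == i)%:R - pi i))).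
rewrite (_ : (fun w => _) = (fun w => res (gj i) n w)); last by apply/funext => w; rewrite /joint row_mxEr mxE.
exact: (res_L2 q0 model nuE n (Lg i)).
Qed.

(** The vectors [Lc] produce the multinomial covariance of the label counts and [Lr] the matrix [G]
    of the residuals. They occupy complementary blocks: the two limits are independent. *)
Lemma joint_cvg : exists gam : probability (borel 'rV[R]_(Q + s)) R, cvg_in_distribution P joint gam.
Proof.
have [G [Gs Gp clt]] := res_clt q0 model k0 nuE Lg.
have [Lb GE] := psd_decomposition Gs Gp.
pose Lc := [seq Num.sqrt (pi q) *: row_mx (\row_q' ((q' == q)%:R - pi q')) (0 : 'rV[R]_s) | q <- enum 'I_Q].
pose Lr := [seq row_mx (0 : 'rV[R]_Q) b | b <- Lb].
have [gam gamE] := gaussian_exists (Lc ++ Lr); exists gam.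
pose C := Cst R 1 + \sum_j 4 * Cst R k * ev nu (fun y => g y 0 j ^+ 2).
have C0 j : 0 <= 4 * Cst R k * ev nu (fun y => g y 0 j ^+ 2).
  by rewrite !mulr_ge0 ?ler0n //; apply: ev_ge0 => y; rewrite sqr_ge0.
apply: (@weak_cvg_trig _ _ _ _ _ _ _ C 2).
- by move=> n; apply: measurable_rV => j; case: (joint_L2 n j).
- by move=> n j; case: (joint_L2 n j).
- move=> n j n1; rewrite /joint; case: (split_ordP j) => i ->.
    rewrite (@eq_ev _ _ _ P _ (fun w => label_counts n w 0 i ^+ 2)); last by move=> w; rewrite row_mxEl.
    by apply: le_trans (label_counts_sqr i n1) _; rewrite lerDl sumr_ge0.
  rewrite (@eq_ev _ _ _ P _ (fun w => res (gj i) n w ^+ 2)); last by move=> w; rewrite row_mxEr mxE.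
  apply: le_trans (res_variance q0 model k0 nuE n (Lg i)) _.
  by rewrite /C (bigD1 i) //= addrCA lerDl addr_ge0 ?ler0n ?sumr_ge0.
move=> c t; rewrite -(hsubmxK t); move: (lsubmx t) (rsubmx t) => a r.
rewrite gamE big_cat /=.
have -> : \sum_(b <- Lc) dot (row_mx a r) b ^+ 2 = \sum_q pi q * recenter a q ^+ 2.
  rewrite big_map big_enum; apply: eq_bigr => q _; rewrite dotC dotZl exprMn sqr_sqrtr // dotC dot_row_mx (dotC r) dot0l addr0.
  congr (_ * _ ^+ 2); rewrite dotE; under eq_bigr do rewrite mxE mulrBl.
  rewrite sumrB /recenter; congr (_ - _); last by apply: eq_bigr => i _; rewrite mulrC.
  by rewrite (bigD1 q) //= eqxx mul1r big1 ?addr0 // => i /negbTE ->; rewrite mul0r.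
have -> : \sum_(b <- Lr) dot (row_mx a r) b ^+ 2 = quad G r.
  by rewrite big_map GE quad_gram; apply: eq_bigr => b _; rewrite dot_row_mx (dotC a) dot0l add0r.
have := clt (recenter a) r c (recenter_mean a).
rewrite (_ : - (2^-1 * _) - _ = - ((\sum_q pi q * recenter a q ^+ 2 + quad G r) / 2)); last by ring.
have E n : ev P (fun w => cos (c + dot (row_mx a r) (joint n w))) = ev P (fun w =>
    cos (c + (Num.sqrt n%:R)^-1 * (\sum_i recenter a (labs n w i)) + res (gdot r) n w)).
  by apply: eq_ev => w; rewrite dot_joint addrA.
by rewrite (funext E).
Qed.

(** Affiliation and equal proportions enter this section only through this degeneracy. *)
Hypothesis Hdeg : forall u, L2 nu u -> degen pi 2 (centered pi (node_fun (cond_mean u))).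

Local Notation p2 u := (proj2 pi (node_fun (cond_mean u))).

(* The limit of n (m^ - m) as a function of the limit of [joint]: the quadratic form coming from
   the labels, plus the residuals. *)
Definition limit_map (v : 'rV[R]_(Q + s)) : 'rV[R]_s := \row_j
  (\sum_a v 0 (lshift s a) * (\sum_b p2 (gj j) a b * v 0 (lshift s b)) + v 0 (rshift Q j) -
   \sum_a pi a * p2 (gj j) a a).

Lemma limit_map_continuous : continuous limit_map.
Proof.
apply: continuous_rV => j.
rewrite (_ : (fun v => _) = (fun v : 'rV[R]_(Q + s) =>
  (\sum_a v 0 (lshift s a) * (\sum_b p2 (gj j) a b * v 0 (lshift s b)) + v 0 (rshift Q j)) +
   - (\sum_a pi a * p2 (gj j) a a))); last by apply/funext => v; rewrite mxE.
apply: contD; last exact: cst_continuous.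
apply: contD; last exact: coord_continuous.
apply: cont_sum => a; apply: contM; first exact: coord_continuous.
by apply: cont_sum => b; apply: contZ; exact: coord_continuous.
Qed.

Lemma sum_label_counts (f : 'I_Q -> R) n w : \sum_q pi q * f q = 0 ->
  \sum_q f q * label_counts n w 0 q = (Num.sqrt n%:R)^-1 * \sum_i f (labs n w i).
Proof.
move=> f0; have := dot_label_counts (\row_q f q) n w; rewrite dotE.
under eq_bigr do rewrite mulrC mxE; move=> ->; congr (_ * _); apply: eq_bigr => i _.
rewrite /recenter mxE (_ : \sum_q _ = 0) ?subr0 // -[RHS]f0.
by apply: eq_bigr => q _; rewrite mxE mulrC.
Qed.

(** Since [proj2] has mean 0 in each variable, the centering of the label counts drops out of the
    quadratic form. *)
Lemma limit_map_joint n w j : limit_map (joint n w) 0 j =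
  n%:R^-1 * (\sum_c \sum_e p2 (gj j) (labs n w c) (labs n w e)) + res (gj j) n w -
  \sum_a pi a * p2 (gj j) a a.
Proof.
have D := Hdeg (Lg j); have dn := dep_node_fun (cond_mean (gj j)).
rewrite mxE /joint row_mxEr [residuals n w 0 j]mxE; congr (_ + _ - _).
have U a : row_mx (label_counts n w) (residuals n w) 0 (lshift s a) = label_counts n w 0 a by rewrite row_mxEl.
under eq_bigr => a _.
  under eq_bigr do rewrite U.
  rewrite U (sum_label_counts n w (proj2_meanr pi1 dn D a)) mulrCA.
  over.
rewrite -mulr_sumr; under eq_bigr do rewrite mulrC mulr_suml.
rewrite exchange_big /=.
under eq_bigr do rewrite (sum_label_counts n w (proj2_meanl pi1 dn D _)).
rewrite -mulr_sumr mulrA -expr2 exprVn sqr_sqrtr ?ler0n // exchange_big.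
by [].
Qed.

Lemma proj2_dot t a b : p2 (gdot t) a b = \sum_j t 0 j * p2 (gj j) a b.
Proof.
rewrite /proj2.
rewrite [RHS](eq_bigr (fun j => \sum_(p : 'I_k * 'I_k | (p.1 < p.2)%N) t 0 j *
  Pr pi (cells [set p.1; p.2]%SET) (centered pi (node_fun (cond_mean (gj j)))) (pt p.1 p.2 a b a))); last first.
  by move=> j _; rewrite mulr_sumr.
rewrite [RHS]exchange_big /=; apply: eq_bigr => p _.
exact: (Pr_center_dot q0 model nuE Lg).
Qed.

Lemma dot_limit_map t n w : dot t (limit_map (joint n w)) =
  n%:R^-1 * (\sum_c \sum_e p2 (gdot t) (labs n w c) (labs n w e)) + res (gdot t) n w -
  \sum_a pi a * p2 (gdot t) a a.
Proof.
have swap (I : finType) (F : 'I_s -> I -> R) :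
    \sum_j t 0 j * (\sum_i F j i) = \sum_i \sum_j t 0 j * F j i.
  by rewrite exchange_big; apply: eq_bigr => j _; rewrite mulr_sumr.
rewrite dotE; under eq_bigr do rewrite limit_map_joint mulrC mulrBr mulrDr.
rewrite sumrB big_split /= -res_dot; congr (_ + _ - _).
  under eq_bigr do rewrite mulrCA.
  rewrite -mulr_sumr swap; congr (_ * _); apply: eq_bigr => c _.
  by rewrite swap; apply: eq_bigr => e _; rewrite proj2_dot.
rewrite swap; apply: eq_bigr => a _.
by rewrite proj2_dot mulr_sumr; apply: eq_bigr => j _; rewrite mulrCA.
Qed.

Lemma scaled_moment_variance u n : L2 nu u -> (k < n)%N ->
  ev P (fun w => (n%:R * (motif_avg x u n w - ev nu u)) ^+ 2) <=
  2 * (4 * Cst R k * ev nu (fun y => u y ^+ 2)) +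
  2 * (Cst R k * Ex pi (fun y => centered pi (node_fun (cond_mean u)) y ^+ 2)).
Proof.
move=> Lu kn; have n0 : (0 < n)%N by apply: leq_ltn_trans kn.
have n1 : n%:R != 0 :> R by rewrite pnatr_eq0 -lt0n.
have Lm := L2Z n%:R (L2B (motif_avg_L2 q0 model nuE n Lu) (L2_cst P (ev nu u))).
have La := L2Z n%:R (L2B (label_avg_L2 q0 model n (cond_mean u)) (L2_cst P (ev nu u))).
have Lr := res_L2 q0 model nuE n Lu.
apply: le_trans (ev_sqr_le2 Lr La Lm _) _.
  by move=> w; rewrite (motif_avgE q0 pi Z) //; field.
apply: lerD; rewrite ler_wpM2l //; first exact: (res_variance q0 model k0 nuE n Lu).
rewrite (label_avg_transfer q0 model (cond_mean u) (fun (_ : {ffun 'I_n -> 'I_Q}) z => (n%:R * (z - ev nu u)) ^+ 2)).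
have dn := dep_sub (nodes_cells k) (dep_center pi (dep_node_fun (cond_mean u))).
apply: le_trans (Uavg_variance pi0 pi1 n k0 dn (Hdeg Lu)).
rewrite mulrC -ExZ le_eqVlt; apply/orP; left; apply/eqP; apply: eq_Ex => y.
by rewrite Uavg_center ?(ltnW kn) // -exprMn (mean_cond_mean q0 model nuE Lu).
Qed.

Lemma degenerate_clt : exists gam : probability (borel 'rV[R]_s) R,
  cvg_in_distribution P (fun n w => n%:R *: (empirical_moment x g n w - moment x g)) gam.
Proof.
have [gam [mV gamV]] := joint_cvg.
have mL : measurable_fun [set: borel 'rV[R]_(Q + s)] (limit_map : _ -> borel 'rV[R]_s).
  by apply: continuous_borel_measurable; exact: limit_map_continuous.
(* The limit law is the image under [limit_map] of the joint limit of label counts and residuals. *)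
have [mu [_ muE]] := law_exists gam mL; exists mu.
pose C j := 2 * (4 * Cst R k * ev nu (fun y => g y 0 j ^+ 2)) +
  2 * (Cst R k * Ex pi (fun y => centered pi (node_fun (cond_mean (gj j))) y ^+ 2)).
have C0 j : 0 <= C j.
  by rewrite addr_ge0 ?mulr_ge0 ?ler0n //; [apply: ev_ge0 => y|apply: Ex_ge0 => // y]; rewrite sqr_ge0.
apply: (@weak_cvg_trig _ _ _ _ _ _ _ (\sum_j C j) k.+1).
- exact: (scaled_moment_measurable q0 model nuE Lg (fun n => n%:R)).
- move=> n j; rewrite (scaled_moment_sqr nuE Lg (fun n => n%:R)).
  by apply: L1Z; case: (L2B (motif_avg_L2 q0 model nuE n (Lg j)) (L2_cst P (ev nu (gj j)))).
- move=> n j kn; rewrite (scaled_moment_sqr nuE Lg (fun n => n%:R)).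
  rewrite (@eq_ev _ _ _ P _ (fun w => (n%:R * (motif_avg x (gj j) n w - ev nu (gj j))) ^+ 2)); last first.
    by move=> w; rewrite exprMn.
  apply: le_trans (scaled_moment_variance (Lg j) kn) _.
  by rewrite (bigD1 j) //= lerDl sumr_ge0.
move=> c t; have Ldot := dot_L2 t Lg.
pose f (v : 'rV[R]_(Q + s)) := cos (c + dot t (limit_map v)).
have cf : continuous f.
  move=> v; apply: (@continuous_comp _ _ _ limit_map (fun y => cos (c + dot t y))).
    exact: limit_map_continuous.
  by apply: (cont_comp _ (@continuous_cos R)); apply: contD; [exact: cst_continuous|exact: continuous_dot].
have bf : exists M, forall v, `|f v| <= M by exists 1 => v; exact: cos_max.
have L1f n : L1 P (fun w => f (joint n w)).
  apply: (@L1_bounded _ _ _ P _ 1) => [|w]; last exact: cos_max.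
  exact: measurableT_comp (continuous_real_measurable cf) (mV n).
have mcos : measurable_fun [set: borel 'rV[R]_s] (fun y : 'rV[R]_s => cos (c + dot t y)).
  apply: continuous_real_measurable; apply: (cont_comp _ (@continuous_cos R)).
  by apply: contD; [exact: cst_continuous|exact: continuous_dot].
have L1g : L1 gam f.
  apply: (@L1_bounded _ _ _ gam _ 1) => [|v]; last exact: cos_max.
  exact: continuous_real_measurable.
have [_ ->] := muE _ mcos L1g.
have fV : ev P (fun w => f (joint n w)) @[n --> \oo] --> ev gam f.
  have := gamV f cf bf; rewrite (ev_EFin L1g).
  rewrite (_ : (fun n => _) = (fun n => (ev P (fun w => f (joint n w)))%:E)); last first.
    by apply/funext => n; rewrite ev_EFin.
  by move=> /fine_cvgP[].
have [K1 K10 K1P] := degenerate_approx pi0 pi1 k0 (dep_node_fun (cond_mean (gdot t))) (Hdeg Ldot).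
have D0 := @sqrt_nat_cvg0 R K1.
(* The residual appears identically in both cosines, so their difference is controlled by the labels
   alone, through [degenerate_approx]. *)
have diff : ev P (fun w => cos (c + dot t (n%:R *: (empirical_moment x g n w - moment x g)))) -
    ev P (fun w => f (joint n w)) @[n --> \oo] --> (0 : R).
  apply/cvgrPdist_le => e e0; move/cvgrPdist_le : D0 => /(_ e e0) De.
  near=> n.
  have kn : (k < n)%N by near: n; exact: nbhs_infty_gt.
  have De' : K1 * (Num.sqrt n%:R)^-1 <= e.
    have : `|0 - K1 * (Num.sqrt n%:R)^-1| <= e by near: n.
    by rewrite sub0r normrN; apply: le_trans; exact: ler_norm.
  rewrite sub0r normrN; apply: le_trans De'; apply: le_trans (K1P n kn).
  have Lcos : L1 P (fun w => cos (c + dot t (n%:R *: (empirical_moment x g n w - moment x g)))).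
    apply: (@L1_bounded _ _ _ P _ 1) => [|w]; last exact: cos_max.
    exact: measurableT_comp mcos (scaled_moment_measurable q0 model nuE Lg (fun n => n%:R) n).
  rewrite -evB //; apply: le_trans (norm_ev _) _; first exact: L1B.
  pose H (l : {ffun 'I_n -> 'I_Q}) z := `|n%:R * (z - Ex pi (node_fun (cond_mean (gdot t)))) -
    (n%:R^-1 * (\sum_c \sum_e p2 (gdot t) (l c) (l e)) - \sum_a pi a * p2 (gdot t) a a)|.
  apply: le_trans (_ : ev P (fun w => H (labs n w) (label_avg q0 Z n (cond_mean (gdot t)) w)) <= _).
    apply: le_ev.
    - by apply: L1_norm; exact: L1B.
    - apply: L1_norm; apply: L1B.
        by apply: L1Z; apply: L2_L1; apply: L2B; [exact: (label_avg_L2 q0 model)|exact: L2_cst].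
      exact: L2_L1 (labs_L2 q0 model (fun l : {ffun 'I_n -> 'I_Q} =>
        n%:R^-1 * (\sum_c \sum_e p2 (gdot t) (l c) (l e)) - \sum_a pi a * p2 (gdot t) a a)).
    move=> w; apply: le_trans (cos_lipschitz _ _) _.
    rewrite le_eqVlt; apply/orP; left; apply/eqP; congr `|_|.
    by rewrite (motif_decomposition q0 model nuE Lg) // dot_limit_map; ring.
  rewrite (label_avg_transfer q0 model (cond_mean (gdot t)) H) le_eqVlt; apply/orP; left; apply/eqP.
  apply: eq_Ex => y; rewrite /H /qform (Uavg_center _ _ _ (ltnW kn)).
  have -> // : \sum_(i < n) \sum_(i' < n) p2 (gdot t) ([ffun a : 'I_n => y [set a]%SET] i) ([ffun a : 'I_n => y [set a]%SET] i') =
    \sum_(i < n) \sum_(i' < n) p2 (gdot t) (y [set i]%SET) (y [set i']%SET).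
  by apply: eq_bigr => i _; apply: eq_bigr => i' _; rewrite !ffunE.
have sumE n : ev P (fun w => cos (c + dot t (n%:R *: (empirical_moment x g n w - moment x g)))) =
    (ev P (fun w => cos (c + dot t (n%:R *: (empirical_moment x g n w - moment x g)))) -
      ev P (fun w => f (joint n w))) + ev P (fun w => f (joint n w)) by rewrite subrK.
rewrite (funext sumE).
suff h : forall l : R, l = ev gam f -> (ev P (fun w => cos (c + dot t (n%:R *: (empirical_moment x g n w - moment x g)))) -
      ev P (fun w => f (joint n w))) + ev P (fun w => f (joint n w)) @[n --> \oo] --> l by exact: h.
by move=> l ->; rewrite -[X in _ --> X]add0r; exact: cvgD.
Unshelve. all: by end_near.
Qed.

End affiliation_limit.

Lemma coord_L2 d (T : measurableType d) (R : realType) (P : probability T R)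
    (X : normedModType R) (x : nat -> nat -> {RV P >-> borel X}) k s
    (g : 'C(k, 2).-tuple (borel X) -> 'rV[R]_s) (nu : probability ('C(k, 2).-tuple (borel X)) R) j :
  measurable_fun [set: 'C(k, 2).-tuple (borel X)] (g : _ -> borel 'rV[R]_s) ->
  finite_second_moment x g ->
  (forall u : 'C(k, 2).-tuple (borel X) -> R, measurable_fun [set: _] u ->
     L1 P (u \o induced_obs x (@first_nodes k)) -> L1 nu u /\ ev nu u = ev P (u \o induced_obs x (@first_nodes k))) ->
  L2 nu (fun y => g y 0 j).
Proof.
move=> mg g2 nuL; have mgj i := measurable_coord i mg; split => //.
have m2 i : measurable_fun [set: _] (fun y => g y 0 i ^+ 2) by exact: measurable_funX.
have mo := measurable_induced_obs x (@first_nodes k).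
have mw i := measurableT_comp (m2 i) mo.
apply: (nuL _ (m2 j) _).1; pose S w := \sum_i g (induced_obs x (@first_nodes k) w) 0 i ^+ 2.
have S0 w : 0 <= S w by apply: sumr_ge0 => i _; exact: sqr_ge0.
have mS : measurable_fun [set: T] S by apply: measurable_sum => i; exact: mw.
have LS : L1 P S.
  apply/integrableP; split; first exact/measurable_EFinP.
  move: g2; rewrite /finite_second_moment unlock; apply: le_lt_trans.
  by rewrite le_eqVlt; apply/orP; left; apply/eqP; apply: eq_integral => w _; rewrite gee0_abs // lee_fin.
apply: (le_L1 (mw j) _ LS) => w; rewrite ger0_norm ?sqr_ge0 // /S (bigD1 j) //= lerDl.
by apply: sumr_ge0 => i _; exact: sqr_ge0.
Qed.

Theorem theorem1 (R : realType) (d : measure_display) (T : measurableType d)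
    (P : probability T R) (X : normedModType R) (Q : nat) (hQ : (1 <= Q)%N)
    (pi : 'I_Q -> R) (Z : nat -> {RV P >-> Q.-tuple bool})
    (x : nat -> nat -> {RV P >-> borel X})
    (K : R.-pker (Q.-tuple bool * Q.-tuple bool)%type ~> borel X)
    (model : mixture_model pi Z x K)
    (k s : nat) (hk : (1 <= k)%N) (hs : (1 <= s)%N)
    (g : 'C(k, 2).-tuple (borel X) -> 'rV[R]_s)
    (mg : measurable_fun [set: 'C(k, 2).-tuple (borel X)]
            (g : _ -> borel 'rV[R]_s))
    (g2 : finite_second_moment x g) :
  {ae P, forall w, empirical_moment x g n w @[n --> \oo] --> moment x g} /\
  exists Sigma : 'M[R]_s,
    (exists2 mu : probability (borel 'rV[R]_s) R,
       is_centered_gaussian Sigma mu &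
       cvg_in_distribution P
         (fun n w => Num.sqrt n%:R *: (empirical_moment x g n w - moment x g))
         mu) /\
    (affiliation Z x -> (forall q, pi q = Q%:R^-1) ->
       Sigma = 0 /\
       exists nu : probability (borel 'rV[R]_s) R,
         cvg_in_distribution P
           (fun n w => n%:R *: (empirical_moment x g n w - moment x g)) nu).
Proof.
pose q0 : 'I_Q := Ordinal hQ.
have [nu [nuE nuL]] := law_exists P (measurable_induced_obs x (@first_nodes k)).
have Lg j : L2 nu (fun y => g y 0 j) := coord_L2 j mg g2 nuL.
have nuE' A : measurable A -> nu A = P (induced_obs x (@first_nodes k) @^-1` A) by [].
split; first exact: (moment_slln q0 model hk nuE' Lg).
exists (\sum_(a <- clt_factors q0 pi Z x g) a^T *m a); split.
  exact: (moment_clt q0 model hk nuE' Lg).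
move=> aff piE.
have pi_gt0 q : 0 < pi q by rewrite piE invr_gt0 ltr0n.
have pi_const q l : pi q = pi l by rewrite !piE.
have pi1 := proportion_sum model.
have sym u (s' : {perm 'I_Q}) (y : {ffun {set 'I_k} -> 'I_Q}) (Lu : L2 nu u) :=
  node_fun_relabel q0 model aff pi_gt0 pi_const nuE' s' y Lu.
split; last first.
  apply: (degenerate_clt (q0 := q0) model hk nuE' Lg) => u Lu.
  by apply: (degen_relabel pi1 pi_const) => s' y; exact: sym.
(* The covariance is the sum of the outer squares of the factors, and each factor vanishes with the
   first-order projection. *)
rewrite big_map big1 // => q _; rewrite (_ : influence _ _ _ _ _ _ = 0) ?scaler0 ?mulmx0 //.
apply/rowP => j; rewrite !mxE; apply: (proj1_relabel pi1 pi_const) => s' y.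
exact: sym.
Qed.
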